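(* Let $p$ be a prime, let $k$ be a field with $\operatorname{char}(k)\ne p$, and let \[ 1\to N\to P'\xrightarrow{\ \pi\ }P\to1 \] be an exact sequence of finite constant $p$-groups. Then \[ \sup_{K/k,\ E\in H^1(K,P)}\operatorname{ed}_K\bigl(\operatorname{Lift}_{P'}(E);p\bigr)=\operatorname{rdim}_p(P',N), \] where $K$ ranges over field extensions of $k$ and $E$ over $P$-torsors over $K$. Hence $\operatorname{rdim}_p(P',N)$ is the optimal uniform bound for the essential $p$-dimension of the gerbes $\operatorname{Lift}_{P'}(E)$.
   Context: For a $P$-torsor $E$ over a field $K/k$, $\operatorname{Lift}_{P'}(E)=\operatorname{Spec}K\times_{BP}BP'=[E/P']$ (with $P'$ acting on $E$ through $\pi$). Its objects over $L/K$ are $P'$-torsors over $L$ together with an identification of their quotient by $N$ with $E_L$; it is a finite gerbe over $K$. $\operatorname{rdim}_p(P',N)=\min\{\dim V: V\text{ a finite-dimensional representation of }P'\text{ over }k^{(p)}\text{ with }V|_N\text{ faithful}\}$, where $k^{(p)}$ is a $p$-closure of $k$: for a Sylow pro-$p$ subgroup $\Phi\subset\operatorname{Gal}(k_s/k)$, $k^{(p)}=\{a\in\bar k:a\text{ purely inseparable over }k_s^\Phi\}$. Essential dimension at $p$. For a category fibered in groupoids $\mathcal Z$ over $K$, a field $M/K$ and $\xi\in\mathcal Z(M)$: $\xi$ descends to $K\subset M_0\subset M$ if $\xi\simeq\xi_0|_M$ for some $\xi_0\in\mathcal Z(M_0)$; $\operatorname{ed}_K(\xi)$ is the minimum of $\operatorname{trdeg}_K(M_0)$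 over such $M_0$; $\operatorname{ed}_K(\xi;p)$ is the minimum of $\operatorname{ed}_K(\xi_{M'})$ over finite $M'/M$ of degree prime to $p$; $\operatorname{ed}_K(\mathcal Z;p)$ is the supremum of $\operatorname{ed}_K(\xi;p)$ over all $M/K$ and $\xi\in\mathcal Z(M)$. *)

(* Defs.v *)
From HB Require Import structures.
From mathcomp Require Import all_boot all_order all_algebra all_fingroup.
From mathcomp Require Import all_solvable all_field all_character.
From mathcomp Require Import boolp mpoly.

Set Implicit Arguments.
Unset Strict Implicit.
Unset Printing Implicit Defensive.

Import GRing.Theory.
Local Open Scope ring_scope.

(* Extended natural numbers: [None] is infinity, [einf] of a set without
   finite element is infinite, and [esup] of an unbounded set is infinite. *)
Definition enat := option nat.

Definition ele (x y : enat) : bool :=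
  match x, y with
  | _, None => true
  | None, Some _ => false
  | Some m, Some n => (m <= n)%N
  end.

Definition einf (S : enat -> Prop) : enat :=
  if pselect (exists n, `[< S (Some n) >]) is left h then Some (ex_minn h)
  else None.

Definition esup (S : enat -> Prop) : enat :=
  einf (fun b => forall x, S x -> ele x b).

Record ext (K : fieldType) := Ext {
  ext_field :> fieldType;
  ext_map : {rmorphism K -> ext_field}
}.

Record ext_hom (K : fieldType) (L L' : ext K) := ExtHom {
  ext_hom_map :> {rmorphism L -> L'};
  ext_homE : forall a : K, ext_hom_map (ext_map L a) = ext_map L' a
}.

Definition alg_indep (K : fieldType) (L : ext K) (n : nat) (x : n.-tuple L) :=
  forall q : {mpoly K[n]}, mmap (ext_map L) (tnth x) q = 0 -> q = 0.

(* A maximal algebraically independent family. *)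
Definition trans_basis (K : fieldType) (L : ext K) (n : nat) (x : n.-tuple L) :=
  alg_indep x /\ forall y : L, ~ alg_indep [tuple of rcons x y].

Definition trdeg (K : fieldType) (L : ext K) : enat :=
  einf (fun d => exists (n : nat) (x : n.-tuple L),
    trans_basis x /\ d = Some n).

(* The data of a category fibered in groupoids over the field extensions of K
   that enters the definition of essential dimension.  All arrows of such a
   category are cartesian, so an arrow from x to y over f : L -> L' exists if
   and only if y is isomorphic to the pullback x|_{L'}. *)
Record fibered (K : fieldType) := Fibered {
  fib_obj : ext K -> Type;
  fib_arrow : forall L L' : ext K, ext_hom L L' ->
    fib_obj L -> fib_obj L' -> Prop
}.

Definition ed_obj (K : fieldType) (Z : fibered K) (M : ext K)
    (xi : fib_obj Z M) : enat :=
  einf (fun d => exists (M0 : ext K) (f : ext_hom M0 M) (xi0 : fib_obj Z M0),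
    fib_arrow f xi0 xi /\ d = trdeg M0).

Definition ext_over (K : fieldType) (M : ext K) (M' : fieldExtType M) : ext K :=
  Ext (GRing.in_alg M' \o ext_map M : {rmorphism K -> M'}).

Definition ext_over_hom (K : fieldType) (M : ext K) (M' : fieldExtType M) :
    ext_hom M (ext_over M') :=
  @ExtHom K M (ext_over M') (GRing.in_alg M' : {rmorphism M -> M'})
    (fun=> erefl).

Definition edp_obj (p : nat) (K : fieldType) (Z : fibered K) (M : ext K)
    (xi : fib_obj Z M) : enat :=
  einf (fun d => exists (M' : fieldExtType M) (xi' : fib_obj Z (ext_over M')),
    [/\ coprime p (\dim {:M'}), fib_arrow (ext_over_hom M') xi xi'
      & d = ed_obj xi']).

Definition edp (p : nat) (K : fieldType) (Z : fibered K) : enat :=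
  esup (fun d => exists (M : ext K) (xi : fib_obj Z M), d = edp_obj p xi).

(* A torsor Spec A over Spec K under the finite constant group G, given by its
   coordinate ring A.  The right action on A comes from a left action on
   Spec A.  With e a K-basis of A, A (x) A is the free left A-module on the
   1 (x) e_i, so [torsor_iso] says that the A-linear map
   A (x) A -> prod_(g in G) A, a (x) b |-> (a * b^g)_g, dual to
   G x Spec A -> Spec A x Spec A, is an isomorphism. *)
Record torsor (G : finGroupType) (K : fieldType) := Torsor {
  torsor_alg :> falgType K;
  torsor_mulC : commutative (@GRing.mul torsor_alg);
  torsor_act : {action G &-> torsor_alg};
  torsor_act_linear : forall g : G, linear (torsor_act^~ g);
  torsor_act_monoid : forall g : G, monoid_morphism (torsor_act^~ g);
  torsor_iso :
    bijective (fun c : {ffun 'I_(\dim {:torsor_alg}) -> torsor_alg} =>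
      [ffun g : G => \sum_i c i * torsor_act (vbasis {:torsor_alg})`_i g])
}.

Section Lift.

Variables (P' P : finGroupType) (pi : {morphism [set: P'] >-> P}).
Variables (K : fieldType) (E : torsor P K).

(* The quotient stack [E/P']: an object over L is a P'-torsor T over L with a
   P'-equivariant K-morphism T -> E, where P' acts on E through pi.
   Equivalently, T comes with an isomorphism of P-torsors T/ker(pi) -> E_L. *)
Record lift_obj (L : ext K) := LiftObj {
  lift_torsor : torsor P' L;
  lift_map : {rmorphism E -> lift_torsor};
  lift_mapZ : forall (c : K) (a : E),
    lift_map (c *: a) = ext_map L c *: lift_map a;
  lift_map_act : forall (a : E) (g : P'),
    lift_map (torsor_act E a (pi g)) = torsor_act lift_torsor (lift_map a) g
}.

(* Dually, P'-equivariant morphisms of torsors over Spec L' -> Spec L, compatible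
   with the maps to E.  An equivariant morphism of torsors is automatically
   cartesian: it identifies the target algebra with the base change. *)
Definition lift_arrow (L L' : ext K) (f : ext_hom L L')
    (x : lift_obj L) (y : lift_obj L') : Prop :=
  exists phi : {rmorphism lift_torsor x -> lift_torsor y},
    [/\ forall (c : L) b, phi (c *: b) = f c *: phi b,
        forall b (g : P'), phi (torsor_act (lift_torsor x) b g)
                           = torsor_act (lift_torsor y) (phi b) g
      & forall a : E, phi (lift_map x a) = lift_map y a].

Definition Lift : fibered K := Fibered lift_arrow.

End Lift.

Section PClosure.

Variables (p : nat) (k : fieldType).

Definition algebraic_closure (kbar : closedFieldType)
    (i : {rmorphism k -> kbar}) : Prop := integralRange i.

(* The minimal polynomial of a is, up to a scalar, the irreducible polynomial
   with root a. *)
Definition separable_over (kbar : fieldType) (i : {rmorphism k -> kbar})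
    (a : kbar) : Prop :=
  exists q : {poly k},
    [/\ irreducible_poly q, separable_poly q & root (map_poly i q) a].

Definition galois_aut (ks : fieldType) (i : {rmorphism k -> ks})
    (s : ks -> ks) : Prop :=
  [/\ zmod_morphism s, monoid_morphism s, bijective s
    & forall a : k, s (i a) = i a].

(* The image in Gal(L/k) of a set Phi of automorphisms of ks, where L is a
   finite Galois extension of k embedded in ks. *)
Definition galois_image (ks : fieldType) (Phi : (ks -> ks) -> Prop)
    (L : splittingFieldType k) (u : {rmorphism L -> ks}) :
    {set gal_of {:L}} :=
  [set t : gal_of {:L} |
    `[< exists s, Phi s /\ forall x : L, s (u x) = u (t x) >]].

(* Sylow pro-p subgroup of Gal(ks/k): a subgroup, closed in the Krull topology,
   which is pro-p and of index prime to p, i.e. whose image in every finite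
   quotient Gal(L/k) is a p-group of index prime to p. *)
Record sylow_pro (ks : fieldType) (i : {rmorphism k -> ks})
    (Phi : (ks -> ks) -> Prop) : Prop := SylowPro {
  sylow_aut : forall s, Phi s -> galois_aut i s;
  sylow_id : Phi id;
  sylow_comp : forall s t, Phi s -> Phi t -> Phi (s \o t);
  sylow_inv : forall s t, Phi s -> cancel s t -> Phi t;
  sylow_closed : forall s, galois_aut i s ->
    (forall e : seq ks, exists t, Phi t /\ {in e, s =1 t}) -> Phi s;
  sylow_finite : forall (L : splittingFieldType k) (u : {rmorphism L -> ks}),
    (forall a : k, u a%:A = i a) -> galois 1 {:L} ->
    (p.-Sylow('Gal({:L} / 1)) (galois_image Phi u))%g
}.

(* kp is (isomorphic to) the subfield of an algebraic closure kbar consisting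
   of the elements purely inseparable over the fixed field of Phi; ks is the
   separable closure of k in kbar.  In characteristic zero [pchar kbar].-nat n
   forces n = 1, and otherwise n is a power of the characteristic. *)
Definition p_closure (kp : fieldType) : Prop :=
  exists (kbar : closedFieldType) (ks : fieldType) (i : {rmorphism k -> ks})
         (j : {rmorphism ks -> kbar}) (h : {rmorphism kp -> kbar})
         (Phi : (ks -> ks) -> Prop),
    let ibar : {rmorphism k -> kbar} := j \o i in
    [/\ algebraic_closure ibar,
        forall a : kbar, separable_over ibar a <-> exists b : ks, a = j b,
        sylow_pro i Phi
      & forall a : kbar,
          (exists c : kp, a = h c) <->
          exists (n : nat) (b : ks),
            [/\ [pchar kbar].-nat n, forall s, Phi s -> s b = b
              & a ^+ n = j b]].

End PClosure.

(* Over F = k^(p) this is rdim_p(G, N). *)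
Definition rdim (F : fieldType) (G : finGroupType) (N : {group G}) : enat :=
  einf (fun d => exists (n : nat) (rV : mx_representation F [set: G] n),
    mx_faithful (subg_repr rV (subsetT N)) /\ d = Some n).

(* Main.v *)
(* Upper bound: a faithful-on-N representation V of dimension D over k^(p) has
   entries algebraic over k, and they generate a prime-to-p extension, so V is
   defined over some M' prime to p over M.  A generic equivariant map from a
   P'-torsor T over M' to V has an image defining T, so T descends, with its map
   to E, to a field generated by D elements.

   Lower bound: a minimal V has irreducible blocks V_s of dimension p^(n_s),
   separated by central elements c_s of order p in N.  Let F be the ratio field
   of the regular representation of P, E the generic torsor Spec F over F^P, and
   kappa the field of ratios of coordinates on F and on each V_s.  The lift of E
   is the field of iterated Laurent series kappa((t_1))...((t_r)), on which P'
   acts through cocycles so that c_s scales t_s.  If the lift, after a prime-to-p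
   extension, came from transcendence degree less than D, equivariant vectors
   with coordinates Y in the descended torsor would satisfy a polynomial
   relation over F^P.  The c_s force the multidegree components of that relation
   to have distinct values, so the residues eta of the ratios of Y within the
   blocks satisfy a multihomogeneous relation.  This contradicts a count of the
   monomials of given multidegree in the variables of F, V and eta: P' acts on
   their span, so the count is divisible by p^(n_s) whenever p does not divide
   the total degree d_x + d_y in the s-th block, and comparing iterated
   differences of the Hilbert function, the degree of kappa(eta) over kappa,
   which is prime to p, would be congruent to 0. *)
Require Import Defs.
From HB Require Import structures.
From mathcomp Require Import all_boot all_order all_algebra all_fingroup.
From mathcomp Require Import all_solvable all_field all_character.
From mathcomp Require Import boolp mpoly.
From mathcomp Require Import generic_quotient ring_quotient fraction.
From mathcomp Require Import zify ring.

Set Implicit Arguments.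
Unset Strict Implicit.
Unset Printing Implicit Defensive.

Import GRing.Theory.
Local Open Scope ring_scope.

(** The lower bound splits D as the sum of the p^(n_s) - 1 plus r. Ratios inside each block lose one
    dimension per block but make every c_s act trivially on kappa; the r lost dimensions come back
    as the values of t_1, ..., t_r, which the c_s can tell apart. A prime-to-p extension does not
    disturb this: an automorphism of order p that is trivial on kappa stays trivial on a residue
    field all of whose elements have degree prime to p. On the residue level two top differences of
    one Hilbert function are compared. With p^(n_s) - 1 differences in the coordinates of every V_s
    the result is the degree of kappa(eta) over kappa; with these differences taken in the eta of
    every block instead, a relation makes the result 0. Trading the two directions, one s at a time,
    changes the result only by multiples of p. Neither value groups nor Hilbert polynomials are
    formed: a place is a ring with a residue map, values are compared by quotients, and the Hilbert
    function is counted through a partition of the standard monomials into cones. *)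

(** * Subrings, subfields, quotients and finite algebras as types *)

Record subring_prop (A : nzRingType) (S : A -> Prop) : Prop := SubringProp {
  subring_prop1 : S 1;
  subring_propB : forall x y, S x -> S y -> S (x - y);
  subring_propM : forall x y, S x -> S y -> S (x * y)
}.

Section SubringType.

Variables (A : nzRingType) (S : A -> Prop) (hS : subring_prop S).

Definition subring_pred of subring_prop S : {pred A} := fun x => `[< S x >].

Lemma subring_pred_closed : subring_closed (subring_pred hS).
Proof.
split; rewrite /subring_pred /in_mem /=.
- exact/asboolP/(subring_prop1 hS).
- by move=> x y /asboolP Sx /asboolP Sy; apply/asboolP/(subring_propB hS).
- by move=> x y /asboolP Sx /asboolP Sy; apply/asboolP/(subring_propM hS).
Qed.

HB.instance Definition _ :=
  GRing.isSubringClosed.Build A (subring_pred hS) subring_pred_closed.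

Record subring_type :=
  SubringType { subring_val : A; _ : subring_val \in subring_pred hS }.

HB.instance Definition _ := [isSub for subring_val].
HB.instance Definition _ := [Choice of subring_type by <:].
HB.instance Definition _ := [SubChoice_isSubNzRing of subring_type by <:].

End SubringType.

Lemma ex_subring (A : nzRingType) (S : A -> Prop) : subring_prop S ->
  exists (B : nzRingType) (f : {rmorphism B -> A}),
    injective f /\ forall x, S x <-> exists y, x = f y.
Proof.
move=> hS; exists (subring_type hS), (val : {rmorphism subring_type hS -> A}).
split; first exact: val_inj.
move=> x; split=> [Sx | [[y Sy] ->]]; last exact/asboolP.
by exists (SubringType (asboolT Sx : x \in subring_pred hS)).
Qed.

Lemma ex_subring_com (A : comNzRingType) (S : A -> Prop) : subring_prop S ->
  exists (B : comNzRingType) (f : {rmorphism B -> A}),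
    injective f /\ forall x, S x <-> exists y, x = f y.
Proof.
case/ex_subring=> B [f [injf Sf]].
have mulC : commutative (@GRing.mul B).
  by move=> x y; apply: (injf); rewrite !rmorphM mulrC.
pose C : comNzRingType := HB.pack B (GRing.PzRing_hasCommutativeMul.Build B mulC).
by exists C, (f : {rmorphism C -> A}).
Qed.

Record subfield_prop (F : fieldType) (S : F -> Prop) : Prop := SubfieldProp {
  subfield_prop1 : S 1;
  subfield_propB : forall x y, S x -> S y -> S (x - y);
  subfield_propM : forall x y, S x -> S y -> S (x * y);
  subfield_propV : forall x, S x -> S x^-1
}.

Lemma nzring_field (B : comNzRingType) :
  (forall x : B, x != 0 -> exists y, y * x = 1) ->
  exists (K : fieldType) (f : {rmorphism B -> K}), bijective f.
Proof.
move=> hV.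
pose inv (x : B) : B :=
  if pselect (exists y, y * x = 1) is left e then projT1 (cid e) else 0.
have mulVf (x : B) : x != 0 -> inv x * x = 1.
  move=> /hV e; rewrite /inv; case: pselect => // e'.
  exact: (projT2 (cid e')).
have inv0 : inv 0 = 0.
  rewrite /inv; case: pselect => // e; exfalso; case: e => y.
  by rewrite mulr0 => /eqP; rewrite eq_sym oner_eq0.
pose K : fieldType := HB.pack B (GRing.ComNzRing_isField.Build B mulVf inv0).
by exists K, (idfun : {rmorphism B -> B}); exists idfun.
Qed.

Lemma ex_subfield (F : fieldType) (S : F -> Prop) : subfield_prop S ->
  exists (K : fieldType) (f : {rmorphism K -> F}),
    forall x, S x <-> exists y, x = f y.
Proof.
case=> S1 SB SM SV.
have [|B [f [injf Sf]]] := @ex_subring_com F S; first by split.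
have /nzring_field[K [g [g' gK g'K]]] : forall x : B, x != 0 -> exists y, y * x = 1.
  move=> x nzx; have /SV/Sf[y Ey] : S (f x) by apply/Sf; exists x.
  exists y; apply: (injf); rewrite rmorphM rmorph1 -Ey mulVf //.
  by rewrite -(rmorph0 f) (inj_eq injf).
have aD : zmod_morphism g'.
  by move=> x y; apply: (can_inj gK); rewrite rmorphB !g'K.
have aM : monoid_morphism g'.
  split; first by apply: (can_inj gK); rewrite g'K rmorph1.
  by move=> x y; apply: (can_inj gK); rewrite rmorphM !g'K.
pose gi : {rmorphism K -> B} := HB.pack g'
  (GRing.isZmodMorphism.Build K B g' aD) (GRing.isMonoidMorphism.Build K B g' aM).
exists K, (f \o gi : {rmorphism K -> F}) => x; split.
  by move/Sf=> [y ->]; exists (g y); rewrite /= gK.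
by case=> y ->; apply/Sf; exists (g' y).
Qed.

Lemma nzring_idomain (B : comNzRingType) :
  (forall x y : B, x * y = 0 -> x = 0 \/ y = 0) ->
  exists (D : idomainType) (f : {rmorphism B -> D}), bijective f.
Proof.
move=> hI.
pose U : pred B := fun x => `[< exists y, y * x = 1 >].
pose inv (x : B) : B :=
  if pselect (exists y, y * x = 1) is left e then projT1 (cid e) else x.
have mulVr : {in U, left_inverse 1 inv *%R}.
  move=> x /asboolP e; rewrite /inv; case: pselect => // e'.
  exact: (projT2 (cid e')).
have unitP (x y : B) : y * x = 1 -> U x by move=> e; apply/asboolP; exists y.
have invout : {in [predC U], inv =1 id}.
  move=> x /asboolP e; rewrite /inv; case: pselect => // e'.
pose B1 : comUnitRingType := HB.pack B
  (GRing.ComNzRing_hasMulInverse.Build B mulVr unitP invout).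
have ax : GRing.integral_domain_axiom B1.
  by move=> x y /hI[->|->]; rewrite eqxx ?orbT.
pose D : idomainType := HB.pack B1 (GRing.ComUnitRing_isIntegral.Build B1 ax).
by exists D, (idfun : {rmorphism B -> B}); exists idfun.
Qed.

Local Notation "x %:F" := (@FracField.tofrac _ x).

Lemma fracE (D : idomainType) (z : {fraction D}) :
  exists a b : D, b != 0 /\ z = a%:F / b%:F.
Proof.
pose r := generic_quotient.repr z; have nzd : (frac r).2 != 0 by [].
exists (frac r).1, (frac r).2; split=> //.
apply: (@mulIf _ (frac r).2%:F); rewrite ?tofrac_eq0 // mulfVK ?tofrac_eq0 //.
rewrite -[z]reprK -/r; unlock FracField.tofrac; rewrite -[LHS]FracField.pi_mul.
apply/eqP; rewrite FracField.equivf_def /FracField.mulf.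
rewrite !numden_Ratio ?mulf_neq0 ?oner_neq0 //.
by rewrite !mulr1 mulrC.
Qed.

(** The field is the fraction field of [A / I]. The ideal is a bare predicate because it will be
    known only by a property: a proper ideal of largest dimension, or the non-units of a valuation
    ring. *)
Lemma ex_prime_quotient (A : comNzRingType) (I : A -> Prop) :
  I 0 -> (forall x y, I x -> I y -> I (x + y)) ->
  (forall a x, I x -> I (a * x)) -> ~ I 1 ->
  (forall x y, I (x * y) -> I x \/ I y) ->
  exists (Q : fieldType) (f : {rmorphism A -> Q}),
    (forall x, f x = 0 <-> I x) /\
    forall z, exists a b, f b != 0 /\ z = f a / f b.
Proof.
move=> I0 ID IM I1 Ip.
pose S : {pred A} := fun x => `[< I x >].
have SP : idealr_closed S.
  split; rewrite /S /in_mem /=; first exact/asboolP.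
    by apply/asboolP.
  by move=> a u v /asboolP Iu /asboolP Iv; apply/asboolP/ID => //; apply: IM.
pose J : idealr A := HB.pack S (isIdealr.Build A S SP).
have [x y|D [g [g' gK g'K]]] := @nzring_idomain (Quotient.quot J).
  rewrite -[x]reprK -[y]reprK -rmorphM => /eqP; rewrite piE Quotient.equivE subr0.
  by case/asboolP/Ip => Ix; [left | right]; apply/eqP;
    rewrite piE Quotient.equivE subr0; apply/asboolP.
exists {fraction D}, (@FracField.tofrac D \o g \o \pi_(Quotient.quot J)%qT : {rmorphism A -> {fraction D}}).
split=> [x | z] /=.
  transitivity (\pi_(Quotient.quot J)%qT x = 0).
    split=> [/eqP|-> /=]; last by rewrite !rmorph0.
    by rewrite tofrac_eq0 => /eqP e; apply: (can_inj gK); rewrite rmorph0.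
  split=> [/eqP|Ix]; first by rewrite piE Quotient.equivE subr0 => /asboolP.
  by apply/eqP; rewrite piE Quotient.equivE subr0; apply/asboolP.
have [a [b [nzb ->]]] := fracE z.
exists (generic_quotient.repr (g' a)), (generic_quotient.repr (g' b)); rewrite !reprK !g'K.
by split; rewrite // tofrac_eq0.
Qed.

Lemma ex_frac_extension (D : idomainType) (K : fieldType) (f : {rmorphism D -> K}) :
  injective f -> exists g : {rmorphism {fraction D} -> K}, forall a, g a%:F = f a.
Proof.
move=> injf.
have f0 (b : D) : b != 0 -> f b != 0 by rewrite -(rmorph0 f) (inj_eq injf).
have /choice[nd ndP] : forall z : {fraction D}, exists ab : D * D,
    ab.2 != 0 /\ z = ab.1%:F / ab.2%:F.
  by move=> z; have [a [b ab]] := fracE z; exists (a, b).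
pose num z := (nd z).1; pose den z := (nd z).2.
have dn0 z : den z != 0 by case: (ndP z).
have ndE z : z = (num z)%:F / (den z)%:F by case: (ndP z).
pose g z := f (num z) / f (den z).
have gE z a b : b != 0 -> z = a%:F / b%:F -> g z = f a / f b.
  move=> nzb; rewrite {1}[z]ndE => /eqP; rewrite eqr_div ?tofrac_eq0 //.
  rewrite -!tofracM tofrac_eq => /eqP e; apply/eqP; rewrite /g eqr_div ?f0 //.
  by rewrite -!rmorphM e.
have gD : zmod_morphism g.
  move=> x y; rewrite (@gE (x - y) (num x * den y - num y * den x) (den x * den y)).
  - rewrite rmorphB !rmorphM /g -[in RHS]mulNr addf_div ?f0 //.
    by rewrite mulNr.
  - by rewrite mulf_neq0.
  - rewrite {1}[x]ndE {1}[y]ndE tofracB !tofracM -[in LHS]mulNr addf_div ?tofrac_eq0 //.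
    by rewrite mulNr.
have gM : monoid_morphism g.
  split; first by rewrite (@gE 1 1 1) ?oner_neq0 ?tofrac1 ?divr1 // !rmorph1 divr1.
  move=> x y; rewrite (@gE (x * y) (num x * num y) (den x * den y)).
  - by rewrite !rmorphM /g mulf_div.
  - by rewrite mulf_neq0.
  - by rewrite {1}[x]ndE {1}[y]ndE mulf_div !tofracM.
pose gi : {rmorphism {fraction D} -> K} := HB.pack g
  (GRing.isZmodMorphism.Build _ _ g gD) (GRing.isMonoidMorphism.Build _ _ g gM).
exists gi => a; rewrite [LHS](@gE a%:F a 1) ?oner_neq0 ?tofrac1 ?divr1 //.
by rewrite rmorph1 divr1.
Qed.

Lemma ex_comring (A : nzRingType) : commutative (@GRing.mul A) ->
  exists (C : comNzRingType) (f : {rmorphism A -> C}) (g : {rmorphism C -> A}),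
    cancel f g /\ cancel g f.
Proof.
move=> mulC.
pose C : comNzRingType := HB.pack A (GRing.PzRing_hasCommutativeMul.Build A mulC).
by exists C, (idfun : {rmorphism A -> A}), (idfun : {rmorphism A -> A}).
Qed.

Section AlgebraOfBasis.

Variables (F : fieldType) (A : nzRingType) (i : {rmorphism F -> A}) (n : nat).
Variable b : 'I_n -> A.

Definition spans := forall z, exists c : 'I_n -> F, z = \sum_j i (c j) * b j.
Definition indep := forall c : 'I_n -> F, \sum_j i (c j) * b j = 0 ->
  forall j, c j = 0.

Hypotheses (mulC : commutative (@GRing.mul A)) (sb : spans) (fb : indep).

(** An alias of [A] indexed by the three hypotheses, so that the vector space and algebra
    structures, which depend on them, can be attached to a type. *)
Definition based_algebra of commutative (@GRing.mul A) & spans & indep : Type := A.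

Local Notation L := (based_algebra mulC sb fb).

HB.instance Definition _ := GRing.NzRing.on L.

Let scale (c : F) (z : L) : L := i c * z.

Fact based_scaleA a c v : scale a (scale c v) = scale (a * c) v.
Proof. by rewrite /scale rmorphM mulrA. Qed.

Fact based_scale1 : left_id 1 scale.
Proof. by move=> x; rewrite /scale rmorph1 mul1r. Qed.

Fact based_scaleDr : right_distributive scale +%R.
Proof. by move=> a x y; rewrite /scale mulrDr. Qed.

Fact based_scaleDl v : {morph scale^~ v : a c / a + c}.
Proof. by move=> a c; rewrite /scale rmorphD mulrDl. Qed.

HB.instance Definition _ := GRing.Zmodule_isLmodule.Build F L
  based_scaleA based_scale1 based_scaleDr based_scaleDl.

Fact based_scaleAl a (u v : L) : a *: (u * v) = (a *: u) * v.
Proof. exact: mulrA. Qed.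

HB.instance Definition _ := GRing.Lmodule_isLalgebra.Build F L based_scaleAl.

Fact based_scaleAr k (x y : L) : k *: (x * y) = x * (k *: y).
Proof.
change (i k * ((x : A) * y) = (x : A) * (i k * y)).
by rewrite mulrA [i k * x]mulC mulrA.
Qed.

HB.instance Definition _ := GRing.Lalgebra_isAlgebra.Build F L based_scaleAr.

Fact based_vector : Vector.axiom n L.
Proof.
have [co coE] := choice sb.
have co_uniq (c : 'I_n -> F) z : z = \sum_j i (c j) * b j -> c =1 co z.
  move=> e j; apply/eqP; rewrite -subr_eq0; apply/eqP.
  apply: (fb (c := fun j => c j - co z j)).
  under eq_bigr do rewrite rmorphB mulrBl.
  by rewrite sumrB -e -coE subrr.
exists (fun z : L => \row_j co z j).
  move=> a x y; apply/rowP=> j; rewrite !mxE; symmetry.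
  apply: (@co_uniq (fun j => a * co x j + co y j)).
  under eq_bigr do rewrite rmorphD rmorphM mulrDl -mulrA.
  by rewrite big_split -mulr_sumr -!coE.
exists (fun r : 'rV[F]_n => \sum_j i (r ord0 j) * b j : L) => [z | r].
  by rewrite [RHS]coE; apply: eq_bigr => j _; rewrite mxE.
by apply/rowP=> j; rewrite !mxE; symmetry; apply: co_uniq.
Qed.

HB.instance Definition _ := Lmodule_hasFinDim.Build F L based_vector.
HB.instance Definition _ := Algebra_isFalgebra.Build F L.

Lemma ex_falgebra :
  exists (L : falgType F) (f : {rmorphism A -> L}) (g : {rmorphism L -> A}),
    [/\ cancel f g, cancel g f, forall c z, g (c *: z) = i c * g z
      & \dim {:L} = n].
Proof.
exists (L : falgType F), (idfun : {rmorphism A -> A}), (idfun : {rmorphism A -> A}).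
by split=> //; rewrite dimvf.
Qed.

End AlgebraOfBasis.

Lemma ex_fieldExt (F E : fieldType) (i : {rmorphism F -> E}) (n : nat)
    (b : 'I_n -> E) : spans i b -> indep i b ->
  exists (L : fieldExtType F) (f : {rmorphism E -> L}) (g : {rmorphism L -> E}),
    [/\ cancel f g, cancel g f, forall c z, g (c *: z) = i c * g z
      & \dim {:L} = n].
Proof.
move=> sb fb; have [L [f [g [fK gK gZ dL]]]] := ex_falgebra (@mulrC E) sb fb.
have mulC : commutative (@GRing.mul L).
  by move=> x y; apply: (can_inj gK); rewrite !rmorphM mulrC.
have fld : GRing.field_axiom L.
  move=> x nzx; apply/unitrP; exists (f (g x)^-1).
  have gx : g x != 0 by rewrite -(rmorph0 g) (can_eq gK).
  by split; apply: (can_inj gK); rewrite rmorphM rmorph1 fK ?mulVf ?mulfV.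
pose m1 := GRing.PzRing_hasCommutativeMul.Build L mulC.
pose L0 : comUnitRingType := HB.pack (Falgebra.sort L) (Falgebra.class L) m1.
pose m2 := GRing.ComUnitRing_isField.Build L0 fld.
pose L1 : fieldExtType F := HB.pack (Falgebra.sort L) (Falgebra.class L) m1 m2.
by exists L1, f, g.
Qed.

(** * Relative algebraic closure and the exchange lemma *)

Section AlgebraicClosure.

Variables (k Om : fieldType) (iota : {rmorphism k -> Om}).
Implicit Types (S T : Om -> Prop) (x y z u : Om).

Definition gen S z := forall T, subfield_prop T ->
  (forall a, T (iota a)) -> (forall x, S x -> T x) -> T z.

Lemma gen_subfield S : subfield_prop (gen S).
Proof.
split=> [T [] // | x y gx gy T hT Tk TS | x y gx gy T hT Tk TS | x gx T hT Tk TS].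
- by apply: (subfield_propB hT); [apply: gx | apply: gy].
- by apply: (subfield_propM hT); [apply: gx | apply: gy].
- by apply: (subfield_propV hT); apply: gx.
Qed.

Lemma gen_base S a : gen S (iota a). Proof. by move=> T _ + _; apply. Qed.

Lemma gen_sub S x : S x -> gen S x. Proof. by move=> Sx T _ _; apply. Qed.

Lemma gen_min S T x : subfield_prop T -> (forall a, T (iota a)) ->
  (forall x, S x -> T x) -> gen S x -> T x.
Proof. by move=> hT Tk TS; apply. Qed.

Lemma gen_field S : exists (K : fieldType) (f : {rmorphism K -> Om}),
  forall x, gen S x <-> exists y : K, x = f y.
Proof. exact: ex_subfield (gen_subfield S). Qed.

(** The relative algebraic closure of k(S) in [Om]. The equation is a polynomial over [Om] whose
    coefficients happen to lie in k(S), which avoids a type for k(S). *)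
Definition algcl S z := exists p : {poly Om},
  [/\ p != 0, root p z & forall i, gen S p`_i].

Lemma poly_lift (K : fieldType) (f : {rmorphism K -> Om}) (p : {poly Om}) :
  (forall i, exists y : K, p`_i = f y) -> exists q : {poly K}, p = map_poly f q.
Proof.
move=> /choice[g gE]; exists (\poly_(i < size p) g i).
apply/polyP=> i; rewrite coef_map coef_poly /=.
by case: ltnP => [_ | le]; [exact: gE | rewrite rmorph0 nth_default].
Qed.

Lemma algclE S (K : fieldType) (f : {rmorphism K -> Om}) z :
  (forall x, gen S x <-> exists y : K, x = f y) ->
  algcl S z <-> algebraicOver f z.
Proof.
move=> fE; split=> [[p [nzp pz gp]] | [q nzq qz]].
  have [q pE] : exists q : {poly K}, p = map_poly f q.
    by apply: poly_lift => i; apply/fE.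
  by exists q; rewrite -?pE // -(map_poly_eq0 f) -pE.
exists (map_poly f q); split=> //; first by rewrite map_poly_eq0.
by move=> i; apply/fE; exists q`_i; rewrite coef_map.
Qed.

Lemma sub_algcl S x : gen S x -> algcl S x.
Proof.
have [K [f fE]] := gen_field S; move=> /[dup] gx /fE[y ->].
by apply/(algclE _ fE); apply: algebraic_id.
Qed.

Lemma algcl_subfield S : subfield_prop (algcl S).
Proof.
have [K [f fE]] := gen_field S; have aE z := algclE z fE.
split=> [|x y /aE ax /aE ay | x y /aE ax /aE ay | x /aE ax]; apply/aE.
- exact: algebraic1.
- exact: algebraic_sub.
- exact: algebraic_mul.
- exact: algebraic_inv.
Qed.

Lemma algcl_root S (p : {poly Om}) z : p != 0 -> root p z ->
  (forall i, algcl S p`_i) -> algcl S z.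
Proof.
have [K [f fE]] := gen_field S; have aE w := algclE w fE.
move=> nzp pz ap; apply/aE/integral_algebraic.
apply: (integral_root nzp pz) => _ /(nthP 0)[i _ <-].
exact/integral_algebraic/aE.
Qed.

Lemma gen_algcl S T x : (forall y, T y -> algcl S y) -> gen T x -> algcl S x.
Proof.
move=> TS; apply: gen_min (algcl_subfield S) _ TS => a.
by apply: sub_algcl; apply: gen_base.
Qed.

Lemma algcl_trans S T x : (forall y, T y -> algcl S y) -> algcl T x -> algcl S x.
Proof.
move=> TS [p [nzp pz gp]]; apply: (algcl_root nzp pz) => i.
exact: gen_algcl (gp i).
Qed.

Lemma algcl_mono S T x : (forall y, S y -> T y) -> algcl S x -> algcl T x.
Proof. by move=> ST; apply: algcl_trans => y /ST/gen_sub/sub_algcl. Qed.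

Definition adj S u : Om -> Prop := fun x => S x \/ x = u.

Definition ratio_at S u x := exists a b : {poly Om},
  [/\ forall i, gen S a`_i, forall i, gen S b`_i, b.[u] != 0 & x = a.[u] / b.[u]].

Lemma gen_adj S u x : gen (adj S u) x -> ratio_at S u x.
Proof.
have hg := gen_subfield S.
have g0 : gen S 0 by rewrite -(rmorph0 iota); apply: gen_base.
have gD x1 y1 : gen S x1 -> gen S y1 -> gen S (x1 + y1).
  move=> gx gy; rewrite -[y1]opprK -[- y1]add0r.
  by apply: (subfield_propB hg) => //; apply: (subfield_propB hg).
have gM (a b : {poly Om}) : (forall i, gen S a`_i) -> (forall i, gen S b`_i) ->
    forall i, gen S (a * b)`_i.
  move=> ga gb i; rewrite coefM; elim/big_ind: _ => // j _.
  exact: (subfield_propM hg).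
have gC c : gen S c -> forall i, gen S (c%:P)`_i.
  by move=> gc i; rewrite coefC; case: eqP.
have gB (a b : {poly Om}) : (forall i, gen S a`_i) -> (forall i, gen S b`_i) ->
    forall i, gen S (a - b)`_i.
  by move=> ga gb i; rewrite coefB; apply: (subfield_propB hg).
have g1 := subfield_prop1 hg.
apply: gen_min => [|a|y].
- split.
  + by exists 1, 1; rewrite -polyC1 !hornerC oner_eq0 divr1; split=> //; apply: gC.
  + move=> _ _ [a [b [ga gb nb ->]]] [c [d [gc gd nd ->]]].
    exists (a * d - c * b), (b * d); split; rewrite ?(hornerM, hornerD, hornerN) ?mulf_neq0 //.
    * by apply: gB; apply: gM.
    * exact: gM.
    * by rewrite -[in LHS]mulNr addf_div // mulNr.
  + move=> _ _ [a [b [ga gb nb ->]]] [c [d [gc gd nd ->]]].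
    exists (a * c), (b * d); split; rewrite ?(hornerM, hornerD, hornerN) ?mulf_neq0 //; try exact: gM.
    by rewrite mulf_div.
  + move=> _ [a [b [ga gb nb ->]]]; have [a0|na] := eqVneq a.[u] 0.
      exists 0, 1; rewrite a0 mul0r invr0 horner0 mul0r hornerC oner_eq0.
      by split=> // i; rewrite ?coef0 //; apply: gC.
    by exists b, a; rewrite invf_div.
- exists (iota a)%:P, 1; rewrite !hornerC oner_eq0 divr1; split=> //; apply: gC => //.
- case=> [Sy | ->].
    exists y%:P, 1; rewrite !hornerC oner_eq0 divr1; split=> //; apply: gC => //.
    exact: gen_sub.
  exists 'X, 1; rewrite hornerX !hornerC oner_eq0 divr1; split=> //; last exact: gC.
  by move=> i; rewrite coefX; case: eqP.
Qed.

(** Clearing denominators in an equation of [z] over k(S)(u) leaves coefficients that are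
    polynomials in [u]. The same expression read as a polynomial in [u] over k(S)(z) is nonzero,
    since otherwise its coefficients would be equations of [z] over k(S). *)
Lemma algcl_exchange S u z :
  algcl (adj S u) z -> ~ algcl S z -> algcl (adj S z) u.
Proof.
have hz := gen_subfield (adj S z).
have SSz y : gen S y -> gen (adj S z) y.
  by apply: gen_min => // [a | x Sx]; [apply: gen_base | apply: gen_sub; left].
have gzX n : gen (adj S z) (z ^+ n).
  elim: n => [|n IH]; first exact: (subfield_prop1 hz).
  by rewrite exprS; apply: (subfield_propM hz) => //; apply: gen_sub; right.
have g0 : gen (adj S z) 0 by rewrite -(rmorph0 iota); apply: gen_base.
have gD x y : gen (adj S z) x -> gen (adj S z) y -> gen (adj S z) (x + y).
  move=> gx gy; rewrite -[y]opprK -[- y]add0r.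
  by apply: (subfield_propB hz) => //; apply: (subfield_propB hz).
case=> p [nzp /rootP pz gp] nz.
have /choice[ab abP] : forall i, exists ab : {poly Om} * {poly Om},
    [/\ forall j, gen S ab.1`_j, forall j, gen S ab.2`_j, ab.2.[u] != 0
      & p`_i = ab.1.[u] / ab.2.[u]].
  by move=> i; have [a [b P]] := gen_adj (gp i); exists (a, b).
pose n := size p.
pose c := \prod_(i < n) (ab i).2.
pose A (i : 'I_n) := (ab i).1 * \prod_(j < n | j != i) (ab j).2.
have cu : c.[u] != 0.
  by rewrite horner_prod; apply/prodf_neq0 => i _; case: (abP i).
have Au (i : 'I_n) : (A i).[u] = c.[u] * p`_i.
  rewrite /c (bigD1 i) //= !hornerM; case: (abP i) => _ _ nb ->.
  by rewrite [RHS]mulrC mulrA divfK.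
have hS := gen_subfield S.
have gS0 : gen S 0 by rewrite -(rmorph0 iota); apply: gen_base.
have gSD x y : gen S x -> gen S y -> gen S (x + y).
  move=> gx gy; rewrite -[y]opprK -[- y]add0r.
  by apply: (subfield_propB hS) => //; apply: (subfield_propB hS).
have gSM (a b : {poly Om}) : (forall i, gen S a`_i) -> (forall i, gen S b`_i) ->
    forall i, gen S (a * b)`_i.
  move=> ga gb i; rewrite coefM; elim/big_ind: _ => // j _.
  exact: (subfield_propM hS).
have gA (i : 'I_n) j : gen S (A i)`_j.
  apply: (gSM); first by case: (abP i).
  elim/big_ind: _ => [l | x y gx gy | l _]; last by case: (abP l).
    by rewrite coefC; case: eqP => // _; apply: (subfield_prop1 hS).
  exact: gSM.
pose R := \sum_(i < n) z ^+ i *: A i.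
exists R; split.
- apply/negP => /eqP R0; case/eqP: nzp; apply/polyP=> l; rewrite coef0.
  have [ln | nl] := ltnP l n; last by rewrite nth_default.
  apply: (mulfI cu); rewrite -(Au (Ordinal ln)) mulr0.
  suff -> : A (Ordinal ln) = 0 by rewrite horner0.
  apply/polyP=> j; rewrite coef0.
  pose q := \poly_(i < n) (if insub i is Some i' then (A i')`_j else 0).
  have qE (i : 'I_n) : q`_i = (A i)`_j by rewrite coef_poly ltn_ord valK.
  rewrite -(qE (Ordinal ln)); have [-> | nzq] := eqVneq q 0; first by rewrite coef0.
  case: nz; exists q; split=> //.
    rewrite /root (@horner_coef_wide _ n) ?size_poly //.
    move/polyP/(_ j): R0; rewrite coef0 coef_sum => /eqP; congr (_ == 0).
    by apply: eq_bigr => i _; rewrite coefZ mulrC qE.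
  move=> i; rewrite coef_poly; case: ifP => // _.
  by case: insubP => // i' _ _; apply: gA.
- apply/rootP; rewrite horner_sum.
  under eq_bigr do rewrite hornerZ Au mulrCA.
  by rewrite -mulr_sumr; under eq_bigr do rewrite mulrC; rewrite -horner_coef pz mulr0.
- move=> j; rewrite coef_sum; elim/big_ind: _ => // i _.
  by rewrite coefZ; apply: (subfield_propM hz) => //; apply: SSz.
Qed.

Lemma algcl_steinitz (s t : seq Om) :
  (forall i, (i < size s)%N -> ~ algcl (fun x => x \in take i s) s`_i) ->
  (forall x, x \in s -> algcl (fun y => y \in t) x) ->
  (size s <= size t)%N.
Proof.
move=> ind spn.
pose cl (r : seq Om) := algcl (fun x => x \in r).
have clS r x : x \in r -> cl r x by move=> xr; apply: sub_algcl; apply: gen_sub.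
have clT r r' x : {in r', forall y, cl r y} -> cl r' x -> cl r x.
  by move=> h; apply: algcl_trans.
suff H (n : nat) : (n <= size s)%N -> exists t' : seq Om,
    (size t' + n <= size t)%N /\ {in t, forall x, cl (take n s ++ t') x}.
  by have [t' [le _]] := H _ (leqnn _); apply: leq_trans le; apply: leq_addl.
elim: n => [_ | n IH lt]; first by exists t; rewrite addn0 take0; split=> // x /clS.
have [t' [le clt]] := IH (ltnW lt).
(* The element of [t'] to give up is the last one of the shortest prefix that makes [x] algebraic:
   exchange then makes it algebraic over [x] and the rest. *)
pose x := s`_n; pose Q j := `[< cl (take n s ++ take j t') x >].
have xt' : Q (size t').
  apply/asboolP; rewrite take_size; apply: (clT _ t) => //.
  by apply: spn; rewrite mem_nth.
have Q0 : ~~ Q 0%N by apply/asboolP; rewrite take0 cats0; apply: ind.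
have exQ : exists j, Q j by exists (size t').
case: (ex_minnP exQ) => [[|j] Qj minj]; first by rewrite Qj in Q0.
have jt : (j < size t')%N by apply: minj.
have Qj' : ~ cl (take n s ++ take j t') x.
  by move=> /asboolP/minj; rewrite ltnn.
pose u := t'`_j.
have exu : algcl (adj (fun y => y \in take n s ++ take j t') x) u.
  apply: algcl_exchange => //; move/asboolP: Qj; apply: algcl_mono => y.
  rewrite (take_nth 0) // mem_cat mem_rcons inE /adj mem_cat.
  by case/or3P=> [-> | /eqP -> | ->]; rewrite ?orbT; [left | right | left].
exists (take j t' ++ drop j.+1 t'); split.
  rewrite size_cat size_take_min size_drop (minn_idPl (ltnW jt)).
  by rewrite addnBA // -addnBA; move: le; rewrite ?subSnn; lia.
move=> y /clt; apply: clT => w.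
rewrite -{1}(cat_take_drop j t') (drop_nth 0 jt) -/u !mem_cat inE.
have inl : {in take n s ++ take j t', forall v, v \in take n.+1 s ++ take j t' ++ drop j.+1 t'}.
  move=> v; rewrite (take_nth 0) // -/x !mem_cat mem_rcons inE.
  by case/orP=> ->; rewrite ?orbT.
case/or4P=> [wn | wj | /eqP -> | wd].
- by apply/clS/inl; rewrite mem_cat wn.
- by apply/clS/inl; rewrite mem_cat wj orbT.
- move: exu; apply: algcl_mono => v [/inl // | ->].
  by rewrite (take_nth 0) // !mem_cat mem_rcons inE eqxx.
- by apply: clS; rewrite !mem_cat wd !orbT.
Qed.

End AlgebraicClosure.

(** * Algebraic relations and transcendence degree *)

Section Relations.

Variables (k Om : fieldType) (iota : {rmorphism k -> Om}).

Lemma algcl_relation (n : nat) (u : 'I_n -> Om) (i : 'I_n) :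
  algcl iota (fun x => exists2 j : 'I_n, (j < i)%N & x = u j) (u i) ->
  exists2 q : {mpoly k[n]}, q != 0 & mmap iota u q = 0.
Proof.
(* Variables before [i] become constants, ['X_i] becomes the indeterminate and later ones 0.
   Polynomials in the earlier variables thus satisfy [cst], and that the relation built below is
   nonzero can be tested in one indeterminate. *)
pose v (j : 'I_n) : {poly Om} :=
  if (j < i)%N then (u j)%:P else if j == i then 'X else 0.
pose ev : {rmorphism {mpoly k[n]} -> {poly Om}} := mmap (polyC \o iota) v.
pose at_u : {rmorphism {mpoly k[n]} -> Om} := mmap iota u.
pose cst (a : {mpoly k[n]}) := ev a = (at_u a)%:P.
have cstB a b : cst a -> cst b -> cst (a - b).
  by rewrite /cst !rmorphB => -> ->; rewrite -polyCB.
have cstM a b : cst a -> cst b -> cst (a * b).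
  by rewrite /cst !rmorphM => -> ->; rewrite -polyCM.
have cst1 : cst 1 by rewrite /cst !rmorph1.
have cst0 : cst 0 by rewrite /cst !rmorph0.
have cstC c : cst c%:MP by rewrite /cst /ev /at_u /= !mmapC.
have cstX (j : 'I_n) : (j < i)%N -> cst 'X_j.
  by move=> ji; rewrite /cst /ev /at_u /= !mmapX !mmap1U /v ji.
pose T z := exists a b, [/\ cst a, cst b, at_u b != 0 & z = at_u a / at_u b].
have hT : subfield_prop T.
  split.
  - by exists 1, 1; rewrite !rmorph1 divr1 oner_eq0.
  - move=> _ _ [a [b [ca cb nb ->]]] [c [d [cc cd nd ->]]].
    exists (a * d - c * b), (b * d); split; rewrite ?rmorphM ?mulf_neq0 //.
    + by apply: (cstB); apply: cstM.
    + exact: cstM.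
    + by rewrite rmorphB !rmorphM -[in LHS]mulNr addf_div // mulNr.
  - move=> _ _ [a [b [ca cb nb ->]]] [c [d [cc cd nd ->]]].
    exists (a * c), (b * d); rewrite !rmorphM mulf_neq0 // mulf_div.
    by split=> //; apply: cstM.
  - move=> _ [a [b [ca cb nb ->]]]; have [a0|na] := eqVneq (at_u a) 0.
      by exists 0, 1; rewrite a0 mul0r invr0 rmorph0 rmorph1 mul0r oner_eq0.
    by exists b, a; rewrite invf_div.
case=> p [nzp /rootP pz gp].
have Tp l : T p`_l.
  apply: (gen_min hT) (gp l) => [c | _ [j ji ->]].
    by exists c%:MP, 1; rewrite rmorph1 divr1 oner_eq0 /at_u /= mmapC.
  by exists 'X_j, 1; rewrite rmorph1 divr1 oner_eq0 /at_u /= mmapX mmap1U; split=> //; apply: cstX.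
have /choice[ab abP] : forall l, exists ab : {mpoly k[n]} * {mpoly k[n]},
    [/\ cst ab.1, cst ab.2, at_u ab.2 != 0 & p`_l = at_u ab.1 / at_u ab.2].
  by move=> l; have [a [b P]] := Tp l; exists (a, b).
pose c := \prod_(l < size p) (ab l).2.
pose A (l : 'I_(size p)) := (ab l).1 * \prod_(j < size p | j != l) (ab j).2.
have cu : at_u c != 0.
  by rewrite rmorph_prod; apply/prodf_neq0 => l _; case: (abP l).
have Au (l : 'I_(size p)) : at_u (A l) = at_u c * p`_l.
  rewrite /c (bigD1 l) //= !rmorphM; case: (abP l) => _ _ nb ->.
  by rewrite [RHS]mulrC mulrA divfK.
have cA l : cst (A l).
  apply: (cstM); first by case: (abP l).
  by elim/big_ind: _ => // j _; case: (abP j).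
exists (\sum_(l < size p) A l * 'X_i ^+ l).
  apply/eqP => /(congr1 ev); rewrite rmorph0 rmorph_sum.
  move/polyP/(_ (size p).-1); rewrite coef0 coef_sum.
  have lt : ((size p).-1 < size p)%N by rewrite prednK // lt0n size_poly_eq0.
  rewrite (bigD1 (Ordinal lt)) //= big1 ?addr0 => [|l nl]; last first.
    rewrite rmorphM rmorphXn /= cA /ev /= mmapX mmap1U /v ltnn eqxx.
    rewrite coefCM coefXn [_ == _]eq_sym (_ : (l == _ :> nat) = false) ?mulr0 //.
    by apply: contra_neqF nl => /eqP e; apply: val_inj.
  rewrite rmorphM rmorphXn /= cA /ev /= mmapX mmap1U /v ltnn eqxx.
  rewrite coefCM coefXn eqxx mulr1 Au => /eqP; rewrite mulf_eq0 (negbTE cu) /=.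
  by rewrite -lead_coefE lead_coef_eq0 (negbTE nzp).
rewrite -/(at_u _) rmorph_sum -[RHS](mulr0 (at_u c)) -[in RHS]pz horner_coef mulr_sumr.
apply: eq_bigr => l _; rewrite rmorphM rmorphXn mulrA Au; congr (_ * _ ^+ _).
by rewrite /at_u /= mmapX mmap1U.
Qed.

Lemma relation_algcl (n : nat) (x : n.-tuple Om) (y : Om) :
  (forall q : {mpoly k[n]}, mmap iota (tnth x) q = 0 -> q = 0) ->
  ~ (forall q : {mpoly k[n.+1]},
       mmap iota (tnth [tuple of rcons x y]) q = 0 -> q = 0) ->
  algcl iota (fun z => z \in x) y.
Proof.
move=> indx /existsNP[q /not_implyP[q0 /eqP nzq]].
have xE (i : 'I_n) : tnth [tuple of rcons x y] (widen_ord (leqnSn n) i) = tnth x i.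
  by rewrite !(tnth_nth 0) /= nth_rcons size_tuple ltn_ord.
have yE : tnth [tuple of rcons x y] ord_max = y.
  by rewrite (tnth_nth 0) /= nth_rcons size_tuple ltnn eqxx.
pose rst (m : 'X_{1..n.+1}) : 'X_{1..n} :=
  [multinom m (widen_ord (leqnSn n) i) | i < n].
pose cf (m : 'X_{1..n.+1}) := iota q@_m * mmap1 (tnth x) (rst m).
have gx j : gen iota (fun z => z \in x) (tnth x j).
  by apply: gen_sub; apply: mem_tnth.
have hg := gen_subfield iota (fun z => z \in x).
(* The relation sorted by powers of the last variable. A coefficient is the value of a nonzero
   polynomial at the independent [x], hence nonzero. *)
exists (\sum_(m <- msupp q) cf m *: 'X^(m ord_max)); split.
- have [m0 m0q] : exists m0, m0 \in msupp q.
    have [e|] := eqVneq (msupp q) [::]; first by rewrite -msupp_eq0 e in nzq.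
    by case: (msupp q) => // m s _; exists m; rewrite inE eqxx.
  apply/eqP => /polyP/(_ (m0 ord_max)); rewrite coef0 coef_sum.
  pose qt : {mpoly k[n]} := \sum_(m <- msupp q | m ord_max == m0 ord_max) q@_m *: 'X_[rst m].
  have -> : \sum_(m <- msupp q) (cf m *: 'X^(m ord_max))`_(m0 ord_max) = mmap iota (tnth x) qt.
    rewrite raddf_sum /= [RHS]big_mkcond; apply: eq_bigr => m _.
    rewrite coefZ coefXn eq_sym; case: eqP => _; rewrite ?mulr0 ?mulr1 //.
    by rewrite mmapZ mmapX.
  move/indx/(congr1 (mcoeff (rst m0))); rewrite mcoeff0 raddf_sum /=.
  rewrite -big_filter (bigD1_seq m0) ?filter_uniq ?msupp_uniq ?mem_filter ?eqxx //=.
  rewrite mcoeffZ mcoeffX eqxx mulr1 big_filter_cond big1_seq ?addr0 => [/eqP|].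
    by apply/negP; rewrite -mcoeff_msupp.
  move=> m /andP[/andP[/eqP e nm] _]; rewrite mcoeffZ mcoeffX.
  case: eqP => [e'|]; rewrite ?mulr0 //; case/eqP: nm; apply/mnmP=> i.
  have [->|ni] := eqVneq i ord_max; first by [].
  have lt : (i < n)%N.
    by rewrite ltn_neqAle -ltnS ltn_ord andbT; apply: contra_neq ni => e''; apply: val_inj.
  move/mnmP/(_ (Ordinal lt)): e'; rewrite !mnmE.
  by rewrite (_ : widen_ord _ _ = i) //; apply: val_inj.
- apply/rootP; rewrite horner_sum -[RHS]q0 /mmap; apply: eq_bigr => m _.
  rewrite hornerZ hornerXn /cf -mulrA; congr (_ * _).
  rewrite /mmap1 big_ord_recr /= yE; congr (_ * _); apply: eq_bigr => i _.
  by rewrite mnmE xE.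
- move=> l; rewrite coef_sum; elim/big_ind: _ => [|a b ga gb|m _].
  + by rewrite -(rmorph0 iota); apply: gen_base.
  + rewrite -[b]opprK -[- b]add0r; apply: (subfield_propB hg) => //.
    by apply: (subfield_propB hg) => //; rewrite -(rmorph0 iota); apply: gen_base.
  + rewrite coefZ coefXn; apply: (subfield_propM hg); last first.
      by case: eqP => _; [apply: (subfield_prop1 hg) | rewrite mulr0n -(rmorph0 iota); apply: gen_base].
    apply: (subfield_propM hg); first exact: gen_base.
    rewrite /mmap1; elim/big_ind: _ => [|a b|i _]; first exact: (subfield_prop1 hg).
      exact: (subfield_propM hg).
    elim: (rst m i) => [|e IH]; first exact: (subfield_prop1 hg).
    by rewrite exprS; apply: (subfield_propM hg).
Qed.

End Relations.

Lemma ele_einf (S : enat -> Prop) (m n : nat) :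
  S (Some m) -> (m <= n)%N -> ele (einf S) (Some n).
Proof.
move=> Sm mn; rewrite /einf; case: pselect => [h|[]]; last by exists m; apply/asboolP.
by case: ex_minnP => l _ /(_ m) minl /=; apply: leq_trans mn; apply/minl/asboolP.
Qed.

Lemma einf_ge (S : enat -> Prop) (b : enat) :
  (forall n, S (Some n) -> ele b (Some n)) -> ele b (einf S).
Proof.
move=> h; rewrite /einf; case: pselect => [e|_]; last by case: b {h}.
by case: ex_minnP => l /asboolP Sl _; apply: h.
Qed.

Lemma einf_some (S : enat -> Prop) n : einf S = Some n -> S (Some n).
Proof.
by rewrite /einf; case: pselect => // e [<-]; case: ex_minnP => l /asboolP.
Qed.

Lemma ele_trans y x z : ele x y -> ele y z -> ele x z.
Proof. by case: x; case: y; case: z => //= a b c; apply: leq_trans. Qed.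

Lemma ele_anti x y : ele x y -> ele y x -> x = y.
Proof.
by case: x y => [m|] [n|] //= mn nm; congr Some; apply/eqP; rewrite eqn_leq mn.
Qed.

Lemma esup_le (S : enat -> Prop) (b : enat) :
  (forall x, S x -> ele x b) -> ele (esup S) b.
Proof. by case: b => [b|] h; [apply: (@ele_einf _ b) | case: esup]. Qed.

Lemma ele_esup (S : enat -> Prop) x : S x -> ele x (esup S).
Proof. by move=> Sx; apply: einf_ge => n; apply. Qed.

(** The spanning family may live in a larger field [Om], because the generators of a descended field
    are elements of a torsor algebra, which is only mapped to a field. Exchange bounds every
    independent family by [size t], so one of maximal size exists. *)
Lemma trdeg_le (K : fieldType) (L : ext K) (Om : fieldType)
    (f : {rmorphism L -> Om}) (t : seq Om) :
  (forall z : L, algcl (f \o ext_map L) (fun y => y \in t) (f z)) ->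
  ele (trdeg L) (Some (size t)).
Proof.
move=> clt.
pose ai n := exists x : n.-tuple L, alg_indep x.
have ai_le n : ai n -> (n <= size t)%N.
  case=> x indx; rewrite -(size_tuple x) -(size_map f).
  apply: (@algcl_steinitz _ _ (f \o ext_map L)) => [i|_ /mapP[z _ ->]]; last exact: clt.
  rewrite size_map size_tuple => lt cl.
  have [|q /eqP nzq q0] := @algcl_relation _ _ (f \o ext_map L) n (f \o tnth x) (Ordinal lt).
    rewrite /= (tnth_nth 0) -(nth_map 0 0) ?size_tuple //.
    apply: algcl_mono cl => y /(nthP 0)[j]; rewrite size_take_min size_map size_tuple.
    move=> lt'; have ji : (j < i)%N by apply: leq_trans lt' _; apply: geq_minl.
    have jn := ltn_trans ji lt.
    rewrite nth_take // (nth_map 0) ?size_tuple // => <-.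
    by exists (Ordinal jn); rewrite //= (tnth_nth 0).
  apply/nzq/indx/(fmorph_inj f); rewrite rmorph0 -q0 rmorph_sum /=.
  apply: eq_bigr => m _; rewrite rmorphM rmorph_prod; congr (_ * _).
  by apply: eq_bigr => j _; rewrite rmorphXn.
have ai0 : exists n, `[< ai n >].
  exists 0%N; apply/asboolP; exists [tuple] => q.
  have -> : q = (q@_0)%:MP.
    by apply/mpolyP=> m; rewrite mcoeffC (_ : m = 0%MM) ?eqxx ?mulr1 //; apply/mnmP=> -[].
  by rewrite mmapC => /eqP; rewrite fmorph_eq0 => /eqP ->; rewrite mpolyC0.
have [|n /asboolP[x indx] maxn] := @ex_maxnP (fun n => `[< ai n >]) (size t) ai0.
  by move=> n /asboolP/ai_le.
apply: (@ele_einf _ n); last by apply: ai_le; exists x.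
exists n, x; split=> //; split=> // y indy.
have : `[< ai n.+1 >] by apply/asboolP; exists [tuple of rcons x y].
by move/maxn; rewrite ltnn.
Qed.

Lemma trdeg_ge (K : fieldType) (L : ext K) (D : nat) :
  (forall t : seq L, (forall z, algcl (ext_map L) (fun y => y \in t) z) ->
    (D <= size t)%N) -> ele (Some D) (trdeg L).
Proof.
move=> h; apply: einf_ge => _ [n [x [[indx maxx] [->]]]] /=.
rewrite -(size_tuple x); apply: h => z; apply: relation_algcl => //.
exact: maxx.
Qed.

(** * Group actions on rings, Galois coordinates and torsors *)

(** The Galois coordinates of Chase, Harrison and Rosenberg. They express that the action is free,
    survive every equivariant ring morphism, and together with the right invariants they
    characterize torsors. *)
Definition chr_coords (G : finGroupType) (A : nzRingType) (act : G -> A -> A) :=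
  exists (n : nat) (a b : 'I_n -> A),
    forall g, \sum_i a i * act g (b i) = (g == 1%g)%:R.

Record ring_action (G : finGroupType) (A : nzRingType) (act : G -> A -> A) : Prop :=
  RingAction {
    ract1 : forall z, act 1%g z = z;
    ractM : forall g h z, act (g * h)%g z = act h (act g z);
    ractB : forall g, zmod_morphism (act g);
    ract_mul : forall g, monoid_morphism (act g)
  }.

Section RingActionTheory.

Variables (G : finGroupType) (A : nzRingType) (act : G -> A -> A).
Hypothesis hact : ring_action act.

Lemma ract_rmorph g : exists f : {rmorphism A -> A}, forall x, f x = act g x.
Proof.
pose f : {rmorphism A -> A} := HB.pack (act g)
  (GRing.isZmodMorphism.Build A A (act g) (ractB hact g))
  (GRing.isMonoidMorphism.Build A A (act g) (ract_mul hact g)).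
by exists f.
Qed.

Lemma ractMl g x y : act g (x * y) = act g x * act g y.
Proof. by have [f E] := ract_rmorph g; rewrite -!E rmorphM. Qed.
Lemma ractD g x y : act g (x + y) = act g x + act g y.
Proof. by have [f E] := ract_rmorph g; rewrite -!E rmorphD. Qed.
Lemma ract_one g : act g 1 = 1.
Proof. by have [f E] := ract_rmorph g; rewrite -!E rmorph1. Qed.
Lemma ract_zero g : act g 0 = 0.
Proof. by have [f E] := ract_rmorph g; rewrite -!E rmorph0. Qed.
Lemma ract_sum (I : Type) (r : seq I) (P : pred I) (F : I -> A) g :
  act g (\sum_(i <- r | P i) F i) = \sum_(i <- r | P i) act g (F i).
Proof.
by have [f E] := ract_rmorph g; rewrite -E rmorph_sum; apply: eq_bigr => i _; apply: E.
Qed.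
Lemma ract_prod (I : Type) (r : seq I) (P : pred I) (F : I -> A) g :
  act g (\prod_(i <- r | P i) F i) = \prod_(i <- r | P i) act g (F i).
Proof.
by have [f E] := ract_rmorph g; rewrite -E rmorph_prod; apply: eq_bigr => i _; apply: E.
Qed.
Lemma ractK g : cancel (act g) (act g^-1%g).
Proof. by move=> x; rewrite -(ractM hact) mulgV (ract1 hact). Qed.
Lemma ractVK g : cancel (act g^-1%g) (act g).
Proof. by move=> x; rewrite -(ractM hact) mulVg (ract1 hact). Qed.

Definition rtrace z := \sum_g act g z.

Lemma rtrace_fixed g z : act g (rtrace z) = rtrace z.
Proof.
rewrite ract_sum [RHS](reindex_inj (mulIg g)) /=.
by apply: eq_bigr => h _; rewrite (ractM hact).
Qed.

Definition rnorm z := \prod_g act g z.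

Lemma rnorm_fixed g z : commutative (@GRing.mul A) -> act g (rnorm z) = rnorm z.
Proof.
move=> mulC.
have [C [f [f' [fK _]]]] := ex_comring mulC; apply: (can_inj fK).
rewrite ract_prod !rmorph_prod [RHS](reindex_inj (mulIg g)) /=.
by apply: eq_bigr => h _; rewrite (ractM hact).
Qed.

(* The trace form recovers z from the coordinates: sum_g z^g (sum_i a_i^g b_i) = z. *)
Lemma chr_decomp n (a b : 'I_n -> A) z : commutative (@GRing.mul A) ->
  (forall g, \sum_i a i * act g (b i) = (g == 1%g)%:R) ->
  z = \sum_i rtrace (z * a i) * b i.
Proof.
move=> mulC ab.
have abV g : \sum_i act g (a i) * b i = (g == 1%g)%:R.
  have -> : \sum_i act g (a i) * b i = act g (\sum_i a i * act g^-1%g (b i)).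
    by rewrite ract_sum; apply: eq_bigr => i _; rewrite ractMl ractVK.
  by rewrite ab invg_eq1; case: eqP; rewrite ?ract_one ?ract_zero.
have -> : \sum_i rtrace (z * a i) * b i = \sum_g act g z * \sum_i act g (a i) * b i.
  under eq_bigr do rewrite mulr_suml.
  rewrite exchange_big /=; apply: eq_bigr => g _; rewrite mulr_sumr.
  by apply: eq_bigr => i _; rewrite ractMl mulrA.
rewrite (bigD1 1%g) //= [X in _ + X]big1 ?addr0 => [|g ng].
  by rewrite abV eqxx mulr1 (ract1 hact).
by rewrite abV (negbTE ng) mulr0.
Qed.

End RingActionTheory.

Lemma spans_minimal (F : fieldType) (A : nzRingType) (i : {rmorphism F -> A}) (n : nat)
    (b : 'I_n -> A) : spans i b ->
  exists (m : nat) (c : 'I_m -> A), spans i c /\ indep i c.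
Proof.
move=> sb.
pose Q m := `[< exists c : 'I_m -> A, spans i c >].
have exQ : exists m, Q m by exists n; apply/asboolP; exists b.
case: (ex_minnP exQ) => m /asboolP[c sc] minm; exists m, c; split=> // d d0 j.
have [//|nz] := eqVneq (d j) 0; exfalso.
case: m c sc minm d d0 j nz => [|m] c sc minm d d0 j nz; first by case: (j) => [[]].
suff /minm : Q m by rewrite ltnn.
apply/asboolP; exists (fun l => c (lift j l)) => z.
have cj : c j = \sum_(l < m) i (- d (lift j l) / d j) * c (lift j l).
  move: d0; rewrite (bigD1_ord j) //= => /eqP; rewrite addr_eq0 => /eqP e.
  have: i (d j)^-1 * (i (d j) * c j) = i (d j)^-1 * - \sum_(l < m) i (d (lift j l)) * c (lift j l) by rewrite e.
  rewrite mulrA -rmorphM mulVf // rmorph1 mul1r => ->.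
  rewrite mulrN mulr_sumr -sumrN; apply: eq_bigr => l _.
  rewrite mulrA -rmorphM -mulNr -rmorphN; congr (i _ * _).
  by rewrite mulNr mulrC.
have [e ->] := sc z.
exists (fun l => e j * (- d (lift j l) / d j) + e (lift j l)).
rewrite (bigD1_ord j) //= cj mulr_sumr -big_split /=; apply: eq_bigr => l _.
by rewrite rmorphD mulrDl rmorphM mulrA.
Qed.

(* The lemmas of the library assume that the set acted upon is finite. *)
Lemma total_actM (G : finGroupType) (T : Type) (act : {action G &-> T}) x g h :
  act x (g * h)%g = act (act x g) h.
Proof. by case: act => to [_ toM] /=; apply: toM; rewrite inE. Qed.

Lemma total_act1 (G : finGroupType) (T : Type) (act : {action G &-> T}) x :
  act x 1%g = x.
Proof.
have [inj _] : is_action [set: G] act by case: act.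
by apply: (inj 1%g); rewrite -total_actM mulg1.
Qed.

Section TorsorOfCoordinates.

Variables (F : fieldType) (G : finGroupType) (L : falgType F).
Hypothesis mulC : commutative (@GRing.mul L).
Variable act : {action G &-> L}.
Hypothesis act_linear : forall g : G, linear (act^~ g).
Hypothesis act_monoid : forall g : G, monoid_morphism (act^~ g).

Lemma torsor_ring_action : ring_action (fun (g : G) z => act z g).
Proof.
split=> [z | g h z | g x y | g].
- exact: total_act1.
- exact: total_actM.
- by have := act_linear g (-1) y x; rewrite !scaleN1r ![- _ + _]addrC.
- exact: act_monoid.
Qed.

(** The inverse sends [w] to the tensor with left factors sum_g w_g a_j^g and right factors [b j],
    expanded in the basis; the matrix [t] of traces against the [a j] is dual to the matrix [s] of
    the [b j]. *)
Lemma torsor_iso_of_coords : (forall z, (forall g, act z g = z) -> exists c, z = c%:A) ->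
  chr_coords (fun g z => act z g) ->
  bijective (fun c : {ffun 'I_(\dim {:L}) -> L} =>
      [ffun g : G => \sum_i c i * act (vbasis {:L})`_i g]).
Proof.
move=> fixF [n [a [b ab]]]; have hact := torsor_ring_action.
have [C [f [f' [fK f'K]]]] := ex_comring mulC.
set e := vbasis {:L}.
have basE : basis_of {:L} e := vbasisP _.
have actZ g c z : act (c *: z) g = c *: act z g.
  by have := act_linear g c z 0; rewrite addr0 (ract_zero hact) addr0.
have [t tE] : exists t : 'I_(\dim {:L}) -> 'I_n -> F,
    forall (i : 'I_(\dim {:L})) j, rtrace (fun g z => act z g) (e`_i * a j) = (t i j)%:A.
  have /choice[t tE] : forall ij : 'I_(\dim {:L}) * 'I_n, exists c : F,
      rtrace (fun g z => act z g) (e`_ij.1 * a ij.2) = c%:A.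
    by move=> ij; apply: fixF => g; apply: (rtrace_fixed hact).
  by exists (fun i j => t (i, j)) => i j; apply: (tE (i, j)).
pose s j l := coord e l (b j).
have bE j : b j = \sum_l s j l *: e`_l by apply: coord_vbasis; apply: memvf.
have ts (i l : 'I_(\dim {:L})) : \sum_j t i j * s j l = (i == l)%:R.
  have := chr_decomp hact e`_i mulC ab.
  under eq_bigr do rewrite tE -scalerAl mul1r.
  move/(congr1 (coord e l)); rewrite linear_sum /=.
  have free_e := basis_free basE.
  rewrite [LHS]coord_free // => ->.
  by apply: eq_bigr => j _; rewrite linearZ.
have mulAl c (x y : L) : x * (c *: y) = c *: (x * y) by rewrite scalerAr.
exists (fun w : {ffun G -> L} => [ffun l => \sum_j s j l *: \sum_g w g * act (a j) g]).
  move=> c; apply/ffunP=> l; rewrite ffunE.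
  transitivity (\sum_j s j l *: \sum_i c i * (t i j)%:A).
    apply: eq_bigr => j _; congr (_ *: _).
    under eq_bigr do rewrite ffunE mulr_suml.
    rewrite exchange_big /=; apply: eq_bigr => i _.
    rewrite -tE mulr_sumr; apply: eq_bigr => g _.
    by rewrite -mulrA (ractMl hact).
  under eq_bigr do rewrite scaler_sumr.
  rewrite exchange_big /= (bigD1 l) //= [X in _ + X]big1 ?addr0 => [|i nil].
    under eq_bigr do rewrite mulAl mulr1 scalerA mulrC.
    by rewrite -scaler_suml ts eqxx scale1r.
  under eq_bigr do rewrite mulAl mulr1 scalerA mulrC.
  by rewrite -scaler_suml ts (negbTE nil) scale0r.
move=> w; apply/ffunP=> h; rewrite ffunE.
under eq_bigr do rewrite ffunE mulr_suml.
rewrite exchange_big /=.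
transitivity (\sum_j (\sum_g w g * act (a j) g) * act (b j) h).
  apply: eq_bigr => j _; rewrite bE (ract_sum hact) mulr_sumr.
  by apply: eq_bigr => l _; rewrite actZ -scalerAl mulAl.
under eq_bigr do rewrite mulr_suml.
rewrite exchange_big /=.
have ab' g : \sum_j act (a j) g * act (b j) h = (g == h)%:R.
  have -> : \sum_j act (a j) g * act (b j) h = act (\sum_j a j * act (b j) (h * g^-1)%g) g.
    rewrite (ract_sum hact); apply: eq_bigr => j _; rewrite (ractMl hact) -total_actM.
    by rewrite mulgKV.
  rewrite ab; have -> : ((h * g^-1)%g == 1%g) = (g == h).
    by rewrite -eq_mulgV1 eq_sym.
  by case: eqP; rewrite ?(ract_one hact) ?(ract_zero hact).
under eq_bigr do (under eq_bigr do rewrite -mulrA; rewrite -mulr_sumr ab').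
rewrite (bigD1 h) //= eqxx mulr1 [X in _ + X]big1 ?addr0 // => g /negbTE ->.
by rewrite mulr0.
Qed.

End TorsorOfCoordinates.

Lemma ex_torsor (F : fieldType) (G : finGroupType) (A : nzRingType)
    (i : {rmorphism F -> A}) (act : G -> A -> A) :
  commutative (@GRing.mul A) -> ring_action act ->
  (forall g c, act g (i c) = i c) ->
  (forall z, (forall g, act g z = z) -> exists c, z = i c) ->
  chr_coords act ->
  exists (T : torsor G F) (f : {rmorphism A -> T}) (f' : {rmorphism T -> A}),
    [/\ cancel f f', cancel f' f, forall c z, f' (c *: z) = i c * f' z
      & forall g z, f (act g z) = torsor_act T (f z) g].
Proof.
move=> mulC hact actF fixF /[dup] [[n [a [b ab]]]] chr.
have sb : spans i b.
  move=> z; have /choice[c cE] j : exists c, rtrace act (z * a j) = i c.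
    by apply: fixF => g; apply: rtrace_fixed.
  exists c; rewrite {1}[z](chr_decomp hact _ mulC ab).
  by apply: eq_bigr => j _; rewrite cE.
have [m [e [se fe]]] := spans_minimal sb.
have [L [f [f' [fK f'K f'Z dL]]]] := ex_falgebra mulC se fe.
pose to z g := f (act g (f' z)).
have to1 : to^~ 1%g =1 id by move=> z; rewrite /to (ract1 hact) f'K.
have toM z : act_morph to z by move=> g h; rewrite /to fK (ractM hact).
pose a1 : {action G &-> L} := TotalAction to1 toM.
have mulCL : commutative (@GRing.mul L).
  by move=> x y; apply: (can_inj f'K); rewrite !rmorphM mulC.
have to_lin g : linear (a1^~ g).
  move=> c x y; apply: (can_inj f'K); rewrite /= /to !(fK, rmorphD, f'Z).
  by rewrite (ractD hact) (ractMl hact) actF.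
have to_mon g : monoid_morphism (a1^~ g).
  split=> [|x y]; apply: (can_inj f'K); rewrite /= /to !(fK, rmorphM, rmorph1).
    exact: ract_one.
  exact: ractMl.
have iso := @torsor_iso_of_coords F G L mulCL a1 to_lin to_mon.
have fixL z : (forall g, a1 z g = z) -> exists c, z = c%:A.
  move=> zf; have [|c cE] := fixF (f' z).
    by move=> g; have := congr1 f' (zf g); rewrite /= /to fK.
  by exists c; apply: (can_inj f'K); rewrite f'Z rmorph1 mulr1.
have chrL : chr_coords (fun g z => a1 z g).
  exists n, (f \o a), (f \o b) => g /=.
  rewrite /to; under eq_bigr do rewrite fK -rmorphM.
  by rewrite -rmorph_sum ab rmorph_nat.
exists (Torsor mulCL to_lin to_mon (iso fixL chrL)), f, f'.
by split=> // g z; rewrite /= /to fK.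
Qed.

Section CoordinatesTheory.

Variables (G : finGroupType) (A : nzRingType) (act : G -> A -> A).
Hypotheses (mulC : commutative (@GRing.mul A)) (hact : ring_action act).

(** A list stands for a tensor in [A (x) A], and this is its image among the functions from [G] to
    [A]. *)
Definition coord_fun (s : seq (A * A)) g := \sum_(x <- s) x.1 * act g x.2.

Lemma coord_fun_mul s t : exists r, forall g,
  coord_fun r g = coord_fun s g * coord_fun t g.
Proof.
exists [seq (x.1 * y.1, x.2 * y.2) | x <- s, y <- t] => g.
rewrite /coord_fun big_allpairs_dep /= mulr_suml; apply: eq_bigr => x _.
rewrite mulr_sumr; apply: eq_bigr => y _ /=.
by rewrite (ractMl hact) -!mulrA; congr (_ * _); rewrite mulrA [y.1 * _]mulC mulrA.
Qed.

Lemma chr_coords_seq s : (forall g, coord_fun s g = (g == 1%g)%:R) -> chr_coords act.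
Proof.
move=> sE; exists (size s), (fun i => (nth (0, 0) s i).1), (fun i => (nth (0, 0) s i).2).
by move=> g; rewrite -sE /coord_fun (big_nth (0, 0)) big_mkord.
Qed.

(** Functions coming from tensors are closed under products, so the delta function at 1 is a product
    of functions that are 1 at the identity and 0 at one given [g]. *)
Lemma chr_coords_separate :
  (forall g, g != 1%g -> exists s, coord_fun s 1%g = 1 /\ coord_fun s g = 0) ->
  chr_coords act.
Proof.
move=> sep.
suff [s [s1 s0]] : exists s, coord_fun s 1%g = 1 /\
    forall g, g \in enum G -> g != 1%g -> coord_fun s g = 0.
  apply: (@chr_coords_seq s) => g; have [-> | ng] := eqVneq g 1%g; first exact: s1.
  by apply: s0; rewrite ?mem_enum.
elim: (enum G) => [|g r [s [s1 s0]]].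
  exists [:: (1, 1)]; rewrite /coord_fun big_seq1 mul1r.
  by split; first exact: (ract_one hact).
have [-> | ng] := eqVneq g 1%g.
  by exists s; split=> // h; rewrite inE => /predU1P[-> | /s0 //]; rewrite eqxx.
have [t [t1 t0]] := sep _ ng; have [u uE] := coord_fun_mul s t.
exists u; split=> [|h]; rewrite uE ?s1 ?t1 ?mul1r // inE => /predU1P[-> _ | /s0 sh nh].
  by rewrite t0 mulr0.
by rewrite sh // mul0r.
Qed.

(** If the traces of all [a j] vanished, decomposing 1 along the coordinates would give 1 = 0. A
    nonzero trace is a scalar and can be normalized. *)
Lemma ex_trace1 (F : fieldType) (i : {rmorphism F -> A}) :
  (forall z, (forall g, act g z = z) -> exists c, z = i c) ->
  (forall g c, act g (i c) = i c) ->
  chr_coords act -> exists a, rtrace act a = 1.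
Proof.
move=> fixF actF [n [a [b ab]]].
have /choice[c cE] j : exists c, rtrace act (a j) = i c.
  by apply: fixF => g; apply: rtrace_fixed.
have [/forallP c0 | ] := boolP [forall j, c j == 0].
  have := chr_decomp hact 1 mulC ab.
  rewrite big1 => [/eqP|j _]; first by rewrite oner_eq0.
  by rewrite mul1r cE (eqP (c0 j)) rmorph0 mul0r.
rewrite negb_forall => /existsP[j nz]; exists (i (c j)^-1 * a j).
rewrite /rtrace; under eq_bigr do rewrite (ractMl hact) actF.
by rewrite -mulr_sumr -/(rtrace act (a j)) cE -rmorphM mulVf // rmorph1.
Qed.

End CoordinatesTheory.

Lemma chr_coords_push (G : finGroupType) (A B : nzRingType) (act : G -> A -> A)
    (actB : G -> B -> B) (f : {rmorphism A -> B}) :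
  (forall g z, f (act g z) = actB g (f z)) -> chr_coords act -> chr_coords actB.
Proof.
move=> fE [n [a [b ab]]]; exists n, (f \o a), (f \o b) => g /=.
under eq_bigr do rewrite -fE -rmorphM.
by rewrite -rmorph_sum ab rmorph_nat.
Qed.

(** For [z] moved by [g], the function h -> (z^h - z^g) / (z - z^g) is 1 at the identity and 0 at
    [g]. *)
Lemma chr_coords_field (G : finGroupType) (E : fieldType) (act : G -> E -> E) :
  ring_action act -> (forall g, g != 1%g -> exists z, act g z != z) ->
  chr_coords act.
Proof.
move=> hact faithful; apply: (chr_coords_separate (@mulrC E) hact) => g /faithful[z nz].
pose c := (z - act g z)^-1.
have nc : z - act g z != 0 by rewrite subr_eq0 eq_sym.
exists [:: (c, z); (- (c * act g z), 1)]; rewrite /coord_fun !big_cons !big_nil /=.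
rewrite !(ract_one hact) (ract1 hact) !addr0 !mulr1 -mulrBr mulVf //.
by split=> //; rewrite subrr.
Qed.

(** * Invariants and base change of torsors *)

Section TorsorTheory.

Variables (G : finGroupType) (F : fieldType) (T : torsor G F).
Let act (g : G) (z : T) := torsor_act T z g.

Lemma torsor_raction : ring_action act.
Proof.
apply: (torsor_ring_action (act := torsor_act T)).
  exact: torsor_act_linear.
exact: torsor_act_monoid.
Qed.

Lemma torsor_actZ g c (z : T) : act g (c *: z) = c *: act g z.
Proof.
have := torsor_act_linear g c z 0.
by rewrite addr0 -!/(act g _) (ract_zero torsor_raction) addr0.
Qed.

Lemma torsor_chr : chr_coords act.
Proof.
have [inv _ invK] := torsor_iso T.
pose c := inv [ffun g : G => (g == 1%g)%:R].
exists (\dim {:T}), c, (fun i => (vbasis {:T})`_i) => g.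
by have /ffunP/(_ g) := invK [ffun g : G => (g == 1%g)%:R]; rewrite !ffunE.
Qed.

(** For a fixed [z] the tensors z (x) 1 and 1 (x) z have the same image under the injective map of
    [torsor_iso]. Comparing their components at a basis vector that occurs in 1 shows that [z] is a
    scalar. *)
Lemma torsor_fixed (z : T) : (forall g, act g z = z) -> exists c, z = c%:A.
Proof.
move=> zf; have inj := bij_inj (torsor_iso T).
set e := vbasis {:T} in inj *.
pose m := coord e^~ 1; pose zeta := coord e^~ z.
have oneE : 1 = \sum_i m i *: e`_i by apply: coord_vbasis; apply: memvf.
have zE : z = \sum_i zeta i *: e`_i by apply: coord_vbasis; apply: memvf.
have /ffunP ff : [ffun i => (zeta i)%:A] = [ffun i => m i *: z].
  apply: inj; apply/ffunP => g; rewrite !ffunE.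
  transitivity z.
    rewrite -[RHS](zf g) zE (ract_sum torsor_raction); apply: eq_bigr => i _.
    by rewrite ffunE torsor_actZ -scalerAl mul1r.
  rewrite -[LHS]mulr1 -(ract_one torsor_raction g) oneE (ract_sum torsor_raction) mulr_sumr.
  apply: eq_bigr => i _; rewrite ffunE torsor_actZ -scalerAl -scalerAr //.
have [i nmi] : exists i, m i != 0.
  apply/existsP; rewrite -negb_forall; apply/negP => /forallP m0.
  have /eqP := oneE; rewrite big1 ?oner_eq0 // => i _.
  by rewrite (eqP (m0 i)) scale0r.
exists ((m i)^-1 * zeta i); have := ff i; rewrite !ffunE => /(congr1 ( *:%R (m i)^-1)).
by rewrite !scalerA mulVf // scale1r.
Qed.

End TorsorTheory.

Section BaseChange.

Variables (G : finGroupType) (F F' : fieldType) (iota : {rmorphism F -> F'}).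
Variable T : torsor G F.

(** The base change is found inside any ring [R] that receives [F'] centrally and [T] compatibly, as
    the subring of sums of products; this replaces the tensor product. Coordinates are pushed
    forward from [T], so only the invariants need an argument. *)
Lemma base_change_in (R : nzRingType) (Lam : {rmorphism T -> R})
    (sg : {rmorphism F' -> R}) (act0 : G -> R -> R) :
  (forall c x, sg c * x = x * sg c) -> (forall c z, Lam (c *: z) = sg (iota c) * Lam z) ->
  ring_action act0 -> (forall g z, act0 g (Lam z) = Lam (torsor_act T z g)) ->
  (forall g c, act0 g (sg c) = sg c) ->
  exists (T' : torsor G F') (f : {rmorphism T -> T'}),
    (forall c z, f (c *: z) = iota c *: f z) /\
    forall z g, f (torsor_act T z g) = torsor_act T' (f z) g.
Proof.
move=> sgC LamZ hact0 actL acts.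
pose val (s : seq (F' * T)) := \sum_(x <- s) sg x.1 * Lam x.2.
have mulT : commutative (@GRing.mul T) := @torsor_mulC G F T.
have mul2 a u b v : sg a * Lam u * (sg b * Lam v) = sg (a * b) * Lam (u * v).
  by rewrite !rmorphM -!mulrA; congr (_ * _); rewrite !mulrA sgC.
have hS : subring_prop (fun x => exists s, x = val s).
  split=> [|_ _ [s ->] [t ->] | _ _ [s ->] [t ->]].
  - by exists [:: (1, 1)]; rewrite /val big_seq1 !rmorph1 mulr1.
  - exists (s ++ [seq (- x.1, x.2) | x <- t]); rewrite /val big_cat big_map /=.
    by under [X in _ = _ + X]eq_bigr do rewrite rmorphN mulNr; rewrite sumrN.
  - exists [seq (x.1 * y.1, x.2 * y.2) | x <- s, y <- t].
    rewrite /val big_allpairs_dep /= mulr_suml; apply: eq_bigr => x _.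
    rewrite mulr_sumr; apply: eq_bigr => y _ /=.
    by rewrite mul2.
have [B [h [injh hE]]] := ex_subring hS.
have valC s t : val s * val t = val t * val s.
  rewrite /val mulr_suml mulr_sumr; apply: eq_bigr => x _.
  rewrite mulr_sumr mulr_suml; apply: eq_bigr => y _.
  by rewrite !mul2 mulrC mulT.
have mulC : commutative (@GRing.mul B).
  move=> x y; apply: (injh); rewrite !rmorphM.
  have /hE[s ->] : exists b, h x = h b by exists x.
  have /hE[t ->] : exists b, h y = h b by exists y.
  exact: valC.
have act_val g s : act0 g (val s) = val [seq (x.1, torsor_act T x.2 g) | x <- s].
  rewrite /val (ract_sum hact0) big_map /=; apply: eq_bigr => x _.
  by rewrite (ractMl hact0) acts actL.
have /choice[actB actBE] : forall gx : G * B, exists y, h y = act0 gx.1 (h gx.2).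
  move=> [g x] /=; have /hE[s ->] : exists b, h x = h b by exists x.
  have /hE[y yE] : exists t, act0 g (val s) = val t by rewrite act_val; eexists.
  by exists y.
pose act g x := actB (g, x).
have hE' g x : h (act g x) = act0 g (h x) by exact: actBE (g, x).
have hact : ring_action act.
  split=> [z | g k z | g x y | g].
  - by apply: (injh); rewrite hE' (ract1 hact0).
  - by apply: (injh); rewrite !hE' (ractM hact0).
  - by apply: (injh); rewrite rmorphB !hE' rmorphB (ractB hact0).
  - split=> [|x y]; apply: (injh); first by rewrite hE' rmorph1 (ract_one hact0).
    by rewrite rmorphM !hE' rmorphM (ractMl hact0).
have /choice[LB LBE] z : exists b, h b = Lam z.
  have /hE[b ->] : exists s, Lam z = val s; last by exists b.
  by exists [:: (1, z)]; rewrite /val big_seq1 rmorph1 mul1r.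
have /choice[sB sBE] c : exists b, h b = sg c.
  have /hE[b ->] : exists s, sg c = val s; last by exists b.
  by exists [:: (c, 1)]; rewrite /val big_seq1 rmorph1 mulr1.
have LBD : zmod_morphism LB by move=> x y; apply: (injh); rewrite rmorphB !LBE rmorphB.
have LBM : monoid_morphism LB.
  by split=> [|x y]; apply: (injh); rewrite ?rmorphM !LBE ?rmorphM ?rmorph1.
have sBD : zmod_morphism sB by move=> x y; apply: (injh); rewrite rmorphB !sBE rmorphB.
have sBM : monoid_morphism sB.
  by split=> [|x y]; apply: (injh); rewrite ?rmorphM !sBE ?rmorphM ?rmorph1.
pose L' : {rmorphism T -> B} := HB.pack LB
  (GRing.isZmodMorphism.Build T B LB LBD) (GRing.isMonoidMorphism.Build T B LB LBM).
pose s' : {rmorphism F' -> B} := HB.pack sB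
  (GRing.isZmodMorphism.Build F' B sB sBD) (GRing.isMonoidMorphism.Build F' B sB sBM).
have actLB g z : L' (torsor_act T z g) = act g (L' z).
  by apply: (injh); rewrite hE' /= !LBE actL.
have chr : chr_coords act by apply: (chr_coords_push actLB); apply: torsor_chr.
have actsB g c : act g (s' c) = s' c by apply: (injh); rewrite hE' /= !sBE acts.
have fT z : (forall g, torsor_act T z g = z) -> exists c, z = in_alg T c.
  by move/torsor_fixed.
have aT g c : torsor_act T (in_alg T c) g = in_alg T c.
  by rewrite /= (torsor_actZ g) (ract_one (torsor_raction T)).
have [a a1] := ex_trace1 mulT (torsor_raction T) fT aT (torsor_chr T).
(* As [a] has trace 1, a fixed [z] is the trace of [z * L' a]; expanding [z] reduces this to traces
   of elements of [T], which are scalars of [F]. *)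
have fixB z : (forall g, act g z = z) -> exists c, z = s' c.
  move=> zf; have /hE[s sE] : exists b, h z = h b by exists z.
  have trL : rtrace act (L' a) = 1.
    rewrite -[RHS](rmorph1 L') -a1 rmorph_sum; apply: eq_bigr => g _.
    by rewrite -actLB.
  have /choice[t tE] x : exists c, rtrace (fun g (z : T) => torsor_act T z g) (x * a) = c%:A.
    by apply: torsor_fixed => g; apply: (rtrace_fixed (torsor_raction T)).
  exists (\sum_(x <- s) x.1 * iota (t x.2)); apply: (injh).
  rewrite -[z]mulr1 -trL mulr_sumr.
  under eq_bigr => g do rewrite -{1}(zf g) -(ractMl hact).
  rewrite rmorph_sum /=; under eq_bigr do rewrite hE' rmorphM sE /= LBE /val mulr_suml (ract_sum hact0).
  rewrite exchange_big sBE rmorph_sum; apply: eq_bigr => x _ /=.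
  under eq_bigr do rewrite -mulrA -rmorphM (ractMl hact0) acts actL.
  rewrite -mulr_sumr -rmorph_sum -/(rtrace (fun g (z : T) => torsor_act T z g) _) tE.
  by rewrite LamZ rmorph1 mulr1 rmorphM.
have [T' [f [f' [fK f'K f'Z fact]]]] := ex_torsor mulC hact actsB fixB chr.
exists T', (f \o L'); split=> [c z | z g] /=.
  apply: (can_inj f'K); rewrite f'Z !fK; apply: (injh).
  by rewrite rmorphM !LBE /= sBE LamZ.
by rewrite -fact; congr (f _); exact: actLB.
Qed.

Lemma ex_coords (V : vectType F) : {x : V | x != 0} ->
  exists (n : nat) (e : 'I_n.+1 -> V) (co : V -> 'I_n.+1 -> F),
    (forall z, z = \sum_i co z i *: e i) /\
    (forall c, co (\sum_i c i *: e i) =1 c).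
Proof.
case=> x nzx; have := vbasisP {:V}; set X := vbasis {:V}.
have : \dim {:V} = \dim {:V} by []; move: X; move: {1 3 4}(\dim {:V}) => n.
case: n => [|n] X _ bX.
  by case/eqP: nzx; have := coord_basis bX (memvf x); rewrite big_ord0.
exists n, (fun i => X`_i), (fun z => coord X ^~ z); split=> [z | c i].
  exact: coord_basis bX (memvf z).
by rewrite coord_sum_free // (basis_free bX).
Qed.

Lemma ex_base_change :
  exists (T' : torsor G F') (f : {rmorphism T -> T'}),
    (forall c z, f (c *: z) = iota c *: f z) /\
    forall z g, f (torsor_act T z g) = torsor_act T' (f z) g.
Proof.
have [|n [e [co [coE eco]]]] := @ex_coords T; first by exists 1; rewrite oner_eq0.
have hact := torsor_raction T; have mulT : commutative (@GRing.mul T) := @torsor_mulC G F T.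
have co_uniq c z : z = \sum_i c i *: e i -> co z =1 c by move=> ->; apply: eco.
pose mx (phi : T -> T) : 'M[F']_n.+1 := \matrix_(i, j) iota (co (phi (e i)) j).
have mxML phi (psi : {linear T -> T}) : mx (psi \o phi) = mx phi *m mx psi.
  apply/matrixP=> i j; rewrite !mxE.
  under eq_bigr do rewrite !mxE -rmorphM.
  rewrite -rmorph_sum; congr (iota _).
  apply: (@co_uniq (fun j => \sum_l co (phi (e i)) l * co (psi (e l)) j)).
  rewrite /= {1}[phi (e i)]coE linear_sum /=.
  under [RHS]eq_bigr do rewrite scaler_suml.
  rewrite exchange_big /=; apply: eq_bigr => l _; rewrite linearZ /= {1}[psi (e l)]coE scaler_sumr.
  by apply: eq_bigr => m _; rewrite scalerA.
have mxM phi psi : linear psi -> mx (psi \o phi) = mx phi *m mx psi.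
  move=> lin.
  pose psiL : {linear T -> T} := HB.pack psi (GRing.isLinear.Build F T T _ psi lin).
  exact: (mxML phi psiL).
have mx1 phi : phi =1 id -> mx phi = 1%:M.
  move=> idE; apply/matrixP=> i j; rewrite !mxE idE.
  rewrite (@co_uniq (fun j => (i == j)%:R)) ?rmorph_nat //.
  rewrite (bigD1 i) //= eqxx scale1r big1 ?addr0 // => l /negbTE.
  by rewrite eq_sym => ->; rewrite scale0r.
have mx_ext phi psi : phi =1 psi -> mx phi = mx psi.
  by move=> E; apply/matrixP=> i j; rewrite !mxE E.
have rlin z : linear ( *%R^~ z : T -> T) by move=> c x y; rewrite mulrDl scalerAl.
have alin g : linear (fun z : T => torsor_act T z g) by exact: torsor_act_linear.
(* The ambient ring is the matrix ring over [F']: [T] acts on itself by multiplication, and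
   conjugation by the matrix [rho g] of the action of [g] turns multiplication by [z] into
   multiplication by z^g. *)
pose Lam (z : T) := mx ( *%R^~ z).
have coL c x y : co (c *: x + y) =1 fun j => c * co x j + co y j.
  apply: co_uniq; under eq_bigr do rewrite scalerDl -scalerA.
  by rewrite big_split -scaler_sumr -!coE.
have LamD : zmod_morphism Lam.
  move=> x y; apply/matrixP=> i j; rewrite !mxE -rmorphB; congr (iota _).
  rewrite mulrBr addrC -scaleN1r coL mulN1r addrC //.
have LamM : monoid_morphism Lam.
  split; first by rewrite /Lam mx1 // => x; rewrite mulr1.
  move=> x y; rewrite /Lam -[RHS](mxM _ _ (rlin y)); apply: mx_ext => z /=.
  by rewrite mulrA.
pose LamR : {rmorphism T -> 'M[F']_n.+1} := HB.pack Lam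
  (GRing.isZmodMorphism.Build _ _ Lam LamD) (GRing.isMonoidMorphism.Build _ _ Lam LamM).
pose rho g := mx (fun z : T => torsor_act T z g).
have rhoM g h : rho (g * h)%g = rho g *m rho h.
  by rewrite /rho -(mxM _ _ (alin h)); apply: mx_ext => z /=; rewrite (ractM hact).
have rho1 : rho 1%g = 1%:M by rewrite /rho mx1 // => z; rewrite (ract1 hact).
pose act0 g (X : 'M[F']_n.+1) := rho g^-1%g *m X *m rho g.
have hact0 : ring_action act0.
  split=> [X | g h X | g X Y | g].
  - by rewrite /act0 invg1 rho1 mul1mx mulmx1.
  - by rewrite /act0 invMg !rhoM !mulmxA.
  - by rewrite /act0 mulmxBr mulmxBl.
  - split=> [|X Y]; rewrite /act0; first by rewrite mulmx1 -rhoM mulVg.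
    have e1 : rho g *m rho g^-1%g = 1%:M by rewrite -rhoM mulgV.
    rewrite -[in RHS]mulmxE !mulmxA; congr (_ *m _).
    by rewrite -!mulmxA [rho g *m (_ *m _)]mulmxA e1 mul1mx.
apply: (@base_change_in _ LamR (@scalar_mx F' n.+1) act0) => //.
- by move=> c X; rewrite -mulmxE -scalar_mxC.
- move=> c z; apply/matrixP=> i j; rewrite -mulmxE mul_scalar_mx !mxE -rmorphM.
  congr (iota _); rewrite -scalerAr -[_ *: _]addr0 coL.
  have := coL (-1) (0 : T) 0 j; rewrite scaler0 addr0 mulN1r addNr => ->.
  by rewrite addr0.
- move=> g z; rewrite /act0 /= /Lam /rho -mulmxA -(mxM _ _ (alin g)) -mxM.
    apply: mx_ext => x /=; rewrite (ractMl hact) -(ractM hact) mulVg (ract1 hact) //.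
  by move=> c x y /=; rewrite mulrDl -scalerAl; apply: alin.
- by move=> g c; rewrite /act0 /= scalar_mxC -mulmxA -rhoM mulVg rho1 mulmx1.
Qed.

End BaseChange.

(** * Generic equivariant vectors and descent of a lift *)

Lemma rmorph_factor (A B C : nzRingType) (h : {rmorphism B -> C}) (f : {rmorphism A -> C}) :
  injective h -> (forall a, exists b, f a = h b) ->
  exists g : {rmorphism A -> B}, forall a, h (g a) = f a.
Proof.
move=> injh /choice[g gE].
have gD : zmod_morphism g by move=> x y; apply: (injh); rewrite rmorphB -!gE rmorphB.
have gM : monoid_morphism g.
  by split=> [|x y]; apply: (injh); rewrite ?rmorphM -!gE ?rmorphM ?rmorph1.
pose gR : {rmorphism A -> B} := HB.pack g
  (GRing.isZmodMorphism.Build A B g gD) (GRing.isMonoidMorphism.Build A B g gM).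
by exists gR => a; rewrite gE.
Qed.

Lemma falg_algebraic (F : fieldType) (L : falgType F) (a : L) :
  exists p : {poly F}, p != 0 /\ \sum_(i < size p) p`_i *: a ^+ i = 0.
Proof.
set d := \dim {:L}; set e := vbasis {:L}.
pose A : 'M[F]_(d.+1, d) := \matrix_(i, j) coord e j (a ^+ i).
have /rowV0Pn[v /sub_kermxP vA nzv] : kermx A != 0.
  by rewrite kermx_eq0 /row_free neq_ltn ltnS rank_leq_col.
pose p := \poly_(i < d.+1) v 0 (inord i).
have pE (i : 'I_d.+1) : p`_i = v 0 i by rewrite coef_poly ltn_ord inord_val.
exists p; split.
  apply: contraNneq nzv => p0; apply/eqP/rowP=> i.
  by rewrite mxE -pE p0 coef0.
transitivity (\sum_(i < d.+1) p`_i *: a ^+ i).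
  rewrite (big_ord_widen d.+1 (fun i => p`_i *: a ^+ i)) ?size_poly // [LHS]big_mkcond.
  by apply: eq_bigr => i _; case: ltnP => // /(nth_default 0) ->; rewrite scale0r.
set z := \sum_(i < _) _.
have -> : z = \sum_j coord e j z *: e`_j by apply: coord_vbasis; apply: memvf.
rewrite big1 // => j _; suff -> : coord e j z = 0 by rewrite scale0r.
move/rowP/(_ j): vA; rewrite !mxE linear_sum => vA0; rewrite -[RHS]vA0.
by apply: eq_bigr => i _; rewrite linearZ pE mxE.
Qed.

Lemma ex_field_point (F : fieldType) (L : falgType F) :
  commutative (@GRing.mul L) ->
  exists (Om : fieldType) (f : {rmorphism L -> Om}), True.
Proof.
move=> mulC; have [C [f [f' [fK f'K]]]] := ex_comring mulC.
(* A proper ideal of largest dimension is maximal, hence prime: adding an element outside it already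
   produces 1. *)
pose ideal (U : {vspace L}) := (forall a x, x \in U -> a * x \in U) /\ 1 \notin U.
pose Q n := `[< exists U, ideal U /\ \dim U = n >].
have Q0 : exists n, Q n.
  exists 0%N; apply/asboolP; exists 0%VS; rewrite dimv0; split=> //; split.
    by move=> a x; rewrite !memv0 => /eqP ->; rewrite mulr0.
  by rewrite memv0 oner_eq0.
case: (@ex_maxnP Q (\dim {:L}) Q0) => [n /asboolP[U [_ <-]]|n].
  exact/dimvS/subvf.
move=> /asboolP[U [[Uid U1] dU]] maxU.
have [||a x|| x y Ixy|Om [g _]] := @ex_prime_quotient C (fun x => f' x \in U).
- by rewrite rmorph0 mem0v.
- by move=> x y Ux Uy; rewrite rmorphD memvD.
- by rewrite rmorphM => /Uid.
- by rewrite rmorph1; apply/negP.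
- have [|nx] := boolP (f' x \in U); [by left | right].
  pose W := (U + limg (amull (f' x)))%VS.
  have Wx z : f' x * z \in W.
    have -> : f' x * z = amull (f' x) z by rewrite lfunE.
    by apply: (subvP (addvSr _ _)); apply: memv_img (memvf z).
  have Wid c w : w \in W -> c * w \in W.
    case/memv_addP=> u Uu [v /memv_imgP[z _ ->] ->]; rewrite lfunE /= mulrDr memvD //.
      by apply: (subvP (addvSl _ _)); apply: Uid.
    by rewrite mulC -mulrA.
  have W1 : 1 \in W.
    apply: contraT => nW1.
    have : Q (\dim W) by apply/asboolP; exists W.
    move/maxU; rewrite -dU => le; case/negP: nx.
    have /eqP -> : U == W by rewrite eqEdim addvSl.
    by rewrite -[f' x]mulr1.
  case/memv_addP: W1 => u Uu [v /memv_imgP[z _ ->]]; rewrite lfunE /= => e.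
  rewrite -[f' y]mul1r e mulrDl memvD //; first by rewrite mulC Uid.
  by rewrite -mulrA [z * _]mulC mulrA -rmorphM mulC Uid.
- by exists Om, (g \o f : {rmorphism L -> Om}).
Qed.

Lemma mulf_inv_comm (F : fieldType) (L : falgType F) (x : L) (phi : L -> L) :
  (forall x y, phi (x * y) = phi x * phi y) -> phi 1 = 1 ->
  (forall x, phi x \is a GRing.unit -> x \is a GRing.unit) ->
  phi x^-1 = (phi x)^-1.
Proof.
move=> phiM phi1 phiU; have [Ux | nUx] := boolP (x \is a GRing.unit); last first.
  by rewrite !invr_out //; apply: contra nUx => /phiU.
have e : phi x * phi x^-1 = 1 by rewrite -phiM divrr.
have e' : phi x^-1 * phi x = 1 by rewrite -phiM mulVr.
have Up : phi x \is a GRing.unit by apply/unitrP; exists (phi x^-1).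
by apply: (mulrI Up); rewrite e divrr.
Qed.

Lemma transcendental_infinite (K M : fieldType) (i : {rmorphism K -> M}) (t : M) :
  ~ algebraicOver i t -> injective (fun n => t ^+ n).
Proof.
move=> nalg; suff H m n : (m < n)%N -> t ^+ m <> t ^+ n.
  by move=> m n e; case: (ltngtP m n) => // /H; rewrite e.
move=> lt e; apply: nalg; exists ('X^n - 'X^m).
  apply/eqP => /(congr1 (fun p : {poly K} => p`_n)); rewrite coefB !coefXn eqxx coef0.
  by rewrite gtn_eqF // subr0 => /eqP; rewrite oner_eq0.
by rewrite rmorphB /= !map_polyXn /root !hornerE e subrr.
Qed.

Section GenericVector.

Variables (G : finGroupType) (K M : fieldType) (i : {rmorphism K -> M}).
Variables (T : torsor G M) (n : nat) (rho : G -> 'M[M]_n).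
Hypotheses (rhoM : forall g h, rho (g * h)%g = rho g *m rho h) (rho1 : rho 1%g = 1%:M).
Hypothesis transc : exists t : M, ~ algebraicOver i t.

Let act (g : G) (z : T) := torsor_act T z g.

(** The vector is a combination, with coefficients the powers of one scalar [th], of averages over
    the group. Every [g] with [rho g != 1%:M] and every conjugate only forbid the roots of a nonzero
    polynomial in [th], and the powers of a transcendental element supply enough scalars. *)
Lemma ex_generic_vector : exists y : 'I_n -> T,
  (forall g j, act g (y j) = \sum_l (rho g j l)%:A * y l) /\
  forall g, rho g != 1%:M -> exists j, y j - act g (y j) \is a GRing.unit.
Proof.
have hact : ring_action act := torsor_raction T.
have mulT : commutative (@GRing.mul T) := @torsor_mulC G M T.
have [Om [ev _]] := ex_field_point mulT.
have [N [a [b ab]]] := torsor_chr T.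
have actZ g c z : act g (c *: z) = c *: act g z := torsor_actZ g c z.
have actC g (c : M) : act g c%:A = c%:A by rewrite actZ (ract_one hact).
have CM (c d : M) : (c * d)%:A = c%:A * d%:A :> T by rewrite -scalerAl mul1r scalerA.
have CD (I : Type) (r : seq I) (P : pred I) (f : I -> M) :
    (\sum_(x <- r | P x) f x)%:A = \sum_(x <- r | P x) (f x)%:A :> T by rewrite scaler_suml.
pose yt (t : 'I_N * 'I_n) j := \sum_h (rho h^-1%g j t.2)%:A * act h (b t.1).
have ytE t g j : act g (yt t j) = \sum_l (rho g j l)%:A * yt t l.
  rewrite /yt (ract_sum hact); under [RHS]eq_bigr do rewrite mulr_sumr.
  rewrite exchange_big [RHS](reindex_inj (mulIg g)) /=; apply: eq_bigr => h _.
  rewrite (ractMl hact) actC -(ractM hact).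
  under [RHS]eq_bigr do rewrite mulrA -CM.
  rewrite -mulr_suml -CD; congr (_%:A * _).
  have -> : rho h^-1%g = rho g *m rho (h * g)^-1%g by rewrite -rhoM invMg mulKVg.
  by rewrite mxE.
(* Weighting the averaged vectors by the [a i] gives back the standard basis vectors. Hence a
   nonzero row cannot annihilate all of them, which makes the polynomials [p g h] below nonzero. *)
have ytd l j : \sum_i a i * yt (i, l) j = (j == l)%:R%:A.
  rewrite /yt /=; under eq_bigr do rewrite mulr_sumr.
  rewrite exchange_big /= (bigD1 1%g) //= [X in _ + X]big1 ?addr0 => [|h nh].
    under eq_bigr do rewrite mulrA [a _ * _]mulT -mulrA.
    by rewrite -mulr_sumr ab eqxx mulr1 invg1 rho1 mxE.
  under eq_bigr do rewrite mulrA [a _ * _]mulT -mulrA.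
  by rewrite -mulr_sumr ab (negbTE nh) mulr0.
have evC (c : M) : c != 0 -> ev c%:A != 0.
  by move=> nz; have := fmorph_eq0 (ev \o in_alg T) c => /= ->.
pose r g h j l := ((1%:M - rho g) *m rho h) j l.
have [n0 | n_gt0] := posnP n.
  have no (j : 'I_n) : False by move: (ltn_ord j); rewrite [X in (_ < X)%N]n0.
  by exists (fun=> 0); split=> [g j | g /eqP[]]; [case: (no j) | apply/matrixP=> j; case: (no j)].
have /choice[jj jjP] g : exists j, rho g != 1%:M -> forall h, exists l, r g h j l != 0.
  have [e | ng] := eqVneq (rho g) 1%:M; first by exists (Ordinal n_gt0) => /eqP[].
  have [j nzj] : exists j, row j (1%:M - rho g) != 0.
    apply/existsP; rewrite -negb_forall; apply: contra ng => /forallP r0.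
    by rewrite eq_sym -subr_eq0; apply/eqP/row_matrixP => j; rewrite row0 (eqP (r0 j)).
  exists j => _ h; apply/existsP; rewrite -negb_forall; apply: contra nzj => /forallP rj.
  have : row j ((1%:M - rho g) *m rho h) = 0.
    by apply/rowP=> l; rewrite [RHS]mxE [LHS]mxE; apply/eqP; apply: rj.
  rewrite row_mul => /(congr1 (mulmx^~ (rho h^-1%g))).
  by rewrite -mulmxA -rhoM mulgV rho1 mulmx1 mul0mx => ->.
pose cf g h t := ev (\sum_l (r g h (jj g) l)%:A * yt t l).
pose p g h : {poly Om} := \sum_t cf g h t *: 'X^(enum_rank t).
have pE g h t : (p g h)`_(enum_rank t) = cf g h t.
  rewrite coef_sum (bigD1 t) //= coefZ coefXn eqxx mulr1 big1 ?addr0 // => t' nt.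
  rewrite coefZ coefXn; case: eqP => [/val_inj/enum_rank_inj e|]; last by rewrite mulr0.
  by rewrite e eqxx in nt.
have p_nz g h : rho g != 1%:M -> p g h != 0.
  move=> /jjP/(_ h)[l nzr]; apply: contraNneq (evC _ nzr) => p0.
  have -> : (r g h (jj g) l)%:A = \sum_i a i * \sum_l' (r g h (jj g) l')%:A * yt (i, l) l'.
    under eq_bigr do rewrite mulr_sumr.
    rewrite exchange_big /= (bigD1 l) //= [X in _ + X]big1 ?addr0 => [|l' nl].
      under eq_bigr do rewrite mulrA [a _ * _]mulT -mulrA.
      by rewrite -mulr_sumr ytd eqxx scale1r mulr1.
    under eq_bigr do rewrite mulrA [a _ * _]mulT -mulrA.
    by rewrite -mulr_sumr ytd (negbTE nl) scale0r mulr0.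
  rewrite rmorph_sum big1 // => k _; rewrite rmorphM -/(cf g h (k, l)) -pE p0 coef0 mulr0 //.
have [t0 nalg] := transc; have injt := transcendental_infinite nalg.
pose P := \prod_(g | rho g != 1%:M) \prod_h p g h.
have P_nz : P != 0.
  by apply/prodf_neq0 => g ng; apply/prodf_neq0 => h _; apply: p_nz.
have [th thP] : exists th : M, P.[ev th%:A] != 0.
  apply: contrapT => /forallNP all0.
  pose rs := [seq ev (t0 ^+ m)%:A | m <- iota 0 (size P)].
  suff : (size rs < size P)%N by rewrite size_map size_iota ltnn.
  apply: max_poly_roots => //.
    by apply/allP=> _ /mapP[m _ ->]; have /negP := all0 (t0 ^+ m); rewrite negbK.
  rewrite map_inj_uniq ?iota_uniq // => m m' e; apply: (injt).
  apply: (fmorph_inj (ev \o in_alg T)); exact: e.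
pose y j := \sum_t th ^+ (enum_rank t) *: yt t j.
have yE g j : act g (y j) = \sum_l (rho g j l)%:A * y l.
  rewrite /y (ract_sum hact); under [RHS]eq_bigr do rewrite mulr_sumr.
  rewrite exchange_big /=; apply: eq_bigr => t _.
  rewrite actZ ytE scaler_sumr; apply: eq_bigr => l _; by rewrite scalerAr.
exists y; split=> // g ng; exists (jj g); set d := y _ - _.
have dE h : act h d = \sum_l (r g h (jj g) l)%:A * y l.
  have -> : d = \sum_l ((1%:M - rho g) (jj g) l)%:A * y l.
    rewrite /d yE -[X in X - _ = _](_ : \sum_l (1%:M (jj g) l)%:A * y l = _).
      rewrite -sumrB; apply: eq_bigr => l _; by rewrite -mulrBl -scalerBl !mxE.
    rewrite (bigD1 (jj g)) //= mxE eqxx scale1r mul1r big1 ?addr0 // => l nl.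
    by rewrite mxE eq_sym (negbTE nl) scale0r mul0r.
  rewrite (ract_sum hact) /r; under eq_bigr do rewrite (ractMl hact) actC yE mulr_sumr.
  rewrite exchange_big /=; apply: eq_bigr => l _.
  rewrite mxE CD mulr_suml; apply: eq_bigr => l' _; by rewrite mulrA -CM.
have dnz h : ev (act h d) != 0.
  suff -> : ev (act h d) = (p g h).[ev th%:A].
    apply: contraNneq thP => p0; rewrite /P horner_prod (bigD1 g) //= horner_prod.
    by rewrite (bigD1 h) //= p0 !mul0r.
  rewrite dE /p horner_sum.
  transitivity (\sum_t ev (th ^+ enum_rank t)%:A * cf g h t).
    rewrite /cf /y; under eq_bigr do rewrite mulr_sumr.
    rewrite exchange_big rmorph_sum /=; apply: eq_bigr => t _.
    rewrite -rmorphM mulr_sumr; congr (ev _); apply: eq_bigr => l _.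
    by rewrite -[LHS]scalerAr -[RHS]scalerAl mul1r.
  apply: eq_bigr => t _; rewrite hornerZ hornerXn mulrC; congr (_ * _).
  by rewrite -rmorphXn /= -(rmorphXn (in_alg T)).
(* The norm of [d] is invariant, hence a scalar, and it is nonzero because every conjugate of [d] is
   nonzero at the point [ev]. The other conjugates then provide the inverse of [d]. *)
have [c cE] : exists c, rnorm act d = c%:A.
  by apply: torsor_fixed => h; apply: (rnorm_fixed hact).
have nzc : c != 0.
  apply/eqP=> c0; move: cE; rewrite c0 scale0r => /(congr1 ev)/eqP.
  by rewrite rmorph0 rmorph_prod; apply/negP/prodf_neq0 => h _; apply: dnz.
have [C [f [f' [fK f'K]]]] := ex_comring mulT.
pose e := f' (\prod_(h | h != 1%g) f (act h d)).
have de : d * e = c%:A.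
  apply: (can_inj fK); rewrite -cE rmorph_prod (bigD1 1%g) //= rmorphM f'K.
  by rewrite (ract1 hact).
apply/unitrP; exists (c^-1 *: e).
rewrite -scalerAl -scalerAr [e * d]mulT de scalerA mulVf // scale1r.
by [].
Qed.

End GenericVector.

Section Descent.

Variables (P' P : finGroupType) (pi : {morphism [set: P'] >-> P}).
Variables (K : fieldType) (E : torsor P K) (M : ext K) (x : lift_obj pi E M).
Variables (n : nat) (rho : P' -> 'M[M]_n).
Hypotheses (rhoM : forall g h, rho (g * h)%g = rho g *m rho h) (rho1 : rho 1%g = 1%:M).
Hypothesis rho_alg : forall g i j, algebraicOver (ext_map M) (rho g i j).
Hypothesis rho_faithful : forall g, pi g = 1%g -> g != 1%g -> rho g != 1%:M.

Let T := lift_torsor x.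
Let act (g : P') (z : T) := torsor_act T z g.

Lemma ext_id_hom (L : ext K) : exists f : ext_hom L L, forall z, f z = z.
Proof. by exists (@ExtHom K L L idfun (fun=> erefl)). Qed.

(** The scalars may be finite in number here, so that no generic vector can be expected; but [M]
    itself has transcendence degree 0 over [K], and no descent is required. *)
Lemma ed_obj_algebraic : (forall t : M, algebraicOver (ext_map M) t) ->
  ele (@ed_obj K (Lift pi E) M x) (Some n).
Proof.
move=> algM.
have : ele (trdeg M) (Some (size (Nil M))).
  apply: (@trdeg_le K M M idfun) => z /=.
  have [p nzp pz] := algM z; exists (map_poly (ext_map M) p).
  rewrite map_poly_eq0; split=> // i; rewrite coef_map; exact: gen_base.
case dM : (trdeg M) => [d|] //= d0.
have [f fE] := ext_id_hom M.
apply: (@ele_einf _ d); last by apply: leq_trans d0 _.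
exists M, f, x; split; last by rewrite dM.
by exists idfun; split=> //= c b; rewrite fE.
Qed.

Lemma ed_obj_transcendental : (exists t : M, ~ algebraicOver (ext_map M) t) ->
  ele (@ed_obj K (Lift pi E) M x) (Some n).
Proof.
move=> transc; have hact : ring_action act := torsor_raction T.
have mulT : commutative (@GRing.mul T) := @torsor_mulC P' M T.
have [y [yE0 yU0]] := ex_generic_vector T rhoM rho1 transc.
have yE g j : act g (y j) = \sum_l (rho g j l)%:A * y l := yE0 g j.
have yU g : rho g != 1%:M -> exists j, y j - act g (y j) \is a GRing.unit := @yU0 g.
have [Om [ev _]] := ex_field_point mulT.
have actZ g c z : act g (c *: z) = c *: act g z := torsor_actZ g c z.
have actC g (c : M) : act g c%:A = c%:A by rewrite actZ (ract_one hact).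
have act_unit g z : (act g z \is a GRing.unit) = (z \is a GRing.unit).
  have H h w : w \is a GRing.unit -> act h w \is a GRing.unit.
    case/unitrP=> v [vw wv]; apply/unitrP; exists (act h v).
    by rewrite -!(ractMl hact) vw wv (ract_one hact).
  by apply/idP/idP => [/(H g^-1%g)|/H //]; rewrite (ractK hact).
have actV g z : act g z^-1 = (act g z)^-1.
  apply: (@mulf_inv_comm M T z (act g)) => [u v||w]; first exact: ractMl.
    exact: ract_one.
  by rewrite act_unit.
(* Generators of the descended algebra: [K], the entries of [rho], the image of [E] and the
   coordinates of the generic vector. All but the last are algebraic over [K], whence the bound
   [n]. *)
pose base (z : T) := [\/ exists c : K, z = (ext_map M c)%:A,
  exists g i j, z = (rho g i j)%:A, exists e : E, z = lift_map x e
  | exists j, z = y j].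
(* [T] need not be a field. Its inverse is the identity on non-units, so that closure under it
   amounts to closure under inverses of units. *)
pose closed (S : T -> Prop) := [/\ S 1, forall z w, S z -> S w -> S (z - w),
  forall z w, S z -> S w -> S (z * w) & forall z, S z -> S z^-1].
pose T0 z := forall S, closed S -> (forall w, base w -> S w) -> S z.
have T0c : closed T0.
  split=> [S [] // | z w Tz Tw S hS bS | z w Tz Tw S hS bS | z Tz S hS bS].
  - by case: (hS) => _ SB _ _; apply: SB; [apply: Tz | apply: Tw].
  - by case: (hS) => _ _ SM _; apply: SM; [apply: Tz | apply: Tw].
  - by case: (hS) => _ _ _ SV; apply: SV; apply: Tz.
case: (T0c) => T01 T0B T0M T0V.
have T0b w : base w -> T0 w by move=> bw S _; apply.
have T00 : T0 0 by rewrite -(subrr 1); apply: T0B.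
have T0D z w : T0 z -> T0 w -> T0 (z + w).
  by move=> Tz Tw; rewrite -[w]opprK -[- w]sub0r; apply: (T0B) => //; apply: T0B.
have T0act g z : T0 z -> T0 (act g z).
  move=> Tz; apply: (Tz (fun w => T0 (act g w))); first split=> [|u v Tu Tv | u v Tu Tv | u Tu].
  - by rewrite (ract_one hact).
  - by rewrite (ractB hact); apply: T0B.
  - by rewrite (ractMl hact); apply: T0M.
  - by rewrite actV; apply: T0V.
  move=> w [[c ->]|[h [i [j ->]]]|[e ->]|[j ->]].
  - by rewrite actC; apply: T0b; constructor 1; exists c.
  - by rewrite actC; apply: T0b; constructor 2; exists h, i, j.
  - rewrite /act -lift_map_act; apply: T0b; constructor 3; by eexists.
  - rewrite yE; elim/big_ind: _ => // l _; apply: T0M; apply: T0b.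
      by constructor 2; exists g, j, l.
    by constructor 4; exists l.
have CB (c d : M) : (c - d)%:A = c%:A - d%:A :> T by rewrite scalerBl.
have CM (c d : M) : (c * d)%:A = c%:A * d%:A :> T by rewrite -scalerAl mul1r scalerA.
have hM0 : subfield_prop (fun m : M => T0 m%:A).
  split=> [|c d Tc Td|c d Tc Td|c Tc]; rewrite ?scale1r ?CB ?CM //.
  - exact: T0B.
  - exact: T0M.
  have [-> | nz] := eqVneq c 0; first by rewrite invr0 scale0r.
  have -> : c^-1%:A = c%:A^-1 :> T; last exact: T0V.
  have U : c%:A \is a @GRing.unit T.
    by apply/unitrP; exists c^-1%:A; rewrite -!CM mulVf // mulfV // scale1r.
  by apply: (mulrI U); rewrite divrr // -CM mulfV // scale1r.
have [K0 [f0 f0E]] := ex_subfield hM0.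
have [|em emE] := @rmorph_factor K K0 M f0 (ext_map M) (fmorph_inj f0).
  move=> c; have /f0E[b bE] : T0 (ext_map M c)%:A; last by exists b.
  by apply: T0b; constructor 1; exists c.
pose M0 : ext K := Ext em.
pose fh : ext_hom M0 M := @ExtHom K M0 M f0 emE.
have [|B [h [injh hE]]] := @ex_subring T T0; first by split.
have [|io ioE] := @rmorph_factor K0 B T h (in_alg T \o f0) injh.
  by move=> c; apply/hE; rewrite /=; apply/f0E; exists c.
have [|lm lmE] := @rmorph_factor E B T h (lift_map x) injh.
  by move=> e; apply/hE; apply: T0b; constructor 3; exists e.
have /choice[aB aBE] : forall gb : P' * B, exists b, act gb.1 (h gb.2) = h b.
  by move=> [g b] /=; apply/hE; apply: T0act; apply/hE; exists b.
pose actB g b := aB (g, b).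
have hA g b : h (actB g b) = act g (h b) by rewrite (aBE (g, b)).
have mulB : commutative (@GRing.mul B).
  by move=> u v; apply: (injh); rewrite !rmorphM mulT.
have hactB : ring_action actB.
  split=> [z | g k z | g u v | g].
  - by apply: (injh); rewrite hA (ract1 hact).
  - by apply: (injh); rewrite !hA (ractM hact).
  - by apply: (injh); rewrite rmorphB !hA rmorphB (ractB hact).
  - split=> [|u v]; apply: (injh); first by rewrite hA rmorph1 (ract_one hact).
    by rewrite rmorphM !hA rmorphM (ractMl hact).
have actBc g c : actB g (io c) = io c by apply: (injh); rewrite hA !ioE /= actC.
have fixB z : (forall g, actB g z = z) -> exists c, z = io c.
  move=> zf; have [|c cE] := @torsor_fixed P' M T (h z).
    by move=> g; rewrite -[RHS](congr1 h (zf g)) hA.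
  have /f0E[b bE] : T0 c%:A by rewrite -cE; apply/hE; exists z.
  by exists b; apply: (injh); rewrite ioE /= -bE.
have [mE [aE [bE abE]]] := torsor_chr E.
have lm_act e g : lm (torsor_act E e (pi g)) = actB g (lm e).
  by apply: (injh); rewrite hA !lmE lift_map_act.
(* An element outside the kernel of [pi] is separated from 1 by coordinates of [E]; one in the
   kernel by a difference [y j - act g (y j)], which is a unit with inverse in [T0]. *)
have chrB : chr_coords actB.
  apply: (chr_coords_separate mulB hactB) => g ng.
  have [pg | npg] := eqVneq (pi g) 1%g; last first.
    exists [seq (lm (aE i), lm (bE i)) | i <- enum 'I_mE].
    have H k : coord_fun actB [seq (lm (aE i), lm (bE i)) | i <- enum 'I_mE] k
        = (pi k == 1%g)%:R.
      rewrite /coord_fun big_map big_enum -(rmorph_nat lm) -abE rmorph_sum.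
      by apply: eq_bigr => i _; rewrite /= -lm_act -rmorphM.
    by rewrite !H morph1 eqxx (negbTE npg).
  have [j Uj] := yU g (rho_faithful pg ng); set d := y j - _ in Uj.
  have T0y : T0 (y j) by apply: T0b; constructor 4; exists j.
  have /hE[yj yjE] := T0y.
  have /hE[v vE] : T0 d^-1 by apply: T0V; apply: T0B => //; apply: T0act.
  have vd : v * (yj - actB g yj) = 1.
    by apply: (injh); rewrite rmorphM rmorphB hA -vE -yjE mulVr // rmorph1.
  exists [:: (v, yj); (- (v * actB g yj), 1)]; rewrite /coord_fun !big_cons !big_nil /=.
  rewrite !(ract_one hactB) (ract1 hactB) !addr0 !mulr1 -mulrBr vd.
  by split=> //; rewrite subrr.
have [T1 [f [f' [fK f'K f'Z fact]]]] := ex_torsor mulB hactB actBc fixB chrB.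
have lmZ (c : K) (a : E) : (f \o lm) (c *: a) = ext_map M0 c *: (f \o lm) a.
  apply: (can_inj f'K); rewrite f'Z /= !fK; apply: (injh).
  by rewrite rmorphM !lmE ioE lift_mapZ /= emE -scalerAl mul1r.
have lmA (a : E) (g : P') : (f \o lm) (torsor_act E a (pi g)) = torsor_act T1 ((f \o lm) a) g.
  by rewrite /= lm_act fact.
pose x0 : lift_obj pi E M0 := @LiftObj _ _ pi K E M0 T1 (f \o lm) lmZ lmA.
have arr : lift_arrow fh x0 x.
  exists (h \o f' : {rmorphism T1 -> T}); split=> [c b | b g | a] /=.
  - by rewrite f'Z rmorphM ioE /= -scalerAl mul1r.
  - apply: etrans (hA g (f' b)); congr (h _).
    by apply: (can_inj fK); rewrite f'K fact f'K.
  - by rewrite fK lmE.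
have le : ele (trdeg M0) (Some n).
  pose t := [seq ev (y j) | j <- enum 'I_n].
  have <- : size t = n by rewrite size_map size_enum_ord.
  apply: (@trdeg_le K M0 Om (ev \o in_alg T \o f0)) => z.
  set em' : {rmorphism K -> Om} := _ \o ext_map M0.
  have emV c : em' c = ev (ext_map M c)%:A by rewrite /em' /= emE.
  pose cl := algcl em' (fun u => u \in t); have hcl := algcl_subfield em' (fun u => u \in t).
  suff H v0 : T0 v0 -> cl (ev v0) by apply: H; apply/f0E; exists z.
  have clK c : cl (em' c) by apply: sub_algcl; apply: gen_base.
  move=> Tv0; apply: (Tv0 (fun w => cl (ev w))); first split=> [|u v Tu Tv | u v Tu Tv | u Tu].
  - by rewrite rmorph1; apply: (subfield_prop1 hcl).
  - by rewrite rmorphB; apply: (subfield_propB hcl).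
  - by rewrite rmorphM; apply: (subfield_propM hcl).
  - have [U | nU] := boolP (u \is a GRing.unit); last by rewrite invr_out.
    by rewrite rmorphV //; apply: (subfield_propV hcl).
  have alg_cl w (p : {poly K}) : p != 0 -> root (map_poly em' p) w -> cl w.
    move=> nzp pw; exists (map_poly em' p); rewrite map_poly_eq0; split=> // i.
    by rewrite coef_map; apply: gen_base.
  move=> _ [[c ->]|[g [i [j ->]]]|[e ->]|[j ->]].
  - by rewrite -emV; apply: clK.
  - have [p nzp /rootP pz] := rho_alg g i j; apply: (alg_cl _ p nzp).
    have -> : map_poly em' p = map_poly (ev \o in_alg T) (map_poly (ext_map M) p).
      by rewrite -map_poly_comp; apply: eq_map_poly => c; rewrite emV.
    have := horner_map (ev \o in_alg T) (map_poly (ext_map M) p) (rho g i j).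
    by rewrite pz rmorph0 /= => e; apply/rootP.
  - have [p [nzp pe]] := falg_algebraic e; apply: (alg_cl _ p nzp).
    have pe' : \sum_(i < size p) ev (lift_map x (p`_i *: e ^+ i)) = 0.
      by have := congr1 (ev \o lift_map x) pe; rewrite rmorph0 rmorph_sum.
    apply/rootP; rewrite horner_coef size_map_poly -[RHS]pe'; apply: eq_bigr => i _.
    by rewrite coef_map [X in X * _]emV lift_mapZ -rmorphXn -rmorphM -scalerAl mul1r rmorphXn.
  - by apply: sub_algcl; apply: gen_sub; apply: map_f; rewrite mem_enum.
case dM : (trdeg M0) le => [d|] //= led.
by apply: (@ele_einf _ d) => //; exists M0, fh, x0.
Qed.

Lemma ed_obj_le : ele (@ed_obj K (Lift pi E) M x) (Some n).
Proof.
have [/ed_obj_algebraic // | /existsNP] := pselect (forall t, algebraicOver (ext_map M) t).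
exact: ed_obj_transcendental.
Qed.

End Descent.

(** * Divisibility of iterated differences *)

Definition diff (h : nat -> int) (x : nat) : int := h x.+1 - h x.

Lemma iter_diffE E h x :
  iter E diff h x = \sum_(k < E.+1) (-1) ^+ (E - k) * ('C(E, k))%:R * h (x + k)%N.
Proof.
elim: E x => [|E IH] x.
  by rewrite big_ord_recl big_ord0 /= addr0 expr0 bin0 !mul1r addn0.
rewrite iterS {1}/diff !{}IH.
rewrite [LHS]addrC big_ord_recl [RHS]big_ord_recl /= !subn0 !bin0 !addn0.
rewrite opprD -addrA exprS mulN1r !mulNr; congr (_ + _).
rewrite [in RHS]big_ord_recr /= subSS subnn binn expr0 mul1r.
rewrite [X in _ + X = _]big_ord_recr /= subnn binn expr0 mul1r addrA addSnnS.
congr (_ + _); rewrite -sumrN -big_split /=.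
apply: eq_bigr => i _; rewrite /bump /= !add1n binS natrD addSnnS !subSS.
rewrite mulrDr mulrDl; congr (_ + _).
by rewrite -[(E - i)%N in RHS]prednK ?subn_gt0 // -subnS exprS mulN1r !mulNr.
Qed.

(* Compares [E * Delta^(E-1) h] and [Delta^E h = 0] term by term at a point
   where [E - k = 1] modulo [p] whenever [h] may fail to be divisible. *)
Lemma dvd_iter_diff (p n E c : nat) (h : nat -> int) : prime p ->
    (0 < E < p ^ n)%N -> (forall x, iter E diff h x = 0) ->
    (forall x, ~~ (p %| x + c)%N -> ((p ^ n)%N %| h x)%Z) ->
  forall x, (p %| iter E.-1 diff h x)%Z.
Proof.
move=> pp /andP[E0 En] hE hd.
have [x0 hx0] : exists x0, (E + x0 + c = 1 %[mod p])%N.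
  exists ((E + c) * p - (E + c) + 1)%N.
  rewrite addnAC addnA subnKC ?leq_pmulr ?prime_gt0 //.
  by rewrite modnMDl.
have cst x : iter E.-1 diff h x = iter E.-1 diff h x0.
  have st y : iter E.-1 diff h y.+1 = iter E.-1 diff h y.
    by apply/eqP; rewrite -subr_eq0 -(hE y) -[in iter E](prednK E0).
  have st0 y : iter E.-1 diff h y = iter E.-1 diff h 0%N.
    by elim: y => // y <-.
  by rewrite st0 [RHS]st0.
move=> x; rewrite {}cst; move: (iter_diffE E h x0); rewrite hE => h0.
set s := logn p E; have sn : (s < n)%N.
  rewrite -(ltn_exp2l _ _ (prime_gt1 pp)); apply: leq_ltn_trans En.
  exact: dvdn_leq E0 (pfactor_dvdnn p E).
(* Here [s] is the exponent of [p] in [E], so that cancelling [E] leaves one factor [p]. In each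
   term either [h] is divisible by p^n with n > s, or [p] divides 1 - (E - k) and p^s divides the
   binomial coefficient. *)
suff dE : ((p ^ s.+1)%N %| E%:R * iter E.-1 diff h x0)%Z.
  have dp := prime_gt0 pp; have [e ce Ee] := pfactor_coprime pp E0.
  move: dE; rewrite [E in E%:R]Ee -/s expnS natrM -mulrAC !natz PoszM.
  rewrite dvdz_mul2r; last by rewrite -lt0n expn_gt0 dp.
  by rewrite Gauss_dvdzr.
have -> : E%:R * iter E.-1 diff h x0 =
   \sum_(k < E.+1) ((-1) ^+ (E - k) * (1 - (E - k)%:R) * ('C(E, k))%:R * h (x0 + k)%N).
  transitivity (\sum_(k < E.+1) (-1) ^+ (E - k) * ('C(E, k))%:R * h (x0 + k)%N
      - \sum_(k < E.+1) (-1) ^+ (E - k) * (E - k)%:R * ('C(E, k))%:R * h (x0 + k)%N).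
    rewrite -h0 sub0r iter_diffE prednK // big_distrr big_ord_recr /= subnn mulr0 !mul0r addr0.
    rewrite -sumrN; apply: eq_bigr => k _.
    have -> : (E - k)%N = (E.-1 - k).+1 by have := ltn_ord k; lia.
    rewrite exprS mulN1r -!mulNr opprK -(mulrA _ _%:R 'C(E, k)%:R) -natrM.
    have <- : (E * 'C(E.-1, k) = (E.-1 - k).+1 * 'C(E, k))%N.
      by rewrite mul_bin_down; congr (_ * _)%N; have := ltn_ord k; lia.
    by rewrite natrM; ring.
  by rewrite -sumrN -big_split; apply: eq_bigr => k _ /=; ring.
apply: rpred_sum => k _; rewrite -!mulrA dvdz_mull //.
case: (boolP (p %| x0 + k + c)%N) => [hb|/hd hg]; last first.
  by do 2 apply: dvdz_mull; apply: dvdz_trans hg; rewrite dvdzE /= dvdn_exp2l.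
have kE : (k <= E)%N by rewrite -ltnS.
have e1 : (E - k = 1 %[mod p])%N.
  rewrite -hx0; have -> : (E + x0 + c = (E - k) + (x0 + k + c))%N by lia.
  by rewrite -modnDmr (eqP hb) addn0.
have cop : coprime (p ^ s) (E - k).
  by rewrite coprimeXl // -coprime_modr e1 coprime_modr coprimen1.
have dC : (p ^ s %| 'C(E, k))%N.
  rewrite -(Gauss_dvdr _ cop) -mul_bin_down.
  by apply: dvdn_mulr; apply: (pfactor_dvdnn p E).
have d1 : (p %| (1 - (E - k)%:R : int))%Z.
  rewrite -opprB rpredN -[1]/(1%N%:Z) natz -eqz_mod_dvd.
  by rewrite !modz_nat e1 eqxx.
rewrite mulrA dvdz_mulr // expnS PoszM; apply: dvdz_mul => //.
by rewrite natz.
Qed.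

(** Newton's formula writes [c n - c 0] as an integral combination of the differences of orders 1 to
    n at 0. *)
Lemma newton_dvd (p : int) (c : nat -> int) (n : nat) :
  (forall j, (0 < j <= n)%N -> (p %| iter j diff c 0%N)%Z) -> (p %| c n - c 0%N)%Z.
Proof.
elim: n c => [|n IH] c hc; first by rewrite subrr dvdz0.
have dA : (p %| diff c n - diff c 0%N)%Z.
  by apply: IH => j /andP[j0 jn]; rewrite -iterSr; apply: hc.
have dB : (p %| diff c 0%N)%Z by apply: (hc 1%N).
have dC : (p %| c n - c 0%N)%Z.
  by apply: IH => j /andP[j0 jn]; apply: hc; rewrite j0 leqW.
have -> : c n.+1 - c 0%N = (diff c n - diff c 0%N) + diff c 0%N + (c n - c 0%N).
  by rewrite /diff; ring.
by rewrite rpredD // rpredD.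
Qed.

Section MixedDifferences.

Variable J : finType.
Implicit Types (b : J) (d : J -> nat) (h : (J -> nat) -> int) (l : seq J).

Definition inc b d : J -> nat := fun b' => (d b' + (b' == b))%N.

Definition dif b h : (J -> nat) -> int := fun d => h (inc b d) - h d.

Lemma difE b h d : dif b h d = h (inc b d) - h d. Proof. by []. Qed.

Definition difs l h := foldr dif h l.

Lemma inc_comm b b' d : inc b (inc b' d) = inc b' (inc b d).
Proof. by apply/funext => b''; rewrite /inc addnAC. Qed.

Lemma dif_comm b b' h : dif b (dif b' h) = dif b' (dif b h).
Proof. by apply/funext => d; rewrite /dif inc_comm; ring. Qed.

Lemma dif_difs b l h : dif b (difs l h) = difs l (dif b h).
Proof. by elim: l => //= b' l IH; rewrite dif_comm IH. Qed.

Lemma difs_sub l h g : difs l (fun d => h d - g d) = (fun d => difs l h d - difs l g d).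
Proof. by elim: l => //= b l ->; apply/funext => d; rewrite /dif; ring. Qed.

Lemma difs_cat l l' h : difs (l ++ l') h = difs l (difs l' h).
Proof. by rewrite /difs foldr_cat. Qed.

Lemma difs_nseq m b h : difs (nseq m b) h = iter m (dif b) h.
Proof. by elim: m => //= m ->. Qed.

Lemma difs_perm l l' h : perm_eq l l' -> difs l h = difs l' h.
Proof.
move=> pl; have com l1 l2 h1 : difs l1 (difs l2 h1) = difs l2 (difs l1 h1).
  by elim: l1 => //= b l1 ->; rewrite dif_difs.
elim: l l' pl => [|b l IH] l' pl; first by move/perm_size/esym/size0nil: pl => ->.
have bl' : b \in l' by rewrite -(perm_mem pl) mem_head.
have [l1 [l2 pE]] : exists l1 l2, l' = l1 ++ b :: l2 by case/splitPr: bl' => l1 l2; exists l1, l2.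
rewrite pE difs_cat com -difs_cat cat_cons /= difs_cat com -difs_cat.
congr dif; apply: IH; rewrite -(perm_cons b); apply: perm_trans pl _.
by rewrite pE -cat1s perm_catCA.
Qed.

Variables (p n N c : nat) (x y : J) (h : (J -> nat) -> int).
Hypotheses (p_pr : prime p) (neq_xy : x != y).
Hypothesis h_vanish : forall l d, (N < size l)%N -> difs l h d = 0.
Hypothesis h_dvd : forall d, ~~ (p %| d x + d y + c)%N -> ((p ^ n)%N %| h d)%Z.
Let q := (p ^ n)%N.

(** Replaces a step in direction [x] by one in direction [y]. As a difference of two difference
    operators it lowers the degree by one, and it raises the total degree in the two directions by
    one, which shifts the constant of the divisibility condition. *)
Let sw g : (J -> nat) -> int := fun d => dif y g d - dif x g d.

Lemma swapE g d : sw g d = g (inc y d) - g (inc x d).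
Proof. by rewrite /sw /dif; ring. Qed.

Lemma difs_swaps_vanish v m g : (forall l d, (m <= size l)%N -> difs l g d = 0) ->
  forall l d, (m <= size l + v)%N -> difs l (iter v sw g) d = 0.
Proof.
elim: v m g => [|v IH] m g hg l d; first by rewrite addn0; apply: hg.
move=> ml; rewrite iterSr (IH m.-1) //; last by move: ml; lia.
move=> l1 d1 ml1; rewrite [sw g]/sw difs_sub -!dif_difs.
have hs b : difs (b :: l1) g d1 = 0.
  by apply: hg; move: ml1; case: (m) => //= m1.
by move: (hs x) (hs y) => /= hx hy; rewrite hx hy subrr.
Qed.

Lemma difs_dvd l g c' : (forall d, ~~ (p %| d x + d y + c')%N -> (q %| g d)%Z) ->
    x \notin l -> y \notin l ->
  forall d, ~~ (p %| d x + d y + c')%N -> (q %| difs l g d)%Z.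
Proof.
move=> hg; elim: l => [|b l IH] //=; rewrite !inE !negb_or => /andP[xb xl] /andP[yb yl] d hd.
have {}IH := IH xl yl; rewrite /dif rpredB ?IH //.
by rewrite /inc (negbTE xb) (negbTE yb) !addn0.
Qed.

Lemma swaps_dvd v g c' : (forall d, ~~ (p %| d x + d y + c')%N -> (q %| g d)%Z) ->
  forall d, ~~ (p %| d x + d y + (c' + v))%N -> (q %| iter v sw g d)%Z.
Proof.
move=> hg; elim: v => [|v IH] d hd; first by apply: hg; move: hd; rewrite addn0.
rewrite iterS swapE rpredB //; apply: IH; apply: contra hd;
by rewrite /inc eqxx ?[y == x]eq_sym (negbTE neq_xy) !addn0 => hp; move: hp;
   congr (_ %| _)%N; lia.
Qed.

(** Trades differences in direction [x] for differences in direction [y]. Let [cc j] use j of the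
    latter and q - 1 - j of the former; its j-th difference at 0 is a (q - j - 1)-st difference in
    [x] of the j-fold swap of [g]. Here [dvd_iter_diff] applies with E = q - j, which is less than q
    as j > 0, and [newton_dvd] adds up the steps. *)
Lemma difs_swap_mod l d : (size l + q.-1 = N)%N -> x \notin l -> y \notin l ->
  (p %| difs (l ++ nseq q.-1 y) h d - difs (l ++ nseq q.-1 x) h d)%Z.
Proof.
move=> sl xl yl; have q0 : (0 < q)%N by rewrite expn_gt0 prime_gt0.
pose g := difs l h.
have gE b m : difs (l ++ nseq m b) h = iter m (dif b) g.
  rewrite -difs_nseq /g -difs_cat; apply: difs_perm.
  by rewrite perm_catC.
have g0 l' d' : (q <= size l')%N -> difs l' g d' = 0.
  by move=> hl'; rewrite /g -difs_cat h_vanish // size_cat -sl; move: hl' q0; lia.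
have gd d' : ~~ (p %| d' x + d' y + c)%N -> (q %| g d')%Z by apply: difs_dvd.
rewrite !gE.
pose cc j := iter (q.-1 - j) (dif x) (iter j (dif y) g) d.
have itx m g1 g2 d1 : iter m (dif x) g1 d1 - iter m (dif x) g2 d1 =
    iter m (dif x) (fun d' => g1 d' - g2 d') d1.
  by rewrite -!difs_nseq difs_sub.
have swC g1 : sw (dif y g1) = dif y (sw g1).
  by apply/funext => d1; rewrite /sw (dif_comm x) /dif; ring.
have swsC m j g1 : iter m sw (iter j (dif y) g1) = iter j (dif y) (iter m sw g1).
  have st j1 g2 : sw (iter j1 (dif y) g2) = iter j1 (dif y) (sw g2).
    by elim: j1 => //= j1 <-; rewrite swC.
  by elim: m => //= m ->; rewrite st.
have ccE j i : (i + j <= q.-1)%N ->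
    iter j diff cc i = iter (q.-1 - i - j) (dif x) (iter i (dif y) (iter j sw g)) d.
  elim: j i => [|j IH] i ij; first by rewrite subn0.
  rewrite iterS /diff !IH //; try lia.
  have -> : (q.-1 - i - j)%N = (q.-1 - i - j.+1).+1 by move: ij; case: (q.-1) => [|m]; lia.
  have -> : (q.-1 - i.+1 - j)%N = (q.-1 - i - j.+1)%N by lia.
  rewrite [in X in _ - X]iterSr itx; congr (iter _ _ _ _).
  rewrite -!swsC; apply/funext => d1.
  by rewrite [iter i.+1 _ _]iterS (swsC j 1%N).
have := @newton_dvd p cc q.-1 _.
rewrite /cc subnn subn0 /=; apply=> j /andP[j0 jq].
rewrite ccE // subn0 /=.
pose hx t := iter j sw g (fun b => (d b + t * (b == x))%N).
have hxE m t : iter m diff hx t = iter m (dif x) (iter j sw g) (fun b => (d b + t * (b == x))%N).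
  elim: m t => //= m IH t; rewrite /diff !IH [RHS]difE.
  suff -> : inc x (fun b => (d b + t * (b == x))%N) = (fun b => (d b + t.+1 * (b == x))%N) by [].
  by apply/funext => b; rewrite /inc mulSn -addnA; congr addn; rewrite addnC.
have := @dvd_iter_diff p n (q - j) (d x + d y + (c + j)) hx p_pr.
have d0 : d = (fun b => (d b + 0 * (b == x))%N) by apply/funext => b; rewrite addn0.
rewrite [in X in _ -> (_ %| X)%Z]d0 -subn1 subnAC subn1 -hxE; apply.
- by rewrite -/q; lia.
- move=> t; rewrite hxE -difs_nseq (difs_swaps_vanish g0) // size_nseq.
  by move: jq q0; lia.
- move=> t ht; apply: (@swaps_dvd j g c gd); apply: contra ht.
  rewrite eqxx [y == x]eq_sym (negbTE neq_xy) muln1 muln0 addn0.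
  by congr (_ %| _)%N; lia.
Qed.

End MixedDifferences.

(** * Stanley decompositions and multigraded counting *)

Section Cones.

Variable n : nat.
Implicit Types (m mu al : 'X_{1..n}) (B : {set 'I_n}) (c : 'X_{1..n} * {set 'I_n}).

Definition in_cone c m :=
  [forall i, if i \in c.2 then (c.1 i <= m i)%N else m i == c.1 i].

Lemma in_coneP c m : reflect (forall i, if i \in c.2 then (c.1 i <= m i)%N : Prop else m i = c.1 i)
  (in_cone c m).
Proof.
apply: (iffP forallP) => h i; move: (h i); case: ifP => // _; first by move/eqP.
by move=> ->.
Qed.

(** A Stanley decomposition of the complement of a monomial ideal. The count states both that the
    cones cover [D] and that they are disjoint. *)
Lemma cone_decomposition (D : 'X_{1..n} -> Prop) :
    (forall m mu, D m -> (mu <= m)%MM -> D mu) ->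
  exists cs : seq ('X_{1..n} * {set 'I_n}),
    forall m, count (in_cone^~ m) cs = `[< D m >].
Proof.
move=> dcl.
suff gen_dec B al : exists cs : seq ('X_{1..n} * {set 'I_n}),
    forall m, count (in_cone^~ m) cs = (in_cone (al, B) m && `[< D m >]).
  have [cs hcs] := gen_dec [set: 'I_n] 0%MM; exists cs => m; rewrite hcs.
  by rewrite (_ : in_cone _ _) //; apply/in_coneP => i; rewrite inE mnmE.
have [r] := ubnP #|B|; elim: r B al => // r IH B al /ltnSE cB.
have [allD|] := pselect (forall m, in_cone (al, B) m -> D m).
  exists [:: (al, B)] => m /=; rewrite addn0.
  by case: (boolP (in_cone _ _)) => // /allD Dm; rewrite (asboolT Dm).
move=> /existsNP[mu /not_implyP[mua nDmu]].
(* [mu] lies in the cone but not in [D], so a member of [D] in the cone has an exponent below that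
   of [mu]. Sorting by the first such free variable [i] and by its exponent [j] gives disjoint
   subcones in which [i] is no longer free. *)
pose bs i j : 'X_{1..n} := [multinom if k == i then j
  else if (k \in B) && (k < i)%N then mu k else al k | k < n].
have /choice[f hf] (ij : 'I_n * nat) : exists cs : seq ('X_{1..n} * {set 'I_n}),
    ij.1 \in B -> forall m, count (in_cone^~ m) cs =
      (in_cone (bs ij.1 ij.2, B :\ ij.1) m && `[< D m >]).
  case: (boolP (ij.1 \in B)) => [iB|]; last by exists [::].
  have [|cs hcs] := IH (B :\ ij.1) (bs ij.1 ij.2); last by exists cs.
  by move: cB; rewrite (cardsD1 ij.1) iB.
pose js i := iota (al i) (mu i - al i).
exists (flatten [seq f (i, j) | i <- enum B, j <- js i]) => m.
pose good i := [&& i \in B, (m i < mu i)%N & [forall (k | (k \in B) && (k < i)%N), (mu k <= m k)%N]].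
have pieceE i j : i \in B -> j \in js i ->
    in_cone (bs i j, B :\ i) m = [&& in_cone (al, B) m, m i == j & good i].
  rewrite /good /js mem_iota => iB /andP[aj jm]; rewrite iB /=.
  apply/in_coneP/and4P => [h|[/in_coneP ha /eqP mi mlt /forallP hk] k].
    have mi : m i = j by have := h i; rewrite /= !inE eqxx mnmE eqxx.
    split; last 3 first.
    - by rewrite mi.
    - by rewrite mi; move: jm; have := leq_subLR (al i) (mu i) (mu i); lia.
    - apply/forallP => k; apply/implyP => /andP[kB ki]; have := h k.
      rewrite /= !inE kB (_ : k != i); last by rewrite -val_eqE /= ltn_eqF.
      by rewrite mnmE -val_eqE /= (ltn_eqF ki) kB ki.
    apply/in_coneP => k /=; have := h k; rewrite /= !inE mnmE.
    case: (altP (k =P i)) => [-> _ | ki] /=; first by rewrite iB mi.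
    case: (boolP (k \in B)) => kB //=; case: ltnP => // _; apply: leq_trans.
    by have /in_coneP/(_ k) := mua; rewrite /= kB.
  rewrite /= !inE mnmE; case: (altP (k =P i)) => [-> | ki] //=.
  have := ha k; rewrite /=; case: (boolP (k \in B)) => kB //= ak.
  by case: ltnP => // kli; have := hk k; rewrite kB kli.
rewrite count_flatten sumnE big_map big_allpairs_dep /=.
rewrite big_enum /=.
case: (boolP (in_cone (al, B) m)) => [mc | mnc] /=; last first.
  rewrite big1 // => i iB; rewrite big_seq big1 // => j jj /=.
  by rewrite (hf (i, j)) //= pieceE // (negbTE mnc).
case: (asboolP (D m)) => Dm; last first.
  rewrite big1 // => i iB; rewrite big1 // => j _ /=.
  by rewrite (hf (i, j)) //= (asboolF Dm) andbF.
have cnt i : i \in B -> (\sum_(j <- js i) count (in_cone^~ m) (f (i, j)) = good i)%N.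
  move=> iB; have ami : (al i <= m i)%N by have /in_coneP/(_ i) := mc; rewrite /= iB.
  transitivity (\sum_(j <- js i) ((j == m i) && good i))%N.
    rewrite big_seq [RHS]big_seq; apply: eq_bigr => j jj.
    by rewrite (hf (i, j)) //= pieceE // mc (asboolT Dm) andbT eq_sym.
  case: (boolP (good i)) => [gi|]; last by rewrite big1 // => j _; rewrite andbF.
  rewrite (bigD1_seq (m i)) /=; last exact: iota_uniq.
    by rewrite eqxx big1 // => j /negbTE ->.
  by have /and3P[_ lt _] := gi; rewrite mem_iota ami /=; lia.
rewrite (eq_bigr (fun i => good i : nat)); last exact: cnt.
have [i0 i0B] : exists2 i : 'I_n, i \in B & (m i < mu i)%N.
  apply: contrapT => hno; apply: nDmu; apply: (dcl m) => //; apply/mnm_lepP => i.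
  have /in_coneP/(_ i) := mua; have /in_coneP/(_ i) := mc; rewrite /=.
  case: ifP => [iB _ _ | _ -> -> //].
  by rewrite leqNgt; apply/negP => lt; apply: hno; exists i.
move=> lt0; pose i1 := [arg min_(i < i0 | (i \in B) && (m i < mu i)%N) (i : nat)].
have [i1B lt1 min1] : [/\ i1 \in B, (m i1 < mu i1)%N &
    forall k, k \in B -> (m k < mu k)%N -> (i1 <= k)%N].
  rewrite /i1; case: arg_minnP; first by rewrite i0B.
  by move=> i /andP[iB lt] hmin; split=> // k kB ltk; apply: hmin; rewrite kB.
have g1 : good i1.
  rewrite /good i1B lt1; apply/forallP => k; apply/implyP => /andP[kB ki].
  by rewrite leqNgt; apply/negP => /(min1 k kB); rewrite leqNgt ki.
rewrite (bigD1 i1) ?i1B //= g1 big1 // => i /andP[iB ii1].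
case: (boolP (good i)) => // /and3P[_ lt /forallP/(_ i1)].
rewrite i1B ltn_neqAle [_ == _]eq_sym (min1 i) // andbT.
by rewrite -[_ == _]/(i == i1) ii1 /= leqNgt lt1.
Qed.

End Cones.

Section BlockCounts.

Variables (n : nat) (J : finType) (bt : 'I_n -> J).
Implicit Types (m al : 'X_{1..n}) (B : {set 'I_n}) (d : J -> nat) (l : seq J).

Definition bdeg m (b : J) : nat := (\sum_(i | bt i == b) m i)%N.

Lemma bdegD m m' b : bdeg (m + m') b = (bdeg m b + bdeg m' b)%N.
Proof. by rewrite /bdeg -big_split; apply: eq_bigr => i _; rewrite mnmDE. Qed.

Lemma bdeg1 i b : bdeg U_(i)%MM b = (b == bt i).
Proof.
rewrite /bdeg; case: (eqVneq b (bt i)) => [->|bi].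
  rewrite (bigD1 i) //= mnm1E eqxx big1 // => j /andP[_ ji].
  by rewrite mnm1E eq_sym (negbTE ji).
by rewrite big1 // => j /eqP jb; rewrite mnm1E; case: eqP => // ij; case/eqP: bi; rewrite -jb ij.
Qed.

Lemma mdeg_bdeg m : mdeg m = (\sum_b bdeg m b)%N.
Proof.
rewrite mdegE (partition_big bt xpredT) //=.
Qed.

Definition has_bdeg d m := [forall b, bdeg m b == d b].

Definition mons d : seq 'X_{1..n} :=
  locked [seq m <- [seq bmnm x | x <- enum [set: 'X_{1..n < (\sum_b d b).+1}]] | has_bdeg d m].

Lemma mem_mons d m : (m \in mons d) = has_bdeg d m.
Proof.
rewrite /mons -lock mem_filter; case: (boolP (has_bdeg d m)) => //= /forallP hm.
have lt : (mdeg m < (\sum_b d b).+1)%N.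
  by rewrite mdeg_bdeg ltnS; apply: leq_sum => b _; rewrite (eqP (hm b)).
by apply/mapP; exists (BMultinom lt); rewrite ?mem_enum ?inE.
Qed.

Lemma mons_uniq d : uniq (mons d).
Proof. by rewrite /mons -lock filter_uniq // map_inj_uniq ?enum_uniq //; apply: val_inj. Qed.

Lemma filter_mons_uniq a d : uniq [seq m <- mons d | a m].
Proof. exact/filter_uniq/mons_uniq. Qed.

Definition cone_count al B d : int := (count (in_cone (al, B)) (mons d))%:Z.

Lemma cone_count0 al B d b : (forall i, i \in B -> bt i != b) -> (bdeg al b < d b)%N ->
  cone_count al B d = 0.
Proof.
move=> hB lt; rewrite /cone_count; congr Posz; apply/eqP; rewrite -leqn0 leqNgt -has_count.
apply/hasP => -[m]; rewrite mem_mons => /forallP/(_ b)/eqP mb /in_coneP mc.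
have e : bdeg m b = bdeg al b; last by move: lt; rewrite -mb e ltnn.
apply: eq_bigr => i /eqP ib; by have := mc i; rewrite /=; case: ifP => // /hB; rewrite ib eqxx.
Qed.

(** Either the exponent of the free variable [i] exceeds its minimum and one factor can be removed,
    or it equals the minimum and [i] might as well not be free. *)
Lemma cone_countD1 al B d i : i \in B ->
  cone_count al B (inc (bt i) d) = cone_count al B d + cone_count al (B :\ i) (inc (bt i) d).
Proof.
move=> iB; rewrite /cone_count -PoszD; congr Posz.
rewrite -!size_filter.
have -> : size [seq x <- mons d | in_cone (al, B) x] =
    size [seq (x + U_(i))%MM | x <- [seq x <- mons d | in_cone (al, B) x]].
  by rewrite size_map.
rewrite -size_cat; apply/perm_size/uniq_perm.
- exact: filter_mons_uniq.
- rewrite cat_uniq map_inj_uniq ?filter_mons_uniq ?andbT //=; last exact: addIm.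
  apply/hasPn => m; rewrite mem_filter => /andP[/in_coneP mc _]; apply/mapP => -[m'].
  rewrite mem_filter => /andP[/in_coneP mc' _] mE.
  have := mc i; rewrite /= !inE eqxx mE mnmDE mnm1E eqxx /=.
  by have := mc' i; rewrite /= iB; lia.
move=> m; rewrite mem_cat !mem_filter !mem_mons.
have dE m' : has_bdeg (inc (bt i) d) (m' + U_(i))%MM = has_bdeg d m'.
  by apply: eq_forallb => b; rewrite bdegD bdeg1 /inc eqn_add2r.
case: (ltnP (al i) (m i)) => [lt|le].
  have mE : m = (m - U_(i) + U_(i))%MM.
    by rewrite submK //; apply/mnm_lepP => j; rewrite mnm1E; case: eqP => // <-; apply: leq_ltn_trans lt.
  have -> : in_cone (al, B :\ i) m = false.
    by apply/in_coneP => /(_ i); rewrite /= !inE eqxx /= => e; rewrite e ltnn in lt.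
  rewrite orbF {1 2}mE dE; apply/andP/mapP => [[/in_coneP mc md]|[m']].
    exists (m - U_(i))%MM => //; rewrite mem_filter mem_mons md andbT.
    apply/in_coneP => j; have := mc j; rewrite -mE /= mnmBE mnm1E.
    by case: eqP => [<-|_]; rewrite ?iB ?subn0 //; lia.
  rewrite mem_filter mem_mons => /andP[/in_coneP mc md] e.
  have -> : (m - U_(i))%MM = m' by rewrite e addmK.
  split=> //; apply/in_coneP => j; have := mc j; rewrite /= mnmDE mnm1E.
  by case: eqP => [<-|_]; rewrite ?iB ?addn0 //; lia.
have -> : (m \in [seq (x + U_(i))%MM | x <- [seq x <- mons d | in_cone (al, B) x]]) = false.
  apply/mapP => -[m']; rewrite mem_filter => /andP[/in_coneP/(_ i)].
  by rewrite /= iB => h _ mE; move: le; rewrite mE mnmDE mnm1E eqxx; lia.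
congr (_ && _); apply/in_coneP/in_coneP => mc j; have := mc j; rewrite /= !inE.
  by case: eqP => [->|] //=; rewrite iB => ?; apply/eqP; rewrite eqn_leq le.
by case: eqP => [->|] //=; rewrite iB => ->.
Qed.

Definition blk B b := [set i in B | bt i == b].

Lemma cone_count1 al B d : (forall b, #|blk B b| = 1%N) -> (forall b, (bdeg al b <= d b)%N) ->
  cone_count al B d = 1.
Proof.
move=> hB hd.
have /choice[r hr] b : exists i, blk B b = [set i] by apply/cards1P/eqP/hB.
have rE i : i \in B -> i = r (bt i).
  by move=> iB; apply/set1P; rewrite -hr inE iB eqxx.
have rB b : (r b \in B) /\ bt (r b) = b.
  by have := set11 (r b); rewrite -hr inE => /andP[-> /eqP].
pose m := [multinom if i \in B then (al i + (d (bt i) - bdeg al (bt i)))%N else al i | i < n].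
have mb : has_bdeg d m.
  apply/forallP => b; rewrite /bdeg (bigD1 (r b)) /=; last by rewrite (rB b).2.
  rewrite mnmE (rB b).1 (rB b).2.
  rewrite (eq_bigr al); last first.
    move=> i /andP[/eqP ib ir]; rewrite mnmE; case: ifP => // /rE e.
    by rewrite e ib eqxx in ir.
  have := hd b; rewrite {1 2}/bdeg (bigD1 (r b)) /=; last by rewrite (rB b).2.
  by move=> h; apply/eqP; move: h; rewrite /=; lia.
rewrite /cone_count -size_filter; congr Posz; rewrite (@perm_size _ _ [:: m]) //.
apply: uniq_perm; rewrite ?filter_mons_uniq // => m'.
rewrite mem_filter mem_mons inE; apply/andP/eqP => [[/in_coneP mc /forallP md]|->]; last first.
  by split=> //; apply/in_coneP => i; rewrite /= mnmE; case: ifP => ->; rewrite ?leq_addr.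
have off i : i \notin B -> m' i = al i by have := mc i; rewrite /=; case: ifP.
apply/mnmP => i; rewrite mnmE; case: ifP => iB; last by rewrite off ?iB.
have := md (bt i); have := hd (bt i); rewrite /bdeg (bigD1 i) //= => h.
rewrite (bigD1 i) //= (eq_bigr al) => [/eqP <-|j /andP[/eqP jb ji]].
  by rewrite subnDr subnKC //; have := mc i; rewrite /= iB.
by apply: off; apply: contra ji => /rE ->; rewrite jb -rE.
Qed.

(** Once degrees exceed those of all vertices of the cones, the counts are in their polynomial
    range. *)
Definition shift (M : nat) d : J -> nat := fun b => (d b + M)%N.

Lemma shift_inc M b d : shift M (inc b d) = inc b (shift M d).
Proof. by apply/funext => b'; rewrite /shift /inc addnAC. Qed.

Lemma difs0 l (h : (J -> nat) -> int) : (forall d, h d = 0) -> forall d, difs l h d = 0.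
Proof. by move=> h0; elim: l => //= b l IH d; rewrite /dif !IH subrr. Qed.

Lemma difs_inc b l (h : (J -> nat) -> int) d : difs l (fun d => h (inc b d)) d = difs l h (inc b d).
Proof. by elim: l d => //= b' l IH d; rewrite /dif !IH inc_comm. Qed.

(** A difference in direction [b] deletes one free variable of that block. A cone with exactly one
    free variable left in every block has one monomial in each large multidegree, and a cone with
    none left in some block has no monomial there. *)
Lemma difs_cone_count M al B l : (forall b, (bdeg al b < M)%N) ->
  ((exists b, (#|blk B b| <= count_mem b l)%N) ->
     forall d, difs l (fun d => cone_count al B (shift M d)) d = 0) /\
  ((forall b, #|blk B b| = (count_mem b l).+1) ->
     forall d, difs l (fun d => cone_count al B (shift M d)) d = 1).
Proof.
move=> hM; have lt b d : (bdeg al b < shift M d b)%N by apply: leq_trans (leq_addl _ _).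
elim: l B => [|b l IH] B.
  split=> [[b hb]|h] d /=; last by apply: cone_count1 => // b; rewrite ltnW.
  have b0 : blk B b = set0 by apply/eqP; rewrite -cards_eq0 -leqn0.
  apply: (@cone_count0 _ _ _ b) => // i iB.
  by apply/eqP => ib; have := in_set0 i; rewrite -b0 inE iB ib eqxx.
have [e|[i ib]] := set_0Vmem (blk B b).
  have z d : cone_count al B (shift M d) = 0.
    apply: (@cone_count0 _ _ _ b) => // i iB; apply/eqP => ib.
    by have := in_set0 i; rewrite -e inE iB ib eqxx.
  split=> h d; first by rewrite difs0.
  by have := h b; rewrite e cards0.
move: ib; rewrite inE => /andP[iB /eqP ib].
have stepE d : difs (b :: l) (fun d => cone_count al B (shift M d)) d =
    difs l (fun d => cone_count al (B :\ i) (shift M d)) (inc b d).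
  rewrite /= dif_difs -difs_inc; congr (difs l _ d); apply/funext => d1.
  by rewrite /dif shift_inc -ib cone_countD1 // addrAC subrr add0r.
have cB b' : #|blk B b'| = ((b == b') + #|blk (B :\ i) b'|)%N.
  rewrite (cardsD1 i) inE iB ib /=; congr (_ + _)%N; apply: eq_card => j.
  by rewrite !inE andbA.
have [IH1 IH2] := IH (B :\ i).
split=> [[b' hb']|h] d; rewrite stepE.
  by apply: IH1; exists b'; move: hb'; rewrite /= cB leq_add2l.
by apply: IH2 => b'; have := h b'; rewrite /= cB -addnS => /addnI.
Qed.

Lemma sum_count_mem l : (\sum_b count_mem b l = size l)%N.
Proof.
elim: l => [|b l IH]; first by rewrite big1.
rewrite /= big_split /= IH (bigD1 b) //= eqxx big1 ?addn0 // => b'.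
by rewrite eq_sym => /negbTE ->.
Qed.

Lemma sum_blk B : (\sum_b #|blk B b| = #|B|)%N.
Proof.
rewrite -sum1_card (partition_big bt xpredT) //=; apply: eq_bigr => b _.
by rewrite -sum1_card; apply: eq_bigl => i; rewrite inE.
Qed.

Variables (D : 'X_{1..n} -> Prop) (cs : seq ('X_{1..n} * {set 'I_n})) (N M : nat).
Hypothesis csD : forall m, count (fun c => in_cone c m) cs = `[< D m >].
Hypothesis csN : forall c, c \in cs -> (#|c.2| <= N + #|J|)%N.
Hypothesis csM : forall c b, c \in cs -> (bdeg c.1 b < M)%N.

Definition dcount d : int := (count (fun m => `[< D m >]) (mons (shift M d)))%:Z.

Lemma dcountE d : dcount d = \sum_(c <- cs) cone_count c.1 c.2 (shift M d).
Proof.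
rewrite /dcount /cone_count.
have -> : \sum_(c <- cs) (count (in_cone (c.1, c.2)) (mons (shift M d)))%:Z =
   ((\sum_(c <- cs) count (in_cone c) (mons (shift M d)))%N)%:Z.
  by rewrite -natz natr_sum; apply: eq_bigr => -[al B] _; rewrite natz.
congr Posz; elim: (mons _) => [|m s IH] /=; first by rewrite big1.
rewrite IH big_split /=; congr (_ + _)%N; rewrite -csD.
by elim: (cs) => [|c cs' IH'] /=; rewrite ?big_nil // big_cons IH'.
Qed.

Lemma difs_dcountE l d : difs l dcount d =
  \sum_(c <- cs) difs l (fun d => cone_count c.1 c.2 (shift M d)) d.
Proof.
have -> : dcount = fun d => \sum_(c <- cs) cone_count c.1 c.2 (shift M d).
  by apply/funext => d'; rewrite dcountE.
elim: l d => //= b l IH d; rewrite /dif !IH -sumrB.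
by apply: eq_bigr.
Qed.

Lemma dcount_vanish l d : (N < size l)%N -> difs l dcount d = 0.
Proof.
move=> Nl; rewrite difs_dcountE big_seq big1 // => -[al B] cin /=.
have [|h1 _] := @difs_cone_count M al B l; first by move=> b; apply: (csM b cin).
apply: h1; apply: contrapT => hno; have := csN cin; rewrite leqNgt /= => /negP; apply.
apply: (@leq_trans (\sum_(b : J) (count_mem b l).+1)).
  rewrite (eq_bigr (fun b => count_mem b l + 1)%N) => [|b _]; last by rewrite addn1.
  by rewrite big_split /= sum_count_mem sum1_card ltn_add2r.
rewrite -sum_blk; apply: leq_sum => b _; rewrite ltnNge; apply/negP => hb.
by apply: hno; exists b.
Qed.

(** The top coefficients of the multigraded Hilbert polynomial. A cone with other block sizes
    contributes 0, since the bound on its number of free variables leaves too few of them in some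
    block. *)
Lemma dcount_top l d : size l = N -> difs l dcount d =
  (count (fun c => [forall b, #|blk c.2 b| == (count_mem b l).+1]) cs)%:Z.
Proof.
move=> Nl; rewrite difs_dcountE -sum1_count -natz natr_sum [RHS]big_mkcond /=.
rewrite big_seq [RHS]big_seq; apply: eq_bigr => -[al B] cin /=.
have [|h1 h2] := @difs_cone_count M al B l; first by move=> b; apply: (csM b cin).
case: ifP => [/forallP hb|/negbT]; first by apply: h2 => b; apply/eqP/hb.
rewrite negb_forall => /existsP[b0 hb0]; apply: h1; apply: contrapT => hno.
have ge b : ((count_mem b l).+1 <= #|blk B b|)%N.
  by rewrite ltnNge; apply/negP => hb; apply: hno; exists b.
have := csN cin; rewrite -sum_blk /= (bigD1 b0) //= leqNgt => /negP; apply.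
rewrite -Nl -sum_count_mem -sum1_card -big_split /= (bigD1 b0) //= addn1 -addSn.
apply: leq_add; first by rewrite ltn_neqAle eq_sym hb0 ge.
by apply: leq_sum => b _; rewrite addn1.
Qed.

End BlockCounts.

(** * Standard monomials of a multigraded family of elements *)

Section MultiHomogeneous.

Variables (k : fieldType) (n : nat) (J : finType) (bt : 'I_n -> J).
Implicit Types (f g : {mpoly k[n]}) (m : 'X_{1..n}) (d : J -> nat).

Definition bhom d f := forall m, m \in msupp f -> has_bdeg bt d m.

Lemma has_bdegP d m : reflect (bdeg bt m = d) (has_bdeg bt d m).
Proof.
apply: (iffP forallP) => [h | -> //]; apply/funext => b; exact/eqP.
Qed.

Lemma bhom_bdeg m : bhom (bdeg bt m) 'X_[m].
Proof. by move=> m'; rewrite msuppX inE => /eqP ->; apply/has_bdegP. Qed.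

Lemma bhom_sum d (I : Type) (r : seq I) (P : pred I) (F : I -> {mpoly k[n]}) :
  (forall i, P i -> bhom d (F i)) -> bhom d (\sum_(i <- r | P i) F i).
Proof.
move=> hF; elim/big_ind: _ => //; first by move=> m; rewrite msupp0.
by move=> f g hf hg m /msuppD_le; rewrite mem_cat => /orP[/hf|/hg].
Qed.

Lemma bhomZ d c f : bhom d f -> bhom d (c *: f).
Proof. by move=> hf m /msuppZ_le /hf. Qed.

Lemma bhomM d d' f g : bhom d f -> bhom d' g -> bhom (fun b => d b + d' b)%N (f * g).
Proof.
move=> hf hg m /msuppM_le /allpairsP[[m1 m2] /= [/hf/has_bdegP <- /hg/has_bdegP <- ->]].
by apply/has_bdegP/funext => b; rewrite bdegD.
Qed.

Lemma bhom_exp d f e : bhom d f -> bhom (fun b => e * d b)%N (f ^+ e).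
Proof.
move=> hf; elim: e => [|e IH].
  by rewrite expr0 -mpolyX0 => m; rewrite msuppX inE => /eqP ->; apply/has_bdegP/funext => b;
    rewrite /bdeg big1 // => i _; rewrite mnm0E.
have := bhomM hf IH; rewrite -exprS.
by rewrite (_ : (fun b => _) = (fun b => e.+1 * d b)%N) //; apply/funext => b; rewrite mulSn.
Qed.

Lemma bhom_prod (I : finType) (dd : I -> J -> nat) (F : I -> {mpoly k[n]}) :
  (forall i, bhom (dd i) (F i)) -> bhom (fun b => \sum_i dd i b)%N (\prod_i F i).
Proof.
move=> hF; elim: (index_enum I) => [|i r IH].
  rewrite big_nil -mpolyX0 => m; rewrite msuppX inE => /eqP ->; apply/has_bdegP/funext => b.
  by rewrite big_nil /bdeg big1 // => j _; rewrite mnm0E.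
have := bhomM (hF i) IH; rewrite big_cons.
rewrite (_ : (fun b => _) = (fun b => \sum_(j <- i :: r) dd j b)%N) //.
by apply/funext => b; rewrite big_cons.
Qed.

Section Evaluation.

Variables (Th : fieldType) (io : {rmorphism k -> Th}) (z : 'I_n -> Th).

(** Standard monomials of the ideal generated by the multihomogeneous relations between the [z].
    Those of a given multidegree form a basis of the span of the values of all monomials of that
    multidegree. *)
Definition std m := ~ exists f : {mpoly k[n]},
  [/\ f != 0, bhom (bdeg bt m) f, mlead f = m & mmap io z f = 0].

Lemma std_down m mu : std m -> (mu <= m)%MM -> std mu.
Proof.
move=> sm le [f [nzf hf lf vf]]; apply: sm; exists (f * 'X_[m - mu]); split.
- by rewrite mulf_neq0 // -msupp_eq0 msuppX.
- rewrite (_ : bdeg bt m = (fun b => bdeg bt mu b + bdeg bt (m - mu) b)%N).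
    by apply: bhomM => //; apply: bhom_bdeg.
  by apply/funext => b; rewrite -bdegD addmC submK.
- by rewrite mleadM -?msupp_eq0 ?msuppX ?msupp_eq0 // lf mleadXm addmC submK.
- by rewrite rmorphM /= vf mul0r.
Qed.

Lemma mmap_mons d f : bhom d f ->
  mmap io z f = \sum_(m <- mons bt d) io f@_m * mmap1 z m.
Proof.
move=> hf; rewrite /mmap [RHS](bigID (fun m => m \in msupp f)) /= [X in _ + X]big1 ?addr0 /=.
  rewrite -[RHS]big_filter; apply: perm_big; apply: uniq_perm; rewrite ?msupp_uniq //.
    exact: filter_mons_uniq.
  by move=> m; rewrite mem_filter mem_mons; case: (boolP (m \in msupp f)) => // /hf ->.
by move=> m; rewrite -mcoeff_eq0 => /eqP ->; rewrite rmorph0 mul0r.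
Qed.

Lemma std_indep d (c : 'X_{1..n} -> k) :
  \sum_(m <- mons bt d | `[< std m >]) io (c m) * mmap1 z m = 0 ->
  forall m, m \in mons bt d -> std m -> c m = 0.
Proof.
move=> h m0 m0d sm0; pose f : {mpoly k[n]} := \sum_(m <- mons bt d | `[< std m >]) c m *: 'X_[m].
have fE m : f@_m = if (m \in mons bt d) && `[< std m >] then c m else 0.
  rewrite /f raddf_sum /= -big_filter.
  case: (boolP ((m \in mons bt d) && `[< std m >])) => hm.
    rewrite (bigD1_seq m) ?filter_mons_uniq ?mem_filter 1?andbC //=.
    rewrite mcoeffZ mcoeffX eqxx mulr1 big1 ?addr0 // => m' /negbTE nm.
    by rewrite mcoeffZ mcoeffX nm mulr0.
  rewrite big_seq big1 // => m'; rewrite mem_filter andbC => hm'.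
  rewrite mcoeffZ mcoeffX; case: eqP => [e|]; last by rewrite mulr0.
  by rewrite -e hm' in hm.
have hf m : m \in msupp f -> m \in mons bt d /\ std m.
  by rewrite mcoeff_msupp fE; case: ifP => [/andP[-> /asboolP]|]; rewrite ?eqxx.
have [f0|nzf] := eqVneq f 0.
  by have := fE m0; rewrite f0 mcoeff0 m0d (asboolT sm0).
have [ld [] //] := hf _ (mlead_supp nzf); exists f; split=> //.
  move=> m /hf[]; rewrite mem_mons => + _; move: ld; rewrite mem_mons.
  by move=> /has_bdegP ->.
rewrite -[RHS]h /f rmorph_sum; apply: eq_bigr => m _.
by rewrite /= mmapZ mmapX.
Qed.

Lemma std_span d m : m \in mons bt d -> exists c : 'X_{1..n} -> k,
  mmap1 z m = \sum_(m' <- mons bt d | `[< std m' >]) io (c m') * mmap1 z m'.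
Proof.
elim/(@ltmwf n): m => m IH md.
have [sm|/contrapT[f [nzf hf lf vf]]] := pselect (std m).
  exists (fun m' => (m' == m)%:R).
  rewrite -big_filter (bigD1_seq m) ?filter_mons_uniq ?mem_filter ?md ?asboolT //=.
  rewrite eqxx rmorph1 mul1r big1 ?addr0 // => m' /negbTE ->.
  by rewrite rmorph0 mul0r.
have dE : bdeg bt m = d by apply/has_bdegP; rewrite -mem_mons.
have /choice[c hc] m1 : exists c : 'X_{1..n} -> k, m1 \in msupp f -> m1 != m ->
    mmap1 z m1 = \sum_(m' <- mons bt d | `[< std m' >]) io (c m') * mmap1 z m'.
  case: (boolP ((m1 \in msupp f) && (m1 != m))) => [/andP[m1f m1m]|hn].
    have lt1 : (m1 < m)%O by rewrite Order.POrderTheory.lt_neqAle m1m -lf msupp_le_mlead.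
    have [|c hc] := IH m1 lt1; last by exists c.
    by have := hf _ m1f; rewrite mem_mons dE.
  by exists (fun=> 0) => h1 h2; rewrite h1 h2 in hn.
have fm0 : f@_m != 0 by rewrite -lf mleadc_eq0.
exists (fun m' => - (f@_m)^-1 * \sum_(m1 <- msupp f | m1 != m) f@_m1 * c m1 m').
have : \sum_(m1 <- msupp f) io f@_m1 * mmap1 z m1 = 0 by rewrite -[RHS]vf.
rewrite (bigD1_seq m) ?msupp_uniq -?lf ?mlead_supp //= lf => /eqP; rewrite addr_eq0 => /eqP e.
have -> : mmap1 z m = io (f@_m)^-1 * (io f@_m * mmap1 z m).
  by rewrite mulrA -rmorphM mulVf // rmorph1 mul1r.
rewrite e mulrN -mulNr -rmorphN.
rewrite big_seq_cond (eq_bigr (fun m1 => \sum_(m' <- mons bt d | `[< std m' >])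
    io (f@_m1 * c m1 m') * mmap1 z m')); last first.
  move=> m1 /andP[m1f m1m]; rewrite hc // mulr_sumr; apply: eq_bigr => m' _.
  by rewrite rmorphM mulrA.
rewrite -big_seq_cond exchange_big mulr_sumr /=; apply: eq_bigr => m' _.
by rewrite -mulr_suml mulrA -rmorph_sum -rmorphM.
Qed.

End Evaluation.

End MultiHomogeneous.

(** * The group action on standard monomials, and the sizes of cones *)

Section MonomialRepresentation.

Variables (k : fieldType) (n : nat) (J : finType) (bt : 'I_n -> J).
Variables (Th : fieldType) (io : {rmorphism k -> Th}) (z : 'I_n -> Th).
Variables (G : finGroupType) (act : G -> Th -> Th) (hact : ring_action act).
Hypothesis act_io : forall g c, act g (io c) = io c.
Variables (u : J -> G -> Th) (A : G -> 'M[k]_n).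
Hypothesis u_neq0 : forall b g, u b g != 0.
Hypothesis u_mul : forall b g h, u b (g * h)%g = act h (u b g) * u b h.
Hypothesis A_block : forall g i j, bt i != bt j -> A g i j = 0.
Hypothesis act_z : forall g i, act g (z i) * u (bt i) g = \sum_j io (A g i j) * z j.

Lemma act_exp g x e : act g (x ^+ e) = act g x ^+ e.
Proof.
elim: e => [|e IH]; first by rewrite !expr0 ract_one.
by rewrite !exprS ractMl // IH.
Qed.

Lemma act_zmon g m : exists2 f : {mpoly k[n]}, bhom bt (bdeg bt m) f &
  act g (mmap1 z m) * (\prod_b u b g ^+ bdeg bt m b) = mmap io z f.
Proof.
exists (\prod_i (\sum_j A g i j *: 'X_j) ^+ m i).
  rewrite (_ : bdeg bt m = fun b => (\sum_i m i * (b == bt i))%N); last first.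
    apply/funext => b; rewrite /bdeg big_mkcond; apply: eq_bigr => i _.
    by rewrite eq_sym; case: eqP => _; rewrite ?muln1 ?muln0.
  apply: bhom_prod => i; apply: bhom_exp; apply: bhom_sum => j _.
  case: (eqVneq (bt i) (bt j)) => [e|ne]; last first.
    by rewrite A_block // scale0r => m'; rewrite msupp0.
  apply: bhomZ; rewrite (_ : (fun b => _) = bdeg bt U_(j)); first exact: bhom_bdeg.
  by apply/funext => b; rewrite bdeg1 e.
rewrite rmorph_prod /mmap1 ract_prod //.
have -> : \prod_b u b g ^+ bdeg bt m b = \prod_i u (bt i) g ^+ m i.
  rewrite (partition_big bt xpredT) //=; apply: eq_bigr => b _.
  by rewrite -prodrXr; apply: eq_bigr => i /eqP ->.
rewrite -big_split; apply: eq_bigr => i _ /=.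
rewrite act_exp -exprMn act_z rmorphXn; congr (_ ^+ _).
rewrite raddf_sum; apply: eq_bigr => j _ /=.
by rewrite mmapZ mmapX mmap1U.
Qed.

(** The action on values of monomials of multidegree [d] is multiplied by the product of the
    [u b g ^+ d b]. This clears the denominators, so that [g] acts through substitution by [A g] and
    keeps the span; the cocycle rule of [u] makes the result multiplicative. *)
Lemma monomial_representation (d : J -> nat) :
  exists rV : mx_representation k [set: G]
                (count (fun m => `[< std bt io z m >]) (mons bt d)),
    forall c (om : J -> k), (forall x, act c x = x) -> (forall b, u b c = io (om b)) ->
      rV c = (\prod_b om b ^+ d b)%:M.
Proof.
rewrite -size_filter; set s := filter _ _; set N := size s.
pose e (a : 'I_N) := mmap1 z (nth 0%MM s a).
pose U g := \prod_b u b g ^+ d b.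
have sE a : (a < N)%N -> nth 0%MM s a \in mons bt d /\ std bt io z (nth 0%MM s a).
  by move=> aN; have := mem_nth 0%MM aN; rewrite mem_filter => /andP[/asboolP].
have sumE (F : 'X_{1..n} -> Th) :
    \sum_(m <- mons bt d | `[< std bt io z m >]) F m = \sum_(a < N) F (nth 0%MM s a).
  by rewrite -big_filter (big_nth 0%MM) big_mkord.
have e_ind (c : 'I_N -> k) : \sum_a io (c a) * e a = 0 -> forall a, c a = 0.
  move=> h a; pose c' m := if insub (index m s) is Some b then c b else 0.
  have c'E (b : 'I_N) : c' (nth 0%MM s b) = c b.
    by rewrite /c' index_uniq ?valK // filter_mons_uniq.
  have [ad ast] := sE a (ltn_ord a).
  rewrite -c'E; apply: (@std_indep _ _ _ bt _ io z d) => //.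
  by rewrite (sumE (fun m => io (c' m) * mmap1 z m)) -[RHS]h; apply: eq_bigr => b _; rewrite c'E.
have e_spn f : bhom bt d f -> exists r : 'I_N -> k, mmap io z f = \sum_a io (r a) * e a.
  move=> hf; have /choice[c hc] (m : 'X_{1..n}) : exists c : 'X_{1..n} -> k, m \in mons bt d ->
      mmap1 z m = \sum_(m' <- mons bt d | `[< std bt io z m' >]) io (c m') * mmap1 z m'.
    case: (boolP (m \in mons bt d)) => [/(std_span io z)[c hc]|]; by [exists c|exists (fun=> 0)].
  exists (fun a => \sum_(m <- mons bt d) f@_m * c m (nth 0%MM s a)).
  rewrite (mmap_mons io z hf) big_seq (eq_bigr (fun m => \sum_(a < N) io (f@_m * c m (nth 0%MM s a)) * e a)).
    rewrite -big_seq exchange_big; apply: eq_bigr => a _ /=.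
    by rewrite rmorph_sum mulr_suml.
  move=> m md; rewrite hc // sumE mulr_sumr; apply: eq_bigr => a _.
  by rewrite rmorphM mulrA.
have e_uniq (r r' : 'I_N -> k) : \sum_a io (r a) * e a = \sum_a io (r' a) * e a -> r =1 r'.
  move=> h a; apply/eqP; rewrite -subr_eq0; apply/eqP; move: a; apply: e_ind.
  rewrite -[RHS](subrr (\sum_a io (r a) * e a)) [in X in _ - X]h -sumrB.
  by apply: eq_bigr => a _; rewrite rmorphB mulrBl.
have /choice[R hR] (ga : G * 'I_N) : exists r : 'I_N -> k,
    act ga.1 (e ga.2) * U ga.1 = \sum_a io (r a) * e a.
  case: ga => g a /=; have [/[!mem_mons] /has_bdegP md _] := sE a (ltn_ord a).
  have [f hf ef] := act_zmon g (nth 0%MM s a); rewrite md in hf ef.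
  by have [r hr] := e_spn f hf; exists r; rewrite -hr -ef.
have u1 b : u b 1%g = 1.
  apply: (mulfI (u_neq0 b 1%g)); rewrite mulr1.
  by rewrite -{3}[1%g]mulg1 u_mul (ract1 hact).
have UM g h : U (g * h)%g = act h (U g) * U h.
  rewrite /U ract_prod // -big_split; apply: eq_bigr => b _ /=.
  by rewrite u_mul exprMn act_exp.
have U1 : U 1%g = 1 by rewrite /U big1 // => b _; rewrite u1 expr1n.
pose rV g : 'M[k]_N := \matrix_(a, b) R (g, a) b.
have rep : mx_repr [set: G] rV.
  split=> [|g h _ _]; apply/matrixP => a b; rewrite !mxE.
    move: b; apply: e_uniq; rewrite -(hR (1%g, a)) /= U1 mulr1 (ract1 hact).
    rewrite (bigD1 a) //= eqxx rmorph1 mul1r big1 ?addr0 // => b /negbTE ba.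
    by rewrite eq_sym ba rmorph0 mul0r.
  move: b; apply: e_uniq; rewrite -(hR ((g * h)%g, a)) /= UM (ractM hact) mulrA -ractMl //.
  rewrite (hR (g, a)) /= ract_sum // mulr_suml.
  rewrite (eq_bigr (fun c => \sum_b io (R (g, a) c * R (h, c) b) * e b)); last first.
    move=> c _; rewrite ractMl // act_io -mulrA (hR (h, c)) /= mulr_sumr.
    by apply: eq_bigr => b _; rewrite rmorphM mulrA.
  rewrite exchange_big; apply: eq_bigr => b _ /=.
  rewrite -mulr_suml -rmorph_sum; congr (io _ * _).
  by apply: eq_bigr => c _; rewrite !mxE.
exists (MxRepresentation rep) => c om cact cu; apply/matrixP => a b; rewrite !mxE.
move: b; apply: e_uniq; rewrite -(hR (c, a)) /= cact.
rewrite (bigD1 a) //= eqxx mulr1n [X in _ + X]big1 ?addr0 => [|b /negbTE ba]; last first.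
  by rewrite eq_sym ba mulr0n rmorph0 mul0r.
rewrite mulrC; congr (_ * _); rewrite rmorph_prod; apply: eq_bigr => b _.
by rewrite cu rmorphXn.
Qed.

End MonomialRepresentation.

Section ConeSize.

Variables (k : fieldType) (n : nat) (J : finType) (bt : 'I_n -> J).
Variables (Th : fieldType) (io : {rmorphism k -> Th}) (z : 'I_n -> Th).

Lemma bdeg_sum (I : Type) (r : seq I) (P : pred I) (F : I -> 'X_{1..n}) b :
  bdeg bt (\sum_(i <- r | P i) F i)%MM b = (\sum_(i <- r | P i) bdeg bt (F i) b)%N.
Proof.
elim/big_rec2: _ => [|i y1 y2 _ <-]; last by rewrite bdegD.
by rewrite /bdeg big1 // => i _; rewrite mnm0E.
Qed.

Lemma bdegMn (m : 'X_{1..n}) e b : bdeg bt (m *+ e)%MM b = (e * bdeg bt m b)%N.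
Proof.
by rewrite /bdeg big_distrr; apply: eq_bigr => i _; rewrite mulmnE mulnC.
Qed.

Lemma mmap1_sum (I : Type) (r : seq I) (P : pred I) (F : I -> 'X_{1..n}) :
  mmap1 z (\sum_(i <- r | P i) F i)%MM = \prod_(i <- r | P i) mmap1 z (F i).
Proof.
elim/big_rec2: _ => [|i y1 y2 _ <-]; first by rewrite mmap11.
by rewrite commr_mmap1_M // => *; apply: mulrC.
Qed.

Lemma mmap1_Un i e : mmap1 z (U_(i) *+ e)%MM = z i ^+ e.
Proof.
rewrite /mmap1 (bigD1 i) //= mulmnE mnm1E eqxx mul1n big1 ?mulr1 // => j ji.
by rewrite mulmnE mnm1E eq_sym (negbTE ji) mul0n expr0.
Qed.

(* A free set of variables gives algebraically independent ratios to one
   representative per block. *)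
Lemma cone_size_le (B : {set 'I_n}) (T : seq Th) :
    (forall m : 'X_{1..n}, (forall i, i \notin B -> m i = 0%N) -> std bt io z m) ->
    (forall i, algcl io (fun x => x \in T) (z i)) ->
  (#|B| <= size T + #|J|)%N.
Proof.
move=> hB hT.
have z0 i : i \in B -> z i != 0.
  move=> iB; apply/eqP => zi0.
  have sU : std bt io z U_(i)%MM.
    by apply: hB => j jB; rewrite mnm1E; case: eqP => // e; rewrite -e iB in jB.
  apply: sU; exists 'X_i; split; first by rewrite -msupp_eq0 msuppX.
  - exact: bhom_bdeg.
  - by rewrite mleadXm.
  - by rewrite mmapX mmap1U.
pose rp b := [pick i in blk bt B b].
have rpP b i : rp b = Some i -> i \in B /\ bt i = b.
  by rewrite /rp; case: pickP => // j; rewrite inE => /andP[jB /eqP jb] [<-].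
pose B' := [set i in B | rp (bt i) != Some i].
have cB : (#|B| <= #|B'| + #|J|)%N.
  rewrite -(cardsID B' B) leq_add ?subset_leq_card ?subsetIr //.
  have inj : {in B :\: B' &, injective bt}.
    move=> i j; rewrite !inE !negb_and !negbK => /andP[+ iB] /andP[+ jB].
    by rewrite iB jB /= => /eqP ri /eqP rj e; move: ri; rewrite e rj => -[].
  by rewrite -(card_in_imset inj) max_card.
suff cB' : (#|B'| <= size T)%N by apply: leq_trans cB _; rewrite leq_add2r.
case: (set_0Vmem B') => [-> |[i00 i00B]]; first by rewrite cards0.
pose r b := odflt i00 (rp b).
have rB b i : i \in B -> bt i = b -> r b \in B /\ bt (r b) = b.
  move=> iB ib; rewrite /r; case E: (rp b) => [j|]; first exact: rpP.
  by move: E; rewrite /rp; case: pickP => // /(_ i); rewrite inE iB ib eqxx.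
pose w i := z i / z (r (bt i)).
pose ev (a : 'I_#|B'|) := enum_val a.
have evB a : ev a \in B by have := enum_valP a; rewrite inE => /andP[].
pose s := [seq w i | i <- enum B'].
have ss : size s = #|B'| by rewrite size_map -cardE.
have sE (a : 'I_#|B'|) : s`_a = w (ev a).
  by rewrite (nth_map (ev a)) -?cardE // -enum_val_nth.
rewrite -ss; apply: (@algcl_steinitz k Th io) => [i' lti' ali|x]; last first.
  have hA := algcl_subfield io (fun x => x \in T).
  case/mapP => i _ ->; apply: (subfield_propM hA) (hT i) _.
  by apply: (subfield_propV hA); apply: hT.
rewrite ss in lti'; pose i := Ordinal lti'.
have [q nzq vq] : exists2 q : {mpoly k[#|B'|]}, q != 0 & mmap io (fun a => w (ev a)) q = 0.
  apply: (@algcl_relation _ _ io _ _ i); rewrite -sE; apply: algcl_mono (ali) => x.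
  case/(nthP 0) => j; rewrite size_takel ?ss ?(ltnW lti') // => ji <-.
  have jB : (j < #|B'|)%N by apply: ltn_trans (lti').
  by exists (Ordinal jB) => //; rewrite nth_take // -[j]/(val (Ordinal jB)) sE.
pose E := msize q; pose S (mu : 'X_{1..#|B'|}) b := (\sum_(a | bt (ev a) == b) mu a)%N.
(* Homogenization: a monomial in the ratios is raised to degree [E] in every block that meets [B],
   by a power of the representative of the block. It uses only variables of [B], so its leading term
   must be standard. *)
pose hm (mu : 'X_{1..#|B'|}) : 'X_{1..n} :=
  (\sum_a (U_(ev a) *+ mu a) + \sum_(b | rp b) (U_(r b) *+ (E - S mu b)))%MM.
have SE mu b : mu \in msupp q -> (S mu b <= E)%N.
  move=> muq; apply: leq_trans (ltnW (msize_mdeg_lt muq)).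
  by rewrite mdegE [X in (_ <= X)%N](bigID (fun a => bt (ev a) == b)) leq_addr.
have rpb b i1 : i1 \in B -> bt i1 = b -> rp b.
  by rewrite /rp; case: pickP => // /(_ i1) + iB ib; rewrite inE iB ib eqxx.
have hm_deg mu b : mu \in msupp q -> bdeg bt (hm mu) b = if rp b then E else 0%N.
  move=> muq; rewrite bdegD !bdeg_sum.
  rewrite (eq_bigr (fun a => if bt (ev a) == b then mu a else 0%N)); last first.
    by move=> a _; rewrite bdegMn bdeg1 eq_sym; case: eqP; rewrite ?muln1 ?muln0.
  rewrite -big_mkcond -/(S mu b).
  have e2 b' : rp b' -> bdeg bt (U_(r b') *+ (E - S mu b')) b =
     if b' == b then (E - S mu b)%N else 0%N.
    case Er: (rp b') => [j|] // _; have [jB jb] := rpP _ _ Er.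
    rewrite bdegMn bdeg1 /r Er /= jb eq_sym.
    by case: eqP => [->|]; rewrite ?muln1 ?muln0.
  rewrite (eq_bigr _ e2) -big_mkcondr /=.
  case Er: (rp b) => [j|]; last first.
    rewrite [X in (_ + X)%N]big_pred0 ?addn0 => [|b'].
      by apply: big1 => a /eqP ab; have := rpb _ _ (evB a) ab; rewrite Er.
    by case: eqP => [->|]; rewrite ?Er ?andbF.
  rewrite (big_pred1 b) => [|b' /=]; first by rewrite subnKC ?SE.
  by rewrite andbC; case: eqP => [->|]; rewrite ?Er.
have hm_ev mu a : hm mu (ev a) = mu a.
  rewrite mnmDE !mnm_sumE (bigD1 a) //= mulmnE mnm1E eqxx mul1n big1 => [|a' a'a].
    rewrite addn0 big1 ?addn0 // => b; case Er: (rp b) => [j|] // _.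
    rewrite mulmnE mnm1E /r Er /=; case: eqP => [e|]; last by rewrite mul0n.
    have := enum_valP a; rewrite inE -/(ev a) -e => /andP[_].
    by rewrite (rpP _ _ Er).2 Er eqxx.
  by rewrite mulmnE mnm1E (inj_eq enum_val_inj) (negbTE a'a) mul0n.
have hm_inj : injective hm by move=> mu mu' e; apply/mnmP => a; rewrite -!hm_ev e.
have hm_B mu i1 : i1 \notin B -> hm mu i1 = 0%N.
  move=> i1B; rewrite mnmDE !mnm_sumE !big1 // => [b|a _].
    case Er: (rp b) => [j|] // _; rewrite mulmnE mnm1E /r Er /=.
    by case: eqP => [e|]; rewrite ?mul0n //; rewrite -e (rpP _ _ Er).1 in i1B.
  by rewrite mulmnE mnm1E; case: eqP => [e|]; rewrite ?mul0n //; rewrite -e evB in i1B.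
pose f : {mpoly k[n]} := \sum_(mu <- msupp q) q@_mu *: 'X_[hm mu].
have f_supp m : m \in msupp f -> exists2 mu, mu \in msupp q & m = hm mu.
  rewrite /f => /msupp_sum_le /flattenP[_ /mapP[mu + ->]].
  rewrite filter_predT => muq /msuppZ_le; rewrite msuppX inE => /eqP ->.
  by exists mu.
have nzf : f != 0.
  apply/eqP => f0; have := congr1 (mcoeff (hm (mlead q))) f0.
  rewrite mcoeff0 raddf_sum /= (bigD1_seq (mlead q)) ?mlead_supp ?msupp_uniq //=.
  rewrite mcoeffZ mcoeffX eqxx mulr1 big1 ?addr0 => [/eqP|mu /negbTE ne].
    by rewrite mleadc_eq0 (negbTE nzq).
  by rewrite mcoeffZ mcoeffX (inj_eq hm_inj) ne mulr0.
have vf : mmap io z f = 0.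
  rewrite raddf_sum /=.
  rewrite big_seq (eq_bigr (fun mu => (\prod_(b | rp b) z (r b) ^+ E) *
     (io q@_mu * mmap1 (fun a => w (ev a)) mu))); last first.
    move=> mu muq; rewrite mmapZ mmapX mulrCA; congr (_ * _).
    rewrite /hm commr_mmap1_M; last by move=> *; apply: mulrC.
    rewrite !mmap1_sum (eq_bigr (fun a => w (ev a) ^+ mu a * z (r (bt (ev a))) ^+ mu a)).
      rewrite big_split /= -mulrA mulrC; congr (_ * _); rewrite mulrC.
      rewrite (partition_big (fun a => bt (ev a)) (fun b => rp b)) /=; last first.
        by move=> a _; apply: rpb (evB a) _.
      rewrite -big_split; apply: eq_bigr => b rb /=.
      rewrite (eq_bigr (fun a => z (r b) ^+ mu a)) => [|a /eqP -> //].
      by rewrite prodrXr mmap1_Un -exprD subnK // SE.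
    move=> a _; rewrite mmap1_Un -exprMn mulfVK // z0 //.
    by have [] := rB _ _ (evB a) erefl.
  by rewrite -big_seq -mulr_sumr -[X in _ * X]/(mmap io _ q) vq mulr0.
have [mu muq lf] := f_supp _ (mlead_supp nzf).
have st : std bt io z (mlead f) by apply: hB => j jB; rewrite lf hm_B.
apply: st; exists f; split=> // m /f_supp[mu' mu'q ->]; apply/has_bdegP.
by apply/funext => b; rewrite lf !hm_deg.
Qed.

End ConeSize.

(** * Standard monomials relative to an intermediate field *)

Section OrderedMonomials.

Import Order.TTheory.

Section RelativeStandard.

Variables (k : fieldType) (n : nat) (J : finType) (bt : 'I_n -> J) (isy : pred J).
Variables (Th : fieldType) (io : {rmorphism k -> Th}) (z : 'I_n -> Th).
Hypothesis yfirst : forall i j : 'I_n, isy (bt i) -> ~~ isy (bt j) -> (i < j)%N.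

Definition nony (f : {mpoly k[n]}) := forall m, m \in msupp f ->
  forall i, isy (bt i) -> m i = 0%N.

Variables (i0 : J -> 'I_n).
Hypotheses (bt_i0 : forall b, bt (i0 b) = b) (z_i0 : forall b, z (i0 b) = 1).
Hypothesis z_indep : forall d f, bhom bt d f -> nony f -> f != 0 -> mmap io z f != 0.

Variables (Kap : fieldType) (ka : {rmorphism Kap -> Th}).
Hypothesis ka_ratio : forall c, exists f g : {mpoly k[n]},
  [/\ nony f, nony g, mmap io z g != 0 & ka c = mmap io z f / mmap io z g].
Hypothesis ka_poly : forall f, nony f -> exists c, mmap io z f = ka c.

Variables (Q : fieldExtType Kap) (fQ : {rmorphism Q -> Th}) (zQ : 'I_n -> Q).
Hypothesis fQZ : forall c q, fQ (c *: q) = ka c * fQ q.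
Hypothesis fQz : forall i, fQ (zQ i) = z i.

Variable E : nat.
Let dE b := if isy b then E else 0%N.

Lemma nonyM f g : nony f -> nony g -> nony (f * g).
Proof.
move=> hf hg m /msuppM_le /allpairsP[[m1 m2] /= [/hf h1 /hg h2 ->]] i iy.
by rewrite mnmDE h1 ?h2.
Qed.

Lemma nony_sum (I : Type) (r : seq I) (P : pred I) (F : I -> {mpoly k[n]}) :
  (forall i, P i -> nony (F i)) -> nony (\sum_(i <- r | P i) F i).
Proof.
move=> hF; elim/big_ind: _ => //; first by move=> m; rewrite msupp0.
by move=> f g hf hg m /msuppD_le; rewrite mem_cat => /orP[/hf|/hg].
Qed.

Lemma nonyZX c (m : 'X_{1..n}) : (forall i, isy (bt i) -> m i = 0%N) -> nony (c *: 'X_[m]).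
Proof. by move=> hm m' /msuppZ_le; rewrite msuppX inE => /eqP ->. Qed.

Lemma common_denominator (s : seq 'X_{1..n}) (c : 'X_{1..n} -> Kap) :
  exists (g : {mpoly k[n]}) (F : 'X_{1..n} -> {mpoly k[n]}),
  [/\ nony g, forall b, nony (F b), mmap io z g != 0 &
      forall b, b \in s -> ka (c b) = mmap io z (F b) / mmap io z g].
Proof.
have n1 : nony 1 by move=> m; rewrite msupp1 inE => /eqP -> i _; rewrite mnm0E.
elim: s => [|b s [g [F [ng nF g0 hF]]]].
  by exists 1, (fun=> 1); split=> //; rewrite rmorph1 oner_eq0.
have [f [h [nf nh h0 e]]] := ka_ratio (c b).
exists (g * h), (fun b' => if b' == b then f * g else F b' * h); split.
- exact: nonyM.
- by move=> b'; case: ifP => _; apply: nonyM.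
- by rewrite rmorphM mulf_neq0.
move=> b'; rewrite inE; case: eqP => [-> _|_ /= /hF ->].
  by rewrite e !rmorphM /=; field; rewrite g0 h0.
by rewrite !rmorphM /=; field; rewrite g0 h0.
Qed.

(** Homogenizes the blocks outside [isy] to degree [e] by the variables [i0 b], whose value is 1, so
    that the value of [f] is kept. *)
Definition mkhom e (f : {mpoly k[n]}) : {mpoly k[n]} := \sum_(m <- msupp f)
  f@_m *: 'X_[m + \sum_(b | ~~ isy b) (U_(i0 b) *+ (e - bdeg bt m b))].

Lemma mkhom_prop e f : nony f -> (msize f <= e)%N ->
  [/\ bhom bt (fun b => if isy b then 0%N else e) (mkhom e f), nony (mkhom e f) &
      mmap io z (mkhom e f) = mmap io z f].
Proof.
move=> nf se; have le m b : m \in msupp f -> (bdeg bt m b <= e)%N.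
  move=> mf; apply: leq_trans (leq_trans (ltnW (msize_mdeg_lt mf)) se).
  by rewrite (mdeg_bdeg bt) (bigD1 b) //= leq_addr.
split.
- rewrite /mkhom big_seq; apply: bhom_sum => m mf; apply: bhomZ.
  rewrite (_ : (fun b => _) = bdeg bt (m + \sum_(b | ~~ isy b) (U_(i0 b) *+ (e - bdeg bt m b)))%MM).
    exact: bhom_bdeg.
  apply/funext => b; rewrite bdegD bdeg_sum.
  rewrite (eq_bigr (fun b' => if b' == b then (e - bdeg bt m b)%N else 0%N)); last first.
    by move=> b' _; rewrite bdegMn bdeg1 bt_i0 eq_sym; case: eqP => [->|]; rewrite ?muln1 ?muln0.
  rewrite -big_mkcondr /=; case: ifP => iy.
    rewrite big_pred0 => [|b']; last by case: eqP => [->|]; rewrite ?iy ?andbF.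
    by rewrite addn0 /bdeg big1 // => i /eqP ib; apply: nf mf _ _; rewrite ib.
  rewrite (big_pred1 b) ?subnKC ?le // => b' /=.
  by rewrite andbC; case: eqP => [->|]; rewrite ?iy.
- rewrite /mkhom big_seq; apply: nony_sum => m mf; apply: nonyZX => i iy.
  rewrite mnmDE (nf m mf i iy) mnm_sumE big1 // => b nb.
  rewrite mulmnE mnm1E; case: eqP => [e0|_]; last by rewrite mul0n.
  by move: iy nb; rewrite -e0 bt_i0 => ->.
rewrite raddf_sum /= [RHS]/mmap; apply: eq_bigr => m _.
rewrite mmapZ mmapX commr_mmap1_M; last by move=> *; apply: mulrC.
rewrite mmap1_sum [X in _ * (_ * X)]big1 ?mulr1 // => b _.
by rewrite mmap1_Un z_i0 expr1n.
Qed.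

Definition ypart (m : 'X_{1..n}) := [multinom if isy (bt i) then m i else 0%N | i < n].
Definition npart (m : 'X_{1..n}) := [multinom if isy (bt i) then 0%N else m i | i < n].

Lemma ynpartE m : (ypart m + npart m)%MM = m.
Proof. by apply/mnmP => i; rewrite mnmDE !mnmE; case: ifP; rewrite ?addn0. Qed.

Lemma bdeg_ypart m b : bdeg bt (ypart m) b = if isy b then bdeg bt m b else 0%N.
Proof.
rewrite /bdeg; case: ifP => iy.
  by apply: eq_bigr => i /eqP ib; rewrite mnmE ib iy.
by apply: big1 => i /eqP ib; rewrite mnmE ib iy.
Qed.

Lemma ypart_y m d : has_bdeg bt d m -> (forall b, isy b -> d b = E) -> ypart m \in mons bt dE.
Proof.
move=> /has_bdegP md hd; rewrite mem_mons; apply/has_bdegP/funext => b.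
by rewrite bdeg_ypart /dE; case: ifP => // /hd <-; rewrite md.
Qed.

Lemma mons_y b : b \in mons bt dE -> forall i, ~~ isy (bt i) -> b i = 0%N.
Proof.
rewrite mem_mons => /has_bdegP bd i iy; have := congr1 (fun d => d (bt i)) bd.
by rewrite /dE (negbTE iy) /bdeg (bigD1 i) //=; lia.
Qed.

Lemma ypartK b (g : 'X_{1..n}) : b \in mons bt dE -> (forall i, isy (bt i) -> g i = 0%N) ->
  ypart (b + g)%MM = b /\ npart (b + g)%MM = g.
Proof.
move=> bE hg; split; apply/mnmP => i; rewrite mnmE mnmDE; case: (boolP (isy (bt i))) => iy.
- by rewrite hg ?addn0.
- by rewrite (mons_y bE).
- by rewrite hg.
- by rewrite (mons_y bE).
Qed.

(** The variables of the blocks in [isy] come first in the order, so that among monomials of equal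
    multidegree they are compared before the others. *)
Lemma ypart_lt m m' : bdeg bt m = bdeg bt m' -> (ypart m < ypart m')%O -> (m < m')%O.
Proof.
move=> md; have mdE : mdeg m = mdeg m' by rewrite !(mdeg_bdeg bt) md.
have ydE : mdeg (ypart m) = mdeg (ypart m').
  by rewrite !(mdeg_bdeg bt); apply: eq_bigr => b _; rewrite !bdeg_ypart md.
case/(ltmcP ydE) => i ieq; rewrite !mnmE; case: ifP => iy // ilt.
apply/(ltmcP mdE); exists i => // j ji; have := ieq j ji; rewrite !mnmE.
by case: (boolP (isy (bt j))) => // jy _; have := yfirst iy jy; rewrite ltnNge ltnW.
Qed.

Definition zmonQ b := mmap1 zQ b.

Lemma fQ_zmonQ b : fQ (zmonQ b) = mmap1 z b.
Proof.
by rewrite rmorph_prod; apply: eq_bigr => i _; rewrite rmorphXn /= fQz.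
Qed.

(** Standardness over [Kap] in place of [k]: the values of the variables outside [isy] have become
    scalars, and only monomials in the remaining ones are compared. *)
Definition kstd b := zmonQ b \notin
  <<[seq zmonQ b' | b' <- mons bt dE & (b' < b)%O]>>%VS.

(** A relation with leading monomial b + g, sorted by its part in the blocks of [isy], is a relation
    over [Kap] with leading monomial b. Its leading coefficient is the value of a nonzero
    multihomogeneous polynomial, which [z_indep] keeps from vanishing. *)
Lemma kstd_std b (g : 'X_{1..n}) : b \in mons bt dE -> (forall i, isy (bt i) -> g i = 0%N) ->
  kstd b -> std bt io z (b + g)%MM.
Proof.
move=> bE hg kb [f [nzf hf lf vf]]; move/negP: kb; apply.
have [yb ng] := ypartK bE hg.
pose fy b' : {mpoly k[n]} := \sum_(m <- msupp f | ypart m == b') f@_m *: 'X_[npart m].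
have dy b' : isy b' -> bdeg bt (b + g) b' = E.
  move=> iy; have := bE; rewrite mem_mons => /has_bdegP/(congr1 (fun d => d b')).
  rewrite /dE iy bdegD => ->; rewrite /bdeg big1 ?addn0 // => i /eqP ib.
  by rewrite hg // ib.
have yE m : m \in msupp f -> ypart m \in mons bt dE.
  by move=> mf; apply: ypart_y (hf m mf) dy.
have yle m : m \in msupp f -> (ypart m <= b)%O.
  move=> mf; rewrite leNgt; apply/negP => lt.
  have /has_bdegP md := hf m mf.
  have : ((b + g)%MM < m)%O by apply: ypart_lt; rewrite ?yb // md.
  by rewrite ltNge -lf msupp_le_mlead.
have nfy b' : nony (fy b').
  by apply: nony_sum => m _; apply: nonyZX => i iy; rewrite mnmE iy.
have hfy b' : bhom bt (fun b1 => if isy b1 then 0%N else bdeg bt (b + g) b1) (fy b').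
  rewrite /fy big_seq_cond; apply: bhom_sum => m /andP[mf _]; apply: bhomZ.
  move=> m'; rewrite msuppX inE => /eqP ->; apply/has_bdegP/funext => b1.
  have /has_bdegP <- := hf m mf; rewrite /bdeg; case: ifP => iy.
    by apply: big1 => i /eqP ib; rewrite mnmE ib iy.
  by apply: eq_bigr => i /eqP ib; rewrite mnmE ib iy.
have nzb : fy b != 0.
  apply/eqP => fb0; have := congr1 (mcoeff g) fb0.
  rewrite mcoeff0 raddf_sum /= big_mkcond (bigD1_seq (b + g)%MM) ?msupp_uniq //=; last first.
    by rewrite -lf mlead_supp.
  rewrite yb eqxx ng mcoeffZ mcoeffX eqxx mulr1 big1 ?addr0 => [/eqP|m mne].
    by rewrite -lf mleadc_eq0 (negbTE nzf).
  case: eqP => // my; rewrite mcoeffZ mcoeffX; case: eqP => [e|]; last by rewrite mulr0.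
  by case/eqP: mne; rewrite -(ynpartE m) my e.
have fb0 := z_indep (hfy b) (nfy b) nzb.
have fE : mmap io z f = \sum_(b' <- mons bt dE) mmap1 z b' * mmap io z (fy b').
  rewrite [LHS]/mmap [RHS](eq_bigr (fun b' => \sum_(m <- msupp f)
       if ypart m == b' then io f@_m * mmap1 z m else 0)); last first.
    move=> b' _; rewrite -big_mkcond /= /fy raddf_sum mulr_sumr /=.
    apply: eq_bigr => m /eqP my; rewrite mmapZ mmapX mulrCA; congr (_ * _).
    by rewrite -[in RHS](ynpartE m) my commr_mmap1_M // => *; apply: mulrC.
  rewrite [RHS]exchange_big big_seq [RHS]big_seq; apply: eq_bigr => m mf /=.
  rewrite (bigD1_seq (ypart m)) ?mons_uniq ?yE //= eqxx big1 ?addr0 // => b' /negbTE.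
  by rewrite eq_sym => ->.
have /choice[c hc] b' : exists c, mmap io z (fy b') / mmap io z (fy b) = ka c.
  have [c1 ->] := ka_poly (nfy b'); have [c2 ->] := ka_poly (nfy b).
  by exists (c1 / c2); rewrite fmorph_div.
have zb : zmonQ b = \sum_(b' <- mons bt dE | (b' < b)%O) (- c b') *: zmonQ b'.
  apply: (fmorph_inj fQ); rewrite fQ_zmonQ rmorph_sum /=.
  apply: (mulIf fb0); apply/eqP; rewrite -subr_eq0; apply/eqP; rewrite -[RHS]vf fE.
  rewrite [RHS](bigID (fun b' => (b' < b)%O)) /= [RHS]addrC; congr (_ + _).
    rewrite big_mkcond (bigD1_seq b) ?mons_uniq //= ltxx /=.
    rewrite big1 ?addr0 // => b' neb; case: ifP => // ltb.
    suff -> : fy b' = 0 by rewrite rmorph0 mulr0.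
    rewrite /fy big_seq_cond big1 // => m /andP[/yle + /eqP my].
    by rewrite my le_eqVlt (negbTE neb) (negbTE ltb).
  rewrite mulr_suml -sumrN; apply: eq_bigr => b' _.
  rewrite fQZ fQ_zmonQ rmorphN -hc.
  by field.
rewrite zb -big_filter; rewrite big_seq; apply: rpred_sum => b' b'in.
by apply/rpredZ/memv_span/map_f.
Qed.

(** A relation over [Kap] is cleared of denominators and homogenized. The leading monomial of the
    common denominator is the shift [g] after which the relation is visible over [k]. *)
Lemma not_kstd b : b \in mons bt dE -> ~~ kstd b ->
  exists2 g : 'X_{1..n}, (forall i, isy (bt i) -> g i = 0%N) & ~ std bt io z (b + g)%MM.
Proof.
move=> bE; rewrite negbK => hb.
have [c cE] : exists c : 'X_{1..n} -> Kap,
    zmonQ b = \sum_(b' <- mons bt dE | (b' < b)%O) c b' *: zmonQ b'.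
  set s := [seq b' <- mons bt dE | (b' < b)%O] in hb.
  have us : uniq s by apply: filter_mons_uniq.
  pose X := [tuple of [seq zmonQ b' | b' <- in_tuple s]].
  have hX : zmonQ b \in <<X>>%VS by rewrite /= in hb *.
  exists (fun b' => if insub (index b' s) is Some i then coord X i (zmonQ b) else 0).
  rewrite {1}(coord_span hX) -[RHS]big_filter -/s [RHS](big_nth 0%MM) big_mkord.
  apply: eq_bigr => i _; rewrite index_uniq // valK; congr (_ *: _).
  by rewrite (nth_map 0%MM).
have [g0 [F0 [ng0 nF0 g00 hF0]]] := common_denominator (mons bt dE) c.
pose e := maxn (msize g0) (\max_(b' <- mons bt dE) msize (F0 b')).
have [bg ng vg] := mkhom_prop ng0 (leq_maxl (msize g0) (\max_(b' <- mons bt dE) msize (F0 b'))).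
have hF b' : b' \in mons bt dE -> [/\ bhom bt (fun b => if isy b then 0%N else e) (mkhom e (F0 b')),
   nony (mkhom e (F0 b')) & mmap io z (mkhom e (F0 b')) = mmap io z (F0 b')].
  move=> b'E; apply: mkhom_prop => //; apply: leq_trans (leq_maxr _ _).
  by rewrite (bigD1_seq b') ?mons_uniq //= leq_maxl.
rewrite -/e in bg ng vg; set g := mkhom e g0 in bg ng vg; clearbody g.
have nzg : g != 0 by apply: contraNneq g00 => h; rewrite -vg h rmorph0.
pose f := g * 'X_[b] - \sum_(b' <- mons bt dE | (b' < b)%O) mkhom e (F0 b') * 'X_[b'].
pose d b1 := ((if isy b1 then 0%N else e) + dE b1)%N.
have bhE b' : b' \in mons bt dE -> bhom bt dE ('X_[b'] : {mpoly k[n]}).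
  by rewrite mem_mons => /has_bdegP <-; apply: bhom_bdeg.
have hf : bhom bt d f.
  have h1 : bhom bt d (g * 'X_[b]) := bhomM bg (bhE b bE).
  have h2 : bhom bt d (\sum_(b' <- mons bt dE | (b' < b)%O) mkhom e (F0 b') * 'X_[b']).
    rewrite big_seq_cond; apply: bhom_sum => b' /andP[b'E _].
    by have [h _ _] := hF b' b'E; apply: (bhomM h (bhE b' b'E)).
  by move=> m /msuppB_le; rewrite mem_cat => /orP[/h1|/h2].
pose ld := (b + mlead g)%MM.
have ngl i : isy (bt i) -> mlead g i = 0%N by apply: ng; rewrite mlead_supp.
have ldd : bdeg bt ld = d.
  apply/funext => b1; rewrite bdegD; have := bg _ (mlead_supp nzg) => /has_bdegP ->.
  by have := bE; rewrite mem_mons => /has_bdegP ->; rewrite addnC.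
have small m b' : b' \in mons bt dE -> (b' < b)%O -> m \in msupp (mkhom e (F0 b') * 'X_[b']) ->
    (m < ld)%O.
  move=> b'E lt mS; have [h1 h2 _] := hF b' b'E.
  have md : bdeg bt m = d by apply/has_bdegP; apply: (bhomM h1 (bhE b' b'E)).
  apply: ypart_lt; first by rewrite md ldd.
  have [-> _] := ypartK bE ngl; move: mS => /msuppM_le /allpairsP[[m1 m2] /= [m1S + ->]].
  rewrite msuppX inE => /eqP ->; rewrite addmC.
  by have [-> _] := ypartK b'E (h2 m1 m1S).
have f_ld : f@_ld = mleadc g.
  have -> : f@_ld = (g * 'X_[b])@_ld -
      (\sum_(b' <- mons bt dE | (b' < b)%O) mkhom e (F0 b') * 'X_[b'])@_ld by apply: mcoeffB.
  have -> : (g * 'X_[b])@_ld = mleadc g by apply: mcoeffMX.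
  rewrite raddf_sum /= big_seq_cond big1 ?subr0 //.
  move=> b' /andP[b'E lt]; apply/eqP; rewrite mcoeff_eq0; apply/negP => mS.
  by have := small _ _ b'E lt mS; rewrite ltxx.
have nzf : f != 0.
  by apply/eqP => f0; have := f_ld; rewrite f0 mcoeff0 => /esym/eqP; rewrite mleadc_eq0 (negbTE nzg).
have lf : mlead f = ld.
  apply/le_anti/andP; split; last first.
    by apply: msupp_le_mlead; rewrite mcoeff_msupp f_ld mleadc_eq0.
  have := mlead_supp nzf; move/msuppB_le; rewrite mem_cat => /orP[|].
    move=> /msuppM_le /allpairsP[[m1 m2] /= [m1S + ->]].
    by rewrite msuppX inE => /eqP ->; rewrite /ld addmC lemc_add2r msupp_le_mlead.
  move/msupp_sum_le/flattenP => -[_ /mapP[b' + ->]].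
  by rewrite mem_filter => /andP[lt b'E] mS; apply/ltW/(small _ b').
exists (mlead g) => //; apply; exists f; split=> //.
  by rewrite -/ld ldd.
have sE : mmap io z (\sum_(b' <- mons bt dE | (b' < b)%O) mkhom e (F0 b') * 'X_[b']) =
    \sum_(b' <- mons bt dE | (b' < b)%O) mmap io z (mkhom e (F0 b') * 'X_[b']).
  by rewrite raddf_sum.
rewrite rmorphB rmorphM /= sE mmapX vg -fQ_zmonQ cE rmorph_sum mulr_sumr -sumrB.
rewrite big_seq_cond big1 // => b' /andP[b'E _]; have [_ _ vF] := hF b' b'E.
rewrite fQZ fQ_zmonQ (hF0 b' b'E) rmorphM /= mmapX vF.
by field; rewrite g00.
Qed.

(* The common shift [g] makes leading coefficients over [Kap] invisible. *)
Lemma kstd_shift (g1 : 'X_{1..n}) : (forall i, isy (bt i) -> g1 i = 0%N) ->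
  exists g : 'X_{1..n}, [/\ forall i, isy (bt i) -> g i = 0%N, (g1 <= g)%MM &
    forall b, b \in mons bt dE -> `[< std bt io z (b + g)%MM >] = kstd b].
Proof.
move=> hg1.
have /choice[G hG] b : exists g : 'X_{1..n}, (forall i, isy (bt i) -> g i = 0%N) /\
    (b \in mons bt dE -> ~~ kstd b -> ~ std bt io z (b + g)%MM).
  case: (boolP ((b \in mons bt dE) && ~~ kstd b)) => [/andP[bE kb]|hn].
    by have [g hg ng] := not_kstd bE kb; exists g.
  by exists 0%MM; split=> [i _|bE kb]; rewrite ?mnm0E // bE kb in hn *.
exists (g1 + \sum_(b <- mons bt dE) G b)%MM; split.
- move=> i iy; rewrite mnmDE hg1 // mnm_sumE big1 // => b _.
  by have [-> ] := hG b.
- exact: lem_addr.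
move=> b bE; apply/asboolP/idP => [sb|kb]; last first.
  apply: kstd_std => // i iy; rewrite mnmDE hg1 // mnm_sumE big1 // => b' _.
  by have [-> ] := hG b'.
case: (boolP (kstd b)) => // kb; have [_ /(_ bE kb) nsb] := hG b; case: nsb.
apply: std_down sb _; apply/mnm_lepP => i; rewrite !mnmDE mnm_sumE leq_add2l.
by apply: leq_trans (leq_addl _ _); rewrite (bigD1_seq b) ?mons_uniq //= leq_addr.
Qed.

End RelativeStandard.

End OrderedMonomials.

Section OrderedStandardMonomials.

Import Order.TTheory.

Lemma span_map_sum (K : fieldType) (V : vectType K) (I : eqType) (f : I -> V) (s : seq I) v :
  uniq s -> v \in <<[seq f i | i <- s]>>%VS -> exists c : I -> K, v = \sum_(i <- s) c i *: f i.
Proof.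
case: s => [_|i0 s0]; first by rewrite span_nil memv0 => /eqP ->; exists (fun=> 0); rewrite big_nil.
set s := i0 :: s0 => us.
pose X := [tuple of [seq f i | i <- in_tuple s]]; move=> vX.
have hX : v \in <<X>>%VS by [].
exists (fun i => if insub (index i s) is Some j then coord X j v else 0).
rewrite {1}(coord_span hX) [RHS](big_nth i0) big_mkord; apply: eq_bigr => j _.
rewrite index_uniq // valK; congr (_ *: _).
by rewrite (nth_map i0).
Qed.

Lemma dim_span_rcons (K : fieldType) (V : vectType K) (X : seq V) v :
  \dim <<rcons X v>>%VS = (\dim <<X>>%VS + (v \notin <<X>>%VS))%N.
Proof.
rewrite -cats1 span_cat span_seq1; case: (boolP (v \in <<X>>%VS)) => vX /=.
  by rewrite addn0 (addv_idPl _).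
have v0 : v != 0 by apply: contraNneq vX => ->; rewrite mem0v.
rewrite dimv_disjoint_sum ?dim_vline ?v0 //; apply/eqP; rewrite -subv0; apply/subvP => w.
rewrite memv_cap memv0 => /andP[wX /vlineP[c wE]].
have [c0|nzc] := eqVneq c 0; first by rewrite wE c0 scale0r.
case/negP: vX; have -> : v = c^-1 *: w by rewrite wE scalerA mulVf // scale1r.
exact: rpredZ.
Qed.

(** Adding the vectors in increasing order raises the dimension of the span exactly at the vectors
    outside the span of the smaller ones. *)
Lemma count_standard (K : fieldType) (V : vectType K) d (I : orderType d) (f : I -> V) (s : seq I) :
  uniq s -> count (fun i => f i \notin <<[seq f j | j <- s & (j < i)%O]>>%VS) s =
    \dim <<[seq f i | i <- s]>>%VS.
Proof.
have srt t : sorted <%O t -> count (fun i => f i \notin <<[seq f j | j <- t & (j < i)%O]>>%VS) t =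
    \dim <<[seq f i | i <- t]>>%VS.
  elim/last_ind: t => [|t x IH] st; first by rewrite /= span_nil dimv0.
  have [tx st'] : all (fun y => (y < x)%O) t /\ sorted <%O t.
    by move: st; rewrite !(sorted_pairwise lt_trans) pairwise_rcons => /andP.
  rewrite map_rcons dim_span_rcons -IH // -cats1 count_cat /= addn0; congr (_ + _)%N.
    apply: eq_in_count => i it; congr (_ \notin <<map f _>>%VS).
    rewrite filter_cat /= ltNge ltW ?cats0 //; exact: (allP tx).
  rewrite filter_cat /= ltxx cats0 (_ : [seq j <- t | (j < x)%O] = t) //.
  exact/all_filterP.
move=> us; have ps : perm_eq (sort <=%O s) s by rewrite perm_sort.
have st : sorted <%O (sort <=%O s).
  by rewrite lt_sorted_uniq_le sort_uniq us sort_le_sorted.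
have spE t t' : perm_eq t t' -> <<[seq f j | j <- t]>>%VS = <<[seq f j | j <- t']>>%VS.
  by move=> p1; apply/eq_span => v; apply/perm_mem/perm_map.
rewrite -(spE _ _ ps) -(srt _ st) -(seq.permP ps); apply: eq_count => i.
by rewrite (spE _ _ (perm_filter _ ps)).
Qed.

(** * Independence of residues from the Hilbert function *)

Section HilbertTheorem.

Variables (p r n : nat) (ns : 'I_r -> nat).
(** [None] is the block of the regular representation, [Some (s, false)] the coordinates on the s-th
    block of V and [Some (s, true)] the residues eta of that block; they are called x and y
    below. *)
Let J : finType := option ('I_r * bool).
Variables (k : fieldType) (bt : 'I_n -> J).
Let isy (b : J) := if b is Some (_, true) then true else false.
Let isx (b : J) := if b is Some (_, false) then true else false.
Variables (Th : fieldType) (io : {rmorphism k -> Th}) (z : 'I_n -> Th).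
Hypothesis p_pr : prime p.
Hypothesis yfirst : forall i j : 'I_n, isy (bt i) -> ~~ isy (bt j) -> (i < j)%N.
Hypothesis card_block : forall s t, #|blk bt [set: 'I_n] (Some (s, t))| = (p ^ ns s)%N.
Variables (i0 : J -> 'I_n).
Hypotheses (bt_i0 : forall b, bt (i0 b) = b) (z_i0 : forall b, z (i0 b) = 1).
Hypothesis z_indep : forall d f, bhom bt d f -> nony bt isy f -> f != 0 -> mmap io z f != 0.
Variables (Kap : fieldType) (ka : {rmorphism Kap -> Th}).
Hypothesis ka_ratio : forall c, exists f g : {mpoly k[n]},
  [/\ nony bt isy f, nony bt isy g, mmap io z g != 0 & ka c = mmap io z f / mmap io z g].
Hypothesis ka_poly : forall f : {mpoly k[n]}, nony bt isy f -> exists c, mmap io z f = ka c.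
Variables (Q : fieldExtType Kap) (fQ : {rmorphism Q -> Th}) (zQ : 'I_n -> Q).
Hypothesis fQZ : forall c q, fQ (c *: q) = ka c * fQ q.
Hypothesis fQz : forall i, fQ (zQ i) = z i.
Hypothesis Q_dim : coprime p (\dim {:Q}).
Variable T : seq Th.
Hypothesis z_T : forall i, algcl io (fun x => x \in T) (z i).
Hypothesis size_T : ((size T).+1 = #|blk bt [set: 'I_n] None| + \sum_s (p ^ ns s).-1)%N.
Hypothesis std_dvd : forall d s, ~~ (p %| d (Some (s, false)) + d (Some (s, true)))%N ->
  (p ^ ns s %| count (fun m => `[< std bt io z m >]) (mons bt d))%N.

Let dE E b := if isy b then E else 0%N.
Let W E := <<[seq zmonQ zQ b | b <- mons bt (dE E)]>>%VS.

Let zQ_i0 b : zQ (i0 b) = 1.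
Proof. by apply: (fmorph_inj fQ); rewrite fQz z_i0 rmorph1. Qed.

Let raise (e : nat) : 'X_{1..n} := (\sum_(b | isy b) (U_(i0 b) *+ e))%MM.

Let zmonQD b b' : zmonQ zQ (b + b')%MM = zmonQ zQ b * zmonQ zQ b'.
Proof. by rewrite /zmonQ commr_mmap1_M // => *; apply: mulrC. Qed.

Let zmonQ_raise e : zmonQ zQ (raise e) = 1.
Proof.
rewrite /zmonQ /raise mmap1_sum big1 // => b _.
by rewrite mmap1_Un zQ_i0 expr1n.
Qed.

Let bdeg_raise e : bdeg bt (raise e) = dE e.
Proof.
apply/funext => b; rewrite /raise bdeg_sum /dE.
rewrite (eq_bigr (fun b' => if b' == b then e else 0%N)); last first.
  by move=> b' _; rewrite bdegMn bdeg1 bt_i0 eq_sym; case: eqP; rewrite ?muln1 ?muln0.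
rewrite -big_mkcondr /=; case: ifP => iy.
  by rewrite (big_pred1 b) // => b' /=; rewrite andbC; case: eqP => [->|].
by rewrite big_pred0 // => b'; case: eqP => [->|]; rewrite ?iy ?andbF.
Qed.

Let monsD E E' b b' : b \in mons bt (dE E) -> b' \in mons bt (dE E') ->
  (b + b')%MM \in mons bt (dE (E + E')).
Proof.
rewrite !mem_mons => /has_bdegP bE /has_bdegP b'E; apply/has_bdegP/funext => b1.
by rewrite bdegD bE b'E /dE; case: ifP.
Qed.

Let raise_mons e : raise e \in mons bt (dE e).
Proof. by rewrite mem_mons; apply/has_bdegP. Qed.

Let W_mono E E' : (E <= E')%N -> (W E <= W E')%VS.
Proof.
move=> le; apply/span_subvP => _ /mapP[b bE ->].
rewrite -[zmonQ zQ b]mulr1 -(zmonQ_raise (E' - E)) -zmonQD; apply/memv_span/map_f.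
by rewrite -(subnKC le); apply: monsD => //; rewrite subnKC.
Qed.

Let W_stable : exists E0, forall E, (E0 <= E)%N -> W E = W E0.
Proof.
pose P d := `[< exists E, \dim (W E) = d >].
have exP : exists d, P d by exists (\dim (W 0)); apply/asboolP; exists 0%N.
have ubP d : P d -> (d <= \dim {:Q})%N.
  by move/asboolP => [E <-]; apply: dimvS; apply: subvf.
case: (ex_maxnP exP ubP) => d /asboolP[E0 dE0] maxd; exists E0 => E le.
apply/esym/eqP; rewrite eqEdim W_mono //= dE0; apply: maxd.
by apply/asboolP; exists E.
Qed.

(** A stable span is closed under products, hence an intermediate field of [Q], whose degree divides
    that of [Q]. *)
Let dim_W_coprime E : W (E + E) = W E -> coprime p (\dim (W E)).
Proof.
move=> WE; have W1 : 1 \in W E.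
  by rewrite -(zmonQ_raise E); apply/memv_span/map_f/raise_mons.
have WM : (W E * W E <= W E)%VS.
  apply/prodvP => u v /(span_map_sum (mons_uniq _ _))[c ->] /(span_map_sum (mons_uniq _ _))[c' ->].
  rewrite mulr_suml big_seq; apply: rpred_sum => b bE.
  rewrite mulr_sumr big_seq; apply: rpred_sum => b' b'E.
  rewrite -scalerAl -scalerAr !rpredZ // -zmonQD -[W E]WE; apply/memv_span/map_f.
  exact: monsD.
have Wa : is_aspace (W E) by rewrite /is_aspace has_algid1.
have := field_dimS (subvf (ASpace Wa)); move: Q_dim => /[swap].
exact: coprime_dvdr.
Qed.

Theorem multihomogeneous_independent d f : bhom bt d f ->
  (forall m, m \in msupp f -> forall i, isx (bt i) -> m i = 0%N) -> mmap io z f = 0 -> f = 0.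
Proof.
move=> hf nxf vf; have [//|nzf] := eqVneq f 0; exfalso.
have sdown m mu : std bt io z m -> (mu <= m)%MM -> std bt io z mu by apply: std_down.
have [cs csD] := cone_decomposition sdown.
have csS c m : c \in cs -> in_cone c m -> std bt io z m.
  move=> cin mc; case: (asboolP (std bt io z m)) (csD m) => // _ c0.
  have : has (fun c => in_cone c m) cs by apply/hasP; exists c.
  by rewrite has_count c0.
have csfree c (m : 'X_{1..n}) : c \in cs -> (forall i, i \notin c.2 -> m i = 0%N) -> std bt io z m.
  move=> cin hm; apply: (sdown (c.1 + m)%MM); last exact: lem_addl.
  apply: (csS c) => //; apply/in_coneP => i; rewrite mnmDE.
  by case: ifP => iB; rewrite ?leq_addr // hm ?addn0 ?iB.
have csN c : c \in cs -> (#|c.2| <= size T + #|J|)%N.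
  by move=> cin; apply: (@cone_size_le _ _ _ bt _ io z) => // m; apply: csfree.
pose M := (\max_(c <- cs) mdeg c.1).+1.
have csM c b : c \in cs -> (bdeg bt c.1 b < M)%N.
  move=> cin; rewrite /M ltnS; apply: (@leq_trans (mdeg c.1)).
    by rewrite (mdeg_bdeg bt) (bigD1 b) //= leq_addr.
  by elim: (cs) cin => //= c' cs' IH; rewrite inE big_cons => /orP[/eqP ->|/IH le];
    rewrite leq_max ?leqnn // le orbT.
pose h := dcount bt (std bt io z) M.
pose a0 := #|blk bt [set: 'I_n] None|.-1.
have a0E : #|blk bt [set: 'I_n] None| = a0.+1.
  by rewrite /a0 prednK // card_gt0; apply/set0Pn; exists (i0 None); rewrite !inE bt_i0 eqxx.
(* For every block one difference less than its number of variables: [None] always, and for each [s]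
   the y block if [s] lies in [S], the x block otherwise. By [size_T] this is exactly the top
   order. *)
pose lst (S : {set 'I_r}) : seq J := nseq a0 None ++
  flatten [seq nseq (p ^ ns s).-1 (Some (s, s \in S)) | s <- enum 'I_r].
have cnt (a : pred J) S : count a (lst S) =
    (a None * a0 + \sum_s a (Some (s, s \in S)) * (p ^ ns s).-1)%N.
  rewrite count_cat count_nseq count_flatten sumnE big_map big_map big_enum /=.
  by congr (_ + _)%N; apply: eq_bigr => s _; rewrite count_nseq.
have sz S : size (lst S) = size T.
  rewrite -(count_predT (lst S)) cnt; apply: succn_inj; rewrite size_T a0E.
  by rewrite mul1n addSn; congr (_ + _).+1; apply: eq_bigr => s _; rewrite mul1n.
have p0 s : (0 < p ^ ns s)%N by rewrite expn_gt0 prime_gt0.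
pose V S := difs (lst S) h (fun=> 0%N).
(* Only the p^(ns s) - 1 differences for [s] change their direction; the list [l0] of the others
   avoids both blocks of [s], as [difs_swap_mod] demands. *)
have step (S : {set 'I_r}) s : s \notin S -> (p %| V (s |: S) - V S)%Z.
  move=> sS; pose l0 := nseq a0 None ++
    flatten [seq nseq (if s' == s then 0%N else (p ^ ns s').-1) (Some (s', s' \in S)) | s' <- enum 'I_r].
  have cnt0 (a : pred J) : count a l0 =
      (a None * a0 + \sum_(s' | s' != s) a (Some (s', s' \in S)) * (p ^ ns s').-1)%N.
    rewrite count_cat count_nseq count_flatten sumnE big_map big_map big_enum /=.
    congr (_ + _)%N; rewrite [RHS]big_mkcond; apply: eq_bigr => s' _.
    by rewrite count_nseq; case: eqP; rewrite ?muln0.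
  have pE (S' : {set 'I_r}) t : (s \in S') = t -> (forall s', s' != s -> (s' \in S') = (s' \in S)) ->
      perm_eq (lst S') (l0 ++ nseq (p ^ ns s).-1 (Some (s, t))).
    move=> st hS'; apply/seq.permP => a; rewrite cnt count_cat cnt0 count_nseq -addnA.
    congr (_ + _)%N; rewrite (bigD1 s) //= addnC st; congr (_ + _)%N.
    by apply: eq_bigr => s' /hS' ->.
  rewrite /V (difs_perm h (pE (s |: S) true _ _)); last 2 first.
  - by rewrite setU11.
  - by move=> s' s's; rewrite !inE (negbTE s's).
  rewrite (difs_perm h (pE S false _ _)) //; last exact/negbTE.
  have nl0 t : Some (s, t) \notin l0.
    rewrite -has_pred1 has_count cnt0 -leqNgt leqn0 addn_eq0 muln_eq0 /=.
    rewrite sum_nat_eq0; apply/forallP => s'; apply/implyP => s's.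
    have ne : Some (s', s' \in S) != Some (s, t) by apply/eqP => -[e _]; rewrite e eqxx in s's.
    by rewrite (negbTE ne).
  apply: (@difs_swap_mod _ p (ns s) (size T) (M + M)); rewrite ?nl0 //.
  - by apply/eqP => -[].
  - by move=> l d'; apply: (dcount_vanish csD csN csM).
  - move=> d' hd'; rewrite /h /dcount dvdzE /=; apply: std_dvd.
    rewrite (_ : (_ + _)%N = (d' (Some (s, false)) + d' (Some (s, true)) + (M + M))%N) //.
    by rewrite /shift addnACA.
  - have := perm_size (pE S false _ _); rewrite sz size_cat size_nseq => -> //.
    exact/negbTE.
have chain (S : {set 'I_r}) : (p %| V S - V set0)%Z.
  have [c] := ubnP #|S|; elim: c S => // c IH S; case: (set_0Vmem S) => [->|[s sS] cS].
    by rewrite subrr dvdz0.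
  rewrite -(setD1K sS) -[V _](subrK (V (S :\ s))) -addrA rpredD //.
    by apply: step; rewrite !inE eqxx.
  by apply: IH; move: cS; rewrite (cardsD1 s) sS.
have count_lst S b : (count_mem b (lst S)).+1 =
   if b is Some (s, t) then if t == (s \in S) then (p ^ ns s)%N else 1%N
   else #|blk bt [set: 'I_n] None|.
  rewrite cnt; case: b => [[s t]|] /=.
    rewrite mul0n add0n (bigD1 s) //= big1 ?addn0 => [|s' /negbTE s's].
      rewrite (inj_eq Some_inj) xpair_eqE eqxx /= eq_sym; case: eqP => _; rewrite ?mul1n ?mul0n ?prednK //.
    by rewrite (inj_eq Some_inj) xpair_eqE s's.
  by rewrite mul1n big1 ?addn0.
have full c b : #|blk bt c b| = #|blk bt [set: 'I_n] b| -> forall i, bt i = b -> i \in c.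
  move=> e i ib; have := @subset_leqif_cards _ (blk bt c b) (blk bt [set: 'I_n] b).
  case; first by apply/subsetP => j; rewrite !inE => /andP[_ ->].
  rewrite e eqxx => _ /esym/eqP/setP/(_ i); rewrite !inE ib eqxx /= andbT.
  by [].
(* A cone counted here would have all variables of block [None] and of all y blocks free. The
   leading monomial of [f], which involves no x, would then be standard, against the relation. *)
have VB : V [set: 'I_r] = 0.
  rewrite /V /h (dcount_top csD csN csM) ?sz //; congr Posz; apply/eqP.
  rewrite -leqn0 leqNgt -has_count; apply/hasP => -[c cin /forallP hc].
  have := @csfree c (mlead f) cin; case; last first.
    by exists f; split=> // m mf; have /has_bdegP -> := hf _ (mlead_supp nzf); apply: hf.
  move=> i; apply: contraNeq => nzi.
  have hb := eqP (hc (bt i)); rewrite count_lst in hb.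
  apply: (full _ (bt i)) => //; rewrite hb.
  case E: (bt i) => [[s t]|] //; rewrite card_block inE.
  case: t E => //= E; case/eqP: nzi; apply: nxf; first exact: mlead_supp.
  by rewrite E.
have [E0 WE] := W_stable.
pose E := (E0 + M)%N.
have copW : coprime p (\dim (W E)).
  by apply: dim_W_coprime; rewrite !WE //; lia.
(* Exponents at least [M] outside the y blocks exceed every vertex, so a cone that contains such a
   monomial has all these variables free. *)
pose g1 : 'X_{1..n} := [multinom if isy (bt i) then 0%N else M | i < n].
have [|g [ng g1g hg]] := @kstd_shift _ _ _ _ isy _ io z yfirst i0 bt_i0 z_i0 z_indep _ _
   ka_ratio ka_poly Q fQ zQ fQZ fQz E g1; first by move=> i iy; rewrite mnmE iy.
have gM i : ~~ isy (bt i) -> (M <= g i)%N.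
  by move=> iy; have /mnm_lepP/(_ i) := g1g; rewrite mnmE (negbTE iy).
have al_le c i : c \in cs -> (c.1 i < M)%N.
  by move=> cin; apply: leq_ltn_trans (csM c (bt i) cin); rewrite /bdeg (bigD1 i) //= leq_addr.
(* The standard monomials b + g, with b of degree [E] in each y block, are counted twice. By [hg]
   and [count_standard] their number is the dimension of [W E]; on the other hand every cone counted
   by [V set0] contains exactly one of them and other cones contain none. *)
have VA : V set0 = (\dim (W E))%:Z.
  rewrite /V /h (dcount_top csD csN csM) ?sz //; congr Posz.
  rewrite /W -(count_standard _ (mons_uniq _ _)) -sum1_count.
  transitivity (\sum_(b <- mons bt (dE E)) \sum_(c <- cs) in_cone c (b + g)%MM)%N; last first.
    rewrite -sum1_count [RHS]big_mkcond /= big_seq [RHS]big_seq; apply: eq_bigr => b bE.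
    have := hg b bE; rewrite -/(kstd _ _ _ _ _) => <-.
    rewrite -[RHS]/(nat_of_bool `[< _ >]) -csD -sum1_count [RHS]big_mkcond.
    by apply: eq_bigr => c _; case: in_cone.
  rewrite exchange_big /= big_mkcond /= big_seq [RHS]big_seq; apply: eq_bigr => c cin.
  have gcone b : b \in mons bt (dE E) -> in_cone c (b + g)%MM ->
     [forall b, #|blk bt c.2 b| == (count_mem b (lst set0)).+1].
    move=> bE /in_coneP bc.
    have inB i : ~~ isy (bt i) -> i \in c.2.
      move=> iy; have := bc i; case: ifP => // _; rewrite mnmDE => e.
      by have := gM i iy; rewrite leqNgt -ltnS; have := al_le c i cin; rewrite -e; lia.
    have ge b1 : ((count_mem b1 (lst set0)).+1 <= #|blk bt c.2 b1|)%N.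
      rewrite count_lst.
      have fullb : ~~ isy b1 -> (#|blk bt [set: 'I_n] b1| <= #|blk bt c.2 b1|)%N.
        move=> b1y; apply/subset_leq_card/subsetP => i; rewrite !inE /= => /eqP ib.
        by rewrite inB ib ?eqxx.
      case: b1 fullb => [[s []]|] fullb; rewrite ?inE //=; last exact: fullb.
        rewrite card_gt0; apply/eqP => b0.
        have bdE : bdeg bt b (Some (s, true)) = E.
          by move: bE; rewrite mem_mons => /has_bdegP ->.
        have := csM c (Some (s, true)) cin; rewrite ltnNge => /negP; apply.
        apply: (@leq_trans E); first by rewrite /E leq_addl.
        rewrite -bdE /bdeg; apply: leq_sum => i /eqP ib.
        have := bc i; have := in_set0 i; rewrite -b0 inE ib eqxx andbT => ->.
        by rewrite mnmDE => <-; rewrite leq_addr.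
      by rewrite -(card_block s false); apply: fullb.
    apply/forallP => b1; rewrite eqn_leq ge andbT leqNgt; apply/negP => lt.
    have := csN c cin; rewrite leqNgt -(sum_blk bt) => /negP; apply.
    rewrite -(sz set0) -sum_count_mem -sum1_card -big_split /= (bigD1 b1) //= [X in (_ < X)%N](bigD1 b1) //=.
    rewrite -addSn addn1; apply: leq_add => //.
    by apply: leq_sum => b2 _; rewrite addn1 ge.
  case: ifP => [hc|/negbT hc]; last first.
    by rewrite big_seq big1 // => b bE; case: (boolP (in_cone _ _)) => // /(gcone b bE); rewrite (negbTE hc).
  have hb b : #|blk bt c.2 b| = if b is Some (s, t) then if t then 1%N else (p ^ ns s)%N
     else #|blk bt [set: 'I_n] None|.
    by rewrite (eqP (forallP hc b)) count_lst; case: b => [[s []]|] //; rewrite inE.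
  have inB i : ~~ isy (bt i) -> i \in c.2.
    move=> iy; apply: (full _ (bt i)) => //; rewrite hb.
    by case: (bt i) iy => [[s []]|] //; rewrite card_block.
  (* The cone restricted to monomials in y. In the other blocks the degree is 0, and one free
     variable [i0] there, necessarily with exponent 0, gives the shape required by [cone_count1]. *)
  pose B2 : {set 'I_n} := [set i | if isy (bt i) then i \in c.2 else i == i0 (bt i)].
  pose al2 : 'X_{1..n} := [multinom if isy (bt i) then c.1 i else 0%N | i < n].
  have [c1] : cone_count bt al2 B2 (dE E) = 1.
   apply: cone_count1 => b.
  - case: (boolP (isy b)) => iy.
      transitivity #|blk bt c.2 b|; last by rewrite hb; case: b iy => [[s []]|].
      by apply: eq_card => i; rewrite !inE; case: (eqVneq (bt i) b) => [->|]; rewrite ?andbF // iy.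
    rewrite -(cards1 (i0 b)); apply: eq_card => i; rewrite !inE.
    case: (eqVneq (bt i) b) => [->|ne]; first by rewrite (negbTE iy) andbT.
    by rewrite andbF; apply/esym/negbTE; apply: contraNneq ne => ->; rewrite bt_i0.
  - rewrite /dE; case: ifP => iy.
      apply: (@leq_trans M); last by rewrite /E leq_addl.
      apply: ltnW; apply: leq_ltn_trans (csM c b cin); rewrite /bdeg.
      by apply: leq_sum => i /eqP ib; rewrite mnmE ib iy.
    by rewrite leqn0 /bdeg sum_nat_eq0; apply/forallP => i; apply/implyP => /eqP ib; rewrite mnmE ib iy.
  rewrite -[LHS]c1 -sum1_count [LHS]big_mkcond /= big_seq [RHS]big_seq.
  apply: eq_bigr => b bE.
  suff -> : in_cone (al2, B2) b = in_cone c (b + g)%MM by case: in_cone.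
  have b0 i : ~~ isy (bt i) -> b i = 0%N by apply: mons_y bE _.
  have al2E i : al2 i = if isy (bt i) then c.1 i else 0%N by rewrite mnmE.
  apply/in_coneP/in_coneP => bc i; have := bc i; rewrite /= !inE al2E mnmDE.
    case: (boolP (isy (bt i))) => iy; first by rewrite ng // addn0.
    by move=> _; rewrite (inB i iy) b0 // add0n; apply: ltnW; apply: leq_trans (gM i iy); apply: al_le.
  case: (boolP (isy (bt i))) => iy; first by rewrite ng // addn0.
  by move=> _; rewrite b0 //; case: ifP.
have := chain [set: 'I_r]; rewrite VB VA sub0r rpredN dvdzE /= => pd.
move: copW; rewrite (prime_coprime _ p_pr) pd.
by [].
Qed.

End HilbertTheorem.

End OrderedStandardMonomials.

(** * Power series and fraction fields with a group action *)

Section OrderedSeries.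

Import Order.TTheory.

Lemma ex_recursive (X : Type) (x0 : X) (Phi : nat -> seq X -> X) :
  exists g : nat -> X, forall n, g n = Phi n (mkseq g n).
Proof.
pose fix s n := if n is n'.+1 then rcons (s n') (Phi n' (s n')) else [::].
have sz n : size (s n) = n by elim: n => //= n IH; rewrite size_rcons IH.
exists (fun n => nth x0 (s n.+1) n) => n.
rewrite [s n.+1]/= nth_rcons sz ltnn eqxx; congr Phi.
apply: (@eq_from_nth _ x0) => [|i]; rewrite sz ?size_mkseq // => lt.
rewrite nth_mkseq //; elim: n lt => // n IH; rewrite ltnS leq_eqVlt => /orP[/eqP -> //|lt].
by rewrite /= nth_rcons sz lt IH.
Qed.

Section PowerSeries.

Variable R : comNzRingType.

Definition pseries := nat -> R.
Implicit Types f g h : pseries.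

HB.instance Definition _ := gen_eqMixin pseries.
HB.instance Definition _ := gen_choiceMixin pseries.

Definition ps_add f g : pseries := fun n => f n + g n.
Definition ps_opp f : pseries := fun n => - f n.
Definition ps_mul f g : pseries := fun n => \sum_(i < n.+1) f i * g (n - i)%N.
Definition ps_one : pseries := fun n => (n == 0%N)%:R.
Definition ps_trunc n f : {poly R} := \poly_(i < n.+1) f i.

Lemma ps_addA : associative ps_add.
Proof. by move=> f g h; apply/funext => n; apply: addrA. Qed.
Lemma ps_addC : commutative ps_add.
Proof. by move=> f g; apply/funext => n; apply: addrC. Qed.
Lemma ps_add0 : left_id (fun=> 0 : R) ps_add.
Proof. by move=> f; apply/funext => n; apply: add0r. Qed.
Lemma ps_addN : left_inverse (fun=> 0 : R) ps_opp ps_add.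
Proof. by move=> f; apply/funext => n; apply: addNr. Qed.

HB.instance Definition _ := GRing.isZmodule.Build pseries ps_addA ps_addC ps_add0 ps_addN.

Lemma coef_trunc n f i : (i <= n)%N -> (ps_trunc n f)`_i = f i.
Proof. by move=> le; rewrite coef_poly ltnS le. Qed.

(** Products agree with products of truncations up to the order considered, so the ring laws are
    inherited from polynomials. *)
Lemma ps_mulE n m f g : (n <= m)%N -> ps_mul f g n = (ps_trunc m f * ps_trunc m g)`_n.
Proof.
move=> le; rewrite [RHS]coefM; apply: eq_bigr => i _.
have in_ : (i <= n)%N by rewrite -ltnS.
by rewrite !coef_trunc // (leq_trans _ le) // leq_subr.
Qed.

Lemma ps_mulA : associative ps_mul.
Proof.
move=> f g h; apply/funext => n.
transitivity ((ps_trunc n f * (ps_trunc n g * ps_trunc n h))`_n).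
  rewrite [RHS]coefM; apply: eq_bigr => i _; have le : (i <= n)%N by rewrite -ltnS.
  by rewrite coef_trunc // -ps_mulE // leq_subr.
rewrite mulrA [LHS]coefM; apply: eq_bigr => i _.
have le : (i <= n)%N by rewrite -ltnS.
by rewrite coef_trunc ?leq_subr // -ps_mulE.
Qed.

Lemma ps_mulC : commutative ps_mul.
Proof. by move=> f g; apply/funext => n; rewrite !(ps_mulE _ _ (leqnn n)) mulrC. Qed.

Lemma ps_mul1 : left_id ps_one ps_mul.
Proof.
move=> f; apply/funext => n; rewrite /ps_mul big_ord_recl subn0 mul1r big1 ?addr0 // => i _.
by rewrite mul0r.
Qed.

Lemma ps_mulDl : left_distributive ps_mul ps_add.
Proof.
move=> f g h; apply/funext => n; rewrite /ps_add /ps_mul -big_split.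
by apply: eq_bigr => i _; apply: mulrDl.
Qed.

Lemma ps_one_neq0 : ps_one != 0 :> pseries.
Proof. by apply/eqP => /(congr1 (fun f => f 0%N))/eqP; rewrite /ps_one oner_eq0. Qed.

HB.instance Definition _ :=
  GRing.Zmodule_isComNzRing.Build pseries ps_mulA ps_mulC ps_mul1 ps_mulDl ps_one_neq0.

Definition psX : pseries := fun n => (n == 1%N)%:R.

Lemma ps_mulX n f : (f * psX ^+ n) = (fun i => if (i < n)%N then 0 else f (i - n)%N) :> pseries.
Proof.
elim: n f => [|n IH] f.
  by rewrite expr0 mulr1; apply/funext => i; rewrite subn0.
rewrite exprS mulrA IH; apply/funext => i; rewrite ltnS.
case: (ltngtP i n) => [//|lt|->]; last first.
  by rewrite subnn -[LHS]/(ps_mul f psX 0%N) /ps_mul big_ord_recl big_ord0 /psX mulr0 addr0.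
rewrite -[LHS]/(ps_mul f psX (i - n)%N) /ps_mul.
have -> : (i - n)%N = (i - n.+1).+1 by lia.
rewrite big_ord_recr big_ord_recr /= subnn subSnn /psX mulr0 addr0 mulr1 big1 ?add0r // => j _.
case: eqP => [e|]; last by rewrite mulr0.
by have := ltn_ord j; lia.
Qed.

Lemma ps_coef0M f g : (f * g) 0%N = f 0%N * g 0%N.
Proof. by rewrite -[LHS]/(ps_mul f g 0%N) /ps_mul big_ord_recl big_ord0 addr0. Qed.

End PowerSeries.

Lemma ex_frac_action (G : finGroupType) (D : idomainType) (act : G -> D -> D) :
  ring_action act -> exists act' : G -> {fraction D} -> {fraction D},
    ring_action act' /\ forall g a, act' g (FracField.tofrac a) = FracField.tofrac (act g a).
Proof.
move=> hact.
have /choice[f hf] g : exists f : {rmorphism {fraction D} -> {fraction D}},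
    forall a, f (FracField.tofrac a) = FracField.tofrac (act g a).
  have [f0 f0E] := ract_rmorph hact g.
  have [|f fE] := @ex_frac_extension D {fraction D} (@FracField.tofrac D \o f0).
    move=> a b /= /eqP; rewrite tofrac_eq => /eqP; rewrite !f0E; exact: can_inj (ractK hact g) _ _.
  by exists f => a; rewrite fE /= f0E.
exists (fun g => f g); split=> //; split.
- move=> z; have [a [b [_ ->]]] := fracE z.
  by rewrite fmorph_div !hf !(ract1 hact).
- move=> g h z; have [a [b [_ ->]]] := fracE z.
  by rewrite !fmorph_div !hf !(ractM hact).
- by move=> g x y; rewrite rmorphB.
- by move=> g; split=> [|x y]; rewrite ?rmorph1 ?rmorphM.
Qed.

Section SeriesField.

Variable L : fieldType.

Lemma ps_order (f : pseries L) : f != 0 ->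
  exists n (g : pseries L), g 0%N != 0 /\ f = g * psX L ^+ n.
Proof.
move=> nzf; have exn : exists n, f n != 0.
  by apply: contrapT => hno; case/eqP: nzf; apply/funext => n; apply: contrapT => /eqP hn; apply: hno; exists n.
exists (ex_minn exn), (fun i => f (i + ex_minn exn)%N); case: ex_minnP => n fn minn.
rewrite add0n; split=> //; rewrite ps_mulX; apply/funext => i.
case: ltnP => [lt|le]; last by rewrite subnK.
by apply/eqP; rewrite -[_ == _]negbK; apply/negP => /minn; rewrite leqNgt lt.
Qed.

Lemma ps_domain (f g : pseries L) : f * g = 0 -> f = 0 \/ g = 0.
Proof.
have [->|/ps_order[n [f' [f0 ->]]]] := eqVneq f 0; first by left.
have [->|/ps_order[m [g' [g0 ->]]]] := eqVneq g 0; first by right.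
move=> e; have : (f' * g' * psX L ^+ (n + m)) (n + m)%N = 0.
  by rewrite exprD mulrACA e.
rewrite ps_mulX ltnn subnn ps_coef0M => /eqP.
by rewrite mulf_eq0 (negbTE f0) (negbTE g0).
Qed.

Lemma ps_inverse (f : pseries L) : f 0%N != 0 -> exists g : pseries L, f * g = 1.
Proof.
move=> f0; have [g gE] := ex_recursive (0 : L) (fun n s =>
  (f 0%N)^-1 * ((n == 0%N)%:R - \sum_(i < n) f i.+1 * nth 0 s (n - i.+1)%N)).
exists g; apply/funext => n; rewrite -[LHS]/(ps_mul f g n) /ps_mul big_ord_recl subn0 gE.
rewrite mulrA mulfV // mul1r.
have -> : \sum_(i < n) f (bump 0 i) * g (n - bump 0 i)%N =
    \sum_(i < n) f i.+1 * nth 0 (mkseq g n) (n - i.+1)%N; last by rewrite subrK.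
apply: eq_bigr => i _; rewrite /bump /= add1n nth_mkseq //.
by have := ltn_ord i; lia.
Qed.

End SeriesField.

End OrderedSeries.

(** * Places, Gauss's lemma and Hensel's lemma *)

(** A valuation ring [O] with its residue map and without a value group: [x] has at least the value
    of [y] when [O (x / y)]. The map [res] is total, but constrained only on [O]. *)
Record place (kap L : fieldType) (O : L -> Prop) (res : L -> kap) : Prop := Place {
  place1 : O 1;
  placeB : forall x y, O x -> O y -> O (x - y);
  placeM : forall x y, O x -> O y -> O (x * y);
  placeV : forall x, O x \/ O x^-1;
  res_one : res 1 = 1;
  resB : forall x y, O x -> O y -> res (x - y) = res x - res y;
  resM : forall x y, O x -> O y -> res (x * y) = res x * res y;
  resV : forall x, O x -> res x != 0 -> O x^-1
}.

Definition opoly (L : fieldType) (O : L -> Prop) (g : {poly L}) := forall i, O g`_i.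

(** A form of Hensel's lemma that passes from a field to its Laurent series, whatever the rank, and
    that bounds residue fields: an integral element of degree d has a residue whose degree divides
    d. *)
Definition henselian (kap L : fieldType) (O : L -> Prop) (res : L -> kap) :=
  forall g : {poly L}, g \is monic -> irreducible_poly g -> opoly O g ->
    exists (q : {poly kap}) (e : nat), irreducible_poly q /\ map_poly res g = q ^+ e.

Section PlaceTheory.

Variables (kap L : fieldType) (O : L -> Prop) (res : L -> kap).
Hypothesis pl : place O res.

Lemma place0 : O 0.
Proof. by rewrite -(subrr 1); apply: (placeB pl); apply: (place1 pl). Qed.

Lemma placeN x : O x -> O (- x).
Proof. by move=> Ox; rewrite -sub0r; apply: (placeB pl) Ox; apply: place0. Qed.

Lemma placeD x y : O x -> O y -> O (x + y).
Proof. by move=> Ox Oy; rewrite -[y]opprK; apply: (placeB pl) Ox _; apply: placeN. Qed.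

Lemma res_zero : res 0 = 0.
Proof. by rewrite -(subrr 1) (resB pl) ?subrr //; apply: (place1 pl). Qed.

Lemma resN x : O x -> res (- x) = - res x.
Proof. by move=> Ox; rewrite -sub0r (resB pl) ?res_zero ?sub0r //; apply: place0. Qed.

Lemma resD x y : O x -> O y -> res (x + y) = res x + res y.
Proof.
by move=> Ox Oy; rewrite -[y]opprK (resB pl) ?resN ?opprK //; rewrite ?resN ?opprK //; apply: placeN.
Qed.

Lemma place_sum (I : Type) (r : seq I) (F : I -> L) : (forall i, O (F i)) ->
  O (\sum_(i <- r) F i) /\ res (\sum_(i <- r) F i) = \sum_(i <- r) res (F i).
Proof.
move=> hF; elim: r => [|i r [IH1 IH2]]; first by rewrite !big_nil res_zero; split=> //; apply: place0.
by rewrite !big_cons resD ?IH2 //; split=> //; apply: placeD.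
Qed.

Lemma place_exp x e : O x -> O (x ^+ e) /\ res (x ^+ e) = res x ^+ e.
Proof.
move=> Ox; elim: e => [|e [IH1 IH2]].
  by rewrite !expr0 (res_one pl); split=> //; apply: (place1 pl).
by rewrite !exprS (resM pl) ?IH2 //; split=> //; apply: (placeM pl).
Qed.

Lemma coef_rmap (g : {poly L}) i : (map_poly res g)`_i = res g`_i.
Proof. by rewrite coef_map_id0 // res_zero. Qed.

Lemma opolyM (g h : {poly L}) : opoly O g -> opoly O h -> opoly O (g * h) /\
  map_poly res (g * h) = map_poly res g * map_poly res h.
Proof.
move=> og oh; have st i : O (g * h)`_i /\ res (g * h)`_i = \sum_(j < i.+1) res g`_j * res h`_(i - j).
  rewrite coefM; have [|h1 ->] := @place_sum _ (index_enum 'I_i.+1) (fun j => g`_j * h`_(i - j)).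
    by move=> j; apply: (placeM pl).
  by split=> //; apply: eq_bigr => j _; rewrite (resM pl).
split=> [i|]; first by case: (st i).
apply/polyP => i; rewrite coef_rmap [RHS]coefM; have [_ ->] := st i.
by apply: eq_bigr => j _; rewrite !coef_rmap.
Qed.

Lemma opolyX (g : {poly L}) e : opoly O g -> opoly O (g ^+ e) /\
  map_poly res (g ^+ e) = map_poly res g ^+ e.
Proof.
move=> og; elim: e => [|e [IH1 IH2]]; last first.
  by rewrite !exprS; have [h1 ->] := opolyM og IH1; rewrite IH2.
rewrite !expr0; split=> [i|].
  by rewrite coef1; case: eqP => _; [apply: (place1 pl) | apply: place0].
by apply/polyP => i; rewrite coef_rmap !coef1; case: eqP => _; rewrite ?(res_one pl) ?res_zero.
Qed.

Lemma dominant_coef (g : {poly L}) : g != 0 ->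
  exists j, g`_j != 0 /\ forall i, O (g`_i / g`_j).
Proof.
move=> nzg.
have dom n : (forall i, (i < n)%N -> g`_i = 0) \/
    exists j, g`_j != 0 /\ forall i, (i < n)%N -> O (g`_i / g`_j).
  elim: n => [|n [IH|[j [nzj IH]]]]; first by left.
    have [gn|nzn] := eqVneq g`_n 0; [left|right; exists n; split=> //] => i;
      rewrite ltnS leq_eqVlt => /orP[/eqP ->|/IH -> //] //.
      by rewrite divff //; apply: (place1 pl).
    by rewrite mul0r; apply: place0.
  right; have [Onj|Ojn] := placeV pl (g`_n / g`_j).
    by exists j; split=> // i; rewrite ltnS leq_eqVlt => /orP[/eqP ->|/IH].
  have [gn|nzn] := eqVneq g`_n 0.
    exists j; split=> // i; rewrite ltnS leq_eqVlt => /orP[/eqP ->|/IH //].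
    by rewrite gn mul0r; apply: place0.
  exists n; split=> // i; rewrite ltnS leq_eqVlt => /orP[/eqP ->|/IH Oi].
    by rewrite divff //; apply: (place1 pl).
  have -> : g`_i / g`_n = (g`_i / g`_j) * (g`_n / g`_j)^-1 by field; rewrite nzn nzj.
  exact: (placeM pl).
have [z|[j [nzj h]]] := dom (size g).
  by case/eqP: nzg; apply/polyP => i; rewrite coef0; case: (ltnP i (size g)) => [/z //|le]; rewrite nth_default.
exists j; split=> // i; case: (ltnP i (size g)) => [/h //|le].
by rewrite nth_default // mul0r; apply: place0.
Qed.

(** Gauss's lemma: divided by a coefficient of least value, [g] has a nonzero reduction. If that
    coefficient were not in [O], the e-th power of this reduction would vanish. *)
Lemma opoly_root_power (g : {poly L}) e : (0 < e)%N -> opoly O (g ^+ e) -> opoly O g.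
Proof.
move=> e0 oge; have [-> i|nzg] := eqVneq g 0; first by rewrite coef0; apply: place0.
have [j [nzj hj]] := dominant_coef nzg; set c := g`_j in nzj hj.
have [Oc|OVc] := placeV pl c.
  by move=> i; rewrite -[g`_i](mulfVK nzj); apply: (placeM pl).
have [rc0|nrc] := eqVneq (res c^-1) 0; last first.
  have Oc : O c by rewrite -[c]invrK; apply: (resV pl).
  by move=> i; rewrite -[g`_i](mulfVK nzj); apply: (placeM pl).
pose P := c^-1 *: g; have oP : opoly O P by move=> i; rewrite coefZ mulrC.
have nzP : map_poly res P != 0.
  apply/eqP => /(congr1 (fun q : {poly kap} => q`_j)); rewrite coef_rmap coefZ coef0 mulVf //.
  by rewrite (res_one pl) => /eqP; rewrite oner_eq0.
have [oPe PeE] := opolyX e oP.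
have : map_poly res (P ^+ e) = 0.
  apply/polyP => i; rewrite coef_rmap coef0 exprZn coefZ.
  have [h1 h2] := place_exp e OVc; rewrite (resM pl) // h2 rc0.
  by rewrite expr0n eqn0Ngt e0 mul0r.
by rewrite PeE => /eqP; rewrite expf_eq0 (negbTE nzP) andbF.
Qed.

End PlaceTheory.

Lemma ex_irreducible_factor (F : fieldType) (g : {poly F}) : (1 < size g)%N ->
  exists q : {poly F}, [/\ q \is monic, irreducible_poly q & q %| g].
Proof.
move=> sg; pose P n := `[< exists q : {poly F}, [/\ (1 < size q)%N, q %| g & size q = n] >].
have exP : exists n, P n by exists (size g); apply/asboolP; exists g.
case: (ex_minnP exP) => n /asboolP[q [sq qg sqn]] minn.
have nzq : q != 0 by rewrite -size_poly_gt0 ltnW.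
have lq : lead_coef q != 0 by rewrite lead_coef_eq0.
exists ((lead_coef q)^-1 *: q); split.
- by rewrite monicE lead_coefZ mulVf.
- split; first by rewrite size_scale ?invr_eq0.
  move=> d sd dq; rewrite -(eqp_rtrans (_ : q %= _)); last by rewrite eqp_sym eqp_scale ?invr_eq0.
  have dq' : d %| q by rewrite (eqp_dvdr _ (eqp_scale q _)) ?invr_eq0 in dq.
  rewrite -(dvdp_size_eqp dq') eqn_leq (dvdp_leq nzq dq') sqn minn //.
  apply/asboolP; exists d; split=> //; last exact: dvdp_trans dq' qg.
  rewrite ltn_neqAle eq_sym sd size_poly_gt0.
  by apply: contraTneq dq' => ->; rewrite dvd0p.
by rewrite (eqp_dvdl _ (eqp_scale _ _)) ?invr_eq0.
Qed.

(** Splitting off the full power of one irreducible factor leaves a coprime cofactor, which must be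
    constant. *)
Lemma coprime_unsplit_power (F : fieldType) (g : {poly F}) : g \is monic -> (1 < size g)%N ->
    (forall a b, g = a * b -> coprimep a b -> (size a <= 1)%N \/ (size b <= 1)%N) ->
  exists (q : {poly F}) (e : nat), [/\ q \is monic, irreducible_poly q, (0 < e)%N & g = q ^+ e].
Proof.
move=> mg sg hg; have [q [mq iq qg]] := ex_irreducible_factor sg.
have nzg := monic_neq0 mg; have sq : (1 < size q)%N by case: iq.
have [e [h [hE nh]]] : exists e h, g = q ^+ e * h /\ ~~ (q %| h).
  have bnd n (f : {poly F}) : (size f <= n)%N -> f != 0 -> exists e h, f = q ^+ e * h /\ ~~ (q %| h).
    elim: n f => [|n IH] f sf nzf; first by move: sf; rewrite leqn0 size_poly_eq0 (negbTE nzf).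
    case: (boolP (q %| f)) => [/dvdpP[f' fE]|nd]; last by exists 0%N, f; rewrite expr0 mul1r.
    have nzf' : f' != 0 by apply: contraNneq nzf => f0; rewrite fE f0 mul0r.
    have sf' : (size f' <= n)%N.
      have := size_mul nzf' (monic_neq0 mq); rewrite -fE => sE; move: nzf'; rewrite -size_poly_gt0 => s0.
      have aux (x y t : nat) : (t <= n.+1 -> 1 < y -> 0 < x -> t = (x + y).-1 -> x <= n)%N by lia.
      exact: aux sf sq s0 sE.
    have [e [h [hE nh]]] := IH f' sf' nzf'.
    by exists e.+1, h; rewrite fE hE exprSr mulrAC.
  exact: bnd (leqnn _) nzg.
have e0 : (0 < e)%N by rewrite lt0n; apply: contraNneq nh => e0; rewrite hE e0 expr0 mul1r in qg.
have cop : coprimep (q ^+ e) h.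
  by apply: coprimep_expl; rewrite irreducible_poly_coprime.
have nzh : h != 0 by apply: contraNneq nzg => h0; rewrite hE h0 mulr0.
exists q, e; split=> //; have [|sh] := hg _ _ hE cop.
  move=> le; have := size_exp q e; have : (0 < (size q).-1 * e)%N by rewrite muln_gt0 e0 andbT; lia.
  by move: le; move: (size (q ^+ e)) (_ * e)%N => x y; lia.
have mh : h \is monic by rewrite -(monicMl _ (monic_exp e mq)) -hE.
rewrite hE (size1_polyC sh); have := mh; rewrite {1}(size1_polyC sh) monicE lead_coefC => /eqP ->.
by rewrite mulr1.
Qed.

Section HenselLifting.

Variable L : fieldType.

Lemma bezout_split (a b : {poly L}) : coprimep a b -> (1 < size a)%N -> b != 0 ->
  forall c : {poly L}, (size c < (size a + size b).-1)%N ->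
    exists uv : {poly L} * {poly L}, [/\ (size uv.1 < size a)%N, (size uv.2 < size b)%N
      & a * uv.2 + b * uv.1 = c].
Proof.
move=> cop sa nzb c sc; have nza : a != 0 by rewrite -size_poly_gt0 ltnW.
have [[s t] /= e] := Bezout_eq1_coprimepP a b cop.
pose u := (c * t) %% a; have su : (size u < size a)%N by rewrite ltn_modp.
have /dvdpP[v vE] : a %| c - b * u.
  have -> : c - b * u = a * (c * s + b * ((c * t) %/ a)).
    have uE : u = c * t - (c * t) %/ a * a by rewrite {1}(divp_eq (c * t) a) addrC addKr.
    have cE : c = c * (s * a + t * b) by rewrite e mulr1.
    by rewrite uE {1}cE; ring.
  exact: dvdp_mulIl.
exists (u, v); split=> //=; last by rewrite mulrC -vE subrK.
have [->|nzv] := eqVneq v 0; first by rewrite size_poly0 size_poly_gt0.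
have : (size (c - b * u)%R < (size a + size b).-1)%N.
  apply: leq_ltn_trans (size_polyD _ _) _; rewrite size_polyN gtn_max sc /=.
  apply: leq_ltn_trans (size_polyMleq _ _) _; move: su sa nzb; rewrite -size_poly_gt0.
  by move: (size a) (size b) (size u) => x y w; lia.
rewrite vE size_mul //; move: sa; move: (size a) (size b) (size v) => x y w; lia.
Qed.

(** Hensel lifting order by order: [P n] is the coefficient of t^n of a polynomial over power
    series. The terms of order n of the two factors solve a Bezout equation in [a] and [b], and the
    degree bounds keep the leading terms in order 0. *)
Lemma hensel_series (a b : {poly L}) (P : nat -> {poly L}) :
    coprimep a b -> (1 < size a)%N -> b != 0 -> P 0%N = a * b ->
    (forall n, (0 < n)%N -> (size (P n) < (size a + size b).-1)%N) ->
  exists A B : nat -> {poly L}, [/\ A 0%N = a, B 0%N = b,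
    forall n, (0 < n)%N -> (size (A n) < size a)%N,
    forall n, (0 < n)%N -> (size (B n) < size b)%N &
    forall n, \sum_(i < n.+1) A i * B (n - i)%N = P n].
Proof.
move=> cop sa nzb P0 sP; have /choice[sol hsol] (c : {poly L}) :
  exists uv : {poly L} * {poly L}, (size c < (size a + size b).-1)%N ->
    [/\ (size uv.1 < size a)%N, (size uv.2 < size b)%N & a * uv.2 + b * uv.1 = c].
  case: (ltnP (size c) (size a + size b).-1) => [lt|le].
    by have [uv h] := bezout_split cop sa nzb lt; exists uv.
  by exists (0, 0).
pose rhs n (s : seq ({poly L} * {poly L})) : {poly L} :=
  P n - \sum_(i < n.-1) (nth (0, 0) s i.+1).1 * (nth (0, 0) s (n - i.+1)).2.
have [g gE] := ex_recursive (0, 0) (fun n s => if n is 0 then (a, b) else sol (rhs n s)).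
have g0 : g 0%N = (a, b) by rewrite gE.
have small n : (0 < n)%N -> [/\ (size (g n).1 < size a)%N, (size (g n).2 < size b)%N &
    a * (g n).2 + b * (g n).1 = P n - \sum_(i < n.-1) (g i.+1).1 * (g (n - i.+1)%N).2].
  elim/ltn_ind: n => n IH n0.
  have -> : \sum_(i < n.-1) (g i.+1).1 * (g (n - i.+1)%N).2 =
      \sum_(i < n.-1) (nth (0, 0) (mkseq g n) i.+1).1 * (nth (0, 0) (mkseq g n) (n - i.+1)).2.
    by apply: eq_bigr => i _; have := ltn_ord i => lt; rewrite !nth_mkseq //; lia.
  rewrite -/(rhs n (mkseq g n)); have -> : g n = sol (rhs n (mkseq g n)).
    by rewrite gE; case: (n) n0.
  apply: hsol; rewrite /rhs; apply: leq_ltn_trans (size_polyD _ _) _; rewrite size_polyN gtn_max sP //=.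
  apply: leq_ltn_trans (size_sum _ _ _) _; rewrite -[X in (_ < X)%N]prednK; last first.
    by move: sa nzb; rewrite -size_poly_gt0; move: (size a) (size b) => x y; lia.
  rewrite ltnS; apply/bigmax_leqP => i _; have lt := ltn_ord i.
  apply: leq_trans (size_polyMleq _ _) _; rewrite !nth_mkseq; try lia.
  have [||s1 _ _] := IH i.+1; try lia; have [||_ s2 _] := IH (n - i.+1)%N; try lia.
  have aux (x y t w : nat) : (x < t -> y < w -> (x + y).-1 <= (t + w).-2)%N by lia.
  exact: aux s1 s2.
exists (fun n => (g n).1), (fun n => (g n).2); split.
- by rewrite g0.
- by rewrite g0.
- by move=> n /small[].
- by move=> n /small[].
case=> [|n]; first by rewrite big_ord_recl big_ord0 addr0 g0 P0.
have [_ _ /= e] := small n.+1 isT.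
rewrite big_ord_recl big_ord_recr /= subn0 subnn g0 /=.
rewrite [_ * b]mulrC addrCA e addrC.
by rewrite (eq_bigr (fun i : 'I_n => (g i.+1).1 * (g (n.+1 - i.+1)%N).2)) ?subrK.
Qed.

End HenselLifting.

(** * Iterated Laurent series with a twisted action *)

Section LaurentStep.

Variables (kap L : fieldType) (O : L -> Prop) (res : L -> kap).
Hypotheses (pl : place O res) (hen : henselian O res).
Variables (LL : fieldType) (emb : {rmorphism pseries L -> LL}).
Hypothesis emb_inj : injective emb.
Hypothesis emb_frac : forall z : LL, exists f g : pseries L, g != 0 /\ z = emb f / emb g.

Definition series_coef0 (z : LL) : L :=
  if pselect (exists f, z = emb f) is left h then projT1 (cid h) 0%N else 0.

Lemma series_coef0E f : series_coef0 (emb f) = f 0%N.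
Proof.
rewrite /series_coef0; case: pselect => [h|[]]; last by exists f.
by case: (cid h) => f' /= /emb_inj ->.
Qed.

(** The composite of the t-adic place, with residue field [L], and the given place of [L]; the rank
    grows by one. *)
Definition series_O (z : LL) := exists f : pseries L, z = emb f /\ O (f 0%N).
Definition series_res (z : LL) := res (series_coef0 z).

Lemma series_place : place series_O series_res.
Proof.
split.
- by exists 1; rewrite rmorph1; split=> //; apply: (place1 pl).
- by move=> _ _ [f [-> f0]] [g [-> g0]]; exists (f - g); rewrite rmorphB; split=> //; apply: (placeB pl).
- move=> _ _ [f [-> f0]] [g [-> g0]]; exists (f * g); rewrite rmorphM ps_coef0M; split=> //.
  exact: (placeM pl).
- move=> z; have [f [g [nzg ->]]] := emb_frac z.
  have [->|nzf] := eqVneq f 0.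
    by left; exists 0; rewrite rmorph0 mul0r; split=> //; apply: (place0 pl).
  have [n [f' [f0 fE]]] := ps_order nzf; have [m [g' [g0 gE]]] := ps_order nzg.
  have [fi fiE] := ps_inverse f0; have [gi giE] := ps_inverse g0.
  have emb0 h : h != 0 -> emb h != 0 by rewrite -(rmorph0 emb) (inj_eq emb_inj).
  have nzf' : f' != 0 by apply: contraNneq f0 => ->.
  have nzg' : g' != 0 by apply: contraNneq g0 => ->.
  have X0 e : emb (psX L ^+ e) != 0.
    apply: emb0; apply: contraNneq (oner_neq0 L) => h.
    have : (1 * psX L ^+ e) e = 0 by rewrite mul1r h.
    by rewrite ps_mulX ltnn subnn => h1; apply/eqP; apply: h1.
  have half (f1 g1 gi1 : pseries L) n1 m1 : g1 != 0 -> g1 * gi1 = 1 -> (m1 <= n1)%N ->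
      emb (f1 * psX L ^+ n1) / emb (g1 * psX L ^+ m1) = emb (f1 * gi1 * psX L ^+ (n1 - m1)).
    move=> nzg1 e le; apply: (mulIf (emb0 (g1 * psX L ^+ m1) _)).
      by apply: contraNneq (X0 m1) => z0; have := congr1 (fun h => gi1 * h) z0;
        rewrite mulrA [gi1 * g1]mulrC e mul1r mulr0 => ->; rewrite rmorph0.
    rewrite mulfVK; last first.
      apply: emb0; apply: contraNneq (X0 m1) => z0; have := congr1 (fun h => gi1 * h) z0.
      by rewrite mulrA [gi1 * g1]mulrC e mul1r mulr0 => ->; rewrite rmorph0.
    rewrite -rmorphM; congr (emb _); rewrite -{1}(subnK le) exprD.
    have -> : f1 * gi1 * psX L ^+ (n1 - m1) * (g1 * psX L ^+ m1) =
       (g1 * gi1) * (f1 * (psX L ^+ (n1 - m1) * psX L ^+ m1)) by ring.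
    by rewrite e mul1r.
  rewrite fE gE; case: (ltngtP m n) => [lt|lt|e].
  - left; rewrite (half _ _ gi) // ?(ltnW lt) //; exists (f' * gi * psX L ^+ (n - m)); split=> //.
    by rewrite ps_mulX subn_gt0 lt; apply: (place0 pl).
  - right; rewrite invf_div (half _ _ fi) // ?(ltnW lt) //; exists (g' * fi * psX L ^+ (m - n)); split=> //.
    by rewrite ps_mulX subn_gt0 lt; apply: (place0 pl).
  have hi h1 : (h1 * psX L ^+ (n - n)) = h1 by rewrite subnn expr0 mulr1.
  have e0 (a b c : pseries L) : b * c = 1 -> (a * c) 0%N = a 0%N / b 0%N.
    move=> bc; rewrite ps_coef0M; congr (_ * _).
    have bc0 : b 0%N * c 0%N = 1 by rewrite -ps_coef0M bc.
    have b0 : b 0%N != 0.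
      by apply/eqP => b0; move/eqP: bc0; rewrite b0 mul0r eq_sym oner_eq0.
    by apply: (mulfI b0); rewrite bc0 mulfV.
  case: (placeV pl (f' 0%N / g' 0%N)) => Oq; [left|right].
    by rewrite e (half _ _ gi) // hi; exists (f' * gi); rewrite (e0 _ _ _ giE).
  by rewrite e invf_div (half _ _ fi) // hi; exists (g' * fi); rewrite (e0 _ _ _ fiE) -invf_div.
- by rewrite /series_res -[1](rmorph1 emb) series_coef0E (res_one pl).
- move=> _ _ [f [-> f0]] [g [-> g0]]; rewrite /series_res -rmorphB !series_coef0E.
  exact: (resB pl).
- move=> _ _ [f [-> f0]] [g [-> g0]]; rewrite /series_res -rmorphM !series_coef0E ps_coef0M.
  exact: (resM pl).
move=> _ [f [-> f0]]; rewrite /series_res series_coef0E => nz.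
have nzf : f 0%N != 0 by apply: contraNneq nz => ->; rewrite (res_zero pl).
have [g fg] := ps_inverse nzf; exists g; split.
  have ef0 : emb f != 0.
    by apply: contraNneq nzf; rewrite -(rmorph0 emb) => /emb_inj ->.
  by apply: (mulfI ef0); rewrite mulfV // -rmorphM fg rmorph1.
have := congr1 (fun h : pseries L => h 0%N) fg; rewrite ps_coef0M => e.
suff -> : g 0%N = (f 0%N)^-1 by apply: (resV pl).
by apply: (mulfI nzf); rewrite e mulfV.
Qed.

(** By Hensel lifting the reduction of [g] modulo t has no coprime splitting, so it is a power of an
    irreducible polynomial [Q] over [L]. Gauss's lemma makes [Q] integral for the place of [L],
    whose own henselian property finishes. *)
Lemma series_henselian : henselian series_O series_res.
Proof.
move=> g mg ig og; have sg : (1 < size g)%N by case: ig.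
have /choice[G GE] i : exists f : pseries L, g`_i = emb f /\ O (f 0%N) by apply: og.
have GL : G (size g).-1 = 1.
  by apply: emb_inj; have [<- _] := GE (size g).-1; rewrite rmorph1; apply/eqP; rewrite -monicE.
pose P n : {poly L} := \poly_(i < size g) G i n.
have sP0 : size (P 0%N) = size g.
  by rewrite /P; case: (size g) sg GL => // m _ /= Gm; rewrite size_poly_eq //= Gm oner_neq0.
have mP0 : P 0%N \is monic.
  by rewrite monicE lead_coefE sP0 coef_poly prednK ?(ltnW sg) // leqnn GL.
have sP n : (0 < n)%N -> (size (P n) < size g)%N.
  move=> n0; rewrite -[X in (_ < X)%N]prednK ?(ltnW sg) // ltnS; apply/leq_sizeP => j le.
  rewrite coef_poly; case: ltnP => // lt; have -> : j = (size g).-1 by lia.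
  by rewrite GL; case: (n) n0.
have unsplit a b : P 0%N = a * b -> coprimep a b -> (size a <= 1)%N \/ (size b <= 1)%N.
  move=> P0 cop; case: (leqP (size a) 1) => [|sa]; [by left | right].
  rewrite leqNgt; apply/negP => sb.
  have nza : a != 0 by rewrite -size_poly_gt0 ltnW.
  have nzb : b != 0 by rewrite -size_poly_gt0 ltnW.
  have sab : ((size a + size b).-1 = size g)%N by rewrite -sP0 P0 size_mul.
  have [|A [B [A0 B0 sA sB AB]]] := @hensel_series L a b P cop sa nzb P0.
    by move=> n n0; rewrite sab sP.
  pose ps (C : nat -> {poly L}) i : pseries L := fun n => (C n)`_i.
  pose pol s C : {poly LL} := \poly_(i < s) emb (ps C i).
  have coefpol s (C : nat -> {poly L}) i : (forall n, (size (C n) <= s)%N) -> (pol s C)`_i = emb (ps C i).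
    move=> hs; rewrite coef_poly; case: ltnP => // le.
    have -> : ps C i = 0 by apply/funext => n; rewrite /ps nth_default // (leq_trans (hs n)).
    by rewrite rmorph0.
  have hA n : (size (A n) <= size a)%N by case: (posnP n) => [->|/sA/ltnW]; rewrite ?A0.
  have hB n : (size (B n) <= size b)%N by case: (posnP n) => [->|/sB/ltnW]; rewrite ?B0.
  have gE : g = pol (size a) A * pol (size b) B.
    apply/polyP => i; rewrite coefM (eq_bigr (fun j : 'I_i.+1 => emb (ps A j * ps B (i - j)%N))).
      rewrite -rmorph_sum; have [-> _] := GE i; congr (emb _); apply/funext => n.
      have -> : (\sum_(j < i.+1) ps A j * ps B (i - j)%N) n = \sum_(j < i.+1) (ps A j * ps B (i - j)%N) n.
        by elim/big_rec2: _ => //= j x y _ <-.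
      transitivity ((P n)`_i).
        rewrite coef_poly; case: ltnP => // le; have := GE i; rewrite nth_default // => -[e _].
        suff -> : G i = 0 by [].
        by apply: emb_inj; rewrite rmorph0.
      rewrite -AB coef_sum (eq_bigr (fun m : 'I_n.+1 => \sum_(j < i.+1) (A m)`_j * (B (n - m)%N)`_(i - j))).
        by rewrite exchange_big.
      by move=> m _; rewrite coefM.
    by move=> j _; rewrite !coefpol // rmorphM.
  have szpol (C : nat -> {poly L}) c : C 0%N = c -> (1 < size c)%N -> size (pol (size c) C) = size c.
    move=> C0 sc; rewrite size_poly_eq //; apply: contraTneq sc.
    rewrite -(rmorph0 emb) => /emb_inj/(congr1 (fun h : pseries L => h 0%N)).
    rewrite /ps C0 => /eqP; rewrite -lead_coefE lead_coef_eq0 => /eqP ->.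
    by rewrite size_poly0.
  have [_ /(_ (pol (size a) A))] := ig; rewrite szpol // neq_ltn sa orbT => /(_ isT).
  rewrite {1}gE dvdp_mulIl => /(_ isT) /eqp_size; rewrite szpol // => e.
  by move: sab; rewrite -e; lia.
have [|Q [e [mQ iQ e0 PQ]]] := coprime_unsplit_power mP0 _ unsplit; first by rewrite sP0.
have oP : opoly O (P 0%N).
  by move=> i; rewrite coef_poly; case: ifP => _; [case: (GE i) | apply: (place0 pl)].
have oQ : opoly O Q by apply: (opoly_root_power pl e0); rewrite -PQ.
have [q [e' [iq qE]]] := hen mQ iQ oQ.
exists q, (e' * e)%N; split=> //; rewrite exprM -qE; have [_ <-] := opolyX pl e oQ.
rewrite -PQ; apply/polyP => i; rewrite (coef_rmap series_place) (coef_rmap pl) coef_poly.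
have [-> _] := GE i; rewrite /series_res series_coef0E; case: ltnP => // le.
by have := GE i; rewrite nth_default // -(rmorph0 emb) => -[/emb_inj <- _].
Qed.

End LaurentStep.

(** All that is kept of the iterated Laurent series field: a henselian place with residue field
    [kap], an action compatible with it, and one element of [ts] for each cocycle of [us], scaled by
    that cocycle. *)
Record tower (kap : fieldType) (G : finGroupType) (sg : G -> kap -> kap) (us : seq (G -> kap))
    (L : fieldType) (io : {rmorphism kap -> L}) (ta : G -> L -> L) (O : L -> Prop)
    (res : L -> kap) (ts : seq L) : Prop := Tower {
  tower_act : ring_action ta;
  tower_io : forall g a, ta g (io a) = io (sg g a);
  tower_place : place O res;
  tower_hen : henselian O res;
  tower_res : forall a, O (io a) /\ res (io a) = a;
  tower_equiv : forall g z, O z -> O (ta g z) /\ res (ta g z) = sg g (res z);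
  tower_size : size ts = size us;
  tower_t : forall i, (i < size us)%N -> ts`_i != 0 /\
    forall g, ta g ts`_i = io (nth (fun=> 0) us i g) * ts`_i
}.

Section TwistedAction.

Variables (L : fieldType) (G : finGroupType) (ta : G -> L -> L) (u : G -> L).
Hypotheses (hta : ring_action ta) (u0 : forall g, u g != 0).
Hypothesis uM : forall g h, u (g * h)%g = ta h (u g) * u h.

(** Extends the action from [L] to power series in t by sending t to [u g] times t. *)
Definition ps_twist g (f : pseries L) : pseries L := fun n => ta g (f n) * u g ^+ n.

Lemma ps_twist_action : ring_action ps_twist.
Proof.
have taX g x n : ta g (x ^+ n) = ta g x ^+ n.
  elim: n => [|n IH]; first by rewrite !expr0 (ract_one hta).
  by rewrite !exprS (ractMl hta) IH.
have u1 : u 1%g = 1.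
  apply: (mulfI (u0 1%g)); rewrite mulr1.
  by rewrite -{3}[1%g]mulg1 uM (ract1 hta).
split.
- by move=> f; apply/funext => n; rewrite /ps_twist u1 expr1n mulr1 (ract1 hta).
- move=> g h f; apply/funext => n; rewrite /ps_twist (ractM hta) (ractMl hta) uM exprMn taX.
  by rewrite mulrA.
- move=> g f f'; apply/funext => n; rewrite /ps_twist.
  by rewrite -[(f - f') n]/(f n - f' n) (ractB hta) mulrBl.
move=> g; split.
  apply/funext => n; rewrite /ps_twist -[(1 : pseries L) n]/((n == 0%N)%:R).
  by case: n => [|n] /=; rewrite ?(ract_one hta) ?(ract_zero hta) ?mul0r ?expr0 ?mulr1.
move=> f f'; apply/funext => n.
rewrite -[RHS]/(\sum_(i < n.+1) (ta g (f i) * u g ^+ i) * (ta g (f' (n - i)%N) * u g ^+ (n - i))).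
rewrite /ps_twist -[(f * f') n]/(\sum_(i < n.+1) f i * f' (n - i)%N) (ract_sum hta) mulr_suml.
apply: eq_bigr => i _; rewrite (ractMl hta) mulrACA -exprD subnKC //.
by rewrite -ltnS.
Qed.

End TwistedAction.

Theorem ex_tower (kap : fieldType) (G : finGroupType) (sg : G -> kap -> kap) (us : seq (G -> kap)) :
  ring_action sg ->
  (forall i, (i < size us)%N -> let u := nth (fun=> 0) us i in
     (forall g, u g != 0) /\ forall g h, u (g * h)%g = sg h (u g) * u h) ->
  exists (L : fieldType) (io : {rmorphism kap -> L}) (ta : G -> L -> L) (O : L -> Prop)
    (res : L -> kap) (ts : seq L), tower sg us io ta O res ts.
Proof.
move=> hsg; elim: us => [|u us IH] hus.
  exists kap, (idfun : {rmorphism kap -> kap}), sg, (fun=> True), id, [::]; split=> //.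
  - by split=> // x; left.
  - by move=> g mg ig _; exists g, 1%N; rewrite expr1 map_poly_id.
have [|L [io [ta [O [res [ts tw]]]]]] := IH; first by move=> i lt; apply: (hus i.+1).
have [u0 uM] := hus 0%N isT; rewrite /= in u0 uM.
have hta := tower_act tw; have pl := tower_place tw.
pose v g := io (u g).
have v0 g : v g != 0 by rewrite fmorph_eq0.
have vM g h : v (g * h)%g = ta h (v g) * v h by rewrite /v (tower_io tw) -rmorphM uM.
have htw := ps_twist_action hta v0 vM.
have [D [f [f' fK f'K]]] := nzring_idomain (@ps_domain L).
have /= [fr frE] : exists fr : {rmorphism D -> pseries L}, forall x, fr x = f' x.
  have f'B : zmod_morphism f'.
    by move=> x y; apply: (can_inj fK); rewrite rmorphB !f'K.
  have f'M : monoid_morphism f'.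
    by split=> [|x y]; apply: (can_inj fK); rewrite ?rmorph1 ?rmorphM ?f'K.
  pose fr : {rmorphism D -> pseries L} := HB.pack f'
    (GRing.isZmodMorphism.Build _ _ f' f'B) (GRing.isMonoidMorphism.Build _ _ f' f'M).
  by exists fr.
pose actD g (x : D) := f (ps_twist ta v g (fr x)).
have hD : ring_action actD.
  have frK x : fr (f x) = x by rewrite frE fK.
  have Kfr x : f (fr x) = x by rewrite frE f'K.
  split.
  - by move=> x; rewrite /actD (ract1 htw) Kfr.
  - by move=> g h x; rewrite /actD (ractM htw) frK.
  - by move=> g x y; rewrite /actD !rmorphB (ractB htw) rmorphB.
  - by move=> g; split=> [|x y]; rewrite /actD ?rmorph1 ?rmorphM ?(ract_one htw) ?(ractMl htw) ?rmorph1 ?rmorphM.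
have [actF [hF actFE]] := ex_frac_action hD.
pose emb : {rmorphism pseries L -> {fraction D}} := @FracField.tofrac D \o f.
have emb_inj : injective emb.
  by move=> x y /eqP; rewrite /= tofrac_eq => /eqP/(can_inj fK).
have emb_frac z : exists x y : pseries L, y != 0 /\ z = emb x / emb y.
  have [a [b [nzb ->]]] := fracE z; exists (f' a), (f' b); rewrite /= !f'K; split=> //.
  by apply: contraNneq nzb => e; rewrite -[b]f'K e rmorph0.
have act_emb g x : actF g (emb x) = emb (ps_twist ta v g x).
  by rewrite /= actFE /actD frE fK.
pose cst (a : L) : pseries L := fun n => if n is 0 then a else 0.
have cstB : zmod_morphism cst.
  by move=> a b; apply/funext => -[|n] //=; rewrite -[RHS]/(0 - 0) subr0.
have cstM : monoid_morphism cst.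
  split=> [|a b]; apply/funext => n; first by case: n.
  rewrite -[RHS]/(\sum_(i < n.+1) cst a i * cst b (n - i)%N) big_ord_recl subn0 big1 ?addr0.
    by case: n => //= n; rewrite mulr0.
  by move=> i _; rewrite mul0r.
pose cs : {rmorphism L -> pseries L} := HB.pack cst
    (GRing.isZmodMorphism.Build _ _ cst cstB) (GRing.isMonoidMorphism.Build _ _ cst cstM).
pose io' : {rmorphism kap -> {fraction D}} := emb \o (cs \o io).
have twist_cst g a : ps_twist ta v g (cst a) = cst (ta g a).
  by apply/funext => -[|n]; rewrite /ps_twist /= ?expr0 ?mulr1 // (ract_zero hta) mul0r.
exists {fraction D}, io', actF, (series_O O emb), (series_res res emb),
  (emb (psX L) :: [seq emb (cst t) | t <- ts]).
have SO x : O (x 0%N) -> series_O O emb (emb x) by move=> Ox; exists x.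
split=> //.
- by move=> g a; rewrite act_emb twist_cst (tower_io tw).
- exact: series_place.
- exact: (series_henselian pl (tower_hen tw) emb_inj emb_frac).
- by move=> a; have [h1 h2] := tower_res tw a; split; [apply: SO | rewrite /series_res series_coef0E].
- move=> g _ [x [-> Ox]]; rewrite act_emb; have [h1 h2] := tower_equiv tw g Ox.
  split; first by apply: SO; rewrite /ps_twist expr0 mulr1.
  by rewrite /series_res !series_coef0E // /ps_twist expr0 mulr1.
- by rewrite /= size_map (tower_size tw).
case=> [_|i lt] /=.
  split=> [|g].
    apply: contraNneq (oner_neq0 L); rewrite -(rmorph0 emb) => /emb_inj/(congr1 (fun h : pseries L => h 1%N)).
    by move=> e; apply/eqP; apply: e.
  rewrite act_emb; transitivity (emb (cst (v g) * psX L)); last exact: rmorphM.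
  apply: (congr1 emb); apply/funext => n.
  rewrite -[RHS]/(\sum_(i < n.+1) cst (v g) i * psX L (n - i)%N) big_ord_recl subn0 big1 ?addr0.
    rewrite /ps_twist /psX; case: eqP => [->|_]; rewrite ?(ract_one hta) ?(ract_zero hta).
      by rewrite expr1 mul1r mulr1.
    by rewrite mul0r mulr0.
  by move=> i _; rewrite mul0r.
have [h1 h2] := tower_t tw lt; have lts : (i < size ts)%N by rewrite (tower_size tw).
rewrite (nth_map 0) //; split=> [|g].
  apply: contraNneq h1; rewrite -(rmorph0 emb) => /emb_inj/(congr1 (fun h : pseries L => h 0%N)).
  by move=> e; apply/eqP; apply: e.
rewrite act_emb twist_cst h2; 
transitivity (emb (cst (io (nth (fun=> 0) us i g)) * cst ts`_i)); last exact: rmorphM.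
by apply: (congr1 emb); apply: (rmorphM cs).
Qed.

(** * Extending a henselian place to a finite extension *)

Lemma ex_minpoly (F : fieldType) (Q : fieldExtType F) (z : Q) :
  exists g : {poly F}, [/\ g \is monic, irreducible_poly g,
    root (map_poly (GRing.in_alg Q) g) z & ((size g).-1 %| \dim {:Q})%N].
Proof.
have /polyOver1P[g gE] := minPolyOver 1%AS z.
have sE : (size g).-1 = adjoin_degree 1%AS z.
  by rewrite -(size_map_poly (GRing.in_alg Q)) -gE size_minPoly.
exists g; split.
- by rewrite -(map_monic (GRing.in_alg Q)) -gE monic_minPoly.
- split=> [|d sd dg].
    by rewrite -(size_map_poly (GRing.in_alg Q)) -gE size_minPoly.
  have dO : map_poly (GRing.in_alg Q) d \is a polyOver 1%AS by apply/polyOver1P; exists d.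
  have : map_poly (GRing.in_alg Q) d %| minPoly 1%AS z by rewrite gE dvdp_map.
  move=> /(minPoly_irr dO)/orP[|]; first by rewrite gE eqp_map.
  by rewrite -size_poly_eq1 size_map_poly (negbTE sd).
- by rewrite -gE root_minPoly.
rewrite sE; have := field_dimS (subvf <<1; z>>%AS); rewrite dim_Fadjoin dimv1 muln1.
by [].
Qed.

Lemma place_horner (kap L : fieldType) (O : L -> Prop) (res : L -> kap) (g : {poly L}) a :
  place O res -> opoly O g -> O a ->
  O g.[a] /\ res g.[a] = \sum_(i < size g) res g`_i * res a ^+ i.
Proof.
move=> pl og Oa; rewrite horner_coef.
have h i : O (a ^+ i) /\ res (a ^+ i) = res a ^+ i by apply: (place_exp pl).
have [|h1 ->] := @place_sum _ _ _ _ pl _ (index_enum 'I_(size g)) (fun i => g`_i * a ^+ i).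
  by move=> i; apply: (placeM pl) => //; have [] := h i.
by split=> //; apply: eq_bigr => i _; have [h2 h3] := h i; rewrite (resM pl) // h3.
Qed.

Section ResidueExtension.

Variables (kap L : fieldType) (O : L -> Prop) (res : L -> kap).
Hypotheses (pl : place O res) (hen : henselian O res).
Variable Om : fieldExtType L.
Notation j := (GRing.in_alg Om).

(** Gauss's lemma for two factors: both are normalized by their dominant coefficients, whose
    inverses lie in [O] because the factors are monic. If one of these inverses has residue 0, the
    product of the two nonzero reductions vanishes. *)
Lemma opoly_monic_factor (g g' : {poly L}) : g \is monic -> g' \is monic ->
  opoly O (g * g') -> opoly O g.
Proof.
move=> mg mg' oh.
have [i [nzc hc]] := dominant_coef pl (monic_neq0 mg); set c := g`_i in nzc hc.
have [i' [nzc' hc']] := dominant_coef pl (monic_neq0 mg'); set c' := g'`_i' in nzc' hc'.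
have OV (h : {poly L}) (x : L) : h \is monic -> (forall i, O (h`_i / x)) -> O x^-1.
  by move=> mh /(_ (size h).-1); rewrite -lead_coefE (monicP mh) mul1r.
have [oV oV'] := (OV g c mg hc, OV g' c' mg' hc').
have gE : forall k, g`_k = g`_k / c * c by move=> k; rewrite mulfVK.
have [rc0|nrc] := eqVneq (res c^-1) 0; last first.
  have Oc : O c by rewrite -[c]invrK; apply: (resV pl).
  by move=> k; rewrite gE; apply: (placeM pl).
have nz (h : {poly L}) (l : nat) (x : L) : x = h`_l -> x != 0 -> map_poly res (x^-1 *: h) != 0.
  move=> xE x0; apply/eqP => /(congr1 (fun q : {poly kap} => q`_l)).
  by rewrite (coef_rmap pl) coefZ coef0 -xE mulVf // (res_one pl) => /eqP; rewrite oner_eq0.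
have oP : opoly O (c^-1 *: g) by move=> k; rewrite coefZ mulrC.
have oP' : opoly O (c'^-1 *: g') by move=> k; rewrite coefZ mulrC.
have [_ e] := opolyM pl oP oP'; have : map_poly res (c^-1 *: g * (c'^-1 *: g')) = 0.
  apply/polyP => k; rewrite (coef_rmap pl) coef0 -scalerAl -scalerAr !coefZ.
  rewrite (resM pl) ?rc0 ?mul0r //; apply: (placeM pl) => //.
by move/eqP; rewrite e mulf_eq0 (negbTE (nz g i c _ _)) // (negbTE (nz g' i' c' _ _)).
Qed.

Definition ival (z : Om) := exists g : {poly L},
  [/\ g \is monic, opoly O g & root (map_poly j g) z].

Lemma ival_ring : exists (B : comNzRingType) (f : {rmorphism B -> L}), injective f /\
  (forall x, O x <-> exists y, x = f y) /\
  forall z, ival z <-> integralOver (j \o f) z.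
Proof.
have hO : subring_prop O by split; [apply: (place1 pl)|apply: (placeB pl)|apply: (placeM pl)].
have [B [f [injf fE]]] := ex_subring_com hO; exists B, f; split=> //; split=> // z; split.
  case=> g [mg og rg]; have [q qE] : exists q : {poly B}, g = map_poly f q.
    have /choice[c hc] i : exists y, g`_i = f y by apply/fE/og.
    exists (\poly_(i < size g) c i); apply/polyP => i; rewrite coef_map coef_poly /=.
    by case: ltnP => [_|le]; [apply: hc | rewrite rmorph0 nth_default].
  exists q; last by rewrite map_poly_comp -qE.
  have sq : size q = size g by rewrite qE size_map_inj_poly ?rmorph0.
  apply/eqP/injf; rewrite rmorph1 lead_coefE sq -(monicP mg) lead_coefE [in RHS]qE coef_map.
  by rewrite -qE.
case=> q mq rq; exists (map_poly f q); rewrite -map_poly_comp; split=> //.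
  exact: monic_map mq.
by move=> i; rewrite coef_map; apply/fE; exists q`_i.
Qed.

Lemma ival_sub x y : ival x -> ival y -> ival (x - y).
Proof.
by have [B [f [_ [_ fE]]]] := ival_ring; move=> /fE ix /fE iy; apply/fE/integral_sub.
Qed.

Lemma ival_mul x y : ival x -> ival y -> ival (x * y).
Proof.
by have [B [f [_ [_ fE]]]] := ival_ring; move=> /fE ix /fE iy; apply/fE/integral_mul.
Qed.

Lemma ival_base a : O a -> ival (j a).
Proof.
by have [B [f [_ [OE fE]]]] := ival_ring; move=> /OE[b ->]; apply/fE/(integral_id (j \o f)).
Qed.

Lemma ival1 : ival 1.
Proof. by rewrite -(rmorph1 j); apply/ival_base/(place1 pl). Qed.

Lemma ival0 : ival 0.
Proof. by rewrite -(subrr 1); apply: ival_sub; apply: ival1. Qed.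

Lemma ival_opp x : ival x -> ival (- x).
Proof. by move=> ix; rewrite -sub0r; apply: ival_sub ix; apply: ival0. Qed.

Lemma ival_add x y : ival x -> ival y -> ival (x + y).
Proof. by move=> ix iy; rewrite -[y]opprK; apply: ival_sub ix _; apply: ival_opp. Qed.

Lemma ival_exp x e : ival x -> ival (x ^+ e).
Proof.
move=> ix; elim: e => [|e IH]; first by rewrite expr0; apply: ival1.
by rewrite exprS; apply: ival_mul.
Qed.

Lemma ival_sum (I : Type) (r : seq I) (F : I -> Om) : (forall i, ival (F i)) ->
  ival (\sum_(i <- r) F i).
Proof.
move=> hF; elim: r => [|i r IH]; first by rewrite big_nil; apply: ival0.
by rewrite big_cons; apply: ival_add.
Qed.

Lemma ival_root (h : {poly Om}) z : h \is monic -> root h z -> (forall i, ival h`_i) -> ival z.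
Proof.
have [B [f [_ [_ fE]]]] := ival_ring; move=> mh rz ih; apply/fE.
apply: (integral_root_monic mh rz) => _ /(nthP 0)[i _ <-]; exact/fE.
Qed.

Lemma ival_minpoly z : ival z -> exists g : {poly L}, [/\ g \is monic, irreducible_poly g,
  opoly O g, root (map_poly j g) z & ((size g).-1 %| \dim {:Om})%N].
Proof.
case=> h [mh oh rh]; have [g [mg ig rg dg]] := ex_minpoly z; exists g; split=> //.
have /dvdpP[g' gE] : g %| h.
  rewrite -[_ %| _]negbK -(irreducible_poly_coprime h ig); apply/negP.
  rewrite -(coprimep_map j) => /coprimep_root/(_ rg).
  by rewrite (rootP rh) eqxx.
have mg' : g' \is monic by rewrite -(monicMr _ mg) -gE.
by apply: (opoly_monic_factor mg mg'); rewrite mulrC -gE.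
Qed.

Lemma ival_baseE a : ival (j a) -> O a.
Proof.
move=> /ival_minpoly[g [mg ig og rg _]]; have ra : root g a.
  by move: rg; rewrite /root horner_map fmorph_eq0.
have : ('X - a%:P) %= g by case: ig => _; apply; rewrite ?size_XsubC // dvdp_XsubCl.
rewrite eqp_monic ?monicXsubC // => /eqP gE.
by have := og 0%N; rewrite -gE coefB coefX coefC sub0r => /(placeN pl); rewrite opprK.
Qed.

(* [g a = (a - z) h z] with [h] over [O]. *)
Lemma ival_unit_at (g : {poly L}) z a : g \is monic -> opoly O g -> root (map_poly j g) z -> ival z ->
  O a -> res g.[a] != 0 -> j a - z != 0 /\ ival (j a - z)^-1.
Proof.
move=> mg og rz iz Oa nz.
have sg : (1 < size g)%N.
  rewrite ltnNge; apply/negP => le; have gc := size1_polyC le.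
  have c1 : g`_0 = 1 by have := monicP mg; rewrite {1}gc lead_coefC.
  by move: rz; rewrite gc c1 polyC1 rmorph1 /root -polyC1 hornerC oner_eq0.
have [Oga _] := place_horner pl og Oa.
have /factor_theorem[h hE] : root (g - g.[a]%:P) a by rewrite /root !hornerE subrr.
have mga : g - g.[a]%:P \is monic.
  rewrite monicE lead_coefDl ?(monicP mg) // size_polyN.
  by apply: leq_ltn_trans sg; apply: size_polyC_leq1.
have mh : h \is monic by rewrite -(monicMr _ (monicXsubC a)) -hE.
have oh : opoly O h.
  apply: (opoly_monic_factor mh (monicXsubC a)); rewrite -hE => i.
  by rewrite coefB coefC; apply: (placeB pl) => //; case: (i == 0%N); [exact: Oga | exact: (place0 pl)].
have ih : ival (map_poly j h).[z].
  rewrite horner_coef; apply: ival_sum => i; rewrite coef_map; apply: ival_mul (ival_exp _ iz).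
  exact: ival_base.
have e : (j a - z) * (map_poly j h).[z] = j g.[a].
  have := congr1 (fun q => (map_poly j q).[z]) hE.
  rewrite rmorphB rmorphM /= map_polyC map_polyXsubC hornerD hornerN hornerC hornerM hornerXsubC.
  by rewrite (rootP rz) sub0r => e1; rewrite -[RHS]opprK e1 -mulrN opprB mulrC.
have ga0 : g.[a] != 0 by apply: contraNneq nz => ->; rewrite (res_zero pl).
have nzj : j g.[a] != 0 by rewrite fmorph_eq0.
have nza : j a - z != 0 by apply: contraNneq nzj => z0; rewrite -e z0 mul0r.
split=> //; have -> : (j a - z)^-1 = (map_poly j h).[z] * j g.[a]^-1.
  by rewrite fmorphV; apply: (mulfI nza); rewrite mulfV // mulrA e mulfV.
by apply: ival_mul ih _; apply/ival_base/(resV pl).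
Qed.

Definition iunit z := [/\ z != 0, ival z & ival z^-1].

(** The minimal polynomial of [z] reduces to a power of one irreducible polynomial, which cannot
    have both 0 and 1 as roots. Where it does not vanish, the value there is a unit divisible by [z]
    or by [1 - z]. *)
Lemma ival_local z : ival z -> iunit z \/ iunit (1 - z).
Proof.
move=> iz; have [g [mg ig og rg _]] := ival_minpoly iz.
have [q [e [iq qE]]] := hen mg ig og.
have hor a : O a -> (map_poly res g).[res a] = res g.[a].
  move=> Oa; have [_ ->] := place_horner pl og Oa.
  rewrite horner_coef size_map_poly_id0; last by rewrite (monicP mg) (res_one pl) oner_eq0.
  by apply: eq_bigr => i _; rewrite (coef_rmap pl).
have [O0 O1] : O 0 /\ O 1 by split; [apply: (place0 pl) | apply: (place1 pl)].
have [r0|n0] := eqVneq (res g.[0]) 0; last first.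
  have [nz iV] := ival_unit_at mg og rg iz O0 n0; rewrite rmorph0 sub0r in nz iV.
  left; split=> //; first by rewrite -oppr_eq0.
  by rewrite -[z]opprK invrN; apply: ival_opp.
have [r1|n1] := eqVneq (res g.[1]) 0; last first.
  have [nz iV] := ival_unit_at mg og rg iz O1 n1; rewrite rmorph1 in nz iV.
  by right; split=> //; apply: ival_sub iz; apply: ival1.
have rt a : O a -> res g.[a] = 0 -> 'X - (res a)%:P %= q.
  move=> Oa ga; case: iq => _; apply; rewrite ?size_XsubC // dvdp_XsubCl.
  have : (q ^+ e).[res a] == 0 by rewrite -qE hor // ga.
  by rewrite horner_exp expf_eq0 => /andP[].
have : 'X - (res 0)%:P %= 'X - (res 1)%:P.
  by apply: eqp_trans (rt 0 O0 r0) _; rewrite eqp_sym; apply: rt.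
rewrite eqp_monic ?monicXsubC // => /eqP/(congr1 (fun q => q.[0])).
rewrite !hornerXsubC (res_zero pl) (res_one pl) subr0 sub0r => /esym/eqP.
by rewrite oppr_eq0 oner_eq0.
Qed.

Lemma iunit1 : iunit 1.
Proof. by split; rewrite ?oner_neq0 ?invr1 //; apply: ival1. Qed.

Lemma iunitM x y : iunit x -> iunit y -> iunit (x * y).
Proof.
by case=> x0 ix ixV [y0 iy iyV]; split; rewrite ?mulf_neq0 ?invfM //; apply: ival_mul.
Qed.

Lemma iunit_addr x y : iunit (x + y) -> ival x -> ival y -> iunit x \/ iunit y.
Proof.
case=> s0 is_ isV ix iy; set s := x + y in s0 is_ isV.
have us : iunit s by [].
have back w : iunit (w / s) -> iunit w.
  by move=> /(iunitM us); rewrite mulrC mulfVK.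
have [|h] := ival_local (ival_mul ix isV); [by left; apply: back | right; apply: back].
by have <- : 1 - x / s = y / s by rewrite -(divff s0) -mulrBl /s addrC addKr.
Qed.

(** An integrally closed local ring is a valuation ring as soon as every [z] satisfies an equation
    with integral coefficients one of which is a unit. The degree drops because, with leading
    coefficient c, the product c z is integral and can be absorbed in the next coefficient; locality
    decides whether a unit survives or z^-1 is integral. *)
Lemma ival_valuation z : ival z \/ ival z^-1.
Proof.
have key n (h : nat -> Om) : (forall i, ival (h i)) -> \sum_(i < n.+1) h i * z ^+ i = 0 ->
    (exists2 i, (i <= n)%N & iunit (h i)) -> ival z \/ ival z^-1.
  elim: n h => [|n IH] h ih h0 [i le ui].
    move: le ui h0; rewrite leqn0 => /eqP -> [n0 _ _].
    by rewrite big_ord_recl big_ord0 addr0 mulr1 => /eqP; rewrite (negbTE n0).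
  pose c := h n.+1; have icz : ival (c * z).
    pose P : {poly Om} := 'X^(n.+1) + \poly_(i < n.+1) (h i * c ^+ (n - i)).
    have sP : (size (\poly_(l < n.+1) (h l * c ^+ (n - l)))%R < size ('X^(n.+1) : {poly Om})%R)%N.
      by rewrite size_polyXn ltnS size_poly.
    apply: (@ival_root P).
    - by rewrite monicE lead_coefDl // lead_coefXn.
    - rewrite /root hornerD hornerXn horner_poly exprMn.
      have := congr1 (fun w => c ^+ n * w) h0; rewrite mulr0 big_ord_recr /= mulrDr addrC => e.
      apply/eqP; rewrite -[RHS]e; congr (_ + _); first by rewrite -/c mulrA -exprSr.
      rewrite mulr_sumr; apply: eq_bigr => l _.
      have ln : (l <= n)%N by rewrite -ltnS.
      have -> : c ^+ n = c ^+ (n - l) * c ^+ l by rewrite -exprD subnK.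
      by rewrite exprMn; ring.
    move=> l; rewrite coefD coefXn coef_poly; apply: ival_add.
      by case: eqP => _; [apply: ival1 | apply: ival0].
    by case: ifP => _; [apply: ival_mul => //; apply: ival_exp; apply: ih | apply: ival0].
  pose h' i := if i == n then c * z + h n else h i.
  have ih' l : ival (h' l) by rewrite /h'; case: eqP => // _; apply: ival_add.
  have h'0 : \sum_(l < n.+1) h' l * z ^+ l = 0.
    rewrite -[RHS]h0 big_ord_recr [in RHS]big_ord_recr [in RHS]big_ord_recr /= /h' eqxx.
    rewrite -addrA; congr (_ + _); last by rewrite exprS /c; ring.
    by apply: eq_bigr => l _; rewrite ltn_eqF.
  case: (ltngtP i n) => [lt|gt|e].
  - by apply: (IH h' ih' h'0); exists i; [apply: ltnW | rewrite /h' (ltn_eqF lt)].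
  - have e : i = n.+1 by lia.
    move: ui; rewrite e -/c => -[c0 _ icV]; left.
    by rewrite -[z](mulKf c0) mulrC; apply: ival_mul.
  have hiV' : ival (h i)^-1 by case: ui.
  have [u|u] := ival_local (ival_opp (ival_mul icz hiV')).
    right; case: u => n0 _; rewrite invrN => /ival_opp; rewrite opprK invfM invrK => iu.
    have cz0 : c * z != 0 by apply: contraNneq n0 => ->; rewrite mul0r oppr0.
    have [c0 z0] : c != 0 /\ z != 0 by move: cz0; rewrite mulf_eq0 negb_or => /andP.
    have [hi0 _ hiV] := ui.
    have -> : z^-1 = c * ((c * z)^-1 * h i) * (h i)^-1 by field; rewrite c0 z0 hi0.
    by apply: ival_mul hiV; apply: ival_mul => //; apply: ih.
  apply: (IH h' ih' h'0); exists n => //; rewrite /h' eqxx -e.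
  have [hi0 _ _] := ui; have -> : c * z + h i = h i * (1 - - (c * z / h i)) by field.
  exact: iunitM.
have [g [mg _ rg _]] := ex_minpoly z.
have [i [nzi hi]] := dominant_coef pl (monic_neq0 mg).
have lt : (i < size g)%N by rewrite ltnNge; apply: contra nzi => le; rewrite nth_default.
have [n sg] : exists n, size g = n.+1.
  by exists (size g).-1; rewrite prednK // (leq_ltn_trans _ lt).
rewrite sg in lt.
apply: (key n (fun l => j (g`_l / g`_i))).
- by move=> l; apply: ival_base.
- transitivity ((j g`_i)^-1 * (map_poly j g).[z]); last by rewrite (rootP rg) mulr0.
  rewrite horner_coef size_map_poly sg mulr_sumr; apply: eq_bigr => l _.
  by rewrite coef_map fmorph_div mulrAC mulrC mulrA.
by exists i => //; rewrite divff // rmorph1; apply: iunit1.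
Qed.

End ResidueExtension.

(* The residue field of the integral closure of the valuation ring [O] in a
   finite extension, with the induced group action. *)
Theorem ex_residue (kap L : fieldType) (G : finGroupType) (sg : G -> kap -> kap)
    (us : seq (G -> kap)) (io : {rmorphism kap -> L}) (ta : G -> L -> L) (O : L -> Prop)
    (res : L -> kap) (ts : seq L) (Om : fieldExtType L) (om : G -> Om -> Om) :
  tower sg us io ta O res ts -> ring_action om -> (forall g a, om g a%:A = (ta g a)%:A) ->
  exists (R : Om -> Prop) (Th : fieldType) (Res : Om -> Th) (jt : {rmorphism kap -> Th})
    (sT : G -> Th -> Th),
  [/\ place R Res, forall a, O a -> R a%:A /\ Res a%:A = jt (res a),
      ring_action sT, forall g z, R z -> R (om g z) /\ Res (om g z) = sT g (Res z) &
      (forall g a, sT g (jt a) = jt (sg g a)) /\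
      forall th, (exists2 z, R z & Res z = th) /\ exists q : {poly kap}, [/\ irreducible_poly q,
        root (map_poly jt q) th & ((size q).-1 %| \dim {:Om})%N]].
Proof.
move=> tw hom omE; have pl := tower_place tw; have hen := tower_hen tw.
pose R := @ival L O Om.
have [R1 RB RM] : [/\ R 1, forall x y, R x -> R y -> R (x - y) & forall x y, R x -> R y -> R (x * y)].
  by split; [apply: ival1 pl _ | apply: ival_sub pl _ | apply: ival_mul pl _].
have Rbase a : O a -> R a%:A by apply: (ival_base pl).
pose U := @iunit L O Om; pose NU z := R z /\ ~ U z.
have local z : R z -> U z \/ U (1 - z) := @ival_local kap L O res pl hen Om z.
have NUadd x y : NU x -> NU y -> NU (x + y).
  case=> Rx nx [Ry ny]; split; first by apply: (ival_add pl).
  by move=> u; case: (iunit_addr pl hen u Rx Ry).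
have NUmul x y : R x -> NU y -> NU (x * y).
  move=> Rx [Ry ny]; split; first exact: RM.
  case; rewrite mulf_eq0 negb_or => /andP[x0 y0] _ RV; apply: ny; split=> //.
  have -> : y^-1 = x * (x * y)^-1 by field; rewrite x0 y0.
  exact: RM.
have Rsub : subring_prop R by split.
have [B [f [injf fE]]] := ex_subring_com Rsub.
pose I b := NU (f b).
have [] := @ex_prime_quotient B I.
- rewrite /I rmorph0; split; first exact: (ival0 pl).
  by case; rewrite eqxx.
- by move=> x y Ix Iy; rewrite /I rmorphD; apply: NUadd.
- by move=> x y Iy; rewrite /I rmorphM; apply: NUmul => //; apply/fE; exists x.
- by rewrite /I rmorph1 => -[_]; apply; apply: (iunit1 pl).
- move=> x y; rewrite /I rmorphM => -[_ nu].
  have [Rx Ry] : R (f x) /\ R (f y) by split; apply/fE; [exists x | exists y].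
  have [ux|nux] := pselect (U (f x)); last by left.
  have [uy|nuy] := pselect (U (f y)); last by right.
  by case: nu; apply: (iunitM pl).
move=> Th [pr [kerpr frpr]].
have RI z : R z -> exists b, z = f b by move=> /fE.
have /choice[lb lbE] z : exists b, R z -> z = f b.
  by have [/RI[b ->]|nR] := pselect (R z); [exists b | exists 0].
pose Res z : Th := pr (lb z).
have ResE b : Res (f b) = pr b.
  by rewrite /Res; congr (pr _); apply: injf; rewrite -lbE //; apply/fE; exists b.
have Res0 z : R z -> Res z = 0 <-> NU z by move=> /RI[b ->]; rewrite ResE; apply: kerpr.
have ResB x y : R x -> R y -> Res (x - y) = Res x - Res y.
  by move=> /RI[b ->] /RI[c ->]; rewrite -rmorphB !ResE rmorphB.
have ResM x y : R x -> R y -> Res (x * y) = Res x * Res y.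
  by move=> /RI[b ->] /RI[c ->]; rewrite -rmorphM !ResE rmorphM.
have Res1 : Res 1 = 1 by rewrite -(rmorph1 f) ResE rmorph1.
have plR : place R Res.
  split=> //; first by move=> z; apply: (ival_valuation pl hen).
  move=> z Rz /eqP nz; have [[_ _ //]|nu] := pselect (U z).
  by case: nz; apply/Res0.
have Rsurj th : exists2 z, R z & Res z = th.
  have [a [b [nIb ->]]] := frpr th; have [Ra Rb] : R (f a) /\ R (f b).
    by split; apply/fE; [exists a | exists b].
  have [b0 _ bV] : U (f b) by apply: contrapT => nu; case/eqP: nIb; apply/kerpr; split.
  exists (f a * (f b)^-1); first exact: RM.
  apply: (mulIf nIb); rewrite mulfVK // -(ResE b) -ResM ?mulfVK ?ResE //; exact: RM.
(* The difference of [a] and [io (res a)] has residue 0. Were it a unit of the integral closure, its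
   inverse would lie in [O], since [O] is integrally closed. *)
have Resbase a : O a -> Res a%:A = Res (io (res a))%:A.
  move=> Oa; have [Oi ri] := tower_res tw (res a).
  have [RA RI'] := (Rbase a Oa, Rbase _ Oi).
  apply/eqP; rewrite -subr_eq0 -ResB // -scalerBl; apply/eqP/Res0.
    by apply/Rbase/(placeB pl).
  split; first by apply/Rbase/(placeB pl).
  case=> nz _; set b := a - io (res a).
  have rb : res b = 0 by rewrite (resB pl) // ri subrr.
  have Ob : O b by apply: (placeB pl).
  have -> : (b%:A : Om)^-1 = (b^-1)%:A by rewrite -[LHS](fmorphV (GRing.in_alg Om)).
  move=> /(ival_baseE pl) ObV; have b0 : b != 0 by apply: contraNneq nz => e; rewrite -/b e scale0r.
  have e1 : res (b / b) = 0 by rewrite (resM pl) // rb mul0r.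
  by move/eqP: e1; rewrite mulfV // (res_one pl) oner_eq0.
pose jt0 a := Res (io a)%:A.
have [OI1 OI2] : (forall a, O (io a)) /\ (forall a, res (io a) = a).
  by split=> a; have [] := tower_res tw a.
have jtB : zmod_morphism jt0.
  by move=> a b; rewrite /jt0 rmorphB scalerBl ResB //; apply: Rbase.
have jtM : monoid_morphism jt0.
  split=> [|a b]; first by rewrite /jt0 rmorph1 scale1r.
  rewrite /jt0 rmorphM (_ : (io a * io b)%:A = (io a)%:A * (io b)%:A :> Om).
    by rewrite ResM //; apply: Rbase.
  exact: (rmorphM (GRing.in_alg Om)).
pose jt : {rmorphism kap -> Th} := HB.pack jt0
    (GRing.isZmodMorphism.Build _ _ jt0 jtB) (GRing.isMonoidMorphism.Build _ _ jt0 jtM).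
have Rom g z : R z -> R (om g z).
  case=> h [mh oh rh]; have [fg fgE] := ract_rmorph (tower_act tw) g.
  have [og ogE] := ract_rmorph hom g; exists (map_poly fg h); split.
  - exact: monic_map.
  - by move=> i; rewrite coef_map /= fgE; have [] := tower_equiv tw g (oh i).
  rewrite -ogE /root -map_poly_comp.
  have -> : map_poly (GRing.in_alg Om \o fg) h = map_poly og (map_poly (GRing.in_alg Om) h).
    rewrite -map_poly_comp; apply: eq_map_poly => a /=.
    by rewrite ogE /= omE fgE.
  by rewrite horner_map (rootP rh) rmorph0.
have om0 g z : (om g z == 0) = (z == 0).
  apply/eqP/eqP => [e|->]; last exact: (ract_zero hom).
  by rewrite -(ractK hom g z) e (ract_zero hom).
have omV g z : (om g z)^-1 = om g z^-1.
  have [og ogE] := ract_rmorph hom g; rewrite -!ogE.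
  have [->|z0] := eqVneq z 0; first by rewrite invr0 rmorph0 invr0.
  apply: (mulfI (_ : og z != 0)); first by rewrite ogE om0.
  by rewrite mulfV ?ogE ?om0 // -!ogE -rmorphM mulfV // rmorph1.
have NUom g z : NU z -> NU (om g z).
  case=> Rz nu; split; first exact: Rom.
  case=> n0 _; rewrite omV => /(Rom g^-1%g); rewrite (ractK hom) => RV.
  by apply: nu; split=> //; rewrite -(om0 g).
have /choice[lf lfE] th : exists z, R z /\ Res z = th by have [z] := Rsurj th; exists z.
pose sT g th := Res (om g (lf th)).
have sTE g z : R z -> Res (om g z) = sT g (Res z).
  move=> Rz; have [Rl rl] := lfE (Res z); apply/eqP; rewrite -subr_eq0 -ResB; try exact: Rom.
  rewrite -(ractB hom); apply/eqP/Res0; first by apply/Rom/RB.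
  by apply/NUom/Res0; [apply: RB | rewrite ResB // rl subrr].
exists R, Th, Res, jt, sT; split=> //.
- by move=> a Oa; split; [apply: Rbase | rewrite Resbase].
- split.
  + by move=> th; have [z Rz <-] := Rsurj th; rewrite -sTE // (ract1 hom).
  + move=> g h th; have [z Rz <-] := Rsurj th; rewrite -!sTE ?(ractM hom) //; exact: Rom.
  + move=> g x y; have [z Rz <-] := Rsurj x; have [w Rw <-] := Rsurj y.
    by rewrite -ResB // -!sTE ?(ractB hom) ?ResB //; try exact: Rom; apply: RB.
  + move=> g; split=> [|x y]; first by rewrite -Res1 -sTE // (ract_one hom).
    have [z Rz <-] := Rsurj x; have [w Rw <-] := Rsurj y.
    by rewrite -ResM // -!sTE ?(ractMl hom) ?ResM //; try exact: Rom; apply: RM.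
- by move=> g z Rz; split; [apply: Rom | apply: sTE].
split.
  move=> g a; rewrite -[sT g (jt a)]/(sT g (Res (io a)%:A)) -sTE; last exact: Rbase.
  have -> : om g (io a)%:A = (io (sg g a))%:A by rewrite omE (tower_io tw).
  by [].
move=> th; split=> //; have [z Rz <-] := Rsurj th.
(* The minimal polynomial of a lift reduces to a power of [q], so [q] vanishes at the residue and
   its degree divides the degree of the lift. *)
have [g [mg ig og rg dg]] := ival_minpoly pl Rz.
have [q [e [iq qE]]] := hen g mg ig og; exists q.
have sE : (size g).-1 = ((size q).-1 * e)%N.
  rewrite -size_exp -qE size_map_poly_id0 //.
  by rewrite (monicP mg) (res_one pl) oner_eq0.
split=> //; last by apply: dvdn_trans dg; rewrite sE dvdn_mulr.
have : root (map_poly jt (q ^+ e)) (Res z); last first.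
  by rewrite rmorphXn /= /root horner_exp expf_eq0 => /andP[].
rewrite -qE /root horner_coef size_map_poly size_map_poly_id0; last first.
  by rewrite (monicP mg) (res_one pl) oner_eq0.
have [|_ e1] := @place_sum _ _ _ _ plR _ (index_enum 'I_(size g)) (fun i => (g`_i)%:A * z ^+ i).
  by move=> i; apply: RM; [apply: Rbase | have [] := place_exp plR i Rz].
have e2 : \sum_(i < size g) (g`_i)%:A * z ^+ i = 0.
  transitivity ((map_poly (GRing.in_alg Om) g).[z]); last exact: (rootP rg).
  rewrite horner_coef size_map_poly; apply: eq_bigr => i _.
  by rewrite coef_map.
rewrite e2 -(subrr 1) ResB // subrr in e1; rewrite -[X in _ == X]/0 [X in _ == X]e1; apply/eqP.
apply: eq_bigr => i _; have [h1 h2] := place_exp plR i Rz.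
by rewrite ResM ?h2 //; [rewrite coef_map (coef_rmap pl) Resbase | apply: Rbase].
Qed.

(* An eigenvector of [c] with eigenvalue [w] has degree divisible by the order
   of [w]. *)
Lemma trivial_on_prime_to_p (kap Th : fieldType) (jt : {rmorphism kap -> Th}) (p : nat)
    (w : kap) (c : {rmorphism Th -> Th}) : prime p -> p.-primitive_root w ->
    (p%:R != 0 :> kap) -> (forall a, c (jt a) = jt a) -> (forall th, iter p c th = th) ->
    (forall th, exists q : {poly kap}, [/\ irreducible_poly q,
        root (map_poly jt q) th & coprime p (size q).-1]) ->
  forall th, c th = th.
Proof.
move=> pp wp pn0 cj cp deg th.
have w0 : w != 0.
  apply/eqP => w0; have /eqP := prim_expr_order wp.
  by rewrite w0 expr0n eqn0Ngt prime_gt0 // eq_sym oner_eq0.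
(* The Lagrange resolvents of [th]. They are eigenvectors of [c] and add up to p times [th], so it
   suffices that those with i > 0 vanish. *)
pose e i := \sum_(l < p) jt (w ^- (i * l)) * iter l c th.
have ce i : c (e i) = jt (w ^+ i) * e i.
  rewrite rmorph_sum mulr_sumr; case: (p) pp cp wp (prime_gt0 pp) => // n _ cp wp _.
  pose F l := jt (w ^+ i) * (jt (w ^- (i * l)) * iter l c th).
  rewrite (eq_bigr (fun l : 'I_n.+1 => F l.+1)); last first.
    move=> l _; rewrite rmorphM cj /F mulrA -rmorphM; congr (jt _ * _).
    by rewrite mulnS exprD invfM mulVKf // expf_neq0.
  rewrite big_ord_recr [RHS]big_ord_recl /= addrC; congr (_ + _).
  have cpn : c (iter n c th) = th := cp th.
  rewrite /F /= cpn muln0 expr0 invr1 mulnC exprM (prim_expr_order wp) expr1n invr1.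
  by [].
have e0 i : (0 < i < p)%N -> e i = 0.
  case/andP=> i0 ip; apply/eqP; apply: contraT => nz.
  have [q [iq rq cq]] := deg (e i).
  pose v := w ^+ i; have v1 : v ^+ (size q).-1 != 1.
    rewrite -exprM; apply/negP => /eqP h.
    have : (p %| i * (size q).-1)%N by rewrite (prim_order_dvd wp) h.
    rewrite Gauss_dvdl //; move/(dvdn_leq i0); by rewrite leqNgt ip.
  have v0 : v != 0 by rewrite expf_neq0.
  have nzq : q != 0 by rewrite -size_poly_gt0; case: iq => /ltnW.
  (* This polynomial has the same degree as [q] and shares a root with it, so the two are
     proportional. Their equal, nonzero constant terms make the factor 1, and the leading terms then
     contradict [v1]. *)
  pose q' := q \Po (v *: 'X).
  have rq' : root (map_poly jt q') (e i).
    have [cr crE] : exists cr : {rmorphism Th -> Th}, cr =1 c by exists c.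
    rewrite map_comp_poly /root horner_comp map_polyZ map_polyX hornerZ hornerX.
    rewrite -ce; have -> : map_poly jt q = map_poly c (map_poly jt q).
      by rewrite -map_poly_comp; apply: eq_map_poly => a /=; rewrite cj.
    by rewrite horner_map (rootP rq) rmorph0.
  have sq' : size q' = size q by rewrite size_comp_poly2 // size_scale // size_polyX.
  have dq : q %| q'.
    rewrite -[_ %| _]negbK -(irreducible_poly_coprime q' iq) -(coprimep_map jt).
    by apply/negP => /coprimep_root/(_ rq); rewrite (rootP rq') eqxx.
  have /eqpP[[a b] /= /andP[a0 b0] ab] : q %= q' by rewrite -(dvdp_size_eqp dq) sq'.
  have q0 : q`_0 != 0.
    apply: contraNneq nz => q00; case: iq => sq iq.
    have : 'X %= q by apply: iq; rewrite ?size_polyX // -['X]subr0 dvdp_XsubCl /root -horner_coef0 in q00 *; apply/eqP.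
    move/eqpP=> [[a' b'] /= /andP[a'0 b'0]] /(congr1 (map_poly jt)); rewrite !map_polyZ map_polyX.
    move/(congr1 (fun h => h.[e i])); rewrite !hornerZ hornerX (rootP rq) mulr0 => /eqP.
    by rewrite mulf_eq0 fmorph_eq0 (negbTE a'0).
  have q'l : q'`_(size q).-1 = v ^+ (size q).-1 * q`_(size q).-1.
    rewrite /q' comp_polyE coef_sum.
    have lt : ((size q).-1 < size q)%N by rewrite prednK ?size_poly_gt0.
    rewrite (bigD1 (Ordinal lt)) //= exprZn !coefZ coefXn eqxx mulr1 big1 ?addr0 => [|l nl]; first by rewrite mulrC.
    rewrite exprZn !coefZ coefXn eq_sym -[_ == _]/(l == Ordinal lt) (negbTE nl).
    by rewrite !mulr0.
  have q'0 : q'`_0 = q`_0 by rewrite -!horner_coef0 horner_comp hornerZ hornerX mulr0.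
  have := congr1 (fun h : {poly kap} => h`_0) ab; rewrite !coefZ q'0 => /(mulIf q0) aE.
  have := congr1 (fun h : {poly kap} => h`_(size q).-1) ab; rewrite !coefZ q'l aE => /(mulfI b0).
  rewrite -{1}[q`__]mul1r => /mulIf; rewrite -lead_coefE lead_coef_eq0 => /(_ nzq) /esym/eqP.
  by rewrite (negbTE v1).
have pjt : p%:R != 0 :> Th by rewrite -(rmorph_nat jt) fmorph_eq0.
have thE : \sum_(i < p) e i = p%:R * th.
  rewrite exchange_big /= (bigD1 (Ordinal (prime_gt0 pp))) //= [X in _ + X]big1 ?addr0.
    rewrite (eq_bigr (fun=> th)) ?sumr_const ?card_ord ?mulr_natl // => i _.
    by rewrite muln0 expr0 invr1 rmorph1 mul1r.
  move=> l nl; rewrite -mulr_suml -rmorph_sum; apply/eqP; rewrite mulf_eq0 fmorph_eq0; apply/orP; left.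
  have l0 : (0 < l)%N by rewrite lt0n.
  have wl : w ^- l != 1.
    rewrite -invr1 (inj_eq invr_inj) -(prim_order_dvd wp); apply/negP => /(dvdn_leq l0).
    by rewrite leqNgt ltn_ord.
  rewrite (eq_bigr (fun i : 'I_p => (w ^- l) ^+ i)); last by move=> i _; rewrite exprVn -exprM mulnC.
  have := subrX1 (w ^- l) p; rewrite exprVn -exprM mulnC exprM (prim_expr_order wp) expr1n invr1 subrr.
  by move=> /esym/eqP; rewrite mulf_eq0 subr_eq0 (negbTE wl).
have : p%:R * th = e 0%N.
  rewrite -thE (bigD1 (Ordinal (prime_gt0 pp))) //= big1 ?addr0 // => i ni.
  by apply: e0; rewrite ltn_ord lt0n andbT.
move=> th0; apply: (mulfI pjt); rewrite th0.
have : c (p%:R * th) = p%:R * c th by rewrite rmorphM rmorph_nat.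
by move=> <-; rewrite th0 ce expr0 rmorph1 mul1r.
Qed.

(** * Finite field extensions and their degrees *)

Section BasisFamilies.

Lemma fieldExt_basis (F : fieldType) (L : fieldExtType F) :
  exists b : 'I_(\dim {:L}) -> L, spans (GRing.in_alg L) b /\ indep (GRing.in_alg L) b.
Proof.
exists (fun i => (vbasis {:L})`_i); have bL := vbasisP {:L}; split=> [z|c c0].
  exists (fun i => coord (vbasis {:L}) i z); rewrite {1}(coord_vbasis (memvf z)).
  by apply: eq_bigr => i _; rewrite mulr_algl.
have /freeP fr := basis_free bL; apply: fr; rewrite -[RHS]c0.
by apply: eq_bigr => i _; rewrite mulr_algl.
Qed.

Lemma basis_dim_unique (F E : fieldType) (i : {rmorphism F -> E}) m n (b : 'I_m -> E) (c : 'I_n -> E) :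
  spans i b -> indep i b -> spans i c -> indep i c -> m = n.
Proof.
move=> sb ib sc ic; have [L [f [g [fK gK gZ <-]]]] := ex_fieldExt sb ib.
pose X := [tuple f (c l) | l < n].
have fZ a z : f (i a * z) = a *: f z by apply: (can_inj gK); rewrite gZ !fK.
have fr : free X.
  apply/(@freeP _ _ n X) => k k0 l0; suff h : \sum_j i (k j) * c j = 0 by exact: ic h l0.
  apply: (can_inj fK).
  rewrite rmorph0 -[RHS]k0 rmorph_sum; apply: eq_bigr => l _.
  by rewrite fZ -tnth_nth tnth_mktuple.
have : basis_of fullv X; last by move/vector.size_basis => ->.
rewrite /basis_of eqEsubv subvf fr andbT /=.
apply/subvP => z _; have [k zk] := sc (g z); rewrite -[z]gK zk rmorph_sum.
apply: rpred_sum => l _; rewrite fZ; apply/rpredZ/memv_span.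
by rewrite -(tnth_mktuple (fun l => f (c l)) l); apply: mem_tnth.
Qed.

Lemma tower_basis (F K E : fieldType) (i : {rmorphism F -> K}) (j : {rmorphism K -> E})
    m n (b : 'I_m -> K) (c : 'I_n -> E) :
  spans i b -> indep i b -> spans j c -> indep j c ->
  exists d : 'I_(n * m) -> E, spans (j \o i) d /\ indep (j \o i) d.
Proof.
move=> sb ib sc ic.
pose t (l : 'I_(n * m)) := enum_val (cast_ord (esym (etrans (card_prod _ _)
   (congr2 muln (card_ord n) (card_ord m)))) l) : 'I_n * 'I_m.
pose ti (uv : 'I_n * 'I_m) : 'I_(n * m) := cast_ord (etrans (card_prod _ _)
   (congr2 muln (card_ord n) (card_ord m))) (enum_rank uv).
have tK : cancel ti t by move=> uv; rewrite /t /ti cast_ordK enum_rankK.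
have tiK : cancel t ti by move=> l; rewrite /t /ti enum_valK cast_ordKV.
exists (fun l => c (t l).1 * j (b (t l).2)).
have sumE (k : 'I_(n * m) -> F) : \sum_l (j \o i) (k l) * (c (t l).1 * j (b (t l).2)) =
    \sum_u j (\sum_v i (k (ti (u, v))) * b v) * c u.
  rewrite (reindex ti) /=; last by exists t => ? _; [apply: tK | apply: tiK].
  rewrite (eq_bigr (fun u => \sum_v j (i (k (ti (u, v)))) * (c u * j (b v)))); last first.
    move=> u _; rewrite rmorph_sum mulr_suml; apply: eq_bigr => v _.
    by rewrite rmorphM mulrAC mulrA.
  rewrite pair_bigA /=; apply: eq_bigr => uv _; rewrite tK.
  by case: uv.
split=> [z|k].
  have [a za] := sc z; have /choice[h hE] u : exists h : 'I_m -> F, a u = \sum_v i (h v) * b v.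
    exact: sb.
  exists (fun l => h (t l).1 (t l).2); rewrite sumE za; apply: eq_bigr => u _; congr (j _ * _).
  by rewrite hE; apply: eq_bigr => v _; rewrite tK.
rewrite sumE => /ic h l; rewrite -(tiK l); case: (t l) => u v.
exact: (ib (fun v => k (ti (u, v))) (h u)).
Qed.

End BasisFamilies.

(** The universal property serves to map the same extension both into the p-closure and into a
    finite extension of another field. *)
Lemma ex_adjoin_root (K : fieldType) (g : {poly K}) : irreducible_poly g ->
  exists (K1 : fieldType) (i : {rmorphism K -> K1}) (z : K1) (b : 'I_(size g).-1 -> K1),
    [/\ spans i b, indep i b, root (map_poly i g) z,
      forall x, exists q : {poly K}, x = (map_poly i q).[z] &
      forall (E : fieldType) (th : {rmorphism K -> E}) (a : E), root (map_poly th g) a ->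
        exists th1 : {rmorphism K1 -> E}, (forall c, th1 (i c) = th c) /\ th1 z = a].
Proof.
move=> ig; have [L dL [z rz fz]] := irredp_FAdjoin ig.
have [b [sb ib]] := fieldExt_basis L; rewrite dL in b sb ib.
pose ev (q : {poly K}) := (map_poly (GRing.in_alg L) q).[z].
have evS x : exists q, x = ev q.
  have /Fadjoin_polyP[q qO ->] : x \in <<1; z>>%VS by rewrite fz memvf.
  by have /polyOver1P[q' ->] := qO; exists q'.
exists L, (GRing.in_alg L), z, b; split=> // E th a ra.
have /choice[lft lftE] := evS.
have wd q q' : ev q = ev q' -> (map_poly th q).[a] = (map_poly th q').[a].
  move=> e; apply/eqP; rewrite -subr_eq0 -hornerN -hornerD -rmorphB -/(root _ a).
  have : g %| q - q'.
    rewrite -[_ %| _]negbK -(irreducible_poly_coprime _ ig); apply/negP.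
    rewrite -(coprimep_map (GRing.in_alg L)) => /coprimep_root/(_ rz).
    by rewrite rmorphB hornerD hornerN -/(ev q) -/(ev q') e subrr eqxx.
  by case/dvdpP => h ->; rewrite rmorphM rootM ra orbT.
have evB q q' : ev (q - q') = ev q - ev q' by rewrite /ev rmorphB hornerD hornerN.
have evM q q' : ev (q * q') = ev q * ev q' by rewrite /ev rmorphM hornerM.
pose t x := (map_poly th (lft x)).[a].
have tE q : t (ev q) = (map_poly th q).[a] by apply: wd; rewrite -lftE.
have tB : zmod_morphism t.
  move=> x y; have [q ->] := evS x; have [q' ->] := evS y.
  by rewrite -evB !tE rmorphB hornerD hornerN.
have tM : monoid_morphism t.
  split=> [|x y].
    have <- : ev 1 = 1 by rewrite /ev rmorph1 -polyC1 hornerC.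
    by rewrite tE rmorph1 -polyC1 hornerC.
  by have [q ->] := evS x; have [q' ->] := evS y; rewrite -evM !tE rmorphM hornerM.
pose t1 : {rmorphism L -> E} := HB.pack t
    (GRing.isZmodMorphism.Build _ _ t tB) (GRing.isMonoidMorphism.Build _ _ t tM).
exists t1; split=> [c|].
  rewrite -[LHS]/(t c%:A); have <- : ev c%:P = c%:A by rewrite /ev map_polyC hornerC.
  by rewrite tE map_polyC hornerC.
rewrite -[LHS]/(t z); have <- : ev 'X = z by rewrite /ev map_polyX hornerX.
by rewrite tE map_polyX hornerX.
Qed.

Lemma algebraic_irreducible (K E : fieldType) (i : {rmorphism K -> E}) (a : E) :
  algebraicOver i a -> exists g : {poly K}, [/\ g \is monic, irreducible_poly g & root (map_poly i g) a].
Proof.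
case=> p nzp rp; have [n] := ubnP (size p); elim: n p nzp rp => // n IH p nzp rp sp.
have s1 : (1 < size p)%N.
  by rewrite -(size_map_poly i); apply: (@root_size_gt1 _ a) => //; rewrite map_poly_eq0.
have [q [mq iq /dvdpP[p' pE]]] := ex_irreducible_factor s1.
case: (boolP (root (map_poly i q) a)) => [rq|nq]; first by exists q.
have nzp' : p' != 0 by apply: contraNneq nzp => e; rewrite pE e mul0r.
have rp' : root (map_poly i p') a by move: rp; rewrite pE rmorphM rootM (negbTE nq) orbF.
have sp' : (size p' < n)%N.
  have sq : (1 < size q)%N by case: iq.
  have s0 : (0 < size p')%N by rewrite size_poly_gt0.
  have aux (x y t : nat) : ((x + y).-1 < t.+1 -> 1 < y -> 0 < x -> x < t)%N by lia.
  have e : size p = (size p' + size q).-1 by rewrite pE (size_mul nzp' (monic_neq0 mq)).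
  by apply: (aux _ (size q)) => //; rewrite -e.
exact: IH p' nzp' rp' sp'.
Qed.

Lemma ex_coprime_factor (K : fieldType) (p : nat) (g : {poly K}) : prime p -> g != 0 ->
  coprime p (size g).-1 -> exists q : {poly K}, [/\ irreducible_poly q, q %| g & coprime p (size q).-1].
Proof.
move=> pp; have [n] := ubnP (size g); elim: n g => // n IH g sg nzg cg.
have s1 : (1 < size g)%N.
  rewrite ltnNge; apply/negP => le; move: cg; have -> : (size g).-1 = 0%N by lia.
  by rewrite /coprime gcdn0 => /eqP p1; move: (prime_gt1 pp); rewrite p1.
have [q [mq iq /dvdpP[g' gE]]] := ex_irreducible_factor s1.
case: (boolP (coprime p (size q).-1)) => [cq|nq]; first by exists q; split=> //; rewrite gE dvdp_mulIr.
have nzg' : g' != 0 by apply: contraNneq nzg => e; rewrite gE e mul0r.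
have sq : (1 < size q)%N by case: iq.
have sE : ((size g).-1 = (size g').-1 + (size q).-1)%N.
  rewrite gE (size_mul nzg' (monic_neq0 mq)); have s0 : (0 < size g')%N by rewrite size_poly_gt0.
  have aux (x y : nat) : (1 < y -> 0 < x -> (x + y).-1.-1 = x.-1 + y.-1)%N by lia.
  exact: aux sq s0.
have pq : (p %| (size q).-1)%N by move: nq; rewrite prime_coprime // negbK.
have sg' : (size g' < n)%N.
  have aux (x y t w : nat) : (t < w.+1 -> 1 < y -> t.-1 = x.-1 + y.-1 -> 0 < t -> x < w)%N by lia.
  by apply: aux sg sq sE _; apply: ltnW.
have cg' : coprime p (size g').-1 by move: cg; rewrite !prime_coprime // sE dvdn_addl.
have [r [ir rg cr]] := IH g' sg' nzg' cg'; exists r; split=> //.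
by rewrite gE dvdp_mulr.
Qed.

(** The last iterated q-th power of [z] outside [K], with q the characteristic, has degree exactly q
    over [K], and q differs from [p]. *)
Lemma purely_inseparable_step (F : fieldType) (Q : fieldExtType F) (p : nat) (K : {subfield Q}) (z : Q) :
  prime p -> p \notin [pchar F] -> z \notin K -> purely_inseparable_element K z ->
  exists z', [/\ z' \notin K, purely_inseparable_element K z' & coprime p (adjoin_degree K z')].
Proof.
move=> pp pF zK iz.
have ns x : x \notin K -> purely_inseparable_element K x -> ~~ separable_element K x.
  by move=> xK ix; apply: contra xK => sx; rewrite -separable_inseparable_element sx.
have /separablePn_pchar[q qQ _] := ns z zK iz.
have /purely_inseparable_elementP_pchar[n nQ znK] := iz.
have q_pr := pcharf_prime qQ.
have ex : exists m, z ^+ (q ^ m) \in K.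
  have : q.-nat n by rewrite -(eq_pnat _ (pcharf_eq qQ)).
  by case/p_natP => e nE; exists e; rewrite -nE.
case: (ex_minnP ex) => -[|m]; first by rewrite expn0 expr1 (negbTE zK).
move=> zm minm; exists (z ^+ (q ^ m)).
have z'K : z ^+ (q ^ m) \notin K by apply/negP => /minm; rewrite ltnn.
have z'q : (z ^+ (q ^ m)) ^+ q \in K by rewrite -exprM mulnC -expnS.
have iz' : purely_inseparable_element K (z ^+ (q ^ m)).
  by apply/purely_inseparable_elementP_pchar; exists q => //; rewrite pnatE.
split=> //; set z' := z ^+ (q ^ m) in z'K z'q iz' *.
have /separablePn_pchar[r rQ [g gK gE]] := ns z' z'K iz'.
have rq : r = q by have := pcharf_eq qQ r; rewrite rQ => /esym/eqP.
have dle : (adjoin_degree K z' <= q)%N.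
  have dv : minPoly K z' %| 'X^q - (z' ^+ q)%:P.
    apply: minPoly_dvdp; first by rewrite rpredB ?polyOverXn ?polyOverC.
    by rewrite /root hornerD hornerN hornerXn hornerC subrr.
  have q0 := prime_gt0 q_pr; have := dvdp_leq _ dv; rewrite size_minPoly size_XnsubC //.
  by rewrite ltnS; apply; rewrite -size_poly_gt0 size_XnsubC.
have dE : adjoin_degree K z' = ((size g).-1 * q)%N.
  have := congr1 (fun h : {poly Q} => (size h).-1) gE.
  by rewrite /= size_minPoly size_comp_poly size_polyXn rq.
have -> : adjoin_degree K z' = q.
  move: dle dE (prime_gt0 q_pr); have : (0 < adjoin_degree K z')%N by [].
  move: (adjoin_degree K z') ((size g).-1) => d [|[|c]]; rewrite ?mul0n ?mul1n //; first by lia.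
  by move=> d0 le e q0; have : (q < c.+2 * q)%N; [rewrite ltn_Pmull | rewrite -e ltnNge le].
rewrite prime_coprime // dvdn_prime2 //; apply: contra pF => /eqP ->.
by rewrite -(pchar_lalg Q).
Qed.

(** The separable part is generated by one element, to which the hypothesis applies. The rest is
    purely inseparable and is climbed by steps of degree the characteristic, which is not [p]. *)
Lemma coprime_dim_of_elements (F : fieldType) (Q : fieldExtType F) (p : nat) :
  prime p -> p \notin [pchar F] ->
  (forall z : Q, separable_element 1 z -> coprime p (adjoin_degree 1%AS z)) ->
  coprime p (\dim {:Q}).
Proof.
move=> pp pF hz; pose x := separable_generator 1%AS {:Q}%AS.
have step n (K : {subfield Q}) : (\dim {:Q} - \dim K < n)%N -> coprime p (\dim K) ->
    (forall z, purely_inseparable_element K z) -> coprime p (\dim {:Q}).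
  elim: n K => // n IH K lt cK iK.
  have [/eqP<- //|nK] := boolP (\dim K == \dim {:Q}).
  have [z zK] : exists z, z \notin K.
    apply: contrapT => hno; case/eqP: nK; apply: congr1; apply/eqP; rewrite eqEsubv subvf /=.
    by apply/subvP => z _; apply: contrapT => /negP zK; apply: hno; exists z.
  have [z' [z'K iz' cz']] := purely_inseparable_step pp pF zK (iK z).
  apply: (IH <<K; z'>>%AS).
  - have : (\dim K < \dim <<K; z'>>)%N.
      rewrite ltn_neqAle dimvS ?subv_adjoin // andbT; apply: contra z'K => /eqP e.
      have /eqP -> : (K == <<K; z'>> :> {vspace Q})%VS by rewrite eqEdim subv_adjoin e leqnn.
      exact: memv_adjoin.
    have aux (a b c m : nat) : (c - a < m.+1 -> b <= c -> a < b -> c - b < m)%N by lia.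
    by apply: aux lt _; apply: dimvS; apply: subvf.
  - by rewrite dim_Fadjoin coprimeMr cz' cK.
  - by move=> w; apply: sub_inseparable (iK w); apply: subv_adjoin.
apply: (step (\dim {:Q}).+1 <<1; x>>%AS); first by rewrite ltnS leq_subr.
  rewrite dim_Fadjoin dimv1 muln1; apply: hz; exact: separable_generatorP.
by move=> z; apply: (purely_inseparableP (separable_generator_maximal _ _)); apply: memvf.
Qed.

Lemma ex_finite_ext (F E : fieldType) (l : {rmorphism F -> E}) (s : seq E) :
  (forall a, a \in s -> algebraicOver l a) ->
  exists (K : fieldType) (i : {rmorphism F -> K}) (j : {rmorphism K -> E}) (n : nat) (b : 'I_n -> K),
    [/\ spans i b, indep i b, forall c, j (i c) = l c, forall a, a \in s -> exists x, a = j x &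
      forall x, gen l (fun y => y \in s) (j x)].
Proof.
elim: s => [|a s IH] hs.
  exists F, (idfun : {rmorphism F -> F}), l, 1%N, (fun=> 1); split=> //.
  - by move=> z; exists (fun=> z); rewrite big_ord1 mulr1.
  - by move=> c; rewrite big_ord1 mulr1 => c0 i; rewrite ord1.
  - by move=> x; apply: gen_base.
have [|K [i [j [n [b [sb ib ji js gK]]]]]] := IH.
  by move=> x xs; apply: hs; rewrite inE xs orbT.
have aK : algebraicOver j a.
  have [q nzq rq] := hs a (mem_head _ _); exists (map_poly i q); first by rewrite map_poly_eq0.
  rewrite -map_poly_comp (_ : map_poly _ q = map_poly l q) //.
  by apply: eq_map_poly => c /=; rewrite ji.
have [g [mg ig rg]] := algebraic_irreducible aK.
have [K1 [i1 [z [c [sc ic rz gz ext]]]]] := ex_adjoin_root ig.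
have [j1 [j1i j1z]] := ext E j a rg.
have [d [sd id_]] := tower_basis sb ib sc ic.
exists K1, (i1 \o i), j1, _, d; split=> //.
- by move=> x; rewrite /= j1i ji.
- by move=> x; rewrite inE => /orP[/eqP ->|/js[y ->]]; [exists z | exists (i1 y); rewrite j1i].
have gs := gen_subfield l (fun y => y \in a :: s).
have gm x : gen l (fun y => y \in s) x -> gen l (fun y => y \in a :: s) x.
  apply: gen_min gs _ _ => [w|w ws]; first exact: gen_base.
  by apply: gen_sub; rewrite inE ws orbT.
have ga : gen l (fun y => y \in a :: s) a by apply: gen_sub; rewrite mem_head.
have [rK [rKf rKE]] := gen_field l (fun y => y \in a :: s).
move=> x; have [q ->] := gz x; rewrite -horner_map j1z horner_coef; apply/rKE.
have /choice[h hE] m : exists y, (map_poly j1 (map_poly i1 q))`_m * a ^+ m = rKf y.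
  have /rKE[y1 ->] := ga; have [y2 y2E] : exists y, j q`_m = rKf y by apply/rKE; apply: gm; apply: gK.
  by exists (y2 * y1 ^+ m); rewrite !coef_map /= j1i y2E rmorphM rmorphXn.
exists (\sum_(m < size (map_poly j1 (map_poly i1 q))) h m).
by rewrite rmorph_sum; apply: eq_bigr => m _.
Qed.

(** * The p-closure: finite subextensions and roots of unity *)

Section PClosureTheory.

Variables (p : nat) (k kp : fieldType).
Hypotheses (p_pr : prime p) (p_char : p \notin [pchar k]).
Variables (kbar : closedFieldType) (ks : fieldType) (i : {rmorphism k -> ks})
  (j : {rmorphism ks -> kbar}) (h : {rmorphism kp -> kbar}) (Phi : (ks -> ks) -> Prop).
Hypothesis kbar_alg : algebraic_closure (j \o i : {rmorphism k -> kbar}).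
Hypothesis ksE : forall a : kbar,
  separable_over (j \o i : {rmorphism k -> kbar}) a <-> exists b : ks, a = j b.
Hypothesis PhiS : sylow_pro p i Phi.
Hypothesis kpE : forall a : kbar, (exists c : kp, a = h c) <->
  exists (n : nat) (b : ks),
    [/\ [pchar kbar].-nat n, forall s, Phi s -> s b = b & a ^+ n = j b].

Let jI : injective j := fmorph_inj j.
Let hI : injective h := fmorph_inj h.

Lemma Phi_rmorph s : Phi s -> exists f : {rmorphism ks -> ks}, forall x, f x = s x.
Proof.
case/(sylow_aut PhiS) => sB sM _ _.
pose f : {rmorphism ks -> ks} := HB.pack s
    (GRing.isZmodMorphism.Build _ _ s sB) (GRing.isMonoidMorphism.Build _ _ s sM).
by exists f.
Qed.

Lemma ex_base_to_kp : exists l : {rmorphism k -> kp}, forall c, h (l c) = j (i c).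
Proof.
apply: (rmorph_factor (f := j \o i)) hI _ => c; apply/kpE; exists 1%N, (i c); split=> //.
by move=> s /(sylow_aut PhiS)[_ _ _ ->].
Qed.

(** Some power b^n with n a power of the characteristic exponent is fixed by [s], and (s b - b)^n =
    s (b^n) - b^n = 0. *)
Lemma fixed_of_kp (c : kp) (b : ks) : h c = j b -> forall s, Phi s -> s b = b.
Proof.
move=> hc s Ps; have /kpE[n [b' [nP fb' e]]] : exists c, j b = h c by exists c.
have [f fE] := Phi_rmorph Ps; rewrite -fE.
have bE : b ^+ n = b' by apply: jI; rewrite rmorphXn.
have : (f b - b) ^+ n = 0.
  have nP' : [pchar ks].-nat n by rewrite -(eq_pnat _ (fmorph_pchar j)).
  have fb'' : f b' = b' by rewrite fE fb'.
  have e2 : f b ^+ n = b' by rewrite -rmorphXn bE.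
  have := exprDn_pchar (f b - b) b nP'; rewrite subrK e2 bE => e1.
  by apply: (addIr b'); rewrite -e1 add0r.
by move/eqP; rewrite expf_eq0 subr_eq0 => /andP[_ /eqP].
Qed.

Lemma ex_splitting_field (q : {poly k}) (rs : seq ks) :
  separable_poly q -> map_poly i q %= \prod_(x <- rs) ('X - x%:P) ->
  exists (L : splittingFieldType k) (u : {rmorphism L -> ks}),
    [/\ forall a, u a%:A = i a, galois 1 {:L}, forall x, x \in rs -> exists y, x = u y &
      forall y, gen i (fun x => x \in rs) (u y)].
Proof.
move=> sq qE.
have [a ars|K [iK [jK [n [b [sb ib jiK jrs gK]]]]]] := @ex_finite_ext k ks i rs.
  exists q; first exact: separable_poly_neq0.
  by rewrite (eqp_root qE) root_prod_XsubC.
have [L0 [f [g [fK gfK gZ _]]]] := ex_fieldExt sb ib.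
pose u0 : {rmorphism L0 -> ks} := jK \o g.
have u0A a : u0 a%:A = i a by rewrite /= gZ rmorph1 mulr1 jiK.
have /choice[r hr] x : exists y : L0, x \in rs -> x = u0 y.
  case: (boolP (x \in rs)) => [/jrs[y ->]|_]; last by exists 0.
  by exists (f y) => _; rewrite /= fK.
pose rs' := [seq r x | x <- rs].
have rsE : [seq u0 y | y <- rs'] = rs.
  by rewrite -map_comp -[RHS]map_id; apply/eq_in_map => x /hr.
pose q' := map_poly (GRing.in_alg L0) q.
have u0q : map_poly u0 q' = map_poly i q.
  by rewrite -map_poly_comp; apply: eq_map_poly => c; apply: u0A.
have q'E : q' %= \prod_(y <- rs') ('X - y%:P).
  rewrite -(eqp_map u0) u0q rmorph_prod /= -[X in X %= _]/(map_poly i q).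
  rewrite (eq_bigr (fun y => 'X - (u0 y)%:P)); last by move=> y _; rewrite map_polyXsubC.
  by rewrite -(big_map u0 xpredT (fun x => 'X - x%:P)) rsE.
have full : <<1 & rs'>>%VS = fullv.
  apply/eqP; rewrite eqEsubv subvf /=; apply/subvP => y _.
  have [w w1 w2] : exists2 w, w \in <<1 & rs'>>%VS & u0 y = u0 w; last by rewrite (fmorph_inj u0 w2).
  apply: (@gen_min k ks i (fun x => x \in rs) (fun x => exists2 w, w \in <<1 & rs'>>%VS & x = u0 w)).
  - split.
    + by exists 1; [apply: mem1v | rewrite rmorph1].
    + by move=> _ _ [w w1 ->] [v v1 ->]; exists (w - v); rewrite ?rmorphB // rpredB.
    + by move=> _ _ [w w1 ->] [v v1 ->]; exists (w * v); rewrite ?rmorphM // rpredM.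
    + by move=> _ [w w1 ->]; exists w^-1; rewrite ?fmorphV // rpredV.
  - by move=> a; exists a%:A; rewrite ?u0A // rpredZ // mem1v.
  - by move=> x xrs; exists (r x); [apply: seqv_sub_adjoin; apply: map_f | apply: hr].
  - exact: gK.
have ax : splitting_field_axiom L0.
  by exists q'; [apply/polyOver1P; exists q | exists rs'].
pose L : splittingFieldType k := HB.pack (FieldExt.sort L0) (FieldExt_isSplittingField.Build k L0 ax).
pose u : {rmorphism L -> ks} := u0.
exists L, u; split=> //.
- apply/splitting_galoisField; exists q'; split.
  + by apply/polyOver1P; exists q.
  + by rewrite separable_map.
  + by exists rs'.
- by move=> x xrs; exists (r x); apply: hr.
- by move=> y; apply: gK.
Qed.

Lemma roots_in_ks (q : {poly k}) : separable_poly q ->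
  exists rs : seq ks, map_poly i q %= \prod_(x <- rs) ('X - x%:P).
Proof.
move=> sq; have nzq := separable_poly_neq0 sq.
pose qb := map_poly (j \o i) q; have nzqb : qb != 0 by rewrite map_poly_eq0.
have [rb rbE] := closed_field_poly_normal qb.
have /choice[r hr] x : exists y, x \in rb -> x = j y.
  case: (boolP (x \in rb)) => [xrb|]; last by exists 0.
  have rx : root qb x by rewrite rbE rootZ ?lead_coef_eq0 // root_prod_XsubC.
  have ax : algebraicOver (j \o i : {rmorphism k -> kbar}) x by exists q.
  have [g [mg ig rg]] := algebraic_irreducible ax.
  have /ksE[y ->] : separable_over (j \o i : {rmorphism k -> kbar}) x; last by exists y.
  exists g; split=> //; apply: dvdp_separable sq.
  rewrite -[_ %| _]negbK -(irreducible_poly_coprime _ ig); apply/negP.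
  by rewrite -(coprimep_map (j \o i)) => /coprimep_root/(_ rg); rewrite (rootP rx) eqxx.
exists [seq r x | x <- rb]; rewrite -(eqp_map j) -map_poly_comp -/qb rbE.
rewrite (eqp_ltrans (eqp_scale _ _)) ?lead_coef_eq0 // big_map rmorph_prod /=.
rewrite (eq_big_seq (fun x => map_poly j ('X - (r x)%:P))) ?eqpxx // => x xrb.
by rewrite map_polyXsubC -hr.
Qed.

Lemma galois_image_group (L : splittingFieldType k) (u : {rmorphism L -> ks}) :
  group_set (galois_image Phi u).
Proof.
apply/group_setP; split=> [|t1 t2]; rewrite !inE.
  by apply/asboolP; exists id; split=> [|x]; [apply: (sylow_id PhiS) | rewrite gal_id].
move=> /asboolP[s1 [P1 e1]] /asboolP[s2 [P2 e2]]; apply/asboolP; exists (s2 \o s1).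
by split=> [|x]; [apply: (sylow_comp PhiS) | rewrite /= e1 e2 galM // memvf].
Qed.

(** It is enough to treat a separable [z]. Its image is fixed by [Phi], so inside a finite Galois
    extension it lies in the fixed field of a Sylow p-subgroup, whose degree over [k] is the index,
    prime to [p]. *)
Lemma kp_ext_coprime (l : {rmorphism k -> kp}) (Q : fieldExtType k) (al : {rmorphism Q -> kp}) :
  (forall c, h (l c) = j (i c)) -> (forall c, al c%:A = l c) -> coprime p (\dim {:Q}).
Proof.
move=> hl alA; apply: coprime_dim_of_elements => // z sz.
have [g [mg ig rg _]] := ex_minpoly z.
have gE : minPoly 1%AS z = map_poly (GRing.in_alg Q) g.
  have /polyOver1P[g' g'E] := minPolyOver 1%AS z.
  have : g %| g'.
    rewrite -[_ %| _]negbK -(irreducible_poly_coprime _ ig); apply/negP.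
    rewrite -(coprimep_map (GRing.in_alg Q)) -g'E => /coprimep_root/(_ rg).
    by rewrite (rootP (root_minPoly _ _)) eqxx.
  rewrite -(dvdp_map (GRing.in_alg Q)) -g'E => d1.
  have d2 : minPoly 1%AS z %| map_poly (GRing.in_alg Q) g.
    by apply: minPoly_dvdp => //; apply/polyOver1P; exists g.
  apply/eqP; rewrite -eqp_monic ?monic_minPoly ?monic_map // /eqp d2.
  by rewrite d1.
have sg : separable_poly g by move: sz; rewrite /separable_element gE separable_map.
have degE : adjoin_degree 1%AS z = (size g).-1.
  by rewrite -(size_map_poly (GRing.in_alg Q)) -gE size_minPoly.
have rhg : root (map_poly (j \o i) g) (h (al z)).
  have := rg; rewrite -(fmorph_root (h \o al)) -map_poly_comp.
  rewrite (_ : map_poly _ g = map_poly (j \o i) g) //.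
  by apply: eq_map_poly => c /=; rewrite alA hl.
have /ksE[be beE] : separable_over (j \o i : {rmorphism k -> kbar}) (h (al z)) by exists g.
have fbe := fixed_of_kp beE.
have rbe : root (map_poly i g) be.
  by rewrite -(fmorph_root j) -map_poly_comp -beE.
have [rs rsE] := roots_in_ks sg.
have [L [u [uA gL urs _]]] := ex_splitting_field sg rsE.
have [w wE] : exists w, be = u w by apply: urs; rewrite -root_prod_XsubC -(eqp_root rsE).
have /and3P[HG pH iH] := sylow_finite PhiS uA gL.
set H := galois_image Phi u in HG pH iH.
have gH : group_set H := galois_image_group u.
pose HH := Group gH.
have wf : w \in fixedField HH.
  apply/fixedFieldP => [|t]; first exact: memvf.
  rewrite inE => /asboolP[s [Ps e]]; apply: (fmorph_inj u).
  by rewrite -e -wE fbe.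
have dL : \dim {:L} = #|'Gal({:L} / 1)%g| by rewrite -(galois_dim gL) dimv1 divn1.
have dF : (\dim (fixedField HH) * #|HH| = \dim {:L})%N.
  by rewrite dim_fixedField mulnC divnK // field_dimS // subvf.
have cF : coprime p (\dim (fixedField HH)).
  have HG' : HH \subset 'Gal({:L} / 1)%g := HG.
  have : (\dim (fixedField HH) = #|'Gal({:L} / 1) : HH|%g)%N.
    by apply/eqP; rewrite -(eqn_pmul2r (cardG_gt0 HH)) dF dL -(Lagrange HG') mulnC.
  move=> ->; move: iH; rewrite p'natE // => nd.
  by rewrite prime_coprime.
rewrite degE; apply: coprime_dvdr cF.
have sub : (<<1; w>> <= fixedField HH)%VS.
  by apply/FadjoinP; split=> //; rewrite sub1v.
have := field_dimS sub; rewrite dim_Fadjoin dimv1 muln1.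
suff -> : adjoin_degree 1%AS w = (size g).-1 by [].
have rw : root (map_poly (GRing.in_alg L) g) w.
  rewrite -(fmorph_root u) -map_poly_comp -wE (_ : map_poly _ g = map_poly i g) //.
  by apply: eq_map_poly => c; apply: uA.
have [g' [mg' ig' rg' _]] := ex_minpoly w.
have /polyOver1P[g2 g2E] := minPolyOver 1%AS w.
have d2 : g2 %| g.
  rewrite -(dvdp_map (GRing.in_alg L)) -g2E; apply: minPoly_dvdp => //.
  by apply/polyOver1P; exists g.
have s2 : size g2 = (adjoin_degree 1%AS w).+1.
  by rewrite -(size_map_poly (GRing.in_alg L)) -g2E size_minPoly.
have : g2 %= g by case: ig => _; apply; rewrite ?s2.
by move/eqp_size; rewrite s2 => <-.
Qed.

(* An element s of Phi maps a p-th root of unity z to a power z^a; as s acts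
   on a finite Galois extension with p-power order and a^p = a mod p, it fixes z. *)
Lemma kp_prim_root : exists w : kp, p.-primitive_root w.
Proof.
have pn0 : p%:R != 0 :> k by move: p_char; rewrite !inE p_pr.
pose q : {poly k} := 'X^p - 1; have p0 := prime_gt0 p_pr.
have sq : separable_poly q by apply: separable_Xn_sub_1.
have [rs rsE] := roots_in_ks sq.
have qiE : map_poly i q = 'X^p - 1 by rewrite rmorphB /= map_polyXn rmorph1.
have rsP x : (x \in rs) = (x ^+ p == 1).
  by rewrite -root_prod_XsubC -(eqp_root rsE) qiE rootE hornerD hornerN hornerXn hornerC subr_eq0.
have urs : uniq rs by rewrite -separable_prod_XsubC -(eqp_separable rsE) separable_map.
have srs : size rs = p.
  have := eqp_size rsE; rewrite qiE size_XnsubC // size_prod_XsubC.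
  by case.
have [z zrs z1] : exists2 z, z \in rs & z != 1.
  apply: contrapT => no; have : (size rs <= size [:: 1%R : ks])%N.
    apply: uniq_leq_size => // x xrs; rewrite inE; apply/negPn/negP => x1; apply: no.
    by exists x.
  by rewrite srs leqNgt prime_gt1.
have zp : z ^+ p = 1 by apply/eqP; rewrite -rsP.
have prz : p.-primitive_root z.
  have [m pm mp] := prim_order_exists p0 zp.
  have [_ dp] := primeP p_pr; case/orP: (dp _ mp) => /eqP mE; last by rewrite -mE.
  by move: pm z1; rewrite mE => /prim_expr_order; rewrite expr1 => ->; rewrite eqxx.
have [L [u [uA gL urs' gu]]] := ex_splitting_field sq rsE.
have fz s : Phi s -> s z = z.
  move=> Ps; have [f fE] := Phi_rmorph Ps.
  have fA c : f (i c) = i c by rewrite fE; have [_ _ _ ->] := sylow_aut PhiS Ps.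
  have /choice[t0 t0E] x : exists y : L, f (u x) = u y.
    apply: (@gen_min k ks i (fun x => x \in rs) (fun x => exists y : L, f x = u y)).
    - split.
      + by exists 1; rewrite !rmorph1.
      + by move=> a b [y e] [y' e']; exists (y - y'); rewrite !rmorphB e e'.
      + by move=> a b [y e] [y' e']; exists (y * y'); rewrite !rmorphM e e'.
      + by move=> a [y e]; exists y^-1; rewrite !fmorphV e.
    - by move=> a; exists a%:A; rewrite uA fA.
    - move=> a ars; apply: urs'; rewrite rsP -rmorphXn.
      by move: ars; rewrite rsP => /eqP ->; rewrite rmorph1.
    - exact: gu.
  have uI := fmorph_inj u.
  have t0B : zmod_morphism t0 by move=> x y; apply: uI; rewrite -t0E !rmorphB !t0E.
  have t0M : monoid_morphism t0.
    by split=> [|x y]; apply: uI; rewrite -t0E ?rmorph1 // !rmorphM !t0E.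
  have t0Z : scalable t0.
    move=> c x; apply: uI; rewrite -t0E -[c *: x]mulr_algl -[c *: t0 x]mulr_algl.
    by rewrite !(rmorphM u) (rmorphM f) !uA fA t0E.
  pose t : {lrmorphism L -> L} := HB.pack t0 (GRing.isZmodMorphism.Build _ _ t0 t0B)
    (GRing.isMonoidMorphism.Build _ _ t0 t0M) (GRing.isScalable.Build _ _ _ _ t0 t0Z).
  have /kAut_to_gal[al alG alE] : kAut 1 {:L} (linfun t).
    rewrite kAutfE; apply/kHomP_tmp; split=> [x /vlineP[c0 ->] | x y _ _]; rewrite !lfunE /=.
      by rewrite -[LHS]/(t0 (c0 *: 1)) t0Z (t0M.1).
    exact: (rmorphM t).
  have alE' x : u (al x) = f (u x) by rewrite -alE ?memvf // lfunE t0E.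
  have /and3P[HG pH iH] := sylow_finite PhiS uA gL.
  have alH : al \in galois_image Phi u.
    by rewrite inE; apply/asboolP; exists s; split=> // x; rewrite -fE alE'.
  have [e oe] : exists e, (al ^+ (p ^ e)%N = 1)%g.
    have pal : (p.-elt al)%g by exact: (mem_p_elt (G := Group (galois_image_group u)) pH alH).
    have [e oe] := p_natP pal; exists e; apply/eqP.
    by rewrite -oe -/(order al) expg_order.
  have [a fza] : exists a, f z = z ^+ a.
    have fzp : f z ^+ p = 1 by rewrite -rmorphXn zp rmorph1.
    by have [a ->] := prim_rootP prz fzp; exists (val a).
  have [w zw] : exists w, z = u w by apply: urs'.
  have pw m : u ((al ^+ m)%g w) = z ^+ (a ^ m)%N.
    elim: m => [|m IH]; first by rewrite expg0 gal_id expn0 expr1 zw.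
    by rewrite expgSr galM ?memvf // alE' IH rmorphXn fza -exprM expnS.
  have ap m : z ^+ (a ^ (p ^ m))%N = z ^+ a.
    elim: m => [|m IH]; first by rewrite expn0 expn1.
    rewrite expnSr expnM; apply/eqP; rewrite (eq_prim_root_expr prz) fermat_little //.
    by rewrite -(eq_prim_root_expr prz) IH.
  by rewrite -fE fza -(ap e) -pw oe gal_id -zw.
have [w hw] : exists w, j z = h w.
  by apply/kpE; exists 1%N, z.
exists w; rewrite -(fmorph_primitive_root h) -hw.
by rewrite fmorph_primitive_root.
Qed.

End PClosureTheory.

Lemma p_closure_facts p (k kp : fieldType) : prime p -> p \notin [pchar k] -> p_closure p k kp ->
  exists l : {rmorphism k -> kp}, [/\ forall a, algebraicOver l a,
    forall (Q : fieldExtType k) (al : {rmorphism Q -> kp}), (forall c, al c%:A = l c) -> coprime p (\dim {:Q})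
    & exists w : kp, p.-primitive_root w].
Proof.
move=> pp pc [kbar [ks [i [j [h [Phi [kb ksE PhiS kpE]]]]]]].
have [l hl] := ex_base_to_kp PhiS kpE; exists l; split.
- move=> a; have [q mq rq] := kb (h a); exists q; first exact: monic_neq0.
  rewrite -(fmorph_root h) -map_poly_comp; apply: etrans rq; congr (root _ _).
  by apply: eq_map_poly => c /=; rewrite hl.
- by move=> Q al alA; eapply (@kp_ext_coprime p k kp); eassumption.
- by eapply (@kp_prim_root p k kp); eassumption.
Qed.

(** * Prime-to-p realization of finitely many elements, and the upper bound *)

Section PrimeToPExtension.

Variables (p : nat) (k kp M : fieldType) (l : {rmorphism k -> kp}) (j0 : {rmorphism k -> M}).
Hypotheses (p_pr : prime p) (l_alg : forall a, algebraicOver l a)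
  (l_coprime : forall (Q : fieldExtType k) (al : {rmorphism Q -> kp}), (forall c, al c%:A = l c) ->
    coprime p (\dim {:Q})).

(** The elements are adjoined one at a time. The minimal polynomial of the next one over [K] has
    degree prime to [p]; over [N] it may become reducible, but some irreducible factor still has
    degree prime to [p], and a root of that factor is adjoined to [N]. *)
Lemma ex_prime_to_p_compositum (s : seq kp) :
  exists (K N : fieldType) (iK : {rmorphism k -> K}) (al : {rmorphism K -> kp})
    (jN : {rmorphism M -> N}) (th : {rmorphism K -> N}) (m : nat) (b : 'I_m -> K) (n : nat) (c : 'I_n -> N),
  [/\ spans iK b /\ indep iK b, spans jN c /\ indep jN c, coprime p n &
   [/\ forall x, al (iK x) = l x, forall x, th (iK x) = jN (j0 x) &
      forall x, x \in s -> exists y, x = al y]].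
Proof.
have one (F : fieldType) : spans (idfun : {rmorphism F -> F}) (fun _ : 'I_1 => 1) /\
    indep (idfun : {rmorphism F -> F}) (fun _ : 'I_1 => 1).
  split=> [z|c0]; first by exists (fun=> z); rewrite big_ord1 mulr1.
  by rewrite big_ord1 mulr1 => e i; rewrite ord1.
elim: s => [|a s [K [N [iK [al [jN [th [m [b [n [c [[sb ib] [sc ic] cn [alE thE sE]]]]]]]]]]]]].
  exists k, M, idfun, l, idfun, j0, 1%N, (fun=> 1), 1%N, (fun=> 1).
  by split; [apply: one | apply: one | rewrite coprimen1 | split].
have aK : algebraicOver al a.
  have [q nq rq] := l_alg a; exists (map_poly iK q); first by rewrite map_poly_eq0.
  rewrite -map_poly_comp; apply: etrans rq; congr (root _ _).
  by apply: eq_map_poly => x /=; rewrite alE.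
have [g [mg ig rg]] := algebraic_irreducible aK.
have [K1 [i1 [z [b1 [sb1 ib1 rz _ univ]]]]] := ex_adjoin_root ig.
have [al1 [al1E al1z]] := univ _ al a rg.
have [d [sd id_]] := tower_basis sb ib sb1 ib1.
have [L [f [f' [fK fK' f'Z dL]]]] := ex_fieldExt sd id_.
have cL : coprime p (\dim {:L}).
  by apply: (l_coprime (al := al1 \o f')) => x /=; rewrite f'Z rmorph1 mulr1 /= al1E alE.
have cg : coprime p (size g).-1 by move: cL; rewrite dL coprimeMr => /andP[].
have nzg : map_poly th g != 0 by rewrite map_poly_eq0 monic_neq0.
have [|q [iq qg cq]] := ex_coprime_factor p_pr nzg; first by rewrite size_map_poly.
have [N1 [jn [y [c1 [sc1 ic1 ry _ _]]]]] := ex_adjoin_root iq.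
have rgy : root (map_poly (jn \o th) g) y.
  have := qg; rewrite -(dvdp_map jn) -map_poly_comp => /dvdpP[q' ->].
  by rewrite rootM ry orbT.
have [th1 [th1E _]] := univ _ (jn \o th) y rgy.
have [e [se ie]] := tower_basis sc ic sc1 ic1.
exists K1, N1, (i1 \o iK), al1, (jn \o jN), th1, _, d, _, e; split=> //.
  by rewrite coprimeMr cq.
split=> [x|x|x] /=; first by rewrite al1E alE.
  by rewrite th1E /= thE.
by rewrite inE => /orP[/eqP ->|/sE[y' ->]]; [exists z | exists (i1 y')].
Qed.

Lemma ex_prime_to_p_extension (s : seq kp) :
  exists (M' : fieldExtType M) (K : fieldType) (iK : {rmorphism k -> K}) (al : {rmorphism K -> kp})
    (th : {rmorphism K -> M'}),
  [/\ coprime p (\dim {:M'}), forall x, al (iK x) = l x, forall x, th (iK x) = (j0 x)%:A &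
      forall x, x \in s -> exists y, x = al y].
Proof.
have [K [N [iK [al [jN [th [m [b [n [c [_ [sc ic] cn [alE thE sE]]]]]]]]]]]] := ex_prime_to_p_compositum s.
have [L [f [f' [fK fK' f'Z dL]]]] := ex_fieldExt sc ic.
exists L, K, iK, al, (f \o th); split=> //; first by rewrite dL.
by move=> x; apply: (can_inj fK'); rewrite /= fK f'Z rmorph1 mulr1 thE.
Qed.

End PrimeToPExtension.

Section UpperBound.

Variables (p : nat) (k kp : fieldType) (l : {rmorphism k -> kp}) (P' P : finGroupType)
  (pi : {morphism [set: P'] >-> P}).
Hypotheses (p_pr : prime p) (l_alg : forall a, algebraicOver l a)
  (l_coprime : forall (Q : fieldExtType k) (al : {rmorphism Q -> kp}), (forall c, al c%:A = l c) ->
    coprime p (\dim {:Q})).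
Variables (D : nat) (rV : mx_representation kp [set: P'] D).
Hypothesis rV_faithful : forall g, pi g = 1%g -> g != 1%g -> rV g != 1%:M.

Lemma edp_obj_le (K : ext k) (E : torsor P K) (M : ext K) (xi : lift_obj pi E M) :
  ele (@edp_obj p K (Lift pi E) M xi) (Some D).
Proof.
pose s := [seq rV u.1 u.2.1 u.2.2 | u : P' * ('I_D * 'I_D)].
have [M' [R [iR [al [th [cM alE thE sE]]]]]] :=
  @ex_prime_to_p_extension p k kp M l (ext_map M \o ext_map K) p_pr l_alg l_coprime s.
have /choice[r rE] (u : P' * ('I_D * 'I_D)) : exists y, rV u.1 u.2.1 u.2.2 = al y.
  by apply: sE; apply/mapP; exists u; rewrite ?mem_enum.
pose rho1 g : 'M[R]_D := \matrix_(i, j) r (g, (i, j)).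
have rho1E g : map_mx al (rho1 g) = rV g by apply/matrixP => i j; rewrite !mxE -rE.
pose rho g := map_mx th (rho1 g).
have rhoM g h : rho (g * h)%g = rho g *m rho h.
  rewrite /rho -map_mxM; congr map_mx; apply: (map_mx_inj (f := al)).
  by rewrite map_mxM !rho1E repr_mxM ?inE.
have rhoone : rho 1%g = 1%:M.
  rewrite /rho -[RHS](map_mx1 th); congr map_mx; apply: (map_mx_inj (f := al)).
  by rewrite map_mx1 rho1E repr_mx1.
have [T' [f [fZ fact]]] := ex_base_change (GRing.in_alg M' : {rmorphism M -> M'}) (lift_torsor xi).
have lmZ (c : K) (a : E) : (f \o lift_map xi) (c *: a) = ext_map (ext_over M') c *: (f \o lift_map xi) a.
  by rewrite /= lift_mapZ fZ.
have lmA (a : E) (g : P') : (f \o lift_map xi) (torsor_act E a (pi g)) = torsor_act T' ((f \o lift_map xi) a) g.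
  by rewrite /= lift_map_act fact.
pose xi' : lift_obj pi E (ext_over M') := @LiftObj P' P pi K E (ext_over M') T' (f \o lift_map xi) lmZ lmA.
have : ele (@ed_obj K (Lift pi E) (ext_over M') xi') (Some D).
  apply: (@ed_obj_le P' P pi K E (ext_over M') xi' D rho) => // [g i j|g pg g1].
    rewrite mxE; have [q nq rq] := l_alg (al (rho1 g i j)).
    exists (map_poly (ext_map K) q); first by rewrite map_poly_eq0.
    have riR : root (map_poly iR q) (rho1 g i j).
      rewrite -(fmorph_root al) -map_poly_comp; apply: etrans rq; congr (root _ _).
      by apply: eq_map_poly => x /=; rewrite alE.
    rewrite -(fmorph_root th) -map_poly_comp in riR.
    rewrite -map_poly_comp; apply: etrans riR; congr (root _ _).
    by apply: eq_map_poly => x /=; rewrite thE.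
  apply: contraNneq (rV_faithful pg g1) => e; rewrite -rho1E.
  have -> : rho1 g = 1%:M by apply: (map_mx_inj (f := th)); rewrite map_mx1.
  by rewrite map_mx1.
case dE : ed_obj => [d|] // dD; apply: (@ele_einf _ d) => //.
exists M', xi'; split=> //; exists f; split=> //.
Qed.

End UpperBound.

(** * Representations of p-groups over a field with p-th roots of unity *)

Section RankOfSemisimple.

Variables (k : fieldType) (gT : finGroupType) (G : {group gT}) (n : nat) (rG : mx_representation k G n).

(** The whole sum is a direct sum of some of the [U i], and so is a complement of [X] in it. *)
Lemma rank_submodule_of_sum (d : nat) (I : finType) (U : I -> 'M[k]_n) m (X : 'M[k]_(m, n)) :
  (forall i, mxsimple rG (U i)) -> (forall i, \rank (U i) = d) -> mxmodule rG X ->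
  (X <= \sum_i U i)%MS -> (d %| \rank X)%N.
Proof.
move=> sU rU mX sX.
have [J [JE dJ]] := sum_mxsimple_direct_sub sU (eqmx_refl _).
have [J' [J'E dJ']] := sum_mxsimple_direct_compl sU mX sX.
have dsum (A : {set I}) : (d %| \sum_(i in A) \rank (U i))%N.
  by apply: dvdn_sum => i _; rewrite rU.
have e1 : \rank (\sum_i U i)%MS = (\sum_(i in J) \rank (U i))%N.
  by rewrite -JE; apply/eqP; move: dJ; rewrite mxdirectE.
have e2 : \rank (\sum_i U i)%MS = (\rank X + \sum_(i in J') \rank (U i))%N.
  by rewrite -J'E; apply/eqP; move: dJ'; rewrite mxdirectE.
by rewrite -(dvdn_addl _ (dsum J')) -e2 e1.
Qed.

Lemma rank_of_simples (d : nat) :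
  ([pchar k]^'.-group G)%g ->
  (forall U : 'M[k]_n, mxsimple rG U -> (d %| \rank U)%N) -> (d %| n)%N.
Proof.
move=> pG dU; have /classicP : classically (d %| n)%N; last by case: (d %| n)%N => //; apply.
apply: classic_bind (mx_reducible_semisimple (mxmodule1 rG) (mx_Maschke_pchar rG pG)).
case=> I U /= sU UE dxU; move=> b0; apply.
rewrite -(mxrank1 k n) -UE (mxdirectP dxU) /=.
by apply: dvdn_sum => i _; apply: dU.
Qed.

End RankOfSemisimple.

(* Frobenius reciprocity in matrix form: the module induced from a submodule S
   of W over H embeds into the direct sum of the twists of W by the powers of
   the character th of G / H, realized on p x n matrices. *)
Section Induced.

Variables (F : fieldType) (p : nat) (w : F) (gT : finGroupType) (G H : {group gT}) (sHG : H \subset G).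
Hypotheses (p_pr : prime p) (w_prim : p.-primitive_root w) (p_neq0 : p%:R != 0 :> F).
Variables (n : nat) (rG : mx_representation F G n) (th : gT -> F) (g0 : gT).
Hypotheses (thM : {in G &, {morph th : x y / (x * y)%g >-> x * y}})
  (thH : forall x, x \in G -> th x = 1 -> x \in H)
  (th_w : forall x, x \in G -> exists a : 'I_p, th x = w ^+ a) (g0G : g0 \in G) (thg0 : th g0 = w).
Variables (S : 'M[F]_n).
Hypotheses (S_mod : mxmodule (subg_repr rG sHG) S) (irr : mx_irreducible rG).

Let Dg g : 'M[F]_p := diag_mx (\row_i th g ^+ i).
Let R g : 'M[F]_(p * n) := lin_mx (mulmxr (rG g) \o mulmx (Dg g)).
Let K (E : 'cV[F]_p) : 'M[F]_(n, p * n) := lin1_mx (mxvec \o mulmx E).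
Let Ez (z : F) : 'cV[F]_p := \col_i z ^+ i.

Let w0 : w != 0.
Proof.
apply/eqP => w00; have := prim_expr_order w_prim; rewrite w00 expr0n.
by rewrite (gtn_eqF (prime_gt0 p_pr)) => /esym/eqP; rewrite oner_eq0.
Qed.

Let th1 : th 1%g = 1.
Proof.
have [a e] := th_w (group1 G); have := thM (group1 G) (group1 G); rewrite mulg1 => e1.
have nz : th 1%g != 0 by rewrite e expf_neq0 // w0.
by apply: (mulfI nz); rewrite -e1 mulr1.
Qed.

Let R_repr : mx_repr G R.
Proof.
split=> [|x y xG yG].
  apply/row_matrixP => i; rewrite !rowE -(vec_mxK (delta_mx 0 i)) mul_vec_lin /= mulmx1 repr_mx1 mulmx1.
  congr mxvec; rewrite -[RHS]mul1mx; congr (_ *m _); apply/matrixP => u v.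
  by rewrite !mxE th1 expr1n.
apply/row_matrixP => i; rewrite !rowE mulmxA -(vec_mxK (delta_mx 0 i)) !mul_vec_lin /=.
rewrite repr_mxM // !mulmxA; congr (mxvec (_ *m _ *m _)).
have -> : Dg (x * y)%g = Dg y *m Dg x.
  rewrite mulmx_diag; congr diag_mx; apply/rowP => u; rewrite !mxE thM // exprMn.
  by rewrite mulrC.
by [].
Qed.
Let RR := MxRepresentation R_repr.

Let KE m (u : 'M_(m, n)) E i : row i u *m K E = mxvec (E *m row i u).
Proof. by rewrite mul_rV_lin1. Qed.

Let RE X g : mxvec X *m R g = mxvec (Dg g *m X *m rG g).
Proof. by rewrite mul_vec_lin. Qed.

Let K_R E g : K E *m R g = rG g *m K (Dg g *m E).
Proof.
apply/row_matrixP => i; rewrite [RHS]row_mul KE -[K E]mul1mx -mulmxA row_mul mulmxA KE RE.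
by rewrite -!mulmxA -row_mul mul1mx.
Qed.

Let K_scale c E : K (c *: E) = c *: K E.
Proof.
apply/row_matrixP => i; rewrite !rowE -scalemxAr !mul_rV_lin1 /= -scalemxAl.
by rewrite linearZ.
Qed.

Let Dg_Ez g z : Dg g *m Ez z = Ez (th g * z).
Proof. by apply/matrixP => u v; rewrite mul_diag_mx !mxE exprMn. Qed.

Let Dg_delta g (i : 'I_p) : Dg g *m delta_mx i 0 = th g ^+ i *: (delta_mx i 0 : 'cV_p).
Proof.
apply/matrixP => u v; rewrite mul_diag_mx !mxE; case: eqVneq => [->|_] //=.
by rewrite !mulr0.
Qed.

Let TF (f : 'rV[F]_p) : 'M[F]_(p * n, n) := lin1_mx (mulmx f \o vec_mx).

Let K_TF E f : K E *m TF f = ((f *m E) 0 0)%:M.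
Proof.
apply/row_matrixP => i; rewrite !rowE mulmxA !mul_rV_lin1 /= mxvecK mulmxA.
by rewrite [in LHS](mx11_scalar (f *m E)) mul_scalar_mx mul_mx_scalar.
Qed.

Let J_free (i : 'I_p) : row_free (K (delta_mx i 0)).
Proof.
apply/row_freeP; exists (TF (delta_mx 0 i)); rewrite K_TF mul_delta_mx mxE !eqxx.
by [].
Qed.

Let J_simple (i : 'I_p) : mxsimple RR <<K (delta_mx i 0)>>%MS.
Proof.
have [n0 irrG] := (mx_irrP rG).1 irr.
split=> [||U mU sU nzU].
- rewrite (eqmx_module _ (genmxE _)); apply/mxmoduleP => g gG.
  by rewrite /= K_R Dg_delta K_scale -scalemxAr scalemx_sub ?submxMl.
- by rewrite -mxrank_eq0 genmxE (eqP (J_free i)) -lt0n.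
move: sU; rewrite genmxE => /submxP[A UE].
have mA : mxmodule rG A.
  apply/mxmoduleP => g gG; have := mxmoduleP mU g gG.
  rewrite /= UE -mulmxA K_R Dg_delta K_scale -!scalemxAr.
  have [a thg] := th_w gG.
  have nz : th g ^+ i != 0 by rewrite thg !expf_neq0 // w0.
  by rewrite (eqmx_scale _ nz) mulmxA submxMfree // J_free.
have nzA : A != 0 by apply: contraNneq nzU => A0; rewrite UE A0 mul0mx.
have fA : row_full <<A>>%MS.
  apply: irrG; first by rewrite (eqmx_module _ (genmxE _)).
  by rewrite -mxrank_eq0 genmxE mxrank_eq0.
have /submxP[B BE] : (1%:M <= A)%MS by move: fA; rewrite -sub1mx genmxE.
by rewrite genmxE UE -{1}[K _]mul1mx BE -mulmxA submxMl.
Qed.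

(** The vectors [Ez (w ^+ a)] are permuted by the diagonal matrices like the cosets of [H], which
    exhibits the induced module; the standard basis vectors are eigenvectors, which exhibits the
    twists by powers of [th]. *)
Let SK (a : 'I_p) := (S *m rG (g0 ^+ a)%g *m K (Ez (w ^+ a))).
Let Y := (\sum_a <<SK a>>)%MS.

Let th_g0X a : th (g0 ^+ a)%g = w ^+ a.
Proof.
elim: a => [|a IH]; first by rewrite expg0 th1.
by rewrite expgSr thM ?groupX // IH thg0 exprSr.
Qed.

Let Y_module : mxmodule RR Y.
Proof.
apply/mxmoduleP => g gG; rewrite sumsmxMr; apply/sumsmx_subP => a _.
have [c cE] : exists c : 'I_p, th (g0 ^+ a * g)%g = w ^+ c by apply: th_w; rewrite groupM ?groupX.
apply: (sumsmx_sup c) => //; rewrite (eqmxMr _ (genmxE _)) genmxE.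
rewrite /SK /= -[S *m _ *m _ *m _]mulmxA K_R Dg_Ez.
have -> : th g * w ^+ a = w ^+ c by rewrite -cE thM ?groupX // th_g0X mulrC.
rewrite mulmxA -[S *m _ *m rG g]mulmxA -repr_mxM ?groupX //.
have hH : (g0 ^+ a * g * (g0 ^+ c)^-1)%g \in H.
  apply: thH; first by rewrite !groupM ?groupV ?groupX.
  have nz : w ^+ c != 0 by rewrite expf_neq0 // w0.
  apply: (mulIf nz); rewrite mul1r -{1}th_g0X -thM ?groupM ?groupV ?groupX //.
  by rewrite mulgKV.
rewrite -[(g0 ^+ a * g)%g](mulgKV (g0 ^+ c)%g) repr_mxM ?groupX //; last by rewrite (subsetP sHG).
by rewrite !mulmxA !submxMr //; apply: (mxmoduleP S_mod _ hH).
Qed.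

(** Orthogonality of the p-th roots of unity: the functional with entries w^(-b i) kills all
    summands but the b-th, on which it is multiplication by the invertible scalar p. *)
Let Y_rank : \rank Y = (p * \rank S)%N.
Proof.
have rK (a b : 'I_p) : K (Ez (w ^+ a)) *m TF (\row_i (w ^+ b) ^- i) = (if a == b then p%:R else 0)%:M.
  rewrite K_TF; congr (_ %:M); rewrite mxE.
  rewrite (eq_bigr (fun i : 'I_p => (w ^+ a / w ^+ b) ^+ i)); last first.
    by move=> i _; rewrite !mxE exprMn exprVn mulrC.
  have [->|nab] := eqVneq a b.
    rewrite divff; last by rewrite expf_neq0 ?w0.
    rewrite (eq_bigr (fun=> 1)); last by move=> i _; rewrite expr1n.
    by rewrite sumr_const card_ord.
  have nz : w ^+ a / w ^+ b - 1 != 0.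
    apply/negP; rewrite subr_eq0 => /eqP e; move/negP: nab; apply.
    have : w ^+ a == w ^+ b by apply/eqP; rewrite -[RHS]mul1r -e mulfVK // expf_neq0.
    by rewrite (eq_prim_root_expr w_prim) !modn_small.
  apply: (mulfI nz); rewrite mulr0 -subrX1 exprMn exprVn -!exprM ![(_ * p)%N]mulnC !exprM.
  by rewrite (prim_expr_order w_prim) !expr1n invr1 mulr1 subrr.
have rSK a : \rank (SK a) = \rank S.
  have fK : row_free (K (Ez (w ^+ a))).
    apply/row_freeP; exists (p%:R^-1 *: TF (\row_i (w ^+ a) ^- i)).
    by rewrite -scalemxAr rK eqxx scale_scalar_mx mulVf.
  rewrite /SK !mxrankMfree //; rewrite row_free_unit.
  by apply: repr_mx_unit; rewrite groupX.
have dx : mxdirect (\sum_a <<SK a>>)%MS.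
  apply/mxdirect_sumsP => b _; apply/eqP; rewrite -submx0; apply/rV_subP => v.
  rewrite sub_capmx genmxE => /andP[/submxP[u vE] /sub_sumsmxP[f vE2]].
  have : v *m TF (\row_i (w ^+ b) ^- i) = 0.
    rewrite vE2 mulmx_suml big1 // => a nab; rewrite -mulmxA.
    have /submxP[B ->] : (<<SK a>> <= SK a)%MS by rewrite genmxE.
    by rewrite /SK -!mulmxA rK (negbTE nab) raddf0 !mulmx0.
  rewrite vE /SK -!mulmxA rK eqxx => e; have : p%:R *: (u *m (S *m rG (g0 ^+ b)%g)) = 0.
    by rewrite -[RHS]e -mul_mx_scalar !mulmxA.
  move/eqP; rewrite scaler_eq0 (negbTE p_neq0) /= => /eqP e'.
  by rewrite submx0 !mulmxA -[u *m S *m _]mulmxA e' mul0mx.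
rewrite /Y (mxdirectP dx) /= (eq_bigr (fun=> \rank S)); last by move=> a _; rewrite genmxE.
by rewrite sum_nat_const card_ord.
Qed.

Lemma induced_rank_dvd : (n %| p * \rank S)%N.
Proof.
rewrite -Y_rank; apply: (@rank_submodule_of_sum _ _ _ _ RR n _ (fun i => <<K (delta_mx i 0)>>%MS)) => //.
  by move=> i /=; rewrite genmxE (eqP (J_free i)).
apply/rV_subP => v _; rewrite -(vec_mxK v).
have -> : mxvec (vec_mx v) = \sum_i row i (vec_mx v) *m K (delta_mx i 0).
  under eq_bigr do rewrite mul_rV_lin1 /=.
  rewrite -linear_sum /=; congr mxvec; apply/matrixP => u t.
  rewrite summxE (bigD1 u) //= big1 => [|i iu].
    by rewrite addr0 !mxE big_ord1 !mxE !eqxx mul1r.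
  by rewrite mxE big_ord1 !mxE eq_sym (negbTE iu) mul0r.
by apply: summx_sub => i _; rewrite (sumsmx_sup i) // genmxE submxMl.
Qed.

End Induced.

(** Only the p-th roots of unity are in [F], so the module need not be absolutely irreducible. By
    induction a simple constituent [S] over a maximal subgroup, of index p, has p-power rank, and
    the dimension divides p times that rank. *)
Lemma irr_dim_pnat (F : fieldType) (p : nat) (w : F) (gT : finGroupType) (G : {group gT}) n
    (rG : mx_representation F G n) :
  prime p -> p.-primitive_root w -> p%:R != 0 :> F -> (p.-group G)%g ->
  mx_irreducible rG -> (p.-nat n)%N.
Proof.
move=> p_pr w_prim pn0; have [m] := ubnP #|G|.
elim: m G n rG => // m IH G n rG cG pG irr; have [n0 irrG] := (mx_irrP rG).1 irr.
have [G1|[M maxM _]] := maximal_exists (sub1G G).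
  pose i0 := Ordinal n0; have dn : row_full (delta_mx i0 i0 : 'M[F]_n).
    apply: irrG; last by rewrite -mxrank_eq0 mxrank_delta.
    apply/mxmoduleP => x xG; have -> : x = 1%g by apply/set1gP; rewrite G1.
    by rewrite repr_mx1 mulmx1.
  by move: dn; rewrite /row_full mxrank_delta => /eqP <-.
have prM := maxgroupp maxM; have nMG := p_maximal_normal pG maxM.
have iM := p_maximal_index pG maxM; have sMG := normal_sub nMG.
have nz1 : (1%:M : 'M[F]_n) != 0 by rewrite -mxrank_eq0 mxrank1 -lt0n.
apply: (mxsimple_exists (mxmodule1 (subg_repr rG sMG)) nz1) => -[S sS _].
have pS : (p.-nat (\rank S))%N.
  apply: (IH M _ (submod_repr (mxsimple_module sS))).
  - by apply: leq_trans (proper_card prM) _; rewrite -ltnS.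
  - exact: pgroupS sMG pG.
  - exact/submod_mx_irr.
have [_ [g0 g0G g0M]] := properP prM.
pose t := coset M g0; have nM x : x \in G -> x \in 'N(M)%g := subsetP (normal_norm nMG) x.
have cQ : #|(G / M)%g| = p by rewrite card_quotient ?normal_norm.
have tQ : t \in (G / M)%g by apply: mem_quotient.
have t1 : t != 1%g by apply: contraNneq g0M => /coset_idr -> //; apply: nM.
have ot : #[t]%g = p.
  have [_ dp] := primeP p_pr; have : (#[t]%g %| p)%N by rewrite -cQ order_dvdG.
  by case/dp/orP => /eqP // /eqP; rewrite order_eq1 (negbTE t1).
have QE : (G / M)%g = <[t]>%g.
  by apply/esym/eqP; rewrite eqEcard cycle_subG tQ cQ -orderE ot leqnn.
have /choice[c cE] x : exists i, x \in G -> coset M x = (t ^+ i)%g.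
  case: (boolP (x \in G)) => [xG|]; last by exists 0%N.
  have /cycleP[i e] : coset M x \in <[t]>%g by rewrite -QE mem_quotient.
  by exists i.
pose th x := w ^+ c x.
have tw i j : (t ^+ i = t ^+ j)%g -> w ^+ i = w ^+ j.
  by move/eqP; rewrite eq_expg_mod_order ot => e; apply/eqP; rewrite (eq_prim_root_expr w_prim).
have : (n %| p * \rank S)%N.
  apply: (@induced_rank_dvd F p w gT G M sMG p_pr w_prim pn0 n rG th g0) => //.
  - by move=> x y xG yG; rewrite /th -exprD; apply: tw; rewrite expgD -!cE ?groupM // morphM ?nM.
  - move=> x xG /eqP; rewrite -(prim_order_dvd w_prim) -ot order_dvdn -cE // => /eqP.
    by apply: coset_idr; apply: nM.
  - move=> x xG; exists (Ordinal (ltn_pmod (c x) (prime_gt0 p_pr))).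
    by rewrite /= (prim_expr_mod w_prim).
  - by rewrite /th -[RHS]expr1; apply: tw; rewrite expg1 -cE.
  - exact: mxsimple_module sS.
by move/pnat_dvd; apply; rewrite pnatM pnat_id.
Qed.

(** Since X^p - 1 splits over [F], the factors at [rG c] multiply to 0, so one of them is not
    invertible; by Schur's lemma it is 0. *)
Lemma irr_central_scalar (F : fieldType) (p : nat) (w : F) (gT : finGroupType) (G : {group gT}) n
    (rG : mx_representation F G n) c :
  p.-primitive_root w -> mx_irreducible rG -> c \in 'Z(G)%g -> (c ^+ p = 1)%g ->
  exists a : nat, rG c = (w ^+ a)%:M.
Proof.
move=> wp irr /centerP[cG cc] cp; have [n0 _] := (mx_irrP rG).1 irr.
case: n rG irr n0 => // n rG irr _; apply: contrapT => no.
have un a : rG c - (w ^+ a)%:M \in unitmx.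
  apply: (mx_Schur irr).
    apply/centgmxP => x xG; rewrite mulmxBl mulmxBr scalar_mxC; congr (_ - _).
    by rewrite -!repr_mxM // cc.
  by apply/negP; rewrite subr_eq0 => /eqP e; apply: no; exists a.
have : horner_mx (rG c) (\prod_(0 <= a < p) ('X - (w ^+ a)%:P)) \in unitmx.
  rewrite rmorph_prod; apply: (@big_ind _ (fun A : 'M_n.+1 => A \in unitmx)) => [|A B|a _].
  - exact: unitmx1.
  - by move=> uA uB; rewrite -[A * B]/(A *m B) unitmx_mul uA.
  - by rewrite rmorphB /= horner_mx_X horner_mx_C.
rewrite (factor_Xn_sub_1 wp) rmorphB rmorphXn rmorph1 /= horner_mx_X.
rewrite -repr_mxX // cp repr_mx1 subrr.
by rewrite -[_ \in _]/(0 \is a GRing.unit) unitr0.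
Qed.

(** A nontrivial normal subgroup of a p-group meets the center, hence contains a central element of
    order p; this is applied to the kernel inside [N]. *)
Lemma faithful_of_center (F : fieldType) (p : nat) (gT : finGroupType) (N : {group gT}) n
    (rG : mx_representation F [set: gT] n) :
  prime p -> (p.-group [set: gT])%g -> (N <| [set: gT])%g ->
  (forall c, c \in N -> c \in 'Z([set: gT])%g -> (c ^+ p = 1)%g -> rG c = 1%:M -> c = 1%g) ->
  mx_faithful (subg_repr rG (subsetT N)).
Proof.
move=> p_pr pG nN H; rewrite /mx_faithful rker_subg.
have nK : (N :&: rker rG <| [set: gT])%g by apply: normalI nN (rker_normal rG).
apply: contrapT => /negP; rewrite subG1 => K1.
have Z1 := meet_center_nil (pgroup_nil pG) nK K1.
have pZ : (p.-group (N :&: rker rG :&: 'Z([set: gT])))%g by apply: pgroupS pG; apply: subsetT.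
have [_ pd _] := pgroup_pdiv pZ Z1.
have [c cK oc] := Cauchy p_pr pd; move: cK; rewrite !inE => /andP[/andP[cN cR] cZ].
have c1 : c = 1%g.
  apply: H => //.
  - by rewrite !inE.
  - by rewrite -oc expg_order.
  - by move: cR => /eqP; rewrite mul1mx.
by move: oc (prime_gt1 p_pr); rewrite c1 order1 => <-.
Qed.

Section SubmoduleScalars.

Variables (F : fieldType) (gT : finGroupType) (G : {group gT}) (n : nat) (rG : mx_representation F G n)
  (U : 'M[F]_n) (mU : mxmodule rG U).

Lemma submod_scalar x a : x \in G -> submod_repr mU x = a%:M ->
  forall m (v : 'M_(m, n)), (v <= U)%MS -> v *m rG x = a *: v.
Proof.
move=> xG e m v vU; rewrite -{1}(in_submodK vU) -val_submodJ //= e mul_mx_scalar linearZ /=.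
by rewrite in_submodK.
Qed.

Lemma submod_scalar_inv x a : x \in G -> U *m rG x = a *: U -> submod_repr mU x = a%:M.
Proof.
move=> xG e; apply: (can_inj (@val_submodK _ _ U _)).
rewrite -[submod_repr mU x]mul1mx val_submodJ // -[a%:M]mul1mx mul_mx_scalar linearZ /=.
have /submxP[B ->] : (val_submod (1%:M : 'M_(\rank U)) <= U)%MS by apply: val_submodP.
by rewrite -mulmxA e -scalemxAr.
Qed.

End SubmoduleScalars.

Lemma repr_scalarX (F : fieldType) (gT : finGroupType) (G : {group gT}) n
    (rG : mx_representation F G n) c (a : F) i : c \in G -> rG c = a%:M -> rG (c ^+ i)%g = (a ^+ i)%:M.
Proof.
move=> cG e; elim: i => [|i IH]; first by rewrite expg0 repr_mx1.
by rewrite expgS repr_mxM ?groupX // IH e -scalar_mxM exprS.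
Qed.

Section MinimalFamily.

Variables (F : fieldType) (p : nat) (w : F) (gT : finGroupType) (N : {group gT}).
Hypotheses (p_pr : prime p) (w_prim : p.-primitive_root w) (p_neq0 : p%:R != 0 :> F).
Hypotheses (pG : (p.-group [set: gT])%g) (nN : (N <| [set: gT])%g).

Let pG' : ([pchar F]^'.-group [set: gT])%g.
Proof.
apply: sub_in_pnat pG => q _; rewrite inE => /eqP ->; rewrite !inE p_pr /=.
by [].
Qed.

Let scal n (rG : mx_representation F [set: gT] n) c : mx_irreducible rG ->
  c \in 'Z([set: gT])%g -> (c ^+ p = 1)%g -> exists a : 'I_p, rG c = (w ^+ a)%:M.
Proof.
move=> irr cZ cp; have [a ->] := irr_central_scalar w_prim irr cZ cp.
exists (Ordinal (ltn_pmod a (prime_gt0 p_pr))); by rewrite /= (prim_expr_mod w_prim).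
Qed.

(* The blocks of a minimal N-faithful representation are separated by central
   elements c_i, and replacing a block by any irreducible module on which c_i
   is nontrivial keeps it N-faithful; hence the block has the least possible
   dimension, and dimensions of irreducible modules are powers of p. *)
Lemma ex_minimal_family : exists (D r : nat) (n : 'I_r -> nat)
    (rho : forall i, mx_representation F [set: gT] (n i)) (c : 'I_r -> gT) (om : 'I_r -> F) (e : 'I_r -> nat),
  [/\ rdim F N = Some D, D = (\sum_i n i)%N, forall i, n i = (p ^ e i)%N,
    (forall g, g \in N -> (forall i, rho i g = 1%:M) -> g = 1%g) & forall i, [/\ c i \in 'Z([set: gT])%g /\ c i \in N /\ (c i ^+ p = 1)%g, rho i (c i) = (om i)%:M, om i ^+ p = 1, om i != 1 &
      (forall j, j != i -> rho j (c i) = 1%:M) /\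
      forall m (rU : mx_representation F [set: gT] m) a, rU (c i) = a%:M -> a ^+ p = 1 -> a != 1 ->
        (n i %| m)%N]].
Proof.
pose dims n := exists rV : mx_representation F [set: gT] n, mx_faithful (subg_repr rV (subsetT N)).
have ex_dims : exists n, `[< dims n >].
  exists (gcard [set: gT]); apply/asboolP; exists (regular_repr F [set: gT]%G).
  exact: subg_mx_faithful (regular_mx_faithful _ _).
have [D dD minD] := ex_minnP ex_dims; have {dD}[rV fV] := asboolP _ dD.
have rD : rdim F N = Some D.
  apply: ele_anti; first by apply: (@ele_einf _ D) => //; exists D, rV.
  by apply: einf_ge => m [m' [rW [fW [->]]]]; apply: minD; apply/asboolP; exists rW.
have rV1 c : c \in N -> rV c = 1%:M -> c = 1%g.
  move=> cN c1; apply/set1gP/(subsetP fV).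
  by rewrite rker_subg inE cN; apply/rkerP; rewrite inE.
pose concl := exists (r : nat) (n : 'I_r -> nat)
    (rho : forall i, mx_representation F [set: gT] (n i)) (c : 'I_r -> gT) (om : 'I_r -> F) (e : 'I_r -> nat),
  [/\ D = (\sum_i n i)%N, forall i, n i = (p ^ e i)%N,
    (forall g, g \in N -> (forall i, rho i g = 1%:M) -> g = 1%g) & forall i, [/\ c i \in 'Z([set: gT])%g /\ c i \in N /\ (c i ^+ p = 1)%g, rho i (c i) = (om i)%:M, om i ^+ p = 1, om i != 1 &
      (forall j, j != i -> rho j (c i) = 1%:M) /\
      forall m (rU : mx_representation F [set: gT] m) a, rU (c i) = a%:M -> a ^+ p = 1 -> a != 1 ->
        (n i %| m)%N]].
suff [r [n [rho [c [om [e [h1 h2 h3 h4]]]]]]] : concl by exists D, r, n, rho, c, om, e.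
apply/asboolP; apply: (mx_reducible_semisimple (mxmodule1 rV) (mx_Maschke_pchar rV pG')) => -[I U /= sU UE dU].
apply/asboolP.
pose mU i := mxsimple_module (sU i); pose rho i := submod_repr (mU i).
have irr i : mx_irreducible (rho i) by apply/submod_mx_irr.
have sumD : D = (\sum_i \rank (U i))%N by rewrite -(mxdirectP dU) /= UE mxrank1.
have all1 c : (forall i, rho i c = 1%:M) -> rV c = 1%:M.
  move=> h; have /sub_sumsmxP[f fE] : (1%:M <= \sum_i U i)%MS by rewrite UE.
  rewrite -[LHS]mul1mx fE mulmx_suml; apply: eq_bigr => i _.
  by rewrite (submod_scalar (in_setT c) (h i)) ?scale1r // submxMl.
pose W s := (\sum_(j | j != s) U j)%MS.
have mW s : mxmodule rV (W s) by apply: sumsmx_module => j _; apply: mU.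
have UW s j : j != s -> (U j <= W s)%MS by move=> js; apply: (sumsmx_sup j).
have rW s : (\rank (W s) <= D - \rank (U s))%N.
  have le : (\rank (W s) <= \sum_(j | j != s) \rank (U j))%N.
    by rewrite /W; elim/big_rec2: _ => [|j x y _ IH]; rewrite ?mxrank0 // (leq_trans (mxrank_adds_leqif _ _)) ?leq_add2l.
  by apply: leq_trans le _; rewrite [X in (_ <= X - _)%N]sumD [X in (_ <= X - _)%N](bigD1 s) //= addKn.
have rU0 s : (0 < \rank (U s))%N by rewrite lt0n mxrank_eq0; case: (sU s).
have rUD s : (\rank (U s) <= D)%N by rewrite [X in (_ <= X)%N]sumD (bigD1 s) //= leq_addr.
have W1 s c : c \in 'Z([set: gT])%g -> (c ^+ p = 1)%g -> submod_repr (mW s) c = 1%:M ->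
    forall j, j != s -> rho j c = 1%:M.
  move=> cZ cp h j js; apply: submod_scalar_inv; rewrite ?inE //.
  by rewrite (submod_scalar _ h) ?inE // UW.
(* The sum of the other blocks has smaller dimension than the minimum, so it is not faithful on [N].
   A central witness of this must act nontrivially on block [s]. *)
have /choice[c cE] s : exists c, [/\ c \in N, c \in 'Z([set: gT])%g, (c ^+ p = 1)%g,
    rho s c <> 1%:M & forall j, j != s -> rho j c = 1%:M].
  apply: contrapT => no.
  have : (D <= \rank (W s))%N.
    apply: minD; apply/asboolP; exists (submod_repr (mW s)); apply: (faithful_of_center p_pr) => //.
    move=> c cN cZ cp /(W1 s c cZ cp) h; apply: rV1 => //; apply: all1 => j.
    case: (eqVneq j s) => [->|/h //]; apply: contrapT => ns; apply: no; by exists c.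
  by move: (rW s) (rU0 s) (rUD s); lia.
have /choice[a aE] s : exists a : 'I_p, rho s (c s) = (w ^+ a)%:M.
  by have [_ cZ cp _ _] := cE s; apply: scal.
have om1 s : w ^+ a s != 1.
  by have [_ _ _ ne _] := cE s; apply/eqP => e; apply: ne; rewrite aE e.
have omp s : (w ^+ a s) ^+ p = 1 by rewrite -exprM mulnC exprM (prim_expr_order w_prim) expr1n.
have pprim (b : F) : b ^+ p = 1 -> b != 1 -> p.-primitive_root b.
  move=> bp b1; have [m pm mp] := prim_order_exists (prime_gt0 p_pr) bp.
  have [_ dp] := primeP p_pr; case/orP: (dp _ mp) => /eqP mE; last by rewrite -mE.
  by move: pm b1; rewrite mE => /prim_expr_order; rewrite expr1 => ->; rewrite eqxx.
have pn s : (p.-nat (\rank (U s)))%N := irr_dim_pnat p_pr w_prim p_neq0 pG (irr s).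
(* Put [rU] in the place of block [s]. A central element of order dividing p that acts trivially on
   the new module agrees on all blocks with a power of [c s], and [rU] shows that this power is
   trivial. Minimality gives an inequality, which between powers of [p] is a divisibility. *)
have exch s m (rU : mx_representation F [set: gT] m) b : mx_irreducible rU ->
    rU (c s) = b%:M -> b ^+ p = 1 -> b != 1 -> (\rank (U s) %| m)%N.
  move=> irU Ub bp b1; have pm := irr_dim_pnat p_pr w_prim p_neq0 pG irU.
  have le : (\rank (U s) <= m)%N.
    pose R x := block_mx (rU x) 0 0 (submod_repr (mW s) x).
    have Rr : mx_repr [set: gT] R.
      split=> [|x y xG yG]; first by rewrite /R !repr_mx1 -scalar_mx_block.
      by rewrite /R !repr_mxM // mulmx_block !mulmx0 !mul0mx !addr0 add0r.
    have : (D <= m + \rank (W s))%N; last by move: (rW s) (rUD s); lia.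
    apply: minD; apply/asboolP; exists (MxRepresentation Rr); apply: (faithful_of_center p_pr) => //.
    move=> x xN xZ xp /=; rewrite /R scalar_mx_block => /eq_block_mx[x1 _ _ /(W1 s x xZ xp) h].
    have [l lE] := scal (irr s) xZ xp.
    have wlp : (w ^+ l) ^+ p = 1 by rewrite -exprM mulnC exprM (prim_expr_order w_prim) expr1n.
    have [i iE] := prim_rootP (pprim _ (omp s) (om1 s)) wlp.
    have [cN cZ cp _ c1] := cE s.
    have xc : x = (c s ^+ i)%g.
      apply/eqP; rewrite eq_mulgV1; apply/eqP; apply: rV1; first by rewrite groupM ?groupV ?groupX.
      apply: all1 => j; rewrite (repr_mxM (rho j) (in_setT _) (in_setT _)) (repr_mxV (rho j) (in_setT _)).
      case: (eqVneq j s) => [->|js].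
        rewrite lE iE (repr_scalarX i (in_setT _) (aE s)) mulmxV // unitmxE det_scalar unitfE !expf_neq0 //.
        by apply/eqP => w00; have := prim_expr_order w_prim; rewrite w00 expr0n (gtn_eqF (prime_gt0 p_pr)) => /esym/eqP; rewrite oner_eq0.
      by rewrite (h j js) (repr_scalarX i (in_setT _) (c1 j js)) expr1n mulmxV // unitmx1.
    have : rU x = (b ^+ i)%:M.
      by rewrite xc (repr_scalarX i (in_setT _) Ub).
    rewrite x1 => e1; have m0 : (0 < m)%N by case/(mx_irrP rU): irU.
    have b1' : b ^+ i == 1 by move/matrixP: e1 => /(_ (Ordinal m0) (Ordinal m0)); rewrite !mxE eqxx /= !mulr1n => <-.
    rewrite -(prim_order_dvd (pprim _ bp b1)) in b1'.
    by rewrite xc; have /dvdnP[q ->] := b1'; rewrite mulnC expgM cp expg1n.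
  have [q1 e1] := p_natP (pn s); have [q2 e2] := p_natP pm.
  by rewrite e1 e2 in le *; apply: dvdn_exp2l; rewrite leq_exp2l ?prime_gt1 in le.
pose ev : 'I_#|I| -> I := enum_val.
have /choice[e eE] s : exists e, \rank (U (ev s)) = (p ^ e)%N.
  by have [q qE] := p_natP (pn (ev s)); exists q.
exists #|I|, (fun s => \rank (U (ev s))), (fun s => rho (ev s)), (c \o ev), (fun s => w ^+ a (ev s)), e.
split=> //.
  by rewrite [LHS]sumD (reindex (enum_val : 'I_#|I| -> I)) //; apply: onW_bij (enum_val_bij _).
  move=> g gN h; apply: rV1 => //; apply: all1 => i.
  by rewrite -(enum_rankK i); apply: h.
move=> s; have [cN cZ cp _ c1] := cE (ev s); split=> //; split=> [j js|m rU b Ub bp b1].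
  by apply: c1; apply: contraNneq js => /enum_val_inj ->.
apply: (rank_of_simples pG' (rG := rU)) => X sX.
apply: (exch (ev s) _ (submod_repr (mxsimple_module sX)) b) => //; first exact/submod_mx_irr.
by apply: submod_scalar_inv; rewrite ?inE // Ub mul_mx_scalar.
Qed.

End MinimalFamily.

(** * The field of the generic lift after a prime-to-p extension *)

(** The conjugates of a basis and those of its dual for the trace form two mutually inverse
    matrices, so the basis has [#|G|] elements. *)
Lemma ex_galois_basis (L M : fieldType) (iM : {rmorphism M -> L}) (G : finGroupType) (ta : G -> L -> L) :
  ring_action ta -> chr_coords ta -> (forall z, (forall g, ta g z = z) -> exists c, z = iM c) ->
  (forall g c, ta g (iM c) = iM c) -> exists b : 'I_#|G| -> L, spans iM b /\ indep iM b.
Proof.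
move=> hta [n [a [b ab]]] fixM taM.
have sb : spans iM b.
  move=> z; have /choice[c cE] j : exists c, rtrace ta (z * a j) = iM c.
    by apply: fixM => g; apply: rtrace_fixed.
  exists c; rewrite {1}[z](chr_decomp hta _ (@mulrC L) ab).
  by apply: eq_bigr => j _; rewrite cE.
have [m [c [sc ic]]] := spans_minimal sb.
suff mE : m = #|G| by rewrite -mE; exists c.
have /choice[k kE] j : exists k : 'I_m -> M, b j = \sum_i iM (k i) * c i := sc (b j).
pose a' i := \sum_j a j * iM (k j i).
have ac g : \sum_i a' i * ta g (c i) = (g == 1%g)%:R.
  rewrite -ab; under eq_bigr do rewrite mulr_suml.
  rewrite exchange_big /=; apply: eq_bigr => j _; rewrite kE (ract_sum hta) mulr_sumr.
  by apply: eq_bigr => i _; rewrite (ractMl hta) taM mulrA.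
pose A : 'M[L]_(m, #|G|) := \matrix_(i, g) ta (enum_val g) (c i).
pose B : 'M[L]_(#|G|, m) := \matrix_(g, i) ta (enum_val g) (a' i).
have AB : A *m B = 1%:M.
  apply/matrixP => i j; rewrite !mxE.
  have trE : rtrace ta (c i * a' j) = \sum_g A i g * B g j.
    rewrite /rtrace (reindex (enum_val : 'I_#|G| -> G)) /=; last exact: onW_bij (enum_val_bij _).
    by apply: eq_bigr => g _; rewrite !mxE (ractMl hta).
  rewrite -trE; have /choice[t tE] l : exists t, rtrace ta (c i * a' l) = iM t.
    by apply: fixM => g; apply: rtrace_fixed.
  have e0 : \sum_l iM (t l - (i == l)%:R) * c l = 0.
    under eq_bigr do rewrite rmorphB mulrBl.
    have e1 : \sum_l iM (t l) * c l = c i.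
      by rewrite [RHS](chr_decomp hta _ (@mulrC L) ac); apply: eq_bigr => l _; rewrite tE.
    rewrite sumrB e1 (bigD1 i) //= big1 => [|l li].
      by rewrite eqxx rmorph1 mul1r addr0 subrr.
    by rewrite eq_sym (negbTE li) rmorph0 mul0r.
  by rewrite tE; have /eqP := ic _ e0 j; rewrite subr_eq0 => /eqP ->; rewrite rmorph_nat.
have BA : B *m A = 1%:M.
  apply/matrixP => g h; rewrite !mxE.
  rewrite (eq_bigr (fun i => ta (enum_val g) (a' i * ta (enum_val h * (enum_val g)^-1)%g (c i)))).
    by rewrite -(ract_sum hta) ac -eq_mulgV1 (inj_eq enum_val_inj) eq_sym; case: (g == h);
      rewrite ?(ract_one hta) ?(ract_zero hta).
  by move=> i _; rewrite !mxE (ractMl hta) -(ractM hta) mulgKV.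
by apply/eqP; rewrite eqn_leq (mulmx1_min AB) (mulmx1_min BA).
Qed.

(** A nonzero element is a root of an irreducible polynomial with nonzero constant term, which
    writes its inverse as a polynomial in it. *)
Lemma image_subfield (F E : fieldType) (A : falgType F) (ev : {rmorphism A -> E}) :
  subfield_prop (fun x => exists z, x = ev z).
Proof.
split=> [|_ _ [z ->] [w ->]|_ _ [z ->] [w ->]|_ [z ->]].
- by exists 1; rewrite rmorph1.
- by exists (z - w); rewrite rmorphB.
- by exists (z * w); rewrite rmorphM.
have [->|nz] := eqVneq (ev z) 0; first by exists 0; rewrite invr0 rmorph0.
have az : algebraicOver (ev \o GRing.in_alg A) (ev z).
  have [p [nzp pz]] := falg_algebraic z; exists p => //.
  rewrite /root horner_coef size_map_poly; apply/eqP.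
  transitivity (ev (\sum_(i < size p) p`_i *: z ^+ i)); last by rewrite pz rmorph0.
  by rewrite rmorph_sum; apply: eq_bigr => i _; rewrite coef_map /= -rmorphXn -rmorphM mulr_algl.
have [g [mg ig rg]] := algebraic_irreducible az.
have g0 : g`_0 != 0.
  apply: contra_neqN nz => /eqP g0.
  have : 'X - 0%:P %| g by rewrite dvdp_XsubCl /root horner_coef0 g0.
  rewrite polyC0 subr0; case: ig => _ h /h; rewrite size_polyX => /(_ isT) eXg.
  have := rg; rewrite -(eqp_root (p := map_poly (ev \o GRing.in_alg A) 'X)).
    by rewrite map_polyX /root hornerX => /eqP.
  by rewrite eqp_map; apply: eXg.
have [h gE] : exists h, g - (g`_0)%:P = h * ('X - 0%:P).
  by apply/factor_theorem; rewrite /root hornerD hornerN hornerC horner_coef0 subrr.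
exists (- (g`_0)^-1 *: (map_poly (GRing.in_alg A) h).[z]).
apply: (mulIf nz); rewrite mulVf // -rmorphM -scalerAl.
have : (map_poly (ev \o GRing.in_alg A) (g - (g`_0)%:P)).[ev z] = - ev (g`_0)%:A.
  by rewrite rmorphB /= map_polyC hornerD hornerN (rootP rg) hornerC add0r.
rewrite gE rmorphM /= hornerM subr0 map_polyX hornerX map_poly_comp /= horner_map /= -rmorphM => e.
rewrite -mulr_algl rmorphM e -rmorphN -rmorphM -scaleNr -scalerAl mul1r scalerA mulrNN mulVf //.
by rewrite scale1r rmorph1.
Qed.

Lemma spans_ext (F A : nzRingType) n (i j : F -> A) (b : 'I_n -> A) : i =1 j ->
  (forall z, exists c : 'I_n -> F, z = \sum_l i (c l) * b l) ->
  forall z, exists c : 'I_n -> F, z = \sum_l j (c l) * b l.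
Proof. by move=> ij s z; have [c ->] := s z; exists c; apply: eq_bigr => l _; rewrite ij. Qed.

Lemma indep_ext (F A : nzRingType) n (i j : F -> A) (b : 'I_n -> A) : i =1 j ->
  (forall c : 'I_n -> F, \sum_l i (c l) * b l = 0 -> forall l, c l = 0) ->
  forall c : 'I_n -> F, \sum_l j (c l) * b l = 0 -> forall l, c l = 0.
Proof. by move=> ij h c e; apply: h; rewrite -[RHS]e; apply: eq_bigr => l _; rewrite ij. Qed.

(* Over the field of invariants M of L, a prime-to-p extension M' is linearly
   disjoint from L, so the torsor T = L (x) M' is a field. *)
Lemma ex_field_of_torsor (p : nat) (G : finGroupType) (M L : fieldType) (iM : {rmorphism M -> L})
    (ta : G -> L -> L) (M' : fieldExtType M) (T : torsor G M') (Lam : {rmorphism L -> T}) :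
  prime p -> (p.-group [set: G])%g -> ring_action ta -> chr_coords ta ->
  (forall z, (forall g, ta g z = z) -> exists c, z = iM c) -> (forall g c, ta g (iM c) = iM c) ->
  coprime p (\dim {:M'}) -> (forall c, Lam (iM c) = (c%:A : M')%:A) ->
  (forall g z, Lam (ta g z) = torsor_act T (Lam z) g) ->
  exists (Om : fieldExtType L) (psi : {rmorphism T -> Om}) (om : G -> Om -> Om),
  [/\ ring_action om, forall g z, om g (psi z) = psi (torsor_act T z g),
      forall z, psi (Lam z) = z%:A & \dim {:Om} = \dim {:M'}].
Proof.
move=> pp pG hta chr fixM taM cM' LamM LamA.
have hT := torsor_raction T; have mulC : commutative (@GRing.mul T) := @torsor_mulC G M' T.
have [gb [sgb igb]] := ex_galois_basis hta chr fixM taM.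
have [n [a [b ab]]] := chr; have [mu [smu imu]] := fieldExt_basis M'; set m := \dim {:M'} in mu smu imu cM' *.
have Lab g : \sum_i Lam (a i) * torsor_act T (Lam (b i)) g = (g == 1%g)%:R.
  by rewrite -(rmorph_nat Lam) -ab rmorph_sum; apply: eq_bigr => i _; rewrite rmorphM LamA.
have dec z : exists c : 'I_n -> M', z = \sum_i (c i)%:A * Lam (b i).
  have /choice[c cE] j : exists c : M', rtrace (fun g z => torsor_act T z g) (z * Lam (a j)) = c%:A.
    by apply: torsor_fixed => g; apply: (rtrace_fixed hT).
  exists c; rewrite {1}[z](chr_decomp hT _ mulC Lab).
  by apply: eq_bigr => j _; rewrite cE.
have spanT z : exists l : 'I_m -> L, z = \sum_j Lam (l j) * (mu j)%:A.
  have [c zc] := dec z; have /choice[k kE] i : exists k : 'I_m -> M, c i = \sum_j (k j)%:A * mu j := smu (c i).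
  exists (fun j => \sum_i iM (k i j) * b i); rewrite zc.
  under [RHS]eq_bigr do rewrite rmorph_sum mulr_suml.
  rewrite exchange_big /=; apply: eq_bigr => i _; rewrite kE scaler_suml mulr_suml.
  apply: eq_bigr => j _; rewrite rmorphM LamM -[RHS]mulrA (mulC (Lam _)) mulrA; congr (_ * _).
  by rewrite [RHS]mulr_algl scalerA.
have [Om0 [ev _]] := ex_field_point mulC.
have [Th [h0 h0E]] := ex_subfield (image_subfield ev).
have [psi psiE] : exists psi : {rmorphism T -> Th}, forall z, h0 (psi z) = ev z.
  by apply: rmorph_factor (fmorph_inj h0) _ => z; apply/h0E; exists z.
have psiS y : exists z, y = psi z.
  have [z yz] : exists z, h0 y = ev z by apply/h0E; exists y.
  by exists z; apply: (fmorph_inj h0); rewrite psiE.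
pose iL : {rmorphism L -> Th} := psi \o Lam; pose iM' : {rmorphism M' -> Th} := psi \o GRing.in_alg T.
have smu' : spans iL (fun j => psi (mu j)%:A).
  move=> y; have [z ->] := psiS y; have [l zl] := spanT z; exists l.
  by rewrite zl rmorph_sum; apply: eq_bigr => j _; rewrite rmorphM.
have sb' : spans iM' (fun i => psi (Lam (b i))).
  move=> y; have [z ->] := psiS y; have [c zc] := dec z; exists c.
  by rewrite zc rmorph_sum; apply: eq_bigr => j _; rewrite rmorphM.
have [e [c [sc ic]]] := spans_minimal smu'; have [q [c' [sc' ic']]] := spans_minimal sb'.
have [d1 [sd1 id1]] := tower_basis sgb igb sc ic; have [d2 [sd2 id2]] := tower_basis smu imu sc' ic'.
have ext : (iM' \o GRing.in_alg M') =1 (iL \o iM) by move=> x; rewrite /= LamM.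
(* The degree of [Th] over [M] along the towers through [L] and through [M']. Since [m] is prime to
   the p-power [#|G|], it divides [e], the degree over [L]; as [m] elements span, e = m and they are
   free, which makes [psi] injective. *)
have eqd : (e * #|G| = q * m)%N.
  exact: (basis_dim_unique sd1 id1 (spans_ext ext sd2) (indep_ext ext id2)).
have me : (m %| e)%N.
  have cmG : coprime m #|G|.
    rewrite coprime_sym -cardsT; have [x ->] := p_natP pG; by rewrite coprimeXl.
  by rewrite -(Gauss_dvdl _ cmG) eqd dvdn_mull.
have e0 : (0 < e)%N.
  rewrite lt0n; apply/eqP => e0; have [k] := sc 1; rewrite big1 => [/eqP|i]; first by rewrite oner_eq0.
  by case: i => i lt; exfalso; move: lt; rewrite e0.
have [Om [f [f' [fK f'K f'Z dOm]]]] := ex_fieldExt sc ic.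
have fL x z : f (iL x * z) = x *: f z by apply: (can_inj f'K); rewrite f'Z !fK.
pose X := [tuple f (psi (mu j)%:A) | j < m].
have spanX : <<X>>%VS = fullv.
  apply/eqP; rewrite eqEsubv subvf; apply/subvP => z _.
  have [k zk] := smu' (f' z); rewrite -[z]f'K zk rmorph_sum; apply: rpred_sum => j _.
  rewrite fL; apply/rpredZ/memv_span; rewrite -(tnth_mktuple (fun j => f (psi (mu j)%:A)) j).
  exact: mem_tnth.
have em : e = m.
  apply/eqP; rewrite eqn_leq (dvdn_leq e0 me) andbT -dOm -spanX -[X in (_ <= X)%N](size_tuple X).
  exact: dim_span.
have freeX : free X by rewrite /free spanX dOm em size_tuple.
have psi0 z : psi z = 0 -> z = 0.
  have [l ->] := spanT z => /(congr1 f); rewrite rmorph0 rmorph_sum rmorph_sum /= => l0.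
  rewrite big1 // => j _; suff -> : l j = 0 by rewrite rmorph0 mul0r.
  have /(@freeP _ _ m X) fr := freeX; apply: (fr l) j; rewrite -[RHS]l0; apply: eq_bigr => j _.
  by rewrite rmorphM fL -tnth_nth tnth_mktuple.
have psiI : injective psi.
  by move=> z w zw; apply/eqP; rewrite -subr_eq0; apply/eqP/psi0; rewrite rmorphB zw subrr.
have /choice[r rE] x : exists z, x = f (psi z).
  by have [z xz] := psiS (f' x); exists z; rewrite -xz f'K.
pose Psi : {rmorphism T -> Om} := f \o psi.
have rPsi z : r (Psi z) = z by apply: psiI; apply: (can_inj fK); rewrite -rE.
pose om (g : G) x := Psi (torsor_act T (r x) g).
have omE g z : om g (Psi z) = Psi (torsor_act T z g) by rewrite /om rPsi.
exists Om, Psi, om; split=> //; last by rewrite dOm.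
  split=> [x|g h x|g x y|g].
  - by rewrite [x]rE -/(Psi _) omE (ract1 hT).
  - have := rE x; move: (r x) => z ->; rewrite -/(Psi z) !omE; congr (Psi _).
    by rewrite -[f (psi z)]/(Psi z) rPsi; apply: (ractM hT).
  - have := rE x; move: (r x) => z ->; have := rE y; move: (r y) => z' ->.
    by rewrite -[f (psi z)]/(Psi z) -[f (psi z')]/(Psi z') -rmorphB !omE -rmorphB; congr (Psi _); apply: (ractB hT).
  - split=> [|x y]; first by rewrite -(rmorph1 Psi) omE (ract_one hT) rmorph1.
    have := rE x; move: (r x) => z ->; have := rE y; move: (r y) => z' ->.
    by rewrite -[f (psi z)]/(Psi z) -[f (psi z')]/(Psi z') -rmorphM !omE -rmorphM; congr (Psi _); apply: (ractMl hT).
by move=> z; apply: (can_inj f'K); rewrite /= fK f'Z rmorph1 mulr1.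
Qed.

(** * Dominant terms and sums with distinct values *)

Section Domination.

Variables (kap L : fieldType) (O : L -> Prop) (res : L -> kap).
Hypothesis pl : place O res.

Lemma ex_dominant (s : seq L) : (exists2 x, x \in s & x != 0) ->
  exists x, [/\ x \in s, x != 0 & forall y, y \in s -> O (y / x)].
Proof.
elim: s => [|a s IH]; first by case.
have [/IH[x [xs nzx xO]]|no] := pselect (exists2 x, x \in s & x != 0).
  move=> _; have [Oa|] := placeV pl (a / x).
    by exists x; split=> // [|y]; rewrite inE ?xs ?orbT // => /orP[/eqP -> //|/xO].
  rewrite invf_div => Oxa; have [a0|nza] := eqVneq a 0.
    exists x; split=> // [|y]; rewrite inE ?xs ?orbT // => /orP[/eqP ->|/xO //].
    by rewrite a0 mul0r; apply: (place0 pl).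
  exists a; split; rewrite ?mem_head // => y; rewrite inE => /orP[/eqP ->|/xO Oy].
    by rewrite divff //; apply: (place1 pl).
  by have -> : y / a = y / x * (x / a) by [rewrite mulrA divfK]; apply: (placeM pl).
case=> x; rewrite inE => /orP[/eqP -> nza|xs nzx]; last by case: no; exists x.
exists a; split; rewrite ?mem_head // => y; rewrite inE => /orP[/eqP ->|ys].
  by rewrite divff //; apply: (place1 pl).
have [->|nzy] := eqVneq y 0; first by rewrite mul0r; apply: (place0 pl).
by case: no; exists y.
Qed.

(** Distinctness of values is the statement that an integral quotient of two terms has residue 0.
    Divided by the term of least value, the sum has residue 1. *)
Lemma sum_distinct_values (I : eqType) (s : seq I) (x : I -> L) : uniq s ->
  (exists i, i \in s) -> (forall i, i \in s -> x i != 0) ->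
  (forall i j, i \in s -> j \in s -> i != j -> O (x i / x j) -> res (x i / x j) = 0) ->
  \sum_(i <- s) x i != 0.
Proof.
move=> us [i1 i1s] nz dis.
have [|_ [/mapP[i0 i0s ->] nz0 dom]] := @ex_dominant [seq x i | i <- s].
  by exists (x i1); [apply: map_f | apply: nz].
pose F i := if i \in s then x i / x i0 else 0.
have FO i : O (F i).
  by rewrite /F; case: ifP => [is_|_]; [apply/dom/map_f | apply: (place0 pl)].
have [_ e] := place_sum pl s FO.
apply: contraTneq (oner_neq0 kap) => s0; rewrite negbK; apply/eqP.
have <- : \sum_(i <- s) res (F i) = 1.
  rewrite (bigD1_seq i0) //= {1}/F i0s divff // (res_one pl) big_seq_cond big1 ?addr0 // => i.
  case/andP => is_ ne; rewrite /F is_; apply: dis => //.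
  exact/dom/map_f.
rewrite -e -[RHS](res_zero pl); congr res; rewrite -[RHS](mul0r (x i0)^-1) -[X in X * _]s0 mulr_suml.
by rewrite big_seq [RHS]big_seq; apply: eq_bigr => i is_; rewrite /F is_.
Qed.

End Domination.

(** * The field of ratios of coordinates *)

Lemma expr_sum (R : nzRingType) (x : R) (I : Type) (r : seq I) (P : pred I) (F : I -> nat) :
  x ^+ (\sum_(i <- r | P i) F i)%N = \prod_(i <- r | P i) x ^+ F i.
Proof.
elim: r => [|i r IH]; first by rewrite !big_nil expr0.
by rewrite !big_cons; case: (P i) => //; rewrite exprD IH.
Qed.

Lemma rmorph_mpoly_ext (F : fieldType) (S : nzRingType) n (f g : {rmorphism {mpoly F[n]} -> S}) :
  (forall c, f c%:MP = g c%:MP) -> (forall i, f 'X_i = g 'X_i) -> f =1 g.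
Proof.
move=> fgC fgX q; rewrite [q]mpolyE !rmorph_sum; apply: eq_bigr => m _.
rewrite -mul_mpolyC !rmorphM fgC mpolyXE_id !rmorph_prod; congr (_ * _).
by apply: eq_bigr => i _; rewrite !rmorphXn fgX.
Qed.

Lemma mmap_tofrac (F : fieldType) n (q : {mpoly F[n]}) :
  mmap (@FracField.tofrac _ \o @mpolyC n F) (fun i => FracField.tofrac ('X_i : {mpoly F[n]})) q
  = FracField.tofrac q.
Proof.
pose f : {rmorphism {mpoly F[n]} -> {fraction {mpoly F[n]}}} :=
  mmap (@FracField.tofrac _ \o @mpolyC n F) (fun i => FracField.tofrac ('X_i : {mpoly F[n]})).
pose g : {rmorphism {mpoly F[n]} -> {fraction {mpoly F[n]}}} := @FracField.tofrac _.
by apply: (@rmorph_mpoly_ext F _ n f g) => [c|i]; rewrite /f /= ?mmapC ?mmapX ?mmap1U.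
Qed.

(* The function field of a product of projective spaces with a linear action:
   the coordinates are the ratios z_i of the variables of a block by a
   representative of the block, and the u_b measure the action on these. *)
Lemma ex_ratio_field (k : fieldType) (G : finGroupType) (n : nat) (B : finType) (bx : 'I_n -> B)
    (r0 : B -> 'I_n) (A : G -> 'M[k]_n) :
  (forall b, bx (r0 b) = b) -> A 1%g = 1%:M -> (forall g h, A (g * h)%g = A g *m A h) ->
  (forall g i j, bx i != bx j -> A g i j = 0) ->
  exists (kap : fieldType) (sg : G -> kap -> kap) (io : {rmorphism k -> kap}) (z : 'I_n -> kap) (u : B -> G -> kap),
  [/\ ring_action sg /\ (forall g c, sg g (io c) = io c),
      (forall b, z (r0 b) = 1) /\ (forall i, z i != 0),
      (forall b g, u b g != 0) /\ (forall b g h, u b (g * h)%g = sg h (u b g) * u b h),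
      forall g i, sg g (z i) * u (bx i) g = \sum_j io (A g i j) * z j &
      (forall d f, bhom bx d f -> f != 0 -> mmap io z f != 0) /\
      (forall S : kap -> Prop, subfield_prop S -> (forall c, S (io c)) -> (forall i, S (z i)) -> forall x, S x)].
Proof.
move=> br A1 AM Ab.
pose actp g : {rmorphism {mpoly k[n]} -> {mpoly k[n]}} := mmap (@mpolyC n k) (fun i => \sum_j A g i j *: 'X_j).
have actC g c : actp g c%:MP = c%:MP by rewrite /actp /= mmapC.
have actX g i : actp g 'X_i = \sum_j A g i j *: 'X_j by rewrite /actp /= mmapX mmap1U.
have actZ g c q : actp g (c *: q) = c *: actp g q by rewrite -!mul_mpolyC rmorphM actC.
have hact : ring_action (fun g q => actp g q).
  split=> [q|g h q|g q q'|g].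
  - apply: (@rmorph_mpoly_ext k _ n (actp 1%g) idfun) => [c|i]; rewrite ?actC ?actX //= A1.
    rewrite (bigD1 i) //= big1 => [|j ji]; first by rewrite mxE eqxx scale1r addr0.
    by rewrite mxE eq_sym (negbTE ji) scale0r.
  - apply: (@rmorph_mpoly_ext k _ n (actp (g * h)%g) (actp h \o actp g)) => [c|i]; rewrite /= ?actC ?actX //.
    rewrite rmorph_sum; under [RHS]eq_bigr do rewrite actZ actX scaler_sumr.
    rewrite exchange_big /=; apply: eq_bigr => j _; rewrite AM mxE scaler_suml.
    by apply: eq_bigr => l _; rewrite scalerA.
  - exact: rmorphB.
  - by split; [apply: rmorph1 | apply: rmorphM].
have [act [ha actE]] := ex_frac_action hact.
pose FF := {fraction {mpoly k[n]}}; pose tf : {rmorphism {mpoly k[n]} -> FF} := @FracField.tofrac _.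
pose iF : {rmorphism k -> FF} := tf \o @mpolyC n k.
have tfI q : tf q = 0 -> q = 0 by move=> e; apply/eqP; rewrite -(tofrac_eq0 q) -/(tf q) e.
pose X i : FF := tf 'X_i; pose Z i := X i / X (r0 (bx i)).
have X0 i : X i != 0.
  by apply: contraTneq isT => /tfI /eqP; rewrite -msupp_eq0 msuppX.
have XA g i : act g (X i) = \sum_j iF (A g i j) * X j.
  rewrite actE actX rmorph_sum; apply: eq_bigr => j _.
  by rewrite -mul_mpolyC rmorphM.
pose U b g := act g (X (r0 b)) / X (r0 b).
have actV g x : act g x^-1 = (act g x)^-1 by have [f fE] := ract_rmorph ha g; rewrite -!fE fmorphV.
have act0 g x : x != 0 -> act g x != 0 by have [f fE] := ract_rmorph ha g; rewrite -!fE fmorph_eq0.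
have ZU g i : act g (Z i) * U (bx i) g = \sum_j iF (A g i j) * Z j.
  rewrite /Z /U (ractMl ha) actV mulrA mulfVK ?act0 // XA mulr_suml; apply: eq_bigr => j _.
  case: (eqVneq (bx i) (bx j)) => [->|ne]; first by rewrite mulrA.
  by rewrite Ab // rmorph0 !mul0r.
pose Sz x := exists i, x = Z i.
have [kap [h hE]] := @gen_field k FF iF Sz.
have hS := gen_subfield iF Sz; have [h1 hB hM hV] := hS.
have hD x y : gen iF Sz x -> gen iF Sz y -> gen iF Sz (x + y).
  move=> gx gy; rewrite -[y]opprK; apply: (hB) => //; rewrite -sub0r; apply: (hB) => //.
  by rewrite -(rmorph0 iF); apply: gen_base.
have hsum (F : 'I_n -> FF) : (forall i, gen iF Sz (F i)) -> gen iF Sz (\sum_i F i).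
  move=> hF; apply: (@big_ind _ (gen iF Sz)) => //; by rewrite -(rmorph0 iF); apply: gen_base.
have gZ i : gen iF Sz (Z i) by apply: gen_sub; exists i.
have gU b g : gen iF Sz (U b g).
  have := ZU g (r0 b); rewrite {1}/Z br divff // (ract_one ha) mul1r => ->.
  by apply: hsum => j; apply: (hM) => //; apply: gen_base.
have U0 b g : U b g != 0 by rewrite mulf_neq0 ?act0 ?invr_eq0.
have actF g c : act g (iF c) = iF c by rewrite actE actC.
have gact g x : gen iF Sz x -> gen iF Sz (act g x).
  apply: (@gen_min k FF iF Sz (fun x => gen iF Sz (act g x))).
  - split.
    + by rewrite (ract_one ha).
    + by move=> a b ga gb; rewrite (ractB ha); apply: (hB).
    + by move=> a b ga gb; rewrite (ractMl ha); apply: (hM).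
    + by move=> a ga; rewrite actV; apply: (hV).
  - by move=> a; rewrite actF; apply: gen_base.
  - move=> _ [i ->]; rewrite -(mulfK (U0 (bx i) g) (act g (Z i))) ZU; apply: (hM); last exact: (hV).
    by apply: hsum => j; apply: (hM) => //; apply: gen_base.
have hI := fmorph_inj h.
have /choice[z zE] i : exists y, Z i = h y by apply/hE.
have /choice[u uE] (bg : B * G) : exists y, U bg.1 bg.2 = h y by apply/hE.
have /choice[sg sgE] (gx : G * kap) : exists y, act gx.1 (h gx.2) = h y.
  by apply/hE; apply: gact; apply/hE; exists gx.2.
have [io ioE] : exists io : {rmorphism k -> kap}, forall c, h (io c) = iF c.
  by apply: rmorph_factor hI _ => c; apply/hE; apply: gen_base.
have sgE' g x : h (sg (g, x)) = act g (h x) by rewrite -sgE.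
exists kap, (fun g x => sg (g, x)), io, z, (fun b g => u (b, g)).
have mE f : h (mmap io z f) = mmap iF Z f.
  rewrite /mmap rmorph_sum; apply: eq_bigr => m _; rewrite rmorphM ioE /mmap1 rmorph_prod.
  by congr (_ * _); apply: eq_bigr => i _; rewrite rmorphXn -zE.
split.
- split=> [|g c]; last by apply: hI; rewrite sgE' ioE actF.
  split=> [x|g g' x|g x y|g].
  + by apply: hI; rewrite sgE' (ract1 ha).
  + by apply: hI; rewrite !sgE' (ractM ha).
  + by apply: hI; rewrite rmorphB !sgE' rmorphB (ractB ha).
  + by split=> [|x y]; apply: hI; rewrite ?rmorphM !sgE' ?rmorph1 ?(ract_one ha) // rmorphM (ractMl ha).
- split=> [b|i]; first by apply: hI; rewrite -zE /Z br divff ?rmorph1.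
  by rewrite -(fmorph_eq0 h) -zE mulf_neq0 ?invr_eq0.
- split=> [b g|b g g']; first by rewrite -(fmorph_eq0 h) -(uE (b, g)) U0.
  apply: hI; rewrite rmorphM sgE' -(uE (b, (g * g')%g)) -(uE (b, g)) -(uE (b, g')) /= /U (ractM ha) (ractMl ha) actV.
  by rewrite mulrA mulfVK ?act0.
- move=> g i; apply: hI; rewrite rmorphM sgE' -zE -(uE (bx i, g)) ZU rmorph_sum.
  by apply: eq_bigr => j _; rewrite rmorphM ioE -zE.
split=> [d f hf nzf|S hS' Sk Sz' x].
  (* For multihomogeneous [f], multiplying by the representatives raised to its degrees turns the
     value at the ratios back into [f] itself. *)
  rewrite -(fmorph_eq0 h) mE; suff e : mmap iF Z f * \prod_b X (r0 b) ^+ d b = tf f.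
    by apply: contraNneq nzf => f0; apply/eqP/tfI; rewrite -e f0 mul0r.
  rewrite -[tf f]mmap_tofrac /mmap mulr_suml big_seq [RHS]big_seq; apply: eq_bigr => m ms.
  rewrite -mulrA; congr (_ * _); have /has_bdegP <- := hf m ms.
  rewrite /mmap1 (eq_bigr (fun b => \prod_(i | bx i == b) X (r0 (bx i)) ^+ m i)); last first.
    by move=> b _; rewrite /bdeg expr_sum; apply: eq_bigr => i /eqP ->.
  have <- : \prod_i X (r0 (bx i)) ^+ m i = \prod_b \prod_(i | bx i == b) X (r0 (bx i)) ^+ m i.
    by rewrite (partition_big bx xpredT).
  rewrite -big_split /=.
  by apply: eq_bigr => i _; rewrite -exprMn /Z mulfVK.
have : gen iF Sz (h x) by apply/hE; exists x.
have e : forall y, gen iF Sz y -> exists2 x', S x' & y = h x'.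
  move=> y; have [S1 SB SM SV] := hS'.
  apply: (@gen_min k FF iF Sz (fun y => exists2 x', S x' & y = h x')).
  - split.
    + by exists 1; rewrite ?rmorph1.
    + by move=> _ _ [a sa ->] [b sb ->]; exists (a - b); [apply: SB | rewrite rmorphB].
    + by move=> _ _ [a sa ->] [b sb ->]; exists (a * b); [apply: SM | rewrite rmorphM].
    + by move=> _ [a sa ->]; exists a^-1; [apply: SV | rewrite fmorphV].
  - by move=> a; exists (io a); rewrite ?ioE.
  - by move=> _ [i ->]; exists (z i); rewrite ?zE.
by move/e => [x' Sx' /hI ->].
Qed.

Section Ratios.

Variables (k : fieldType) (n : nat) (J : finType) (bt : 'I_n -> J) (isy : pred J).
Variables (Th : fieldType) (io : {rmorphism k -> Th}) (z : 'I_n -> Th).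
Implicit Types f g : {mpoly k[n]}.

Lemma nonyB f g : nony bt isy f -> nony bt isy g -> nony bt isy (f - g).
Proof. by move=> hf hg m /msuppB_le; rewrite mem_cat => /orP[/hf|/hg]. Qed.

Lemma nonyC c : nony bt isy (c%:MP : {mpoly k[n]}).
Proof. by move=> m; rewrite msuppC; case: ifP => // _; rewrite inE => /eqP -> i _; rewrite mnm0E. Qed.

Lemma nonyX i : ~~ isy (bt i) -> nony bt isy ('X_i : {mpoly k[n]}).
Proof.
move=> ni m; rewrite msuppX inE => /eqP -> j yj; rewrite mnm1E.
by case: eqP => // ij; move: ni; rewrite ij yj.
Qed.

Definition ratio (x : Th) := exists f g : {mpoly k[n]},
  [/\ nony bt isy f, nony bt isy g, mmap io z g != 0 & x = mmap io z f / mmap io z g].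

Lemma ratio_poly f : nony bt isy f -> ratio (mmap io z f).
Proof.
move=> nf; exists f, 1; split=> //; first by rewrite -mpolyC1; apply: nonyC.
  by rewrite rmorph1 oner_neq0.
by rewrite rmorph1 divr1.
Qed.

Lemma ratio_subfield : subfield_prop ratio.
Proof.
split=> [|x y [f [g [nf ng g0 ->]]] [f' [g' [nf' ng' g0' ->]]]|x y [f [g [nf ng g0 ->]]] [f' [g' [nf' ng' g0' ->]]]|x [f [g [nf ng g0 ->]]]].
- rewrite -(rmorph1 (mmap io z)); apply: ratio_poly.
  by rewrite -mpolyC1; apply: nonyC.
- exists (f * g' - f' * g), (g * g'); split; rewrite ?rmorphM ?mulf_neq0 //.
  + by apply: nonyB; apply: nonyM.
  + exact: nonyM.
  + by rewrite rmorphB !rmorphM /= -[X in _ + X = _]mulNr addf_div // mulNr.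
- exists (f * f'), (g * g'); split; rewrite ?rmorphM ?mulf_neq0 //; try exact: nonyM.
  by rewrite /= mulf_div.
have [f0|nz] := eqVneq (mmap io z f) 0; last by exists g, f; rewrite invf_div.
rewrite f0 mul0r invr0 -(rmorph0 (mmap io z)); apply: ratio_poly.
by rewrite -mpolyC0; apply: nonyC.
Qed.

End Ratios.

Lemma nony_restrict (k : fieldType) (n m : nat) (J B : finType) (bt : 'I_(n + m) -> J) (isy : pred J)
    (bx : 'I_m -> B) (emb : B -> J) (f : {mpoly k[n + m]}) :
  injective emb -> (forall a, isy (bt (lshift m a))) -> (forall b, bt (rshift n b) = emb (bx b)) ->
  nony bt isy f -> exists f' : {mpoly k[m]},
  [/\ f != 0 -> f' != 0, forall d, bhom bt d f -> bhom bx (fun b => d (emb b)) f' &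
      forall (Th : fieldType) (io : {rmorphism k -> Th}) (z : 'I_(n + m) -> Th),
        mmap io z f = mmap io (fun b => z (rshift n b)) f'].
Proof.
move=> embI isyl btr nf.
pose rest (mm : 'X_{1..n + m}) : 'X_{1..m} := [multinom mm (rshift n b) | b < m].
have z0 mm a : mm \in msupp f -> mm (lshift m a) = 0%N by move=> /nf; apply; apply: isyl.
have restI m1 m2 : m1 \in msupp f -> m2 \in msupp f -> rest m1 = rest m2 -> m1 = m2.
  move=> s1 s2 e; apply/mnmP => i; rewrite -(splitK i); case: (split i) => a /=; first by rewrite !z0.
  by move/mnmP: e => /(_ a); rewrite !mnmE.
exists (\sum_(mm <- msupp f) f@_mm *: 'X_[rest mm]); split.
- move=> nzf; have [m0 s0] : exists m0, m0 \in msupp f.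
    by case e : (msupp f) => [|m0 s]; [move: nzf; rewrite -msupp_eq0 e | exists m0; rewrite mem_head].
  apply/eqP => /(congr1 (mcoeff (rest m0))); rewrite mcoeff0 raddf_sum /= (bigD1_seq m0 s0 (msupp_uniq f)) /=.
  rewrite big_seq_cond big1 => [|m1 /andP[s1 ne]].
    by rewrite mcoeffZ mcoeffX eqxx mulr1 addr0 => /eqP; rewrite -[_ == 0]negbK -mcoeff_msupp s0.
  by rewrite mcoeffZ mcoeffX; case: eqP => [/restI|_]; rewrite ?mulr0 // => e; move: ne; rewrite e ?eqxx.
- move=> d hf; rewrite big_seq; apply: bhom_sum => mm ms; apply: bhomZ.
  rewrite (_ : (fun b => _) = bdeg bx (rest mm)); first exact: bhom_bdeg.
  apply/funext => b; have /has_bdegP <- := hf mm ms; rewrite /bdeg big_mkcond big_split_ord /=.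
  rewrite big1 ?add0n; last by move=> a _; rewrite z0 // if_same.
  rewrite [RHS]big_mkcond; apply: eq_bigr => b' _.
  by rewrite btr (inj_eq embI) mnmE.
move=> Th io z; rewrite raddf_sum /= /mmap.
rewrite big_seq [RHS]big_seq; apply: eq_bigr => mm ms.
rewrite -/(mmap io (fun b => z (rshift n b)) _) mmapZ mmapX; congr (_ * _).
rewrite /mmap1 big_split_ord /= big1 ?mul1r; last by move=> a _; rewrite z0 ?expr0.
by apply: eq_bigr => b _; rewrite mnmE.
Qed.

Lemma adjoin_degree_irreducible (F : fieldType) (Q : fieldExtType F) (q : {poly F}) (z : Q) :
  irreducible_poly q -> root (map_poly (GRing.in_alg Q) q) z -> adjoin_degree 1%AS z = (size q).-1.
Proof.
move=> iq rq; have /polyOver1P[g gE] := minPolyOver 1%AS z.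
have d1 : q %| g.
  rewrite -[_ %| _]negbK -(irreducible_poly_coprime _ iq); apply/negP.
  rewrite -(coprimep_map (GRing.in_alg Q)) -gE => /coprimep_root/(_ rq).
  by rewrite (rootP (root_minPoly _ _)) eqxx.
have d2 : g %| q.
  rewrite -(dvdp_map (GRing.in_alg Q)) -gE; apply: minPoly_dvdp => //.
  by apply/polyOver1P; exists q.
have : q %= g by rewrite /eqp d1.
move/eqp_size ->; rewrite -(size_map_poly (GRing.in_alg Q)) -gE size_minPoly.
by [].
Qed.

Lemma prime_root_primitive (F : fieldType) (p : nat) (b : F) : prime p -> b ^+ p = 1 -> b != 1 ->
  p.-primitive_root b.
Proof.
move=> pp bp b1; have [m pm mp] := prim_order_exists (prime_gt0 pp) bp.
have [_ dp] := primeP pp; case/orP: (dp _ mp) => /eqP mE; last by rewrite -mE.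
by move: pm b1; rewrite mE => /prim_expr_order; rewrite expr1 => ->; rewrite eqxx.
Qed.

Lemma nonyD (k : fieldType) (n : nat) (J : finType) (bt : 'I_n -> J) (isy : pred J) (f g : {mpoly k[n]}) :
  nony bt isy f -> nony bt isy g -> nony bt isy (f + g).
Proof. by move=> hf hg m /msuppD_le; rewrite mem_cat => /orP[/hf|/hg]. Qed.

(** * Independence of the residues of equivariant vectors *)

Section ResidualIndependence.

Variables (p r : nat) (e nn : 'I_r -> nat) (k : fieldType) (w : k) (G P : finGroupType) (pi : G -> P).
Hypotheses (p_pr : prime p) (w_prim : p.-primitive_root w) (p_neq0 : p%:R != 0 :> k)
  (nnE : forall s, nn s = (p ^ e s)%N).
Let XT : finType := {s : 'I_r & 'I_(nn s)}.
Let XV : finType := (XT + option P)%type.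
Variables (AX : G -> XT -> XT -> k) (c : 'I_r -> G) (om : 'I_r -> k).
Hypotheses (AX_block : forall g t t', tag t != tag t' -> AX g t t' = 0)
  (AX_c : forall s t t', AX (c s) t t' = (if tag t == s then om s else 1) * (t == t')%:R)
  (om_p : forall s, om s ^+ p = 1) (om_1 : forall s, om s != 1)
  (c_p : forall s, (c s ^+ p = 1)%g) (pi_c : forall s, pi (c s) = 1%g)
  (dim_dvd : forall s m (rU : mx_representation k [set: G] m) a, rU (c s) = a%:M -> a ^+ p = 1 -> a != 1 ->
     (p ^ e s %| m)%N).

Definition xblock (v : XV) : option 'I_r := if v is inl t then Some (tag t) else None.
(** [option P] stands for the regular representation of [P] plus a fixed coordinate [None]. With the
    latter as representative, the ratios of this block are the coordinates of the regular
    representation and its cocycle is trivial. *)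
Definition xentry (g : G) (v v' : XV) : k := match v, v' with
  | inl t, inl t' => AX g t t'
  | inr a, inr b => (b == omap (fun h => (h * pi g)%g) a)%:R
  | _, _ => 0 end.
Let m := #|XV|.
Definition bx (i : 'I_m) := xblock (enum_val i).
Definition Ax g : 'M[k]_m := \matrix_(i, j) xentry g (enum_val i) (enum_val j).
Variables (r0 : option 'I_r -> 'I_m).
Hypothesis r0E : forall b, bx (r0 b) = b.

Variables (kap : fieldType) (sg : G -> kap -> kap) (iok : {rmorphism k -> kap}) (zk : 'I_m -> kap)
  (uk : option 'I_r -> G -> kap).
Hypotheses (sg_io : forall g a, sg g (iok a) = iok a) (hsg : ring_action sg) (zk_r0 : forall b, zk (r0 b) = 1)
  (uk0 : forall b g, uk b g != 0) (ukM : forall b g h, uk b (g * h)%g = sg h (uk b g) * uk b h)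
  (sgz : forall g i, sg g (zk i) * uk (bx i) g = \sum_j iok (Ax g i j) * zk j)
  (zk_indep : forall d f, bhom bx d f -> f != 0 -> mmap iok zk f != 0)
  (kap_gen : forall S : kap -> Prop, subfield_prop S -> (forall a, S (iok a)) -> (forall i, S (zk i)) -> forall x, S x).

Variables (Th : fieldType) (jt : {rmorphism kap -> Th}) (sT : G -> Th -> Th).
Hypotheses (hsT : ring_action sT) (sT_jt : forall g a, sT g (jt a) = jt (sg g a))
  (Th_deg : forall th, exists q : {poly kap}, [/\ irreducible_poly q, root (map_poly jt q) th & coprime p (size q).-1]).
Variables (eta : XT -> Th) (v : 'I_r -> G -> Th) (l0 : 'I_r -> XT).
Hypotheses (v0 : forall s g, v s g != 0) (vM : forall s g h, v s (g * h)%g = sT h (v s g) * v s h)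
  (eta_act : forall g t, sT g (eta t) * v (tag t) g = \sum_t' jt (iok (AX g t t')) * eta t')
  (l0E : forall s, tag (l0 s) = s) (eta_l0 : forall s, eta (l0 s) = 1)
  (v_c : forall s s', v s' (c s) = jt (iok (if s' == s then om s else 1))).

Let J : finType := option ('I_r * bool).
Let n1 := #|XT|.
Let emb (b : option 'I_r) : J := omap (fun s => (s, false)) b.
Let bt (i : 'I_(n1 + m)) : J := match split i with
  | inl a => Some (tag (enum_val a), true) | inr b => emb (bx b) end.
Let io : {rmorphism k -> Th} := jt \o iok.
Let z (i : 'I_(n1 + m)) : Th := match split i with inl a => eta (enum_val a) | inr b => jt (zk b) end.
Let isy (b : J) := if b is Some (_, true) then true else false.
Let i0 (b : J) : 'I_(n1 + m) := match b with
  | Some (s, true) => lshift m (enum_rank (l0 s))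
  | Some (s, false) => rshift n1 (r0 (Some s)) | None => rshift n1 (r0 None) end.

Let btl a : bt (lshift m a) = Some (tag (enum_val a), true).
Proof. by rewrite /bt (unsplitK (inl a)). Qed.
Let btr b : bt (rshift n1 b) = emb (bx b).
Proof. by rewrite /bt (unsplitK (inr b)). Qed.
Let zl a : z (lshift m a) = eta (enum_val a).
Proof. by rewrite /z (unsplitK (inl a)). Qed.
Let zr b : z (rshift n1 b) = jt (zk b).
Proof. by rewrite /z (unsplitK (inr b)). Qed.

Let embI : injective emb.
Proof. by case=> [s|] [s'|] //= [->]. Qed.

Let isyr b : isy (bt (rshift n1 b)) = false.
Proof. by rewrite btr; case: (bx b). Qed.
Let isyl a : isy (bt (lshift m a)) = true.
Proof. by rewrite btl. Qed.

Let yfirst (i j : 'I_(n1 + m)) : isy (bt i) -> ~~ isy (bt j) -> (i < j)%N.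
Proof.
rewrite -(splitK i) -(splitK j); case: (split i) => a; case: (split j) => b /=; rewrite ?isyl ?isyr //.
by move=> _ _; apply: ltn_addr.
Qed.

Let mmap_r f : nony bt isy f -> exists f' : {mpoly k[m]},
  [/\ f != 0 -> f' != 0, forall d, bhom bt d f -> bhom bx (fun b => d (emb b)) f' &
     mmap io z f = jt (mmap iok zk f')].
Proof.
move=> nf; have [f' [h1 h2 h3]] := @nony_restrict k n1 m J _ bt isy bx emb f embI isyl btr nf.
exists f'; split=> //; rewrite h3 /mmap rmorph_sum; apply: eq_bigr => mm _.
by rewrite rmorphM /mmap1 rmorph_prod; congr (_ * _); apply: eq_bigr => b _; rewrite zr rmorphXn.
Qed.

Let z_indep d f : bhom bt d f -> nony bt isy f -> f != 0 -> mmap io z f != 0.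
Proof.
move=> hf nf nzf; have [f' [h1 h2 ->]] := mmap_r nf.
by rewrite fmorph_eq0; apply: zk_indep (h2 d hf) (h1 nzf).
Qed.

Let ka_ratio (a : kap) : ratio bt isy io z (jt a).
Proof.
have [S1 SB SM SV] := ratio_subfield bt isy io z.
apply: (kap_gen (S := fun a => ratio bt isy io z (jt a))).
- by split=> [|x y hx hy|x y hx hy|x hx]; rewrite ?rmorph1 ?rmorphB ?rmorphM ?fmorphV; [apply: S1|apply: SB|apply: SM|apply: SV].
- move=> x; rewrite -[jt _]/(io x) -(mmapC z io x); apply: ratio_poly; exact: nonyC.
- move=> i; have <- : mmap io z 'X_(rshift n1 i) = jt (zk i) by rewrite mmapX mmap1U zr.
  by apply: ratio_poly; apply: nonyX; rewrite isyr.
Qed.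

Let sum_split (F : 'I_(n1 + m) -> nat) :
  (\sum_i F i = \sum_t F (lshift m (enum_rank t)) + (\sum_(t : XT) F (rshift n1 (enum_rank (inl t : XV))) +
    \sum_(a : option P) F (rshift n1 (enum_rank (inr a : XV)))))%N.
Proof.
rewrite big_split_ord /=; congr (_ + _)%N.
  by rewrite (reindex (enum_rank : XT -> 'I_n1)) //; apply: onW_bij; apply: enum_rank_bij.
rewrite (reindex (enum_rank : XV -> 'I_m)) /=; last by apply: onW_bij; apply: enum_rank_bij.
by rewrite big_sumType.
Qed.

Let blkE b : #|blk bt [set: 'I_(n1 + m)] b| = (\sum_i (bt i == b))%N.
Proof.
rewrite -sum1_card big_mkcond; apply: eq_bigr => i _; rewrite /blk !inE.
by case: (bt i == b).
Qed.

Let card_tag s : (\sum_(t : XT) (tag t == s) = nn s)%N.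
Proof.
apply: etrans (esym (sig_big_dep (fun _ => true) (fun _ _ => true) (fun s' (_ : 'I_(nn s')) => nat_of_bool (s' == s)))) _ => /=.
rewrite (bigD1 s) //= [X in (_ + X)%N]big1 => [|s' ss]; last by rewrite big1 // => a _; rewrite (negbTE ss).
by rewrite addn0 eqxx sum_nat_const card_ord muln1.
Qed.

Let card_block s t : #|blk bt [set: 'I_(n1 + m)] (Some (s, t))| = (p ^ e s)%N.
Proof.
rewrite blkE sum_split -nnE -(card_tag s).
under eq_bigr do rewrite btl enum_rankK.
under [X in (_ + (X + _))%N]eq_bigr do rewrite btr /bx enum_rankK /=.
under [X in (_ + (_ + X))%N]eq_bigr do rewrite btr /bx enum_rankK /=.
rewrite [X in (_ + (_ + X))%N]big1 ?addn0 //.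
case: t.
  rewrite [X in (_ + X)%N]big1 ?addn0; last by move=> t _; case: eqP => // -[].
  by apply: eq_bigr => t _; congr nat_of_bool; apply/eqP/eqP => [[]|->].
rewrite [X in (X + _)%N]big1 ?add0n; last by move=> t _; case: eqP => // -[].
by apply: eq_bigr => t _; congr nat_of_bool; apply/eqP/eqP => [[]|->].
Qed.

Let card_none : #|blk bt [set: 'I_(n1 + m)] None| = #|{: option P}|.
Proof.
rewrite blkE sum_split -[RHS]sum1_card.
rewrite [X in (X + _)%N]big1 ?add0n; last by move=> t _; rewrite btl.
rewrite [X in (X + _)%N]big1 ?add0n; last by move=> t _; rewrite btr /bx enum_rankK.
by apply: eq_bigr => a _; rewrite btr /bx enum_rankK.
Qed.

Let T : seq Th := [seq jt (zk i) | i <- enum 'I_m & i != r0 (bx i)].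

Let size_T : ((size T).+1 = #|blk bt [set: 'I_(n1 + m)] None| + \sum_s (p ^ e s).-1)%N.
Proof.
have mE : m = (#|XT| + #|{: option P}|)%N by rewrite /m card_sum.
have XTE : #|XT| = (\sum_s nn s)%N.
  rewrite -[LHS]sum1_card; transitivity (\sum_(t : XT) \sum_s (tag t == s))%N.
    apply: eq_big => // t _; rewrite (bigD1 (tag t)) //= eqxx big1 // => s.
    by rewrite eq_sym => /negbTE ->.
  by rewrite exchange_big /=; apply: eq_bigr => s _; rewrite card_tag.
have e2 : count (fun i => i == r0 (bx i)) (enum 'I_m) = r.+1.
  rewrite -size_filter; have -> : r.+1 = size [seq r0 b | b <- enum {: option 'I_r}].
    by rewrite size_map -cardE card_option card_ord.
  apply: perm_size; apply: uniq_perm; first by rewrite filter_uniq ?enum_uniq.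
    by rewrite map_inj_uniq ?enum_uniq // => b b' /(congr1 bx); rewrite !r0E.
  move=> i; rewrite mem_filter mem_enum andbT; apply/eqP/mapP => [ei|[b _ ->]]; last by rewrite r0E.
  by exists (bx i); rewrite ?mem_enum.
have sT' : (size T + r.+1 = m)%N.
  rewrite size_map size_filter -e2 addnC -[RHS](size_enum_ord m).
  by rewrite -[RHS](count_predC (fun i => i == r0 (bx i)) (enum 'I_m)).
have e3 : (\sum_s nn s = \sum_s (p ^ e s).-1 + r)%N.
  rewrite -[X in (_ + X)%N](card_ord r) -[X in (_ + X)%N]sum1_card -big_split /=; apply: eq_bigr => s _.
  by rewrite nnE addn1 prednK // expn_gt0 prime_gt0.
rewrite card_none; move: sT'; rewrite mE XTE e3.
by move: (size T) #|{: option P}| (\sum_s (p ^ e s).-1)%N => x y t; lia.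
Qed.

Let ab s (b : option 'I_r) : k := if b == Some s then om s else 1.

Let xentry_c s x x' : xentry (c s) x x' = ab s (xblock x) * (x == x')%:R.
Proof.
case: x x' => [t|a] [t'|a'] /=; [by rewrite AX_c | | | ].
- exact: esym (mulr0 _).
- exact: esym (mulr0 _).
rewrite mul1r -[inr a == inr a']/(a == a') eq_sym; congr (_ == _)%:R.
by case: a => // h /=; rewrite pi_c mulg1.
Qed.

Let sum_c s i : \sum_j iok (Ax (c s) i j) * zk j = iok (ab s (bx i)) * zk i.
Proof.
rewrite (bigD1 i) //= big1 => [|j ji]; rewrite mxE xentry_c ?eqxx ?mulr1 ?addr0 //.
by rewrite (inj_eq enum_val_inj) eq_sym (negbTE ji) mulr0 rmorph0 mul0r.
Qed.

Let uk_c s b : uk b (c s) = iok (ab s b).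
Proof. by have := sgz (c s) (r0 b); rewrite sum_c zk_r0 (ract_one hsg) mul1r mulr1 r0E. Qed.

Let c_fix s a : sg (c s) a = a.
Proof.
apply: (kap_gen (S := fun a => sg (c s) a = a)).
- split=> [|x y ex ey|x y ex ey|x ex].
  + exact: ract_one.
  + by rewrite (ractB hsg) ex ey.
  + by rewrite (ractMl hsg) ex ey.
  + by have [f fE] := ract_rmorph hsg (c s); rewrite -fE fmorphV fE ex.
- by move=> x; rewrite sg_io.
- move=> i; apply: (mulIf (uk0 (bx i) (c s))); rewrite sgz sum_c uk_c.
  by rewrite mulrC.
Qed.

(** [c s] acts on every block by a scalar, invisible to ratios, so it fixes [kap]. Having order
    dividing [p], it fixes [Th] as well, where all degrees over [kap] are prime to [p]. *)
Lemma central_fixes s th : sT (c s) th = th.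
Proof.
have [f fE] := ract_rmorph hsT (c s); rewrite -fE.
have w' : p.-primitive_root (iok w) by rewrite fmorph_primitive_root.
apply: (trivial_on_prime_to_p (jt := jt) (p := p) p_pr w') => //.
- by rewrite -(rmorph_nat iok) fmorph_eq0.
- by move=> a; rewrite fE sT_jt c_fix.
- move=> x; have it n : iter n f x = sT (c s ^+ n)%g x.
    elim: n => [|n IH]; first by rewrite expg0 (ract1 hsT).
    by rewrite iterS IH fE -(ractM hsT) -expgSr.
  by rewrite it c_p (ract1 hsT).
Qed.

(** The count is the dimension of the representation on monomials of multidegree [d]. There [c s]
    acts by [om s] to the power of the total degree in the two blocks of [s], which is nontrivial
    under the hypothesis, so that [dim_dvd] applies. *)
Let std_dvd d s : ~~ (p %| d (Some (s, false)) + d (Some (s, true)))%N ->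
  (p ^ e s %| count (fun mm => `[< std bt io z mm >]) (mons bt d))%N.
Proof.
move=> nd.
pose u (b : J) g : Th := match b with Some (s, true) => v s g | Some (s, false) => jt (uk (Some s) g)
  | None => jt (uk None g) end.
pose A g : 'M[k]_(n1 + m) := \matrix_(i, j) match split i, split j with
  | inl a, inl b => AX g (enum_val a) (enum_val b) | inr a, inr b => Ax g a b | _, _ => 0 end.
have act_io g x : sT g (io x) = io x by rewrite sT_jt sg_io.
have u_neq0 b g : u b g != 0 by case: b => [[s' []]|] /=; rewrite ?v0 // fmorph_eq0 uk0.
have u_mul b g h : u b (g * h)%g = sT h (u b g) * u b h.
  by case: b => [[s' []]|] /=; rewrite ?vM // ukM rmorphM sT_jt.
have Ax_block g a b : bx a != bx b -> Ax g a b = 0.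
  rewrite mxE /bx; case: (enum_val a) => [t|x]; case: (enum_val b) => [t'|y] //= ne.
  by apply: AX_block; apply: contraNneq ne => ->.
have A_block g i j : bt i != bt j -> A g i j = 0.
  rewrite mxE /bt; case: (split i) => a; case: (split j) => b //= ne.
    by apply: AX_block; apply: contraNneq ne => ->.
  by apply: Ax_block; apply: contraNneq ne => ->.
have act_z g i : sT g (z i) * u (bt i) g = \sum_j io (A g i j) * z j.
  rewrite big_split_ord /= -(splitK i); case: (split i) => a /=.
    rewrite [X in _ + X]big1 ?addr0 => [|b _]; last by rewrite mxE (unsplitK (inl a)) (unsplitK (inr b)) /= !rmorph0 mul0r.
    rewrite zl btl /= eta_act (reindex (enum_val : 'I_n1 -> XT)) /=; last exact: onW_bij (enum_val_bij _).
    by apply: eq_bigr => b _; rewrite mxE (unsplitK (inl a)) (unsplitK (inl b)) zl.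
  rewrite [X in X + _]big1 ?add0r => [|b _]; last by rewrite mxE (unsplitK (inr a)) (unsplitK (inl b)) /= !rmorph0 mul0r.
  have -> : u (bt (rshift n1 a)) g = jt (uk (bx a) g) by rewrite btr; case: (bx a).
  rewrite zr sT_jt -rmorphM sgz rmorph_sum; apply: eq_bigr => b _.
  by rewrite [in RHS]mxE (unsplitK (inr a)) (unsplitK (inr b)) zr rmorphM.
have [rV rVE] := monomial_representation hsT act_io u_neq0 u_mul A_block act_z d.
pose om' (b : J) : k := if b is Some (s', _) then if s' == s then om s else 1 else 1.
have := rVE (c s) om' (central_fixes s); move/(_ _)/dim_dvd; apply.
- case=> [[s' []]|] /=; first by rewrite v_c.
    by rewrite uk_c.
  by rewrite uk_c.
- rewrite -prodrXl big1 // => -[[s' b]|] _ /=; rewrite ?expr1n //.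
  by case: ifP => _; rewrite ?expr1n // -exprM mulnC exprM om_p expr1n.
have -> : \prod_b om' b ^+ d b = om s ^+ (d (Some (s, false)) + d (Some (s, true)))%N.
  have omE t : om' (Some (s, t)) = om s by rewrite /om' eqxx.
  have om'1 b : b != Some (s, false) -> b != Some (s, true) -> om' b = 1.
    case: b => [[s' t]|] //= h1 h2; rewrite /om'; case: eqP => // e1; move: h1 h2; rewrite e1.
    by case: t; rewrite eqxx.
  clearbody om'; rewrite (bigD1 (Some (s, false))) //= (bigD1 (Some (s, true))) /=; last by apply/eqP => -[].
  rewrite !omE.
  rewrite exprD; congr (_ * _); rewrite big1 ?mulr1 // => b /andP[b1 b2].
  by rewrite om'1 ?expr1n.
rewrite -(prim_order_dvd (prime_root_primitive p_pr (om_p s) (om_1 s))).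
exact: nd.
Qed.

Let z_T i : algcl io (fun x => x \in T) (z i).
Proof.
have [S1 SB SM SV] := algcl_subfield io (fun x => x \in T).
have jtT a : algcl io (fun x => x \in T) (jt a).
  apply: (kap_gen (S := fun a => algcl io (fun x => x \in T) (jt a))).
  - by split=> [|x y hx hy|x y hx hy|x hx]; rewrite ?rmorph1 ?rmorphB ?rmorphM ?fmorphV; [apply: S1|apply: SB|apply: SM|apply: SV].
  - by move=> x; apply: sub_algcl; rewrite -[jt _]/(io x); exact: gen_base.
  - move=> b; case: (eqVneq b (r0 (bx b))) => [->|ne]; first by rewrite zk_r0 rmorph1.
    apply: sub_algcl; apply: gen_sub; apply/mapP; exists b => //.
    by rewrite mem_filter ne mem_enum.
rewrite -(splitK i); case: (split i) => a /=; rewrite ?zl ?zr //.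
have [q [iq rq _]] := Th_deg (eta (enum_val a)).
apply: (algcl_root (p := map_poly jt q)) => //; first by rewrite map_poly_eq0 irredp_neq0.
by move=> j; rewrite coef_map; apply: jtT.
Qed.

Variables (F0 : fieldType) (io0 : {rmorphism F0 -> kap}).
Hypothesis io0_gen : forall a, gen iok (fun x => exists i, bx i = None /\ x = zk i) (io0 a).

(** The coefficients in [F0] are ratios of polynomials in the variables of block [None]. Clearing
    denominators and homogenizing turns a relation over [F0] into a multihomogeneous one over [k] in
    these variables and the eta, without the coordinates on V, as [multihomogeneous_independent]
    requires. *)
Theorem residues_independent d (q : {mpoly F0[n1]}) :
  bhom (fun a : 'I_n1 => tag (enum_val a : XT)) d q -> q != 0 ->
  mmap (jt \o io0) (fun a : 'I_n1 => eta (enum_val a)) q != 0.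
Proof.
move=> hq nzq; apply/eqP => q0.
pose isy' (b : J) := b != None; pose ka0 : {rmorphism F0 -> Th} := jt \o io0.
have zN i : bx i = None -> ~~ isy' (bt (rshift n1 i)) by rewrite btr => ->.
have ratio0 a : ratio bt isy' io z (ka0 a).
  have [S1 SB SM SV] := ratio_subfield bt isy' io z.
  apply: (gen_min (T := fun x => ratio bt isy' io z (jt x)) _ _ _ (io0_gen a)).
  - by split=> [|x y hx hy|x y hx hy|x hx]; rewrite ?rmorph1 ?rmorphB ?rmorphM ?fmorphV; [apply: S1|apply: SB|apply: SM|apply: SV].
  - move=> x; rewrite -[jt _]/(io x) -(mmapC z io x); apply: ratio_poly; exact: nonyC.
  - move=> _ [i [bi ->]]; have <- : mmap io z 'X_(rshift n1 i) = jt (zk i) by rewrite mmapX mmap1U zr.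
    by apply: ratio_poly; apply: nonyX; apply: zN.
pose lft (mm : 'X_{1..n1}) : 'X_{1..n1 + m} := [multinom match split i with inl a => mm a | inr _ => 0%N end | i < n1 + m].
pose rst (mm : 'X_{1..n1 + m}) : 'X_{1..n1} := [multinom mm (lshift m a) | a < n1].
have lftl mm a : lft mm (lshift m a) = mm a by rewrite mnmE (unsplitK (inl a)).
have lftr mm b : lft mm (rshift n1 b) = 0%N by rewrite mnmE (unsplitK (inr b)).
have lftK mm : rst (lft mm) = mm by apply/mnmP => a; rewrite mnmE lftl.
have [g [FF [ng nF g0 FE]]] := common_denominator (bt := bt) (isy := isy') (io := io) (z := z) (ka := ka0) ratio0
  [seq lft mm | mm <- msupp q] (fun mm => q@_(rst mm)).
pose E0 := (\sum_(mm <- msupp q) msize (FF (lft mm)))%N.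
have leE mm : mm \in msupp q -> (msize (FF (lft mm)) <= E0)%N.
  by move=> ms; rewrite /E0 (bigD1_seq mm ms (msupp_uniq q)) leq_addr.
have bt_i0 b : bt (i0 b) = b.
  by case: b => [[s []]|] /=; rewrite ?btl ?enum_rankK ?l0E // btr r0E.
have z_i0 b : z (i0 b) = 1.
  by case: b => [[s []]|] /=; rewrite ?zl ?enum_rankK ?eta_l0 // zr zk_r0 rmorph1.
pose H mm := mkhom bt isy' i0 E0 (FF (lft mm)).
have HP mm : mm \in msupp q -> [/\ bhom bt (fun b => if isy' b then 0%N else E0) (H mm), nony bt isy' (H mm)
    & mmap io z (H mm) = mmap io z (FF (lft mm))].
  by move=> ms; apply: mkhom_prop (leE mm ms) => //; apply: nF.
pose f := \sum_(mm <- msupp q) H mm * 'X_[lft mm].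
pose isx (b : J) := if b is Some (_, false) then true else false.
have lft_deg mm : mm \in msupp q -> bdeg bt (lft mm) = fun b => if b is Some (s, true) then d s else 0%N.
  move=> ms; apply/funext => b; rewrite /bdeg big_mkcond big_split_ord /= [X in (_ + X)%N]big1 ?addn0; last first.
    by move=> i _; rewrite lftr if_same.
  under eq_bigr do rewrite btl lftl.
  case: b => [[s []]|]; last by rewrite big1.
    have /has_bdegP <- := hq mm ms; rewrite /bdeg [RHS]big_mkcond; apply: eq_bigr => a _.
    have -> : (Some (tag (enum_val a), true) == Some (s, true) :> J) = (tag (enum_val a) == s).
      by apply/eqP/eqP => [[]|->].
    by [].
  by rewrite big1 // => a _; case: eqP => // -[].
have hf : bhom bt (fun b => (if isy' b then 0 else E0) + (if b is Some (s, true) then d s else 0))%N f.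
  rewrite /f big_seq; apply: bhom_sum => mm ms; have [h1 _ _] := HP mm ms.
  apply: bhomM => //; rewrite -(lft_deg mm ms); exact: bhom_bdeg.
have nxf : nony bt isx f.
  rewrite /f big_seq; apply: (@big_ind _ (nony bt isx)).
  - by rewrite -mpolyC0; apply: nonyC.
  - exact: nonyD.
  move=> mm ms; have [_ h2 _] := HP mm ms; apply: nonyM.
    by move=> m1 m1s i xi; apply: (h2 m1 m1s); move: xi; rewrite /isy'; case: (bt i).
  move=> m1; rewrite msuppX inE => /eqP -> i; rewrite -(splitK i); case: (split i) => a /=.
    by rewrite btl.
  by rewrite lftr.
have mmX mm : mmap1 z (lft mm) = mmap1 (fun a : 'I_n1 => eta (enum_val a)) mm.
  rewrite /mmap1 big_split_ord /= [X in _ * X]big1 ?mulr1; last by move=> i _; rewrite lftr expr0.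
  by apply: eq_bigr => a _; rewrite lftl zl.
have HE mm : mm \in msupp q -> mmap io z (H mm) = mmap io z g * ka0 q@_mm.
  move=> ms; have [_ _ ->] := HP mm ms; have := FE (lft mm) (map_f _ ms); rewrite lftK => ->.
  by rewrite mulrC divfK.
have f0 : mmap io z f = 0.
  have qE : mmap ka0 (fun a : 'I_n1 => eta (enum_val a)) q =
    \sum_(mm <- msupp q) ka0 q@_mm * mmap1 (fun a : 'I_n1 => eta (enum_val a)) mm by [].
  transitivity (\sum_(mm <- msupp q) mmap io z g * (ka0 q@_mm * mmap1 (fun a : 'I_n1 => eta (enum_val a)) mm)).
    rewrite /f rmorph_sum /=; apply: eq_big_seq => mm ms.
    by rewrite rmorphM /= (HE mm ms) mmapX mmX mulrA.
  by rewrite -mulr_sumr -qE q0 mulr0.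
have s_eta x : x \in codom eta -> algebraicOver jt x.
  by move=> _; have [q' [iq rq _]] := Th_deg x; exists q'; rewrite ?irredp_neq0.
have [K [i [j [n [b [sb ib jiK jim _]]]]]] := @ex_finite_ext kap Th jt (codom eta) s_eta.
have [Q [f1 [f2 [f1K f2K f2Z _]]]] := ex_fieldExt sb ib.
pose fQ : {rmorphism Q -> Th} := j \o f2.
have fQZ a x : fQ (a *: x) = jt a * fQ x by rewrite /= f2Z rmorphM jiK.
have /choice[zQ fQz] l : exists y, fQ y = z l.
  rewrite -(splitK l); case: (split l) => a /=; rewrite ?zl ?zr.
    by have [y ->] := jim _ (codom_f eta (enum_val a)); exists (f1 y); rewrite f1K.
  by exists (zk a)%:A; rewrite f2Z rmorph1 mulr1 jiK.
have Q_dim : coprime p (\dim {:Q}).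
  apply: coprime_dim_of_elements => //.
    by rewrite !inE p_pr -(rmorph_nat iok) fmorph_eq0.
  move=> x _; have [q' [iq rq cq]] := Th_deg (fQ x).
  rewrite (adjoin_degree_irreducible (q := q') iq) //.
  rewrite -(fmorph_root fQ) -map_poly_comp; apply: etrans rq; congr (root _ _).
  by apply: eq_map_poly => a; rewrite /= f2Z rmorph1 mulr1 jiK.
have fz : f = 0.
  apply: (@multihomogeneous_independent p r (n1 + m) e k bt Th io z p_pr yfirst card_block i0 bt_i0 z_i0
    z_indep kap jt ka_ratio _ Q fQ zQ fQZ fQz Q_dim T z_T size_T std_dvd _ f hf _ f0) => //.
  by move=> f3 nf3; have [f3' [_ _ ->]] := mmap_r nf3; exists (mmap iok zk f3').
(* Evaluates all variables except those of the eta. Applied to [f], it returns [q] times the value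
   of the common denominator, so [f = 0] contradicts [q != 0]. *)
pose Psi : {rmorphism {mpoly k[n1 + m]} -> {mpoly Th[n1]}} := mmap (@mpolyC n1 Th \o io)
  (fun l => match split l with inl a => 'X_a | inr _ => (z l)%:MP end).
have PsiH mm : mm \in msupp q -> Psi (H mm) = (mmap io z (H mm))%:MP.
  move=> ms; have [_ h2 _] := HP mm ms; rewrite /Psi /= /mmap rmorph_sum /= big_seq [RHS]big_seq.
  apply: eq_bigr => m1 m1s; rewrite rmorphM /= /mmap1 rmorph_prod; congr (_ * _); apply: eq_bigr => l _.
  rewrite rmorphXn -(splitK l); case: (split l) => a /=; last by rewrite (unsplitK (inr a)).
  by rewrite (h2 m1 m1s) ?expr0 // btl.
have PsiX mm : Psi 'X_[lft mm] = 'X_[mm].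
  rewrite /Psi /= mmapX /mmap1 big_split_ord /= [X in _ * X]big1 ?mulr1; last by move=> a _; rewrite lftr expr0.
  rewrite mpolyXE_id; apply: eq_bigr => a _; rewrite lftl (unsplitK (inl a)).
  by [].
have [m0 m0s] : exists m0, m0 \in msupp q.
  by case eq : (msupp q) => [|m0 s]; [move: nzq; rewrite -msupp_eq0 eq | exists m0; rewrite mem_head].
have : (Psi f)@_m0 = mmap io z g * ka0 q@_m0.
  rewrite /f rmorph_sum raddf_sum /= (bigD1_seq m0 m0s (msupp_uniq q)) /= big_seq_cond big1 => [|m1 /andP[m1s ne]].
    by rewrite rmorphM PsiH // PsiX mul_mpolyC mcoeffZ mcoeffX eqxx mulr1 addr0 HE.
  by rewrite rmorphM PsiH // PsiX mul_mpolyC mcoeffZ mcoeffX (negbTE ne) mulr0.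
rewrite fz rmorph0 mcoeff0 => /esym/eqP; rewrite mulf_eq0 (negbTE g0) fmorph_eq0 /=.
by rewrite -[_ == 0]negbK -mcoeff_msupp m0s.
Qed.

End ResidualIndependence.

(** * Matrix entries of a family of representations *)

Section RepresentationEntries.

Variables (F : fieldType) (G P : finGroupType) (pi : {morphism [set: G] >-> P}) (r : nat) (n : 'I_r -> nat)
  (rho : forall i, mx_representation F [set: G] (n i)).
Let XT : finType := {s : 'I_r & 'I_(n s)}.
Local Notation tg a := (existT (fun s : 'I_r => 'I_(n s)) _ a).

Definition rep_entry (g : G) (t t' : XT) : F :=
  if tag t == tag t' then rho (tag t) g (tagged t) (tagged_as t t') else 0.

Lemma rep_entry_block g t t' : tag t != tag t' -> rep_entry g t t' = 0.
Proof. by rewrite /rep_entry => /negbTE ->. Qed.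

Lemma rep_entryE g s a b : rep_entry g (tg a) (tg b) = rho s g a b.
Proof. by rewrite /rep_entry eqxx tagged_asE. Qed.

Lemma sum_rep_entry (A : nzRingType) (f : {rmorphism F -> A}) g s a (X : XT -> A) :
  \sum_t f (rep_entry g (existT (fun s : 'I_r => 'I_(n s)) s a) t) * X t = \sum_b f (rho s g a b) * X (tg b).
Proof.
pose Q (s' : 'I_r) (b : 'I_(n s')) := f (rep_entry g (existT (fun s : 'I_r => 'I_(n s)) s a) (tg b)) * X (tg b).
transitivity (\sum_(t : XT) Q (tag t) (tagged t)).
  by apply: eq_bigr => -[s' b] _.
apply: etrans (esym (sig_big_dep (fun _ => true) (fun _ _ => true) Q)) _ => /=.
rewrite (bigD1 s) //= [X in _ + X]big1 ?addr0 => [|s' ss].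
  by apply: eq_bigr => b _; rewrite /Q rep_entryE.
by rewrite big1 // => b _; rewrite /Q rep_entry_block ?rmorph0 ?mul0r //= eq_sym.
Qed.

Lemma rep_entry_scalar g (a : 'I_r -> F) : (forall s, rho s g = (a s)%:M) ->
  forall t t', rep_entry g t t' = a (tag t) * (t == t')%:R.
Proof.
move=> ga [s x] [s' y]; case: (eqVneq s s') => [e|ne].
  case: s' / e y => y; rewrite rep_entryE ga mxE -[RHS]/(a s * _) eq_Tagged /=.
  by case: (x == y); rewrite ?mulr1 ?mulr0.
rewrite rep_entry_block //=; case: eqP => [/(congr1 tag)/= e|_]; last by rewrite mulr0.
by move: ne; rewrite e eqxx.
Qed.

Lemma rep_entryM g h t t' : rep_entry (g * h)%g t t' = \sum_u rep_entry g t u * rep_entry h u t'.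
Proof.
case: t t' => [s x] [s' y].
have -> : \sum_u rep_entry g (existT _ s x) u * rep_entry h u (existT _ s' y) =
    \sum_b rho s g x b * rep_entry h (tg b) (existT _ s' y).
  exact: (@sum_rep_entry F idfun g s x (fun u => rep_entry h u (existT _ s' y))).
case: (eqVneq s s') => [e|ne].
  case: s' / e y => y; rewrite rep_entryE repr_mxM ?inE // mxE.
  by apply: eq_bigr => b _; rewrite rep_entryE.
by rewrite rep_entry_block // big1 // => b _; rewrite rep_entry_block ?mulr0.
Qed.

Lemma Ax1 : Ax pi rep_entry 1%g = 1%:M.
Proof.
apply/matrixP => i j; rewrite !mxE -(inj_eq enum_val_inj).
case: (enum_val i) (enum_val j) => [t|a] [t'|b] //=; first last.
  rewrite morph1 -[inr a == inr b]/(a == b) eq_sym; congr (_ == _)%:R.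
  by case: a => //= h; rewrite mulg1.
rewrite (@rep_entry_scalar 1%g (fun=> 1)) ?mul1r // => s.
by rewrite repr_mx1.
Qed.

Lemma AxM g h : Ax pi rep_entry (g * h)%g = Ax pi rep_entry g *m Ax pi rep_entry h.
Proof.
apply/matrixP => i j; rewrite !mxE (reindex (enum_rank : (XT + option P)%type -> _)) /=; last first.
  by apply: onW_bij; apply: enum_rank_bij.
under eq_bigr do rewrite !mxE enum_rankK.
rewrite big_sumType /=; case: (enum_val i) (enum_val j) => [t|a] [t'|b] /=.
- by rewrite [X in _ + X]big1 ?addr0 => [|u _]; rewrite ?mul0r // rep_entryM.
- by rewrite !big1 ?addr0 // => u _; rewrite ?mul0r ?mulr0.
- by rewrite !big1 ?addr0 // => u _; rewrite ?mul0r ?mulr0.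
rewrite [X in X + _]big1 ?add0r => [|u _]; last by rewrite mul0r.
rewrite (bigD1 (omap (fun x => (x * pi g)%g) a)) //= eqxx mul1r big1 ?addr0 => [|u ne].
  by congr (_ == _)%:R; case: a => //= x; rewrite morphM ?inE // mulgA.
by rewrite (negbTE ne) mul0r.
Qed.

Lemma Ax_block g i j : bx i != bx j -> Ax pi rep_entry g i j = 0.
Proof.
rewrite mxE /bx; case: (enum_val i) (enum_val j) => [t|a] [t'|b] //= ne.
by apply: rep_entry_block; apply: contraNneq ne => ->.
Qed.

End RepresentationEntries.

(** * Values of equivariant vectors and the absence of relations *)

Section UnitValues.

Variables (kap L : fieldType) (O : L -> Prop) (res : L -> kap).
Hypothesis pl : place O res.

Definition val_unit z := O z /\ res z != 0.

Lemma val_unitM x y : val_unit x -> val_unit y -> val_unit (x * y).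
Proof. by case=> Ox rx [Oy ry]; split; [apply: (placeM pl) | rewrite (resM pl) // mulf_neq0]. Qed.

Lemma val_unitV x : val_unit x -> val_unit x^-1.
Proof.
case=> Ox rx; have Ov := resV pl Ox rx; split=> //.
have x0 : x != 0 by apply: contraNneq rx => ->; rewrite (res_zero pl).
have := res_one pl; rewrite -(divff x0) (resM pl) // => e.
by apply: contra_eq_neq e => ->; rewrite mulr0 eq_sym oner_eq0.
Qed.

Lemma val_unit_root x m : (0 < m)%N -> val_unit (x ^+ m) -> val_unit x.
Proof.
move=> m0 ux; have [Ox|Ov] := placeV pl x.
  split=> //; have [_] := ux; have [_ ->] := place_exp pl m Ox.
  by rewrite expf_eq0 m0.
rewrite -[x]invrK; apply: val_unitV; split=> //.
have [_] := val_unitV ux; rewrite -exprVn; have [_ ->] := place_exp pl m Ov.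
by rewrite expf_eq0 m0.
Qed.

Variables (r p : nat) (y : 'I_r -> L) (p_pr : prime p).
Hypothesis y0 : forall s, y s != 0.
Hypothesis sep : forall (s : 'I_r) (d d' : 'I_r -> nat), val_unit (\prod_s y s ^+ d s / \prod_s y s ^+ d' s) ->
  d s = d' s %[mod p].

(* The value group is torsion free, so exponents may be divided by p as long
   as they are congruent modulo p. *)
Lemma unit_exponents (d d' : 'I_r -> nat) :
  val_unit (\prod_s y s ^+ d s / \prod_s y s ^+ d' s) -> d =1 d'.
Proof.
have [m] := ubnP (\sum_s d s + \sum_s d' s)%N; elim: m d d' => // m IH d d' lt ud.
have dm s : d s = d' s %[mod p] := sep s ud.
pose a (d : 'I_r -> nat) s := (d s %/ p)%N.
have aE (d0 : 'I_r -> nat) s : d0 s = (a d0 s * p + d0 s %% p)%N by apply: divn_eq.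
have [z0|nz] := posnP (\sum_s d s + \sum_s d' s)%N.
  move=> s; have h (d0 : 'I_r -> nat) : (d0 s <= \sum_s' d0 s')%N by rewrite (bigD1 s) //= leq_addr.
  move: (h d) (h d') z0; move: (\sum_s' d s')%N (\sum_s' d' s')%N (d s) (d' s) => x1 x2 x3 x4; lia.
have le (d0 : 'I_r -> nat) : (p * \sum_s a d0 s <= \sum_s d0 s)%N.
  by rewrite big_distrr /=; apply: leq_sum => s _; rewrite mulnC leq_trunc_div.
have : a d =1 a d'.
  apply: IH.
    move: (le d) (le d') (prime_gt1 p_pr) lt nz.
    move: (\sum_s a d s)%N (\sum_s a d' s)%N (\sum_s d s)%N (\sum_s d' s)%N => x1 x2 x3 x4; nia.
  apply: (val_unit_root (prime_gt0 p_pr)); rewrite exprMn exprVn -!prodrXl.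
  pose C := \prod_s y s ^+ (d s %% p).
  have C0 : C != 0 by apply/prodf_neq0 => s _; rewrite expf_neq0.
  have e1 : \prod_s y s ^+ d s = \prod_s (y s ^+ a d s) ^+ p * C.
    by rewrite -big_split /=; apply: eq_bigr => s _; rewrite -exprM -exprD -aE.
  have e2 : \prod_s y s ^+ d' s = \prod_s (y s ^+ a d' s) ^+ p * C.
    by rewrite -big_split /=; apply: eq_bigr => s _; rewrite -exprM dm -exprD -aE.
  move: ud; rewrite e1 e2 invfM mulrACA divff // mulr1.
  by [].
by move=> h s; rewrite (aE d) (aE d') h dm.
Qed.

End UnitValues.

Section NoRelation.

Variables (p r : nat) (e nn : 'I_r -> nat) (k : fieldType) (w : k) (G P : finGroupType) (pi : G -> P).
Hypotheses (p_pr : prime p) (w_prim : p.-primitive_root w) (p_neq0 : p%:R != 0 :> k)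
  (nnE : forall s, nn s = (p ^ e s)%N).
Let XT : finType := {s : 'I_r & 'I_(nn s)}.
Let XV : finType := (XT + option P)%type.
Variables (AX : G -> XT -> XT -> k) (c : 'I_r -> G) (om : 'I_r -> k).
Hypotheses (AX_block : forall g t t', tag t != tag t' -> AX g t t' = 0)
  (AX_c : forall s t t', AX (c s) t t' = (if tag t == s then om s else 1) * (t == t')%:R)
  (om_p : forall s, om s ^+ p = 1) (om_1 : forall s, om s != 1)
  (c_p : forall s, (c s ^+ p = 1)%g) (pi_c : forall s, pi (c s) = 1%g)
  (dim_dvd : forall s m (rU : mx_representation k [set: G] m) a, rU (c s) = a%:M -> a ^+ p = 1 -> a != 1 ->
     (p ^ e s %| m)%N).

Let m := #|XV|.
Local Notation bx := (@bx r nn P).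
Local Notation Ax := (@Ax r nn k G P pi AX).
Variables (r0 : option 'I_r -> 'I_m).
Hypothesis r0E : forall b, bx (r0 b) = b.

Variables (kap : fieldType) (sg : G -> kap -> kap) (iok : {rmorphism k -> kap}) (zk : 'I_m -> kap)
  (uk : option 'I_r -> G -> kap).
Hypotheses (sg_io : forall g a, sg g (iok a) = iok a) (hsg : ring_action sg) (zk_r0 : forall b, zk (r0 b) = 1)
  (uk0 : forall b g, uk b g != 0) (ukM : forall b g h, uk b (g * h)%g = sg h (uk b g) * uk b h)
  (sgz : forall g i, sg g (zk i) * uk (bx i) g = \sum_j iok (Ax g i j) * zk j)
  (zk_indep : forall d f, bhom bx d f -> f != 0 -> mmap iok zk f != 0)
  (kap_gen : forall S : kap -> Prop, subfield_prop S -> (forall a, S (iok a)) -> (forall i, S (zk i)) -> forall x, S x).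

Variables (Th : fieldType) (jt : {rmorphism kap -> Th}) (sT : G -> Th -> Th).
Hypotheses (hsT : ring_action sT) (sT_jt : forall g a, sT g (jt a) = jt (sg g a))
  (Th_deg : forall th, exists q : {poly kap}, [/\ irreducible_poly q, root (map_poly jt q) th & coprime p (size q).-1]).
Variables (Om : fieldType) (R : Om -> Prop) (Res : Om -> Th) (iK : {rmorphism kap -> Om}) (act : G -> Om -> Om).
Hypotheses (plR : place R Res) (iK_R : forall a, R (iK a) /\ Res (iK a) = jt a) (hact : ring_action act)
  (act_R : forall g x, R x -> R (act g x) /\ Res (act g x) = sT g (Res x)).
Variable Y : XT -> Om.
Hypotheses (Y_act : forall g t, act g (Y t) = \sum_t' iK (iok (AX g t t')) * Y t')
  (Y_neq0 : forall s, exists t, tag t = s /\ Y t != 0).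
Variables (F0 : fieldType) (io0 : {rmorphism F0 -> kap}).
Hypothesis io0_gen : forall a, gen iok (fun x => exists i, bx i = None /\ x = zk i) (io0 a).

Let actV g x : act g x^-1 = (act g x)^-1.
Proof. by have [f fE] := ract_rmorph hact g; rewrite -!fE fmorphV. Qed.
Let actX g x j : act g (x ^+ j) = act g x ^+ j.
Proof. by have [f fE] := ract_rmorph hact g; rewrite -!fE rmorphXn. Qed.

(** The multidegree component q_d has value Y0^d times a unit, where Y0 collects the dominant
    coordinates: its residue is q_d at the eta, nonzero by [residues_independent]. Distinct
    multidegrees give distinct values, so the components cannot cancel. *)
Lemma no_relation (q : {mpoly F0[#|XT|]}) : q != 0 ->
  mmap (iK \o io0) (fun a : 'I_#|XT| => Y (enum_val a)) q != 0.
Proof.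
move=> nzq.
have /choice[l0 l0P] s : exists t, [/\ tag t = s, Y t != 0 & forall t', tag t' = s -> R (Y t' / Y t)].
  have [t1 [t1s Yt1]] := Y_neq0 s.
  have [|_ [/mapP[t ts ->] nz dom]] := @ex_dominant _ _ _ _ plR [seq Y t | t <- enum XT & tag t == s].
    by exists (Y t1) => //; apply: map_f; rewrite mem_filter t1s eqxx mem_enum.
  move: ts; rewrite mem_filter => /andP[/eqP ts _]; exists t; split=> // t' t's.
  by apply: dom; apply: map_f; rewrite mem_filter t's eqxx mem_enum.
pose rat t := Y t / Y (l0 (tag t)); pose V s g := act g (Y (l0 s)) / Y (l0 s).
have l0E s : tag (l0 s) = s by have [] := l0P s.
have Y0 s : Y (l0 s) != 0 by have [] := l0P s.
have ratR t : R (rat t) by have [_ _ h] := l0P (tag t); apply: h.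
have rat_l0 s : rat (l0 s) = 1 by rewrite /rat l0E divff.
have act0 g x : x != 0 -> act g x != 0 by have [f fE] := ract_rmorph hact g; rewrite -!fE fmorph_eq0.
have RO (F : XT -> Om) : (forall t, R (F t)) -> R (\sum_t F t) /\ Res (\sum_t F t) = \sum_t Res (F t).
  exact: place_sum.
have sumE g t : \sum_t' iK (iok (AX g t t')) * Y t' = (\sum_t' iK (iok (AX g t t')) * rat t') * Y (l0 (tag t)).
  rewrite mulr_suml; apply: eq_bigr => t' _; case: (eqVneq (tag t) (tag t')) => [->|ne].
    by rewrite -mulrA divfK.
  by rewrite AX_block // !rmorph0 !mul0r.
have R_ent g t t' : R (iK (iok (AX g t t')) * rat t').
  by apply: (placeM plR); [have [] := iK_R (iok (AX g t t')) | apply: ratR].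
have Res_ent g t t' : Res (iK (iok (AX g t t')) * rat t') = jt (iok (AX g t t')) * Res (rat t').
  by have [h1 h2] := iK_R (iok (AX g t t')); rewrite (resM plR) ?h2.
have VE s g : V s g = \sum_t iK (iok (AX g (l0 s) t)) * rat t.
  by rewrite /V Y_act sumE l0E mulfK.
have VR s g : R (V s g) by rewrite VE; have [] := RO _ (R_ent g (l0 s)).
have VM s g h : V s (g * h)%g = act h (V s g) * V s h.
  by rewrite /V (ractM hact) (ractMl hact) actV mulrA mulfVK ?act0.
pose v s g := Res (V s g).
(* The cocycle rule at [g^-1%g] and [g] writes 1 as a product with factor [V s g], both factors
   being integral; so its residue is nonzero. *)
have v0 s g : v s g != 0.
  have V1 : V s 1%g = 1 by rewrite /V (ract1 hact) divff.
  have := VM s g^-1%g g; rewrite mulVg V1 => /(congr1 Res).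
  have [h1 _] := act_R g (VR s g^-1%g); rewrite (res_one plR) (resM plR) // => e1.
  by apply/eqP => e0; move/eqP: e1; rewrite -/(v s g) e0 mulr0 oner_eq0.
have vM s g h : v s (g * h)%g = sT h (v s g) * v s h.
  by have [h1 h2] := act_R h (VR s g); rewrite /v VM (resM plR) // h2.
pose eta t := Res (rat t).
have eta_act g t : sT g (eta t) * v (tag t) g = \sum_t' jt (iok (AX g t t')) * eta t'.
  have [h1 h2] := act_R g (ratR t); rewrite -h2 -(resM plR) //.
  have -> : act g (rat t) * V (tag t) g = \sum_t' iK (iok (AX g t t')) * rat t'.
    rewrite /rat /V (ractMl hact) actV mulrA mulfVK ?act0 // Y_act sumE mulfK //.
  have [_ ->] := RO _ (R_ent g t); by apply: eq_bigr => t' _; rewrite Res_ent.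
have eta_l0 s : eta (l0 s) = 1 by rewrite /eta rat_l0 (res_one plR).
have Y_c s t : act (c s) (Y t) = iK (iok (if tag t == s then om s else 1)) * Y t.
  rewrite Y_act (bigD1 t) //= big1 => [|t' ne]; rewrite AX_c ?eqxx ?mulr1 ?addr0 //.
  by rewrite (eq_sym t t') (negbTE ne) mulr0 !rmorph0 mul0r.
have v_c s s' : v s' (c s) = jt (iok (if s' == s then om s else 1)).
  rewrite /v /V Y_c l0E mulfK //; exact: (iK_R _).2.
have fixT s th : sT (c s) th = th.
  by eapply (@central_fixes p r nn k w G P pi); eassumption.
have indep_eta d (q' : {mpoly F0[#|XT|]}) : bhom (fun a : 'I_#|XT| => tag (enum_val a : XT)) d q' -> q' != 0 ->
    mmap (jt \o io0) (fun a : 'I_#|XT| => eta (enum_val a)) q' != 0.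
  by move=> hq' nzq'; eapply (@residues_independent p r e nn k w G P pi); eassumption.
pose bt0 (a : 'I_#|XT|) := tag (enum_val a : XT).
pose deg (mm : 'X_{1..#|XT|}) : {ffun 'I_r -> nat} := [ffun s => bdeg bt0 mm s].
pose ds := undup [seq deg mm | mm <- msupp q].
pose qd (d : {ffun 'I_r -> nat}) : {mpoly F0[#|XT|]} := \sum_(mm <- msupp q | deg mm == d) q@_mm *: 'X_[mm].
pose Y0d (d : {ffun 'I_r -> nat}) := \prod_s Y (l0 s) ^+ d s.
pose rq (d : {ffun 'I_r -> nat}) := mmap (iK \o io0) (fun a : 'I_#|XT| => rat (enum_val a)) (qd d).
have qd_hom (d : {ffun 'I_r -> nat}) : bhom bt0 d (qd d).
  apply: bhom_sum => mm /eqP <-; apply: bhomZ; rewrite (_ : (deg mm : 'I_r -> nat) = bdeg bt0 mm).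
    exact: bhom_bdeg.
  by apply/funext => s; rewrite ffunE.
have qd0 d : d \in ds -> qd d != 0.
  rewrite mem_undup => /mapP[m0 m0s ->]; apply/eqP => /(congr1 (mcoeff m0)).
  rewrite mcoeff0 raddf_sum /= -big_filter (bigD1_seq m0) /=; first last.
  - by rewrite filter_uniq ?msupp_uniq.
  - by rewrite mem_filter eqxx.
  rewrite big1 => [|mm ne]; last by rewrite mcoeffZ mcoeffX (negbTE ne) mulr0.
  by rewrite mcoeffZ mcoeffX eqxx mulr1 addr0 => /eqP; rewrite -[_ == 0]negbK -mcoeff_msupp m0s.
have mmapS (S : fieldType) (h : {rmorphism F0 -> S}) (X : 'I_#|XT| -> S) (d : {ffun 'I_r -> nat}) :
    mmap h X (qd d) = \sum_(mm <- msupp q | deg mm == d) h q@_mm * mmap1 X mm.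
  by rewrite /qd rmorph_sum; apply: eq_bigr => mm _; rewrite /= mmapZ mmapX.
have Rexp mm : R (mmap1 (fun a : 'I_#|XT| => rat (enum_val a)) mm) /\
    Res (mmap1 (fun a : 'I_#|XT| => rat (enum_val a)) mm) = mmap1 (fun a : 'I_#|XT| => eta (enum_val a)) mm.
  rewrite /mmap1; elim: (index_enum _) => [|a s [IH1 IH2]].
    by rewrite !big_nil (res_one plR); split=> //; apply: (place1 plR).
  rewrite !big_cons; have [h1 h2] := place_exp plR (mm a) (ratR (enum_val a)).
  by split; [apply: (placeM plR) | rewrite (resM plR) // h2 IH2].
have rqE d : R (rq d) /\ Res (rq d) = mmap (jt \o io0) (fun a : 'I_#|XT| => eta (enum_val a)) (qd d).
  rewrite /rq !mmapS -big_filter -[X in _ = X]big_filter.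
  have [|h1 ->] := place_sum plR [seq mm <- msupp q | deg mm == d]
    (F := fun mm => (iK \o io0) q@_mm * mmap1 (fun a : 'I_#|XT| => rat (enum_val a)) mm).
    by move=> mm; apply: (placeM plR); [have [] := iK_R (io0 q@_mm) | have [] := Rexp mm].
  split=> //; apply: eq_bigr => mm _; have [h2 h3] := Rexp mm; have [h4 h5] := iK_R (io0 q@_mm).
  by rewrite (resM plR) // h3 /= h5.
have rq_unit d : d \in ds -> val_unit R Res (rq d).
  by move=> dd; have [h1 h2] := rqE d; split=> //; rewrite h2; apply: indep_eta (qd_hom d) (qd0 d dd).
have Y0d0 d : Y0d d != 0 by apply/prodf_neq0 => s _; rewrite expf_neq0.
have unit0 x : val_unit R Res x -> x != 0.
  by case=> _; apply: contraNneq => ->; rewrite (res_zero plR).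
have -> : mmap (iK \o io0) (fun a : 'I_#|XT| => Y (enum_val a)) q = \sum_(d <- ds) Y0d d * rq d.
  transitivity (\sum_(d <- ds) \sum_(mm <- msupp q | deg mm == d)
      (iK \o io0) q@_mm * mmap1 (fun a : 'I_#|XT| => Y (enum_val a)) mm).
    rewrite (exchange_big_dep xpredT) //= /mmap; apply: eq_big_seq => mm ms.
    rewrite -big_filter (_ : [seq d <- ds | deg mm == d] = [:: deg mm]) ?big_seq1 //.
    rewrite -(eq_filter (a1 := pred1 (deg mm))) => [|d]; last by rewrite /= eq_sym.
    by rewrite filter_pred1_uniq ?undup_uniq // mem_undup map_f.
  apply: eq_bigr => d _; rewrite /rq mmapS mulr_sumr; apply: eq_bigr => mm /eqP <-.
  rewrite mulrCA; congr (_ * _); rewrite /Y0d /mmap1.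
  rewrite (eq_bigr (fun s => \prod_(a | bt0 a == s) Y (l0 (bt0 a)) ^+ mm a)); last first.
    by move=> s _; rewrite ffunE /bdeg expr_sum; apply: eq_bigr => a /eqP ->.
  have <- : \prod_a Y (l0 (bt0 a)) ^+ mm a = \prod_s \prod_(a | bt0 a == s) Y (l0 (bt0 a)) ^+ mm a.
    by rewrite (partition_big bt0 xpredT).
  by rewrite -big_split /=; apply: eq_bigr => a _; rewrite -exprMn /rat mulrC divfK.
apply: (sum_distinct_values plR); first exact: undup_uniq.
- case eq : (msupp q) => [|m0 s]; first by move: nzq; rewrite -msupp_eq0 eq.
  by exists (deg m0); rewrite mem_undup map_f // eq mem_head.
- by move=> d dd; rewrite mulf_neq0 ?Y0d0 // (unit0 _ (rq_unit d dd)).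
move=> d d' dd dd' ne xR; apply/eqP; apply: contraNT ne => xn; apply/eqP/ffunP.
apply: (unit_exponents plR p_pr Y0).
  (* [c s] multiplies this unit by a power of [om s] with exponent [a s] minus [a' s], yet fixes its
     residue. The power is therefore 1, and the exponents agree modulo [p]. *)
  move=> s a a' ua; pose W := \prod_s Y (l0 s) ^+ a s / \prod_s Y (l0 s) ^+ a' s.
  have [W1 W2] := ua; have [h1 h2] := act_R (c s) W1.
  pose ab s' := if s' == s then om s else 1.
  have pE (b : 'I_r -> nat) : act (c s) (\prod_s Y (l0 s) ^+ b s) = iK (iok (om s ^+ b s)) * \prod_s Y (l0 s) ^+ b s.
    rewrite (ract_prod hact) (eq_bigr (fun s' => iK (iok (ab s' ^+ b s')) * Y (l0 s') ^+ b s')); last first.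
      by move=> s' _; rewrite actX Y_c l0E exprMn -!rmorphXn.
    rewrite big_split /=; congr (_ * _); rewrite (bigD1 s) //= /ab eqxx big1 ?mulr1 // => s' ss.
    by rewrite (negbTE ss) expr1n !rmorph1.
  have Wc : act (c s) W = iK (iok (om s ^+ a s / om s ^+ a' s)) * W.
    by rewrite /W (ractMl hact) actV !pE invfM mulrACA !fmorph_div.
  rewrite fixT Wc in h2; have [i1 i2] := iK_R (iok (om s ^+ a s / om s ^+ a' s)).
  have e1 : jt (iok (om s ^+ a s / om s ^+ a' s)) = 1.
    by apply: (mulIf W2); rewrite mul1r -i2 -(resM plR).
  have e2 : om s ^+ a s / om s ^+ a' s = 1.
    by apply: (fmorph_inj iok); apply: (fmorph_inj jt); rewrite e1 !rmorph1.
  have om0 : om s != 0 by apply/eqP => z0; have := om_p s; rewrite z0 expr0n (gtn_eqF (prime_gt0 p_pr)) => /esym/eqP; rewrite oner_eq0.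
  apply/eqP; rewrite -(eq_prim_root_expr (prime_root_primitive p_pr (om_p s) (om_1 s))).
  by rewrite -[X in _ == X]mul1r -e2 divfK // expf_neq0.
have ux : val_unit R Res (Y0d d * rq d / (Y0d d' * rq d')) by split.
have := val_unitM plR (val_unitM plR ux (rq_unit d' dd')) (val_unitV plR (rq_unit d dd)).
rewrite (_ : _ * _ * _ = Y0d d / Y0d d') //.
have n1 := unit0 _ (rq_unit d dd); have n2 := unit0 _ (rq_unit d' dd'); have n3 := Y0d0 d'.
by field; rewrite n1 n2 n3.
Qed.

End NoRelation.

Lemma algcl_rmorph (k L Om : fieldType) (iota : {rmorphism k -> L}) (h : {rmorphism L -> Om})
    (S : L -> Prop) (S' : Om -> Prop) z :
  (forall x, S x -> S' (h x)) -> algcl iota S z -> algcl (h \o iota) S' (h z).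
Proof.
move=> SS' [q [nzq qz gq]]; exists (map_poly h q); split; rewrite ?map_poly_eq0 ?fmorph_root // => i.
have [g1 gB gM gV] := gen_subfield (h \o iota) S'.
rewrite coef_map; apply: (gen_min (T := fun x => gen (h \o iota) S' (h x)) _ _ _ (gq i)).
- by split=> [|x y hx hy|x y hx hy|x hx]; rewrite ?rmorph1 ?rmorphB ?rmorphM ?fmorphV; [apply: g1|apply: gB|apply: gM|apply: gV].
- by move=> a; exact: (@gen_base k Om (h \o iota) S' a).
- by move=> x /SS'; apply: gen_sub.
Qed.

(** * The generic torsor and its generic lift *)

Section RatioTorsor.

Variables (r : nat) (nn : 'I_r -> nat) (k : fieldType) (G P : finGroupType) (pi : {morphism [set: G] >-> P}).
Let XT : finType := {s : 'I_r & 'I_(nn s)}.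
Let XV : finType := (XT + option P)%type.
Variable AX : G -> XT -> XT -> k.
Let m := #|XV|.
Local Notation bx := (@bx r nn P).
Local Notation Ax := (@Ax r nn k G P pi AX).
Variables (r0 : option 'I_r -> 'I_m).
Hypotheses (r0E : forall b, bx (r0 b) = b) (r0N : r0 None = enum_rank (inr None : XV)).
Variables (kap : fieldType) (sg : G -> kap -> kap) (iok : {rmorphism k -> kap}) (zk : 'I_m -> kap)
  (uk : option 'I_r -> G -> kap).
Hypotheses (sg_io : forall g a, sg g (iok a) = iok a) (hsg : ring_action sg) (zk_r0 : forall b, zk (r0 b) = 1)
  (uk0 : forall b g, uk b g != 0)
  (sgz : forall g i, sg g (zk i) * uk (bx i) g = \sum_j iok (Ax g i j) * zk j)
  (zk_indep : forall d f, bhom bx d f -> f != 0 -> mmap iok zk f != 0)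
  (pi_surj : forall h, exists g, pi g = h).

Lemma zk_linear_indep b (a : 'I_m -> k) : (forall j, bx j != b -> a j = 0) ->
  \sum_j iok (a j) * zk j = 0 -> forall j, a j = 0.
Proof.
move=> ab s0 j; apply: contrapT => /eqP aj.
pose f : {mpoly k[m]} := \sum_j a j *: 'X_j.
have hf : bhom bx (fun b' => (b' == b) : nat) f.
  apply: bhom_sum => i _; case: (eqVneq (bx i) b) => [bi|/ab ->]; last by rewrite scale0r => mm; rewrite msupp0.
  apply: bhomZ; rewrite (_ : (fun b' => _) = bdeg bx U_(i)); first exact: bhom_bdeg.
  by apply/funext => b'; rewrite bdeg1 bi.
have nzf : f != 0.
  apply: contraNneq aj => f0; have := congr1 (mcoeff U_(j)) f0; rewrite mcoeff0 raddf_sum /= (bigD1 j) //= big1.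
    by rewrite addr0 mcoeffZ mcoeffX eqxx mulr1 => ->.
  move=> i ij; rewrite mcoeffZ mcoeffX; case: eqP => [/mnmP/(_ i)|_]; rewrite ?mulr0 //.
  by rewrite !mnm1E eqxx eq_sym (negbTE ij).
have := zk_indep hf nzf; rewrite rmorph_sum /=.
by rewrite (eq_bigr (fun j => iok (a j) * zk j)) ?s0 ?eqxx // => i _; rewrite mmapZ mmapX mmap1U.
Qed.

Let vp (a : option P) : 'I_m := enum_rank (inr a : XV).
Let bx_vp a : bx (vp a) = None.
Proof. by rewrite /bx enum_rankK. Qed.

Let sum_vp g a : \sum_j iok (Ax g (vp a) j) * zk j = zk (vp (omap (fun h => (h * pi g)%g) a)).
Proof.
rewrite (bigD1 (vp (omap (fun h => (h * pi g)%g) a))) //= big1 => [|j ne].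
  by rewrite addr0 mxE !enum_rankK /= eqxx rmorph1 mul1r.
rewrite mxE enum_rankK; move: ne; rewrite -(inj_eq enum_val_inj) enum_rankK.
case: (enum_val j) => [t|b] /= ne; rewrite ?rmorph0 ?mul0r //.
have -> : (b == omap (fun h => (h * pi g)%g) a) = false by apply: contraNF ne => /eqP ->.
by rewrite rmorph0 mul0r.
Qed.

Let ukN g : uk None g = 1.
Proof.
have := sgz g (r0 None); rewrite zk_r0 (ract_one hsg) mul1r r0E => ->.
by rewrite r0N sum_vp /= -(zk_r0 None) r0N.
Qed.

Let sg_vp g a : sg g (zk (vp a)) = zk (vp (omap (fun h => (h * pi g)%g) a)).
Proof. by have := sgz g (vp a); rewrite bx_vp ukN mulr1 sum_vp. Qed.

Let SN x := exists i, bx i = None /\ x = zk i.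

Let SN_vp x : SN x -> exists a, x = zk (vp a).
Proof.
case=> i [bi ->]; move: bi; rewrite /bx; case e : (enum_val i) => [t|a] //= _; exists a.
by rewrite /vp -e enum_valK.
Qed.

(** The constants [k], which will be the p-closure, are invariant, so that they lie in the base [K]
    of the torsor; [K] is an extension of the ground field [k0] through [l]. The entries of the
    representation are thus available over [K]. *)
Lemma ex_ratio_torsor (k0 : fieldType) (l : {rmorphism k0 -> k}) :
  exists (K : ext k0) (E : torsor P K) (io0 : {rmorphism K -> kap}) (jE : {rmorphism E -> kap}),
  [/\ forall c z, jE (c *: z) = io0 c * jE z, forall g a, sg g (jE a) = jE (torsor_act E a (pi g)),
      forall x, gen iok SN (io0 x), forall g x, sg g (io0 x) = io0 x & forall c, exists x, io0 x = iok c].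
Proof.
have gact g x : gen iok SN x -> gen iok SN (sg g x).
  have [g1 gB gM gV] := gen_subfield iok SN.
  apply: (gen_min (T := fun x => gen iok SN (sg g x))).
  - split=> [|x' y hx hy|x' y hx hy|x' hx].
    + by rewrite (ract_one hsg); apply: g1.
    + by rewrite (ractB hsg); apply: gB.
    + by rewrite (ractMl hsg); apply: gM.
    + by have [f fE] := ract_rmorph hsg g; rewrite -fE fmorphV fE; apply: gV.
  - by move=> a; rewrite sg_io; apply: gen_base.
  - move=> _ /SN_vp[a ->]; rewrite sg_vp; apply: gen_sub; exists (vp (omap (fun h => (h * pi g)%g) a)).
    by rewrite bx_vp.
have gpi g g' x : pi g = pi g' -> gen iok SN x -> sg g x = sg g' x.
  move=> e; have [f fE] := ract_rmorph hsg g; have [f' fE'] := ract_rmorph hsg g'; rewrite -fE -fE'.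
  apply: (gen_min (T := fun x => f x = f' x)).
  - by split=> [|x' y hx hy|x' y hx hy|x' hx]; rewrite ?rmorph1 ?rmorphB ?rmorphM ?fmorphV ?hx ?hy.
  - by move=> a; rewrite fE fE' !sg_io.
  - by move=> _ /SN_vp[a ->]; rewrite fE fE' !sg_vp e.
have [Fd [hF hFE]] := @gen_field k kap iok SN.
have hFI := fmorph_inj hF; have hFg x : gen iok SN (hF x) by apply/hFE; exists x.
(* [P] acts through a set-theoretic section of [pi]; by [gpi] the choice does not affect the action
   on the field of block [None]. *)
have /choice[sig sigE] := pi_surj.
have /choice[aF0 aF0E] (hx : P * Fd) : exists y, sg (sig hx.1) (hF hx.2) = hF y.
  by apply/hFE; apply: gact; apply: hFg.
pose aF h x := aF0 (h, x).
have aFE g x : hF (aF (pi g) x) = sg g (hF x) by rewrite -aF0E /=; apply: gpi; rewrite ?sigE.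
have aFh h x : hF (aF h x) = sg (sig h) (hF x) by rewrite -aF0E.
have haF : ring_action aF.
  split=> [x|g h x|g x y|g].
  - by apply: hFI; rewrite -(morph1 pi) aFE (ract1 hsg).
  - apply: hFI; rewrite -[g]sigE -[h]sigE -morphM ?inE // !aFE (ractM hsg).
    by [].
  - by apply: hFI; rewrite rmorphB !aFh rmorphB (ractB hsg).
  - by split=> [|x y]; apply: hFI; rewrite ?rmorphM !aFh ?rmorph1 ?(ract_one hsg) // rmorphM (ractMl hsg).
have [Kd [hK hKE]] : exists (Kd : fieldType) (hK : {rmorphism Kd -> Fd}), forall x, (forall h, aF h x = x) <-> exists y, x = hK y.
  apply: ex_subfield; split=> [h|x y hx hy h|x y hx hy h|x hx h].
  - exact: (ract_one haF).
  - by rewrite (ractB haF) hx hy.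
  - by rewrite (ractMl haF) hx hy.
  - by have [f fE] := ract_rmorph haF h; rewrite -fE fmorphV fE hx.
have chr : chr_coords aF.
  apply: chr_coords_field => // h h1; have [y yE] : exists y, zk (vp (Some 1%g)) = hF y.
    by apply/hFE; apply: gen_sub; exists (vp (Some 1%g)); rewrite bx_vp.
  (* [h] carries the coordinate of 1 to that of [h], and distinct coordinates are linearly
     independent over [k]. *)
  exists y; apply/eqP => /(congr1 hF); rewrite -{1}[h]sigE aFE -yE sg_vp /= mul1g sigE => e.
  pose a j : k := (j == vp (Some h))%:R - (j == vp (Some 1%g))%:R.
  have := @zk_linear_indep None a _ _ (vp (Some h)); rewrite /a eqxx.
  have -> : (vp (Some h) == vp (Some 1%g)) = false.
    by apply/negbTE; apply: contra h1 => /eqP/enum_rank_inj[->].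
  rewrite subr0 => F; have /eqP : (1 : k) = 0; last by rewrite oner_eq0.
  apply: F.
    move=> j bj; have nj x : (j == vp x) = false by apply: contraNF bj => /eqP ->; rewrite bx_vp.
    by rewrite /a !nj subrr.
  rewrite /a; under eq_bigr do rewrite rmorphB !rmorph_nat mulrBl.
  rewrite sumrB; have sE (j0 : 'I_m) : \sum_j (j == j0)%:R * zk j = zk j0.
    by rewrite (bigD1 j0) //= eqxx mul1r big1 ?addr0 // => j /negbTE ->; rewrite mul0r.
  by rewrite !sE e subrr.
have [E [fE [fE' [fK fK' fE'Z fEA]]]] := ex_torsor (@mulrC Fd) haF
  (fun h c => (hKE (hK c)).2 (ex_intro _ c erefl) h) (fun x => (hKE x).1) chr.
have hKF h c : aF h (hK c) = hK c by apply: ((hKE (hK c)).2 (ex_intro _ c erefl) h).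
have inK c : exists x, hF (hK x) = iok c.
  have /hFE[y yE] : gen iok SN (iok c) by apply: gen_base.
  have /hKE[x yx] : forall h, aF h y = y by move=> h; apply: hFI; rewrite aFh -yE sg_io.
  by exists x; rewrite -yx yE.
have [iK iKE] : exists iK : {rmorphism k0 -> Kd}, forall c, (hF \o hK) (iK c) = (iok \o l) c.
  apply: rmorph_factor (fmorph_inj _) _ => c; have [x xE] := inK (l c); exists x.
  by rewrite /= xE.
exists (Ext iK), E, (hF \o hK), (hF \o fE'); split=> //.
- by move=> c z; rewrite /= fE'Z rmorphM.
- by move=> g a; rewrite /= -aFE; congr (hF _); rewrite -[in RHS](fK' a) -fEA fK.
- by move=> x; apply: hFg.
- by move=> g x; rewrite /= -aFE hKF.
Qed.

End RatioTorsor.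

Section GenericLift.

Variables (r : nat) (kap : fieldType) (G P : finGroupType) (pi : {morphism [set: G] >-> P}) (k0 : fieldType)
  (sg : G -> kap -> kap) (us : seq (G -> kap)) (L : fieldType) (io : {rmorphism kap -> L})
  (ta : G -> L -> L) (O : L -> Prop) (res : L -> kap) (ts : seq L).
Hypotheses (tw : tower sg us io ta O res ts)
  (faithful : forall g, (forall x, sg g x = x) -> (forall i, (i < size us)%N -> nth (fun=> 0) us i g = 1) -> g = 1%g).
Variables (K : fieldType) (E : torsor P K) (io0 : {rmorphism K -> kap}) (jE : {rmorphism E -> kap}).
Hypotheses (jEZ : forall c z, jE (c *: z) = io0 c * jE z)
  (jEA : forall g a, sg g (jE a) = jE (torsor_act E a (pi g))) (io0_fix : forall g x, sg g (io0 x) = io0 x).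

Lemma ex_generic_lift : exists (M : ext K) (xi : lift_obj pi E M) (hM : {rmorphism M -> L})
    (fX : {rmorphism L -> lift_torsor xi}),
  [/\ chr_coords ta, forall z, (forall g, ta g z = z) -> exists c, z = hM c,
      (forall g c, ta g (hM c) = hM c) /\ (forall x, hM (ext_map M x) = io (io0 x)) &
      [/\ forall c, fX (hM c) = c%:A, forall g z, fX (ta g z) = torsor_act (lift_torsor xi) (fX z) g &
         forall a, lift_map xi a = fX (io (jE a))]].
Proof.
have hta := tower_act tw.
(* An element that acts trivially on [L] fixes [kap], and it fixes the members of [ts], so all its
   cocycles are 1; this is the situation excluded by [faithful]. *)
have chr : chr_coords ta.
  apply: chr_coords_field => // g g1; apply: contrapT => no.
  have fx z : ta g z = z by apply: contrapT => /eqP nz; apply: no; exists z.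
  case/eqP: g1; apply: faithful => [x|i lt].
    by apply: (fmorph_inj io); rewrite -(tower_io tw) fx.
  have [t0 tE] := tower_t tw lt; apply: (fmorph_inj io); apply: (mulIf t0).
  by rewrite -tE fx rmorph1 mul1r.
have [Md [hM hME]] : exists (Md : fieldType) (hM : {rmorphism Md -> L}), forall x, (forall g, ta g x = x) <-> exists y, x = hM y.
  apply: ex_subfield; split=> [h|x y hx hy h|x y hx hy h|x hx h].
  - exact: (ract_one hta).
  - by rewrite (ractB hta) hx hy.
  - by rewrite (ractMl hta) hx hy.
  - by have [f fE] := ract_rmorph hta h; rewrite -fE fmorphV fE hx.
have hMF g c : ta g (hM c) = hM c by apply: ((hME (hM c)).2 (ex_intro _ c erefl) g).
have [iM iME] : exists iM : {rmorphism K -> Md}, forall x, hM (iM x) = (io \o io0) x.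
  apply: rmorph_factor (fmorph_inj _) _ => c; have [x xE] : exists x, (io \o io0) c = hM x.
    by apply/hME => g; rewrite /= (tower_io tw) io0_fix.
  by exists x.
have [T [fX [fX' [fK fK' fX'Z fXA]]]] := ex_torsor (@mulrC L) hta hMF (fun x => (hME x).1) chr.
have fXM c : fX (hM c) = c%:A by apply: (can_inj fK'); rewrite fK fX'Z rmorph1 mulr1.
pose M : ext K := Ext iM; pose lm : {rmorphism E -> T} := fX \o io \o jE.
have lmZ (c : K) (a : E) : lm (c *: a) = ext_map M c *: lm a.
  by rewrite /= jEZ !rmorphM -[io (io0 c)]iME fXM mulr_algl.
have lmA (a : E) (g : G) : lm (torsor_act E a (pi g)) = torsor_act T (lm a) g.
  by rewrite /= -jEA -(tower_io tw) fXA.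
exists M, (@LiftObj G P pi K E M T lm lmZ lmA), hM, fX.
by split; [exact: chr | move=> z /hME | split=> // x; rewrite -iME | split].
Qed.

End GenericLift.

(** * The lower bound *)

Section LowerBound.

Variables (p r : nat) (e nn : 'I_r -> nat) (k : fieldType) (w : k) (G P : finGroupType) (pi : {morphism [set: G] >-> P}).
Hypotheses (p_pr : prime p) (w_prim : p.-primitive_root w) (p_neq0 : p%:R != 0 :> k)
  (nnE : forall s, nn s = (p ^ e s)%N).
Let XT : finType := {s : 'I_r & 'I_(nn s)}.
Let XV : finType := (XT + option P)%type.
Variables (AX : G -> XT -> XT -> k) (c : 'I_r -> G) (om : 'I_r -> k).
Hypotheses (AX_block : forall g t t', tag t != tag t' -> AX g t t' = 0)
  (AX_c : forall s t t', AX (c s) t t' = (if tag t == s then om s else 1) * (t == t')%:R)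
  (om_p : forall s, om s ^+ p = 1) (om_1 : forall s, om s != 1)
  (c_p : forall s, (c s ^+ p = 1)%g) (pi_c : forall s, pi (c s) = 1%g)
  (dim_dvd : forall s m (rU : mx_representation k [set: G] m) a, rU (c s) = a%:M -> a ^+ p = 1 -> a != 1 ->
     (p ^ e s %| m)%N).

Let m := #|XV|.
Local Notation bx := (@bx r nn P).
Local Notation Ax := (@Ax r nn k G P pi AX).
Variables (r0 : option 'I_r -> 'I_m).
Hypothesis r0E : forall b, bx (r0 b) = b.

Variables (kap : fieldType) (sg : G -> kap -> kap) (iok : {rmorphism k -> kap}) (zk : 'I_m -> kap)
  (uk : option 'I_r -> G -> kap).
Hypotheses (sg_io : forall g a, sg g (iok a) = iok a) (hsg : ring_action sg) (zk_r0 : forall b, zk (r0 b) = 1)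
  (uk0 : forall b g, uk b g != 0) (ukM : forall b g h, uk b (g * h)%g = sg h (uk b g) * uk b h)
  (sgz : forall g i, sg g (zk i) * uk (bx i) g = \sum_j iok (Ax g i j) * zk j)
  (zk_indep : forall d f, bhom bx d f -> f != 0 -> mmap iok zk f != 0)
  (kap_gen : forall S : kap -> Prop, subfield_prop S -> (forall a, S (iok a)) -> (forall i, S (zk i)) -> forall x, S x).

Variables (pG : (p.-group [set: G])%g) (rho : forall s, mx_representation k [set: G] (nn s)).
Hypothesis AXE : AX = rep_entry rho.
Variables (us : seq (G -> kap)) (L : fieldType) (io : {rmorphism kap -> L})
  (ta : G -> L -> L) (O : L -> Prop) (res : L -> kap) (ts : seq L).
Hypothesis tw : tower sg us io ta O res ts.
Variables (k0 : fieldType) (K : ext k0) (E : torsor P K) (io0 : {rmorphism K -> kap}) (jE : {rmorphism E -> kap}).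
Hypotheses (io0_gen : forall a, gen iok (fun x => exists i, bx i = None /\ x = zk i) (io0 a))
  (io0_iok : forall c, exists x, io0 x = iok c).
Variables (M : ext K) (xi : lift_obj pi E M) (hM : {rmorphism M -> L}) (fX : {rmorphism L -> lift_torsor xi}).
Hypotheses (chr : chr_coords ta) (fixM : forall z, (forall g, ta g z = z) -> exists c, z = hM c)
  (taM : forall g c, ta g (hM c) = hM c) (hMK : forall x, hM (ext_map M x) = io (io0 x))
  (fXM : forall c, fX (hM c) = c%:A) (fXA : forall g z, fX (ta g z) = torsor_act (lift_torsor xi) (fX z) g).

Let DX := (\sum_s nn s)%N.

Lemma lift_trdeg_ge (M' : fieldExtType M) (xi' : lift_obj pi E (ext_over M')) (M0 : ext K)
    (f : ext_hom M0 (ext_over M')) (xi0 : lift_obj pi E M0) :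
  coprime p (\dim {:M'}) -> lift_arrow (ext_over_hom M') xi xi' -> lift_arrow f xi0 xi' ->
  ele (Some DX) (trdeg M0).
Proof.
move=> cM' [phi [phiZ phiA _]] [phi0 [phi0Z phi0A _]].
pose T' : torsor G M' := lift_torsor xi'; pose T0 := lift_torsor xi0.
pose Lam : {rmorphism L -> T'} := phi \o fX.
have LamM c0 : Lam (hM c0) = (c0%:A : M')%:A by rewrite /= fXM phiZ rmorph1.
have LamA g z : Lam (ta g z) = torsor_act T' (Lam z) g by rewrite /= fXA phiA.
(* The torsor of [xi'] is a field of prime-to-p degree over [L], into which the descended torsor
   [T0] is mapped equivariantly. The place of [L] extends to it next. *)
have [Om [psi [oa [hom omE psiL dOm]]]] :=
  ex_field_of_torsor p_pr pG (tower_act tw) chr fixM taM cM' LamM LamA.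
have omA g a : oa g a%:A = (ta g a)%:A by rewrite -!psiL omE LamA.
have [R [Th [Res [jt [sT [plR RO hsT RsT [sTjt Thdeg]]]]]]] := ex_residue tw hom omA.
pose Phi : {rmorphism T0 -> Om} := psi \o phi0.
have PhiA g b : oa g (Phi b) = Phi (torsor_act T0 b g) by rewrite /= omE phi0A.
pose beta : {rmorphism K -> Om} := (Phi \o GRing.in_alg T0) \o ext_map M0.
pose iK : {rmorphism kap -> Om} := GRing.in_alg Om \o io.
have betaE x : beta x = iK (io0 x).
  rewrite /= phi0Z rmorph1 ext_homE -hMK -psiL LamM.
  by [].
have Thdeg' th : exists q : {poly kap}, [/\ irreducible_poly q, root (map_poly jt q) th & coprime p (size q).-1].
  have [_ [q [iq rq dq]]] := Thdeg th; exists q; split=> //.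
  by apply: coprime_dvdr dq _; rewrite dOm.
have iK_R a : R (iK a) /\ Res (iK a) = jt a.
  by have [h1 h2] := tower_res tw a; have [h3 h4] := RO _ h1; rewrite /= h4 h2.
have om_iK g a : oa g (iK a) = iK (sg g a) by rewrite /= omA (tower_io tw).
apply: trdeg_ge => t ht; rewrite leqNgt; apply/negP => lt.
have [nb [a [b ab]]] := torsor_chr T0.
have ab' g : \sum_i Phi (a i) * oa g (Phi (b i)) = (g == 1%g)%:R.
  by rewrite -(rmorph_nat Phi) -ab rmorph_sum; apply: eq_bigr => i _; rewrite rmorphM PhiA.
(* Equivariant vectors for [rho s], obtained by averaging one column of the representation against
   an element of [T0]; their entries are algebraic over whatever makes [T0] algebraic. *)
pose Yv s (o : 'I_(nn s)) i x := \sum_h iK (iok (rho s h^-1%g x o)) * oa h (Phi (b i)).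
have YvA s o i g x : oa g (@Yv s o i x) = \sum_y iK (iok (rho s g x y)) * @Yv s o i y.
  rewrite (ract_sum hom); transitivity (\sum_h iK (iok (rho s (g * h^-1)%g x o)) * oa h (Phi (b i))).
    rewrite [RHS](reindex_inj (mulIg g)) /=; apply: eq_bigr => h _.
    by rewrite (ractMl hom) om_iK sg_io (ractM hom) invMg mulKVg.
  under [RHS]eq_bigr do rewrite mulr_sumr.
  rewrite exchange_big; apply: eq_bigr => h _; rewrite (repr_mxM (rho s) (in_setT g) (in_setT h^-1%g)).
  have -> : iK (iok ((rho s g *m rho s h^-1%g) x o)) = \sum_y iK (iok (rho s g x y)) * iK (iok (rho s h^-1%g y o)).
    by rewrite mxE (rmorph_sum iok) (rmorph_sum iK); apply: eq_bigr => y _; rewrite (rmorphM iok) (rmorphM iK).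
  by rewrite mulr_suml; apply: eq_bigr => y _; rewrite mulrA.
have nn0 s : (0 < nn s)%N by rewrite nnE expn_gt0 prime_gt0.
pose o s : 'I_(nn s) := Ordinal (nn0 s).
(* Weighted by the [a i], the entries at [o s] add up to the entry of the identity matrix there,
   which is 1; so they are not all 0. *)
have /choice[ci ciP] s : exists i, Yv s (o s) i (o s) != 0.
  apply: contrapT => no; have z i : Yv s (o s) i (o s) = 0.
    by apply: contrapT => /eqP nz; apply: no; exists i.
  have : \sum_i Phi (a i) * Yv s (o s) i (o s) = 1.
    have r1 : iK (iok (rho s 1^-1%g (o s) (o s))) = 1.
      by rewrite invg1 repr_mx1 mxE eqxx (rmorph1 iok) (rmorph1 iK).
    transitivity (\sum_h iK (iok (rho s h^-1%g (o s) (o s))) * \sum_i Phi (a i) * oa h (Phi (b i))).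
      rewrite /Yv; under eq_bigr do rewrite mulr_sumr.
      rewrite exchange_big; apply: eq_bigr => h _; rewrite mulr_sumr; apply: eq_bigr => i _.
      exact: mulrCA.
    rewrite (eq_bigr (fun h => iK (iok (rho s h^-1%g (o s) (o s))) * (h == 1%g)%:R)); last by move=> h _; rewrite ab'.
    rewrite (bigD1 1%g) // eqxx r1 mulr1 big1; first exact: addr0.
    by move=> h h1; rewrite (negbTE h1) mulr0.
  by rewrite big1 => [/esym/eqP|i _]; rewrite ?oner_eq0 // z mulr0.
pose Y (u : XT) := Yv (tag u) (o (tag u)) (ci (tag u)) (tagged u).
have Y_act g u : oa g (Y u) = \sum_u' iK (iok (AX g u u')) * Y u'.
  rewrite AXE; case: u => s x; rewrite /Y YvA.
  by rewrite -(sum_rep_entry rho (iK \o iok) g x Y).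
have Y0 s : exists u, tag u = s /\ Y u != 0.
  by exists (existT (fun s => 'I_(nn s)) s (o s)); split; [| exact: ciP].
pose tt := [seq Phi (x%:A) | x <- t].
have algM0 x : algcl beta (fun y => y \in tt) (Phi x%:A).
  apply: (@algcl_rmorph K M0 Om (ext_map M0) (Phi \o GRing.in_alg T0) (fun y => y \in t)) => [y yt|]; last exact: ht.
  exact: (map_f (fun x : M0 => Phi x%:A)).
have algPhi x : algcl beta (fun y => y \in tt) (Phi x).
  have [q [nzq qx]] := falg_algebraic x.
  apply: (@algcl_root K Om beta _ (map_poly (Phi \o GRing.in_alg T0) q)); first by rewrite map_poly_eq0.
    apply/eqP; rewrite horner_coef size_map_poly; transitivity (Phi (\sum_(i < size q) q`_i *: x ^+ i)); last by rewrite qx rmorph0.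
    by rewrite rmorph_sum; apply: eq_bigr => i _; rewrite coef_map /= -!rmorphXn -!rmorphM mulr_algl.
  by move=> i; rewrite coef_map; apply: algM0.
have [s1 sB sM sV] := algcl_subfield beta (fun y => y \in tt).
have s0 : algcl beta (fun y => y \in tt) 0 by rewrite -(subrr 1); apply: sB.
have sD x y : algcl beta (fun y => y \in tt) x -> algcl beta (fun y => y \in tt) y -> algcl beta (fun y => y \in tt) (x + y).
  by move=> hx hy; rewrite -[y]opprK; apply: (sB) => //; rewrite -sub0r; apply: (sB).
have algY u : algcl beta (fun y => y \in tt) (Y u).
  apply: big_ind => // h _; apply: sM; last by rewrite PhiA; apply: algPhi.
  have [x <-] := io0_iok (rho (tag u) h^-1%g (tagged u) (o (tag u))).
  by rewrite -betaE; apply: sub_algcl; apply: gen_base.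
pose u0 (i : 'I_#|XT|) := Y (enum_val i).
have XTE : #|XT| = DX.
  rewrite card_tagged sumnE big_map big_enum /=.
  by apply: eq_bigr => s _; rewrite card_ord.
(* The entries of the chosen vectors are [DX] in number and algebraic over the fewer than [DX]
   elements of [tt], so one of them is algebraic over the previous ones, and a relation over [K]
   follows. *)
have [i ai] : exists i : 'I_#|XT|, algcl beta (fun x => exists2 j : 'I_#|XT|, (j < i)%N & x = u0 j) (u0 i).
  apply: contrapT => no; have : (size [seq u0 i | i <- enum 'I_#|XT|] <= size tt)%N.
    apply: (algcl_steinitz (iota := beta)) => [i|x /mapP[i _ ->]]; last exact: algY.
    rewrite size_map size_enum_ord => li ai; apply: no; exists (Ordinal li).
    move: ai; rewrite (nth_map (Ordinal li)) ?size_enum_ord // (nth_ord_enum _ (Ordinal li)); apply: algcl_mono.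
    move=> y; rewrite -map_take => /mapP[j /(nthP (Ordinal li))[v vl <-] ->].
    move: vl; rewrite size_take size_enum_ord li => vl; exists (nth (Ordinal li) (take i (enum 'I_#|XT|)) v) => //.
    by rewrite nth_take // nth_enum_ord // (ltn_trans vl).
  by rewrite size_map -cardE card_ord XTE size_map leqNgt lt.
have [q nzq q0] := algcl_relation ai.
have : mmap (iK \o io0) (fun a : 'I_#|XT| => Y (enum_val a)) q != 0.
  eapply (@no_relation p r e nn k w G P pi); eassumption.
rewrite (_ : mmap _ _ q = 0) ?eqxx //; rewrite -[RHS]q0; apply: eq_bigr => mm _.
by congr (_ * _); apply: esym (betaE _).
Qed.

End LowerBound.

Theorem edp_lower_bound (p : nat) (k kp : fieldType) (l : {rmorphism k -> kp}) (w : kp) (P' P : finGroupType)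
    (N : {group P'}) (pi : {morphism [set: P'] >-> P}) :
  prime p -> p \notin [pchar k] -> p.-primitive_root w -> (p.-group [set: P'])%g ->
  ('ker pi = N)%g -> (pi @* [set: P'] = [set: P])%g ->
  exists (K : ext k) (E : torsor P K), ele (rdim kp N) (edp p (Lift pi E)).
Proof.
move=> pp pc wp pG kerN imP.
have pn0 : p%:R != 0 :> kp.
  by rewrite -(rmorph_nat l) fmorph_eq0; move: pc; rewrite !inE pp.
have nN : (N <| [set: P'])%g by rewrite -kerN ker_normal.
have piN g : g \in N -> pi g = 1%g by rewrite -kerN => /kerP h; apply: h; rewrite inE.
have pi_surj h : exists g, pi g = h.
  have : h \in (pi @* [set: P'])%g by rewrite imP inE.
  by case/morphimP => g _ _ ->; exists g.
have [D [r [n [rho [c [om [e [rD DE nE faith cP]]]]]]]] := ex_minimal_family pp wp pn0 pG nN.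
have n0 s : (0 < n s)%N by rewrite nE expn_gt0 prime_gt0.
pose XT : finType := {s : 'I_r & 'I_(n s)}; pose XV : finType := (XT + option P)%type.
pose r0 (b : option 'I_r) : 'I_#|XV| := match b with
  | Some s => enum_rank (inl (existT (fun s => 'I_(n s)) s (Ordinal (n0 s))) : XV)
  | None => enum_rank (inr None : XV) end.
have r0E b : @bx r n P (r0 b) = b by case: b => [s|]; rewrite /bx enum_rankK.
pose AX := rep_entry rho.
have [kap [sg [iok [zk [uk [[hsg sgio] [zk1 zk0] [uk0 ukM] sgz [zkind kapgen]]]]]]] :=
  ex_ratio_field r0E (Ax1 pi rho) (AxM pi rho) (@Ax_block kp P' P pi r n rho).
have [K [E [io0 [jE [jEZ jEA io0g io0f io0k]]]]] :=
  @ex_ratio_torsor r n kp P' P pi AX r0 r0E erefl kap sg iok zk uk sgio hsg zk1 sgz zkind pi_surj k l.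
(* One Laurent variable for each block of V, twisted by the cocycle of that block; by [ukN] the
   remaining cocycle, of block [None], is identically 1. *)
pose us := [seq uk (Some s) | s <- enum 'I_r].
have usE i (lt : (i < r)%N) : nth (fun=> 0) us i = uk (Some (Ordinal lt)).
  by rewrite (nth_map (Ordinal lt)) ?size_enum_ord // (nth_ord_enum _ (Ordinal lt)).
have usP i : (i < size us)%N -> let u := nth (fun=> 0) us i in
     (forall g, u g != 0) /\ forall g h, u (g * h)%g = sg h (u g) * u h.
  by rewrite size_map size_enum_ord => lt; rewrite usE; split=> [g|g h]; [apply: uk0 | apply: ukM].
have [L [io [ta [O [res [ts tw]]]]]] := ex_tower hsg usP.
have ukN g : uk None g = 1.
  have [g1 g1E] := pi_surj 1%g; have := sgz g (r0 None); rewrite zk1 (ract_one hsg) mul1r r0E => ->.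
  rewrite (bigD1 (r0 None)) //= big1 => [|j ne].
    have -> : Ax pi AX g (r0 None) (r0 None) = 1 by rewrite mxE !enum_rankK.
    by rewrite addr0 rmorph1 mul1r (zk1 None).
  rewrite mxE enum_rankK; move: ne; rewrite -(inj_eq enum_val_inj) enum_rankK.
  case: (enum_val j) => [t|[b|]] ne.
  - by rewrite /= rmorph0 mul0r.
  - by have -> : xentry pi AX g (inr None) (inr (Some b)) = 0 by []; rewrite rmorph0 mul0r.
  - by rewrite eqxx in ne.
(* When the action and all cocycles of [g] are trivial, the coordinates are fixed and their linear
   independence makes the matrix of [g] the identity. The regular block then gives [pi g = 1%g], so
   [g] lies in [N], and the blocks of V are jointly faithful on [N]. *)
have faithful g : (forall x, sg g x = x) -> (forall i, (i < size us)%N -> nth (fun=> 0) us i g = 1) -> g = 1%g.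
  move=> gx gu; have uk1 b : uk b g = 1.
    case: b => [[s lt]|] //; have := gu s; rewrite size_map size_enum_ord => /(_ lt).
    by rewrite usE.
  have A1 i j : Ax pi AX g i j = (i == j)%:R.
    apply/eqP; rewrite -subr_eq0; apply/eqP.
    apply: (@zk_linear_indep r n kp P kap iok zk zkind (@bx r n P i) (fun j => Ax pi AX g i j - (i == j)%:R)).
      move=> j' ne; rewrite Ax_block; last by rewrite eq_sym.
      have -> : (i == j') = false by apply: contraNF ne => /eqP ->.
      by rewrite subr0.
    under eq_bigr do rewrite rmorphB mulrBl.
    rewrite sumrB -sgz gx uk1 mulr1 (bigD1 i) //= eqxx rmorph1 mul1r big1 ?addr0 ?subrr // => j' ne.
    by rewrite eq_sym (negbTE ne) rmorph0 mul0r.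
  have pg : pi g = 1%g.
    have := A1 (enum_rank (inr (Some 1%g) : XV)) (enum_rank (inr (Some (pi g)) : XV)).
    rewrite mxE !enum_rankK /= mul1g eqxx (inj_eq enum_rank_inj).
    by case: eqP => [[] //|_ /eqP]; rewrite oner_eq0.
  apply: faith; first by rewrite -kerN; apply/kerP; rewrite ?inE.
  move=> s; apply/matrixP => x y.
  have := A1 (enum_rank (inl (existT (fun s => 'I_(n s)) s x) : XV)) (enum_rank (inl (existT (fun s => 'I_(n s)) s y) : XV)).
  rewrite mxE !enum_rankK /= /AX rep_entryE (inj_eq enum_rank_inj) => ->; rewrite mxE; congr (_)%:R.
  by rewrite -[inl _ == inl _]/(existT (fun s => 'I_(n s)) s x == existT (fun s => 'I_(n s)) s y) eq_Tagged.
have [M [xi [hM [fX [chr fixM [taM hMK] [fXM fXA _]]]]]] := ex_generic_lift tw faithful jEZ jEA io0f.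
have cN s : (c s ^+ p = 1)%g by have [[_ [_ cp]] _ _ _ _] := cP s.
have pic s : pi (c s) = 1%g by have [[_ [cN' _]] _ _ _ _] := cP s; apply: piN.
have omp s : om s ^+ p = 1 by have [] := cP s.
have om1 s : om s != 1 by have [] := cP s.
have AXc s t t' : AX (c s) t t' = (if tag t == s then om s else 1) * (t == t')%:R.
  rewrite /AX (@rep_entry_scalar _ _ _ _ rho (c s) (fun s' => if s' == s then om s else 1)) // => s'.
  by have [_ h1 _ _ [h2 _]] := cP s; case: (eqVneq s' s) => [->|/h2].
have dvd s m (rU : mx_representation kp [set: P'] m) a : rU (c s) = a%:M -> a ^+ p = 1 -> a != 1 -> (p ^ e s %| m)%N.
  by have [_ _ _ _ [_ h]] := cP s; rewrite -nE; apply: h.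
exists K, E; rewrite rD DE; apply: (@ele_trans (@edp_obj p K (Lift pi E) M xi)); last first.
  by apply: ele_esup; exists M, xi.
apply: einf_ge => _ [M' [xi' [cM' arr ->]]]; apply: einf_ge => _ [M0 [f [xi0 [arr0 ->]]]].
eapply (@lift_trdeg_ge p r e n kp w P' P pi) with (xi' := xi') (xi0 := xi0); try eassumption.
- exact: rep_entry_block.
- by [].
- exact: arr0.
Qed.

Theorem corollary7p4 (p : nat) (k kp : fieldType) (P' P : finGroupType)
    (N : {group P'}) (pi : {morphism [set: P'] >-> P}) :
  prime p ->
  p \notin [pchar k]%R ->
  p_closure p k kp ->
  (p.-group [set: P'])%g -> (p.-group N)%g -> (p.-group [set: P])%g ->
  ('ker pi = N)%g ->
  (pi @* [set: P'] = [set: P])%g ->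
  esup (fun d => exists (K : ext k) (E : torsor P K), d = edp p (Lift pi E))
    = rdim kp N
  /\ (forall b : enat,
       (forall (K : ext k) (E : torsor P K), ele (edp p (Lift pi E)) b)
       <-> ele (rdim kp N) b).
Proof.
move=> pp pc pcl pG _ _ kerN imP.
have [l [l_alg l_cop [w wp]]] := p_closure_facts pp pc pcl.
(* A single torsor already reaches the bound. This yields both the value of the supremum and the
   optimality of the bound among uniform ones. *)
have [K0 [E0 low]] := edp_lower_bound l pp pc wp pG kerN imP.
have up (K : ext k) (E : torsor P K) : ele (edp p (Lift pi E)) (rdim kp N).
  apply: esup_le => _ [M [xi ->]]; case rD : (rdim kp N) => [D|]; last by case: edp_obj.
  have [n [rV [fV [En]]]] := einf_some rD; rewrite En.
  apply: (@edp_obj_le p k kp l P' P pi pp l_alg l_cop n rV) => g pg g1.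
  have gN : g \in N by rewrite -kerN; apply/kerP; rewrite ?inE.
  apply: contra g1 => /eqP e; apply/eqP/set1gP/(subsetP fV).
  by rewrite rker_subg inE gN; apply/rkerP; rewrite inE.
split=> [|b].
  apply: ele_anti; first by apply: esup_le => _ [K [E ->]]; apply: up.
  by apply: ele_trans low _; apply: ele_esup; exists K0, E0.
split=> [h|h K E]; last exact: ele_trans (up K E) h.
exact: ele_trans low (h K0 E0).
Qed.
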